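(* Let $\lambda',\lambda'',\lambda'''\in\mathbb C$ and set $\ell:=\frac12(\lambda'''-\lambda'-\lambda'')$. Suppose that $\ell\in\mathbb N$, $\mathrm{Re}(\lambda'+\ell)>0$ and $\mathrm{Re}(\lambda''+\ell)>0$. (1) The map $\Psi_{\lambda',\lambda''}^{\lambda'''}:\mathcal O(\Pi)\to\mathcal O(\Pi\times\Pi)$ intertwines the action of the universal covering group $\widetilde{SL(2,\mathbb R)}$ from $\pi_{\lambda'''}$ to the tensor product representation $\pi_{\lambda'}\widehat\otimes\pi_{\lambda''}$, that is, $\Psi_{\lambda',\lambda''}^{\lambda'''}\circ\pi_{\lambda'''}(g)=(\pi_{\lambda'}\widehat\otimes\pi_{\lambda''})(g)\circ\Psi_{\lambda',\lambda''}^{\lambda'''}$ for all $g\in\widetilde{SL(2,\mathbb R)}$. (2) Moreover, if both $\lambda'$ and $\lambda''$ are real and greater than $1$, then the linear map $\Psi_{\lambda',\lambda''}^{\lambda'''}$ induces an isometric embedding (up to rescaling, i.e. up to multiplication by a positive constant) of weighted Bergman spaces $$\mathcal H^2(\Pi)_{\lambda'''}\longrightarrow\mathcal H^2(\Pi\times\Pi)_{(\lambda',\lambda'')}.$$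
   Context: $\mathbb N=\{0,1,2,\dots\}$. $\Pi=\{z=x+iy\in\mathbb C: y>0\}$ is the upper half-plane; $\mathcal O(\cdot)$ denotes the space of holomorphic functions. The universal covering group $\widetilde{SL(2,\mathbb R)}$ may be realized as the set of pairs $(A,\varphi)$ with $A=\begin{pmatrix}a&b\\c&d\end{pmatrix}\in SL(2,\mathbb R)$ and $\varphi:\Pi\to\mathbb C$ holomorphic with $e^{\varphi(z)}=cz+d$, with product $(A_1,\varphi_1)(A_2,\varphi_2)=(A_1A_2,\ \varphi_1(A_2z)+\varphi_2(z))$, where $Az=\frac{az+b}{cz+d}$. For $\lambda\in\mathbb C$ the representation $\pi_\lambda$ on $\mathcal O(\Pi)$ is $(\pi_\lambda(g)f)(z)=e^{-\lambda\varphi(z)}f(Az)$ where $g^{-1}=(A,\varphi)$ (i.e. $(cz+d)^{-\lambda}f(\frac{az+b}{cz+d})$). The tensor product representation $\pi_{\lambda'}\widehat\otimes\pi_{\lambda''}$ on $\mathcal O(\Pi\times\Pi)$ (restricted to the diagonal) is $f\mapsto e^{-\lambda'\varphi(\zeta_1)-\lambda''\varphi(\zeta_2)}f(A\zeta_1,A\zeta_2)$. For $\lambda>1$, $\mathcal H^2(\Pi)_\lambda:=\mathcal O(\Pi)\cap L^2(\Pi,y^{\lambda-2}dx\,dy)$. For $\lambda',\lambda''>1$, $\mathcal H^2(\Pi\times\Pi)_{(\lambda',\lambda'')}:=\mathcal O(\Pi\times\Pi)\cap L^2(\Pi\times\Pi,\,y_1^{\lambda'-2}y_2^{\lambda''-2}dx_1dy_1dx_2dy_2)\simeq\mathcal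 H^2(\Pi)_{\lambda'}\widehat\otimes\mathcal H^2(\Pi)_{\lambda''}$ (Hilbert tensor product). For $g\in\mathcal O(\Pi)$ the holographic operator is $$(\Psi_{\lambda',\lambda''}^{\lambda'''}g)(\zeta_1,\zeta_2):=\frac{(\zeta_1-\zeta_2)^\ell}{2^{\lambda'+\lambda''+2\ell-1}\,\ell!}\int_{-1}^1 g\Big(\frac{(\zeta_2-\zeta_1)v+(\zeta_1+\zeta_2)}2\Big)(1-v)^{\lambda'+\ell-1}(1+v)^{\lambda''+\ell-1}dv .$$ *)

(* Defs.v *)
From HB Require Import structures.
From mathcomp Require Import all_boot all_order all_algebra.
From mathcomp Require Import all_classical all_reals all_analysis.
From mathcomp Require Import complex ring lra.

Set Implicit Arguments.
Unset Strict Implicit.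
Unset Printing Implicit Defensive.

Import Order.TTheory GRing.Theory Num.Theory.
Import numFieldNormedType.Exports.

Local Open Scope classical_set_scope.
Local Open Scope ring_scope.
Local Open Scope complex_scope.

(* The name [Re] is shadowed by the one of [Num.Theory]. *)
Local Notation Re := complex.Re.
Local Notation Im := complex.Im.

Section ComplexFunctions.
Context {R : realType}.
Local Notation C := (R[i]).
Implicit Types z w s : C.

Definition cexp z : C :=
  (expR (Re z) * cos (Im z)) +i* (expR (Re z) * sin (Im z)).

(* Complex power of a nonnegative real (junk for [x < 0]); the value at 0
   follows the convention of [powR]. *)
Definition cpow (x : R) s : C :=
  if x == 0 then (s == 0)%:R else cexp (s * (ln x)%:C).

Definition cRintegral (D : set R) (f : R -> C) : C :=
  (\int[lebesgue_measure]_(v in D) Re (f v)) +i*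
  (\int[lebesgue_measure]_(v in D) Im (f v)).

Lemma cexp0 : cexp 0 = 1.
Proof. by rewrite /cexp /= expR0 cos0 sin0 mulr1 mulr0. Qed.

Lemma cexpD z w : cexp (z + w) = cexp z * cexp w.
Proof.
case: z => a b; case: w => c d; rewrite /cexp /= expRD cosD sinD.
apply/eqP; rewrite eq_complex /=; apply/andP; split; apply/eqP; ring.
Qed.

Lemma cexpN z : cexp (- z) = (cexp z)^-1.
Proof.
have E : cexp (- z) * cexp z = 1 by rewrite -cexpD addNr cexp0.
have nz : cexp z != 0 by apply: contra_eqN E => /eqP ->; rewrite mulr0 eq_sym oner_eq0.
by apply: (mulIf nz); rewrite E mulVf.
Qed.

(* Complex Frechet differentiability, at every point of an open set [D]. *)
Definition holomorphic_on (V : normedModType C) (D : set V) (f : V -> C) :=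
  forall p, D p -> differentiable (f : V -> C^o) p.

Definition halfplane : set C := [set z | 0 < Im z].

(* The spaces O(Pi) and O(Pi x Pi): their elements are represented by total
   functions, of which only the values on Pi, resp. Pi x Pi, matter. *)
Definition OPi : set (C -> C) :=
  [set f | @holomorphic_on C^o halfplane f].

Definition OPiPi : set (C * C -> C) :=
  [set f | @holomorphic_on (C^o * C^o)%type (halfplane `*` halfplane) f].

End ComplexFunctions.

Section UniversalCover.
Context {R : realType}.
Local Notation C := (R[i]).
Implicit Types (A B : 'M[R]_2) (z : C).

Definition mobius_den A z : C := (A 1 0)%:C * z + (A 1 1)%:C.

Definition mobius A z : C :=
  ((A 0 0)%:C * z + (A 0 1)%:C) / mobius_den A z.

(* The function [cover_phi] is only defined on Pi in the mathematical object;
   it is normalized to 0 elsewhere so that equality of pairs is Leibniz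
   equality. *)
Record SL2cover := MkSL2cover {
  cover_mx : 'M[R]_2;
  cover_phi : C -> C;
  cover_det : \det cover_mx = 1;
  cover_holo : OPi cover_phi;
  cover_exp : forall z, halfplane z ->
    cexp (cover_phi z) = mobius_den cover_mx z;
  cover_out : forall z, ~ halfplane z -> cover_phi z = 0 }.

Lemma SL2cover_eq (g h : SL2cover) :
  cover_mx g = cover_mx h ->
  (forall z, halfplane z -> cover_phi g z = cover_phi h z) -> g = h.
Proof.
case: g h => [A p ? ? ? op] [B q ? ? ? oq] /= eAB epq.
have {}epq : p = q.
  apply/funext => z; have [/epq//|nz] := pselect (halfplane z).
  by rewrite op// oq.
by subst; congr MkSL2cover; exact: Prop_irrelevance.
Qed.

Lemma det2 A : \det A = A 0 0 * A 1 1 - A 0 1 * A 1 0.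
Proof.
rewrite (expand_det_row _ 0) !big_ord_recl big_ord0 /cofactor !det_mx11 !mxE /=.
rewrite addr0 expr0 mul1r expr1 mulN1r mulrN.
by congr (A _ _ * A _ _ - A _ _ * A _ _); apply/val_inj.
Qed.

Lemma mobius_denE A x y :
  mobius_den A (x +i* y) = (A 1 0 * x + A 1 1) +i* (A 1 0 * y).
Proof.
by apply/eqP; rewrite eq_complex /= !mul0r !subr0 !addr0 !eqxx.
Qed.

Lemma mobius_den_neq0 A z : \det A = 1 -> halfplane z -> mobius_den A z != 0.
Proof.
rewrite det2 /halfplane /=; case: z => x y /= dA y0.
rewrite mobius_denE eq_complex /=; apply/negP => /andP[/eqP e1 /eqP e2].
have c0 : A 1 0 = 0.
  by move/eqP: e2; rewrite mulf_eq0 (gt_eqF y0) orbF => /eqP.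
move: dA e1; rewrite c0 mulr0 subr0 mul0r add0r => dA d0.
by move: dA; rewrite d0 mulr0 => /eqP; rewrite eq_sym oner_eq0.
Qed.

Lemma mobius_halfplane A z :
  \det A = 1 -> halfplane z -> halfplane (mobius A z).
Proof.
move=> dA hz; have := mobius_den_neq0 dA hz; move: dA hz.
rewrite det2 /halfplane /mobius /=; case: z => x y /= dA y0.
rewrite mobius_denE eq_complex /= => nz.
set p := A 1 0 * x + A 1 1 in nz *; set q := A 1 0 * y in nz *.
have n0 : 0 < p ^+ 2 + q ^+ 2.
  rewrite lt_def addr_ge0 ?sqr_ge0// andbT paddr_eq0 ?sqr_ge0//.
  by rewrite !sqrf_eq0.
set w := (X in 0 < X); have -> : w = y / (p ^+ 2 + q ^+ 2).
  rewrite {}/w -[y in RHS]mul1r -dA /q /p; field.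
  by rewrite -/q -/p lt0r_neq0.
exact: divr_gt0.
Qed.

Lemma mobius_denM A B z : mobius_den B z != 0 ->
  mobius_den (A *m B) z = mobius_den A (mobius B z) * mobius_den B z.
Proof.
rewrite /mobius => nz; rewrite {2}/mobius_den mulrDl -mulrA divfK//.
rewrite /mobius_den !mxE !big_ord_recl !big_ord0 !addr0.
have -> : lift ord0 (ord0 : 'I_1) = 1 by apply/val_inj.
rewrite !rmorphD !rmorphM /=; ring.
Qed.

Lemma mobiusM A B z : mobius_den B z != 0 ->
  mobius (A *m B) z = mobius A (mobius B z).
Proof.
move=> nz; rewrite {1}/mobius mobius_denM// invfM mulrA mulrAC.
rewrite [in RHS]/mobius; congr (_ / _).
rewrite /mobius -/(mobius_den B z) mulrA.
apply: (mulIf nz); rewrite divfK// mulrDl divfK// /mobius_den.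
rewrite !mxE !big_ord_recl !big_ord0 !addr0.
have -> : lift ord0 (ord0 : 'I_1) = 1 by apply/val_inj.
rewrite !rmorphD !rmorphM /=; ring.
Qed.

Lemma mobius_den1 z : mobius_den 1%:M z = 1.
Proof. by rewrite /mobius_den !mxE /= mul0r add0r. Qed.

Lemma mobius1 z : mobius 1%:M z = z.
Proof. by rewrite /mobius mobius_den1 !mxE /= mul1r addr0 divr1. Qed.

Lemma mobius_OPi A : \det A = 1 -> OPi (mobius A).
Proof.
move=> dA z hz; have aff : forall a b : C,
    differentiable ((fun w => a * w + b) : C^o -> C^o) (z : C^o).
  move=> a b.
  by apply: (@differentiableD _ C^o C^o (fun w => a * w) (fun=> b)).
apply: (@differentiableM _ C^o _ (fun w => (mobius_den A w)^-1)).
  exact: aff.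
apply: (@differentiableV _ C^o (mobius_den A)); first exact: aff.
exact: mobius_den_neq0.
Qed.

Lemma halfplane_near z : halfplane z -> \forall w \near (z : C^o), halfplane w.
Proof.
rewrite /halfplane /= => hz; apply/nbhs_normP; exists (Im z)%:C => /=.
  by rewrite ltcR.
move=> w /=; rewrite normc_def ltcR => zw.
have : `|Im (z - w)| <= Num.sqrt (Re (z - w) ^+ 2 + Im (z - w) ^+ 2).
  by rewrite -sqrtr_sqr ler_wsqrtr// lerDr sqr_ge0.
move=> /le_lt_trans/(_ zw); rewrite raddfB /= ltr_norml => /andP[_].
lra.
Qed.

Lemma OPi_eq (f h : C -> C) :
  (forall z, halfplane z -> f z = h z) -> OPi f -> OPi h.
Proof.
move=> fh Of z hz; apply/(derivable1_diffP (h : C^o -> C^o)).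
apply: (@near_eq_derivable _ C^o C^o f); last first.
  by apply/(derivable1_diffP (f : C^o -> C^o)); exact: Of.
by near=> w; apply: fh; near: w; exact: halfplane_near.
Unshelve. all: by end_near. Qed.

Lemma OPi_mobius A (f : C -> C) : \det A = 1 -> OPi f -> OPi (f \o mobius A).
Proof.
move=> dA Of z hz; apply: (@differentiable_comp _ C^o C^o C^o).
  exact: mobius_OPi.
exact: Of (mobius_halfplane dA hz).
Qed.

Definition on_halfplane (f : C -> C) z : C := if 0 < Im z then f z else 0.

Lemma on_halfplaneE f z : halfplane z -> on_halfplane f z = f z.
Proof. by rewrite /halfplane /on_halfplane /= => ->. Qed.

Lemma on_halfplane_out f z : ~ halfplane z -> on_halfplane f z = 0.
Proof. by rewrite /halfplane /on_halfplane /=; case: ifP. Qed.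

Lemma OPi_on_halfplane f : OPi f -> OPi (on_halfplane f).
Proof. by apply: OPi_eq => z hz; rewrite on_halfplaneE. Qed.

Section Mul.
Variables g h : SL2cover.

Definition cover_mul_phi : C -> C := on_halfplane
  (fun z => cover_phi g (mobius (cover_mx h) z) + cover_phi h z).

Fact cover_mul_det : \det (cover_mx g *m cover_mx h) = 1.
Proof. by rewrite det_mulmx !cover_det mulr1. Qed.

Fact cover_mul_holo : OPi cover_mul_phi.
Proof.
apply: OPi_on_halfplane => z hz; apply: (@differentiableD _ C^o C^o).
  exact: (OPi_mobius (cover_det h) (@cover_holo g)).
exact: cover_holo.
Qed.

Fact cover_mul_exp z : halfplane z ->
  cexp (cover_mul_phi z) = mobius_den (cover_mx g *m cover_mx h) z.
Proof.
move=> hz; have hd := cover_det h; rewrite /cover_mul_phi on_halfplaneE//.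
rewrite cexpD !cover_exp//; last exact: mobius_halfplane.
by rewrite mobius_denM// mobius_den_neq0.
Qed.

Definition cover_mul := MkSL2cover cover_mul_det cover_mul_holo cover_mul_exp
  (fun z => @on_halfplane_out _ z).
End Mul.

Lemma cover_mul_phiE g h z : halfplane z -> cover_mul_phi g h z =
  cover_phi g (mobius (cover_mx h) z) + cover_phi h z.
Proof. exact: on_halfplaneE. Qed.

Fact cover_one_holo : OPi (fun _ : C => 0 : C).
Proof. by move=> z _; exact: (@differentiable_cst _ C^o C^o). Qed.

Fact cover_one_exp z : halfplane z -> cexp 0 = mobius_den 1%:M z.
Proof. by rewrite cexp0 mobius_den1. Qed.

Definition cover_one :=
  MkSL2cover (det1 R 2) cover_one_holo cover_one_exp (fun _ _ => erefl).

Section Inv.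
Variable g : SL2cover.
Let B := invmx (cover_mx g).

Definition cover_inv_phi : C -> C :=
  on_halfplane (fun z => - cover_phi g (mobius B z)).

Let unitA : cover_mx g \in unitmx.
Proof. by rewrite unitmxE cover_det unitr1. Qed.

Fact cover_inv_det : \det B = 1.
Proof. by rewrite det_inv cover_det invr1. Qed.

Fact cover_inv_holo : OPi cover_inv_phi.
Proof.
apply: OPi_on_halfplane => z hz; apply: (@differentiableN _ C^o C^o).
exact: (OPi_mobius cover_inv_det (@cover_holo g)).
Qed.

Fact cover_inv_exp z : halfplane z -> cexp (cover_inv_phi z) = mobius_den B z.
Proof.
move=> hz; have hB := mobius_halfplane cover_inv_det hz.
rewrite /cover_inv_phi on_halfplaneE// cexpN cover_exp//.
have nz := mobius_den_neq0 cover_inv_det hz.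
have nA := mobius_den_neq0 (cover_det g) hB.
have := @mobius_denM (cover_mx g) B z nz.
rewrite mulmxV// mobius_den1 => e.
by apply: (mulfI nA); rewrite mulfV// -e.
Qed.

Definition cover_inv := MkSL2cover cover_inv_det cover_inv_holo cover_inv_exp
  (fun z => @on_halfplane_out _ z).
End Inv.

Fact cover_mulA : associative cover_mul.
Proof.
move=> f g h; apply: SL2cover_eq => [|z hz] /=; first exact: mulmxA.
have hd := cover_det h.
rewrite !cover_mul_phiE//=.
rewrite !cover_mul_phiE//; last exact: mobius_halfplane.
by rewrite addrA mobiusM// mobius_den_neq0.
Qed.

Fact cover_mul1 : left_id cover_one cover_mul.
Proof.
move=> g; apply: SL2cover_eq => [|z hz] /=; first exact: mul1mx.
by rewrite /cover_mul_phi on_halfplaneE//= add0r.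
Qed.

Fact cover_mulr1 : right_id cover_one cover_mul.
Proof.
move=> g; apply: SL2cover_eq => [|z hz] /=; first exact: mulmx1.
by rewrite /cover_mul_phi on_halfplaneE//= mobius1 addr0.
Qed.

Fact cover_mulV : left_inverse cover_one cover_inv cover_mul.
Proof.
move=> g; have dg := cover_det g; apply: SL2cover_eq => [|z hz] /=.
  by rewrite mulVmx// unitmxE dg unitr1.
rewrite /cover_mul_phi /= /cover_inv_phi !on_halfplaneE//; last first.
  exact: mobius_halfplane.
rewrite -mobiusM ?mobius_den_neq0// mulVmx ?mobius1 ?addNr//.
by rewrite unitmxE dg unitr1.
Qed.

Fact cover_mulrV : right_inverse cover_one cover_inv cover_mul.
Proof.
move=> g; apply: SL2cover_eq => [|z hz] /=.
  by rewrite mulmxV// unitmxE cover_det unitr1.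
by rewrite /cover_mul_phi /= /cover_inv_phi !on_halfplaneE// addrN.
Qed.

HB.instance Definition _ := gen_eqMixin SL2cover.
HB.instance Definition _ := gen_choiceMixin SL2cover.
HB.instance Definition _ := monoid.isGroup.Build SL2cover
  cover_mulA cover_mul1 cover_mulr1 cover_mulV cover_mulrV.

End UniversalCover.
Arguments SL2cover : clear implicits.

Section Representations.
Context {R : realType}.
Local Notation C := (R[i]).

Definition pi_rep (lam : C) (g : SL2cover R) (f : C -> C) (z : C) : C :=
  cexp (- lam * cover_phi (g^-1)%g z) * f (mobius (cover_mx (g^-1)%g) z).

Definition pi_tensor (lam1 lam2 : C) (g : SL2cover R) (f : C * C -> C)
    (p : C * C) : C :=
  cexp (- lam1 * cover_phi (g^-1)%g p.1 - lam2 * cover_phi (g^-1)%g p.2) *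
  f (mobius (cover_mx (g^-1)%g) p.1, mobius (cover_mx (g^-1)%g) p.2).

(* The parameter [lam3] of the operator only enters through
   [l = (lam3 - lam1 - lam2) / 2]. *)
Definition Psi (lam1 lam2 : C) (l : nat) (g : C -> C) (p : C * C) : C :=
  (p.1 - p.2) ^+ l / (cpow 2 (lam1 + lam2 + (2 * l)%:R - 1) * l`!%:R) *
  cRintegral `[-1, 1]
    (fun v => g (((p.2 - p.1) * v%:C + (p.1 + p.2)) / 2) *
              cpow (1 - v) (lam1 + l%:R - 1) * cpow (1 + v) (lam2 + l%:R - 1)).

End Representations.

Section WeightedBergman.
Context {R : realType}.
Local Notation C := (R[i]).
Local Notation leb := (@lebesgue_measure R).
Local Notation leb2 := (leb \x leb)%E.

Section WeightedL2.
Context {d : measure_display} {T : measurableType d}.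
Variables (mu : set T -> \bar R) (D : set T) (w : T -> R) (f : T -> C).

(* L^2 with respect to the measure [w x mu(dx)] on [D]. *)
Definition sqnormL2 : \bar R :=
  (\int[mu]_(x in D) (ComplexField.Normc.normc (f x) ^+ 2 * w x)%:E)%E.

Definition inL2 : Prop :=
  [/\ measurable_fun D (fun x => Re (f x)),
      measurable_fun D (fun x => Im (f x)) & (sqnormL2 < +oo)%E].

Definition normL2 : R := Num.sqrt (fine sqnormL2).
End WeightedL2.

(* The Bergman spaces are [H2 lam] over Pi and [H22 lam1 lam2] over Pi x Pi,
   with C identified with R^2 by [toC] for the integrals. *)
Definition toC (p : R * R) : C := p.1 +i* p.2.

Definition upper : set (R * R) := [set p | 0 < p.2].

Definition weight (lam : R) (p : R * R) : R := p.2 `^ (lam - 2).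

Definition H2 (lam : R) : set (C -> C) :=
  [set f | OPi f /\ inL2 leb2 upper (weight lam) (f \o toC)].

Definition normH2 (lam : R) (f : C -> C) : R :=
  normL2 leb2 upper (weight lam) (f \o toC).

Definition toCC (p : (R * R) * (R * R)) : C * C := (toC p.1, toC p.2).

Definition weight2 (lam1 lam2 : R) (p : (R * R) * (R * R)) : R :=
  weight lam1 p.1 * weight lam2 p.2.

Definition H22 (lam1 lam2 : R) : set (C * C -> C) :=
  [set F | OPiPi F /\ inL2 (leb2 \x leb2)%E (upper `*` upper)
                        (weight2 lam1 lam2) (F \o toCC)].

Definition normH22 (lam1 lam2 : R) (F : C * C -> C) : R :=
  normL2 (leb2 \x leb2)%E (upper `*` upper) (weight2 lam1 lam2) (F \o toCC).

End WeightedBergman.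

(* Main.v *)
From HB Require Import structures.
Require Import Defs.
From mathcomp Require Import all_boot all_order all_algebra.
From mathcomp Require Import all_classical all_reals all_analysis.
From mathcomp Require Import measurable_realfun.
From mathcomp Require Import complex ring lra.

Import Order.TTheory GRing.Theory Num.Theory.
Import numFieldNormedType.Exports.
Local Open Scope classical_set_scope.
Local Open Scope ring_scope.

(** The integral in the operator is the average of [g] over the segment between
    the two points, for a Beta weight with exponents [al = lam1 + l] and
    [be = lam2 + l]; their sum is [lam3].

    Intertwining.  Let [phi] be holomorphic with exponential [c z + d].
    Feynman's formula ([feynman]) says that the average of [exp (- (al + be) phi)]
    is [exp (- al phi (z1) - be phi (z2))] times the mass of the weight.  It is
    proved by letting [z2] start from [z1] and move along the segment: the
    derivative of the normalized integrand is exact in the variable of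
    integration.  Applying the formula with shifted exponents to the terms of a
    binomial expansion computes all moments of a Moebius transformation, hence
    the average is equivariant for polynomials, and for all holomorphic functions
    by approximation on a disc ([mobius_equivariance]).  The factor
    [(z1 - z2) ^+ l] absorbs the difference between [al], [be] and [lam1], [lam2].

    The approximation, and the holomorphy of the average, use that complex
    differentiable functions satisfy Cauchy's formula.  This is obtained from
    Goursat's theorem ([goursat]), through primitives.

    Isometry.  The kernel [ker s w] is the power of exponent [- s] of
    [-'i] times [z - w^*].  In the Bergman space of parameter [s] it reproduces the
    value at [w], up to a constant ([reproducing]): it suffices to prove that it
    is orthogonal to the functions [(z - w) g], and their pairing is the integral
    of an exact form, which vanishes by Stokes' theorem ([stokes]).  By Feynman's
    formula the image of a kernel of exponent [lam3] is the product of
    [(z1 - z2) ^+ l] with two kernels, that is, a sum of products of kernels with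
    shifted exponents.  Pairings of such kernels are again kernels
    ([ker_pairing]), and they add up to a multiple of [ker lam3 w' w], which is
    itself a multiple of the pairing of the original kernels.  So the operator
    multiplies the squared norm by a constant on the span of the kernels.  A
    function of the Bergman space is approximated by the sequence of the span
    that minimizes the distance to it: by the reproducing formula the sequence
    converges pointwise to the function, since the difference becomes orthogonal
    to all kernels, and Fatou's lemma gives the convergence in norm on both sides
    ([Psi_isometry]). *)

Set Implicit Arguments.
Unset Strict Implicit.
Unset Printing Implicit Defensive.
Local Open Scope complex_scope.
Local Notation Re := complex.Re.
Local Notation Im := complex.Im.
Local Notation nc := ComplexField.Normc.normc.
Local Notation "x ^*" := (conjc x) : ring_scope.

(** * Modulus and components of complex numbers *)

Section ComplexModulus.
Context {R : realType}.
Local Notation C := (R[i]).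
Implicit Types (z w : C) (x y : R).

Lemma normcE z : `|z| = (nc z)%:C.
Proof. by case: z. Qed.

Lemma ncE z : nc z = Num.sqrt (Re z ^+ 2 + Im z ^+ 2).
Proof. by case: z. Qed.

Lemma nc_ge0 z : 0 <= nc z.
Proof. by rewrite ncE sqrtr_ge0. Qed.

Lemma ncM z w : nc (z * w) = nc z * nc w.
Proof. exact: ComplexField.Normc.normcM. Qed.

Lemma ncV z : nc z^-1 = (nc z)^-1.
Proof. exact: ComplexField.Normc.normcV. Qed.

Lemma ncD z w : nc (z + w) <= nc z + nc w.
Proof. exact: le_normcD. Qed.

Lemma ncN z : nc (- z) = nc z.
Proof. exact: normcN. Qed.

Lemma ncB z w : nc (z - w) = nc (w - z).
Proof. by rewrite -opprB ncN. Qed.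

Lemma nc0 : nc (0 : C) = 0.
Proof. exact: ComplexField.Normc.normc0. Qed.

Lemma nc1 : nc (1 : C) = 1.
Proof. exact: ComplexField.Normc.normc1. Qed.

Lemma ncR x : nc x%:C = `|x|.
Proof. by rewrite ncE /= expr0n /= addr0 sqrtr_sqr. Qed.

Lemma nci : nc ('i : C) = 1.
Proof. by rewrite ncE /= expr0n /= add0r expr1n sqrtr1. Qed.

Lemma nc_conj z : nc (z^*) = nc z.
Proof. by case: z => a b; rewrite !ncE /= sqrrN. Qed.

Lemma ncX z n : nc (z ^+ n) = nc z ^+ n.
Proof. by elim: n => [|n IH]; rewrite ?expr0 ?nc1// !exprS ncM IH. Qed.

Lemma ge_nc_Re z : `|Re z| <= nc z.
Proof. by rewrite ncE -sqrtr_sqr ler_wsqrtr// lerDl sqr_ge0. Qed.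

Lemma ge_nc_Im z : `|Im z| <= nc z.
Proof. by rewrite ncE -sqrtr_sqr ler_wsqrtr// lerDr sqr_ge0. Qed.

Lemma nc_le z : nc z <= `|Re z| + `|Im z|.
Proof.
rewrite {1}(complexE z) (le_trans (ncD _ _))// ncM nci mul1r !ncR.
by [].
Qed.

Lemma nc_eq0 z : (nc z == 0) = (z == 0).
Proof.
apply/eqP/eqP => [/ComplexField.Normc.eq0_normc//|->]; exact: nc0.
Qed.

Lemma nc_gt0 z : (0 < nc z) = (z != 0).
Proof. by rewrite lt_def nc_ge0 andbT nc_eq0. Qed.

Lemma sqr_nc z : nc z ^+ 2 = Re z ^+ 2 + Im z ^+ 2.
Proof. by rewrite ncE sqr_sqrtr// addr_ge0 ?sqr_ge0. Qed.

Lemma ncDB z w : nc z - nc w <= nc (z - w).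
Proof. by rewrite lerBlDr (le_trans _ (ncD _ _))// subrK. Qed.

Lemma ReD z w : Re (z + w) = Re z + Re w. Proof. by case: z; case: w. Qed.
Lemma ImD z w : Im (z + w) = Im z + Im w. Proof. by case: z; case: w. Qed.
Lemma ReN z : Re (- z) = - Re z. Proof. by case: z. Qed.
Lemma ImN z : Im (- z) = - Im z. Proof. by case: z. Qed.
Lemma ReB z w : Re (z - w) = Re z - Re w. Proof. by rewrite ReD ReN. Qed.
Lemma ImB z w : Im (z - w) = Im z - Im w. Proof. by rewrite ImD ImN. Qed.
Lemma ReM z w : Re (z * w) = Re z * Re w - Im z * Im w.
Proof. by case: z; case: w. Qed.
Lemma ImM z w : Im (z * w) = Re z * Im w + Im z * Re w.
Proof. by case: z => a b; case: w => c d /=. Qed.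

Lemma eqC z w : Re z = Re w -> Im z = Im w -> z = w.
Proof. by case: z => a b; case: w => c d /= -> ->. Qed.

Lemma RDC x y : (x + y)%:C = x%:C + y%:C :> C. Proof. exact: rmorphD. Qed.
Lemma RBC x y : (x - y)%:C = x%:C - y%:C :> C. Proof. exact: rmorphB. Qed.
Lemma RNC x : (- x)%:C = - x%:C :> C. Proof. exact: rmorphN. Qed.
Lemma RMC x y : (x * y)%:C = x%:C * y%:C :> C. Proof. exact: rmorphM. Qed.
Lemma RVC x : (x^-1)%:C = (x%:C)^-1 :> C. Proof. exact: fmorphV. Qed.
Lemma natC n : (n%:R)%:C = n%:R :> C. Proof. exact: rmorph_nat. Qed.

(** The norm of a complex number is itself complex; this and the next lemmas
    move neighbourhoods and limits to the real-valued modulus. *)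
Lemma nbhsCP z (P : set C) :
  nbhs (z : C^o) P <-> exists2 e : R, 0 < e & forall w, nc (w - z) < e -> P w.
Proof.
split=> [/nbhs_normP[e /= e0 H]|[e e0 H]].
  exists (Re e) => [|w we].
    by move: e0; rewrite ltcE /= => /andP[].
  apply: H => /=; rewrite distrC normcE.
  have <- : (Re e)%:C = e by apply: RRe_real; apply: gtr0_real.
  by rewrite ltcR.
apply/(@nbhs_normP _ C^o); exists e%:C => /=; first by rewrite ltcR.
by move=> w /=; rewrite distrC normcE ltcR; exact: H.
Qed.

Lemma nearC z (e : R) (P : set C) : 0 < e ->
  (forall w, nc (w - z) < e -> P w) -> nbhs (z : C^o) P.
Proof. by move=> e0 H; apply/nbhsCP; exists e. Qed.

Lemma cvgCP {T : Type} (F : set_system T) (FF : Filter F) (f : T -> C) z :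
  (f : T -> C^o) x @[x --> F] --> (z : C^o) <->
  forall e : R, 0 < e -> \forall x \near F, nc (f x - z) < e.
Proof.
split=> [H e e0|H P /nbhsCP[e e0 HP]].
  by apply: (H (fun w => nc (w - z) < e)); apply/nbhsCP; exists e.
by rewrite /nbhs /=; near=> x; apply: HP; near: x; exact: H.
Unshelve. all: by end_near. Qed.

Lemma cvg_Re {T : Type} (F : set_system T) (FF : Filter F) (f : T -> C) z :
  (f : T -> C^o) x @[x --> F] --> (z : C^o) -> Re (f x) @[x --> F] --> Re z.
Proof.
move=> /cvgCP H; apply/cvgrPdist_lt => e e0; near=> x.
rewrite distrC -ReB; apply: le_lt_trans (ge_nc_Re _) _.
by near: x; exact: H.
Unshelve. all: by end_near. Qed.

Lemma cvg_Im {T : Type} (F : set_system T) (FF : Filter F) (f : T -> C) z :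
  (f : T -> C^o) x @[x --> F] --> (z : C^o) -> Im (f x) @[x --> F] --> Im z.
Proof.
move=> /cvgCP H; apply/cvgrPdist_lt => e e0; near=> x.
rewrite distrC -ImB; apply: le_lt_trans (ge_nc_Im _) _.
by near: x; exact: H.
Unshelve. all: by end_near. Qed.

Lemma cvg_cplx {T : Type} (F : set_system T) (FF : Filter F) (f : T -> C) z :
  Re (f x) @[x --> F] --> Re z -> Im (f x) @[x --> F] --> Im z ->
  (f : T -> C^o) x @[x --> F] --> (z : C^o).
Proof.
move=> /cvgrPdist_lt Hr /cvgrPdist_lt Hi; apply/cvgCP => e e0; near=> x.
rewrite (le_lt_trans (nc_le _))// ReB ImB (splitr e) ltrD// distrC.
  by near: x; apply: Hr; rewrite divr_gt0.
by near: x; apply: Hi; rewrite divr_gt0.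
Unshelve. all: by end_near. Qed.

Lemma cvg_nc {T : Type} (F : set_system T) (FF : Filter F) (f : T -> C) z :
  (f : T -> C^o) x @[x --> F] --> (z : C^o) -> nc (f x) @[x --> F] --> nc z.
Proof.
move=> /cvgCP H; apply/cvgrPdist_lt => e e0; near=> x.
apply: le_lt_trans (_ : nc (f x - z) < e); last by near: x; exact: H.
have h1 := ncDB (f x) z; have h2 := ncDB z (f x); rewrite ncB in h2.
by rewrite ler_norml; apply/andP; split; lra.
Unshelve. all: by end_near. Qed.

End ComplexModulus.

Arguments ComplexField.Normc.normc : simpl never.

(** * Slopes and derivatives *)

Section Caratheodory.
Context {R : realType}.
Local Notation C := (R[i]).

(** Continuity at a point. It is an inductive predicate rather than a
    convergence statement so that unification does not unfold it. *)
Variant contc {T : topologicalType} (F : T -> C) (x : T) : Prop :=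
  Contc of (F : T -> C^o) y @[y --> x] --> (F x : C^o).

Lemma contcE {T : topologicalType} (F : T -> C) (x : T) :
  contc F x -> (F : T -> C^o) y @[y --> x] --> (F x : C^o).
Proof. by case. Qed.

Lemma contcP {T : topologicalType} (F : T -> C) (x : T) : contc F x <->
  forall eps : R, 0 < eps -> \forall y \near x, nc (F y - F x) < eps.
Proof.
split=> [[] /cvgCP//|H]; apply/Contc/cvgCP; exact: H.
Qed.

(** Differentiability in the sense of Caratheodory, along the coordinate [e]:
    the slope extends continuously to [x]. With [e] the embedding of the
    reals it is the derivative of a curve, with [e] the identity it is the
    complex derivative, and the same rules of calculus serve for both. *)
Definition has_slope {T : topologicalType} (e F : T -> C) (x : T) (d : C) :=
  exists p : T -> C, [/\ contc p x, p x = d &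
    forall y, F y - F x = p y * (e y - e x)].

Section Rules.
Context {T : topologicalType}.
Implicit Types (e F G : T -> C) (x : T) (d : C).

Lemma contD F G x : contc F x ->
  contc G x ->
  contc (fun y => F y + G y) x.
Proof. by move=> [cF] [cG]; apply: Contc; exact: (@cvgD _ C^o _ _ _ F G _ _ cF cG). Qed.

Lemma contM F G x : contc F x ->
  contc G x ->
  contc (fun y => F y * G y) x.
Proof. by move=> [cF] [cG]; apply: Contc; exact: (@cvgM _ _ _ _ F G _ _ cF cG). Qed.

Lemma contN F x : contc F x ->
  contc (fun y => - F y) x.
Proof. by move=> [cF]; apply: Contc; exact: (@cvgN _ C^o _ _ _ F _ cF). Qed.

Lemma contC (c : C) x : contc (fun=> c) x.
Proof. apply: Contc; exact: cvg_cst. Qed.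

Lemma contV F x : contc F x -> F x != 0 ->
  contc (fun y => (F y)^-1) x.
Proof. by move=> [cF] F0; apply: Contc; exact: (@cvgV _ _ _ _ F _ F0 cF). Qed.

Lemma contX F x n : contc F x ->
  contc (fun y => F y ^+ n) x.
Proof.
move=> cF; elim: n => [|n IH]; first exact: contC.
under eq_fun do rewrite exprS; exact: contM.
Qed.

Lemma cont_conj F x : contc F x ->
  contc (fun y => (F y)^*) x.
Proof.
move=> /contcP H; apply/contcP => e e0; near=> y.
by rewrite -rmorphB nc_conj; near: y; exact: H.
Unshelve. all: by end_near. Qed.

Lemma contRC (f : T -> R) x : f y @[y --> x] --> f x ->
  contc (fun y => (f y)%:C) x.
Proof. by move=> cf; apply: Contc; apply: cvg_cplx => //=; exact: cvg_cst. Qed.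

Lemma cont_comp (f : C -> C) G x : contc (f : C^o -> C) (G x) -> contc G x ->
  contc (fun y => f (G y)) x.
Proof.
move=> /contcP cf /contcP cG; apply/contcP => e e0.
have /nbhsCP[r r0 hr] := cf e e0.
by near=> y; apply: hr; near: y; exact: cG.
Unshelve. all: by end_near. Qed.

Lemma has_slope_cont e F x d : contc e x ->
  has_slope e F x d -> contc F x.
Proof.
move=> ce [p [cp _ pE]].
have -> : F = fun y => p y * (e y + - e x) + F x.
  by apply/funext => y; rewrite -pE subrK.
apply: contD; last exact: contC.
apply: contM cp _; apply: contD ce _; exact: contC.
Qed.

Lemma has_slope_near e F G x d : injective e ->
  (\forall y \near x, F y = G y) -> has_slope e F x d -> has_slope e G x d.
Proof.
move=> ie FG [p [cp pd pE]].
have Fx : F x = G x by exact: nbhs_singleton FG.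
exists (fun y => if y == x then d else (G y - G x) / (e y - e x)).
have ey y : y != x -> e y - e x != 0.
  by apply: contra; rewrite subr_eq0 => /eqP/ie->.
split=> [||y]; last 2 first.
- by rewrite eqxx.
- by have [->|yx] := eqVneq y x; rewrite ?subrr ?mulr0// divfK// ey.
case: cp => cp; apply: Contc; rewrite eqxx -pd; apply: cvg_trans cp.
apply: near_eq_cvg; near=> y.
have [->|yx] := eqVneq y x; first by [].
apply: (mulIf (ey _ yx)); rewrite -pE divfK ?ey// -Fx; congr (_ - _).
by near: y.
Unshelve. all: by end_near. Qed.

Lemma has_slope_cst e (c : C) x : has_slope e (fun=> c) x 0.
Proof.
by exists (fun=> 0); split=> // [|y]; [exact: contC|rewrite mul0r subrr].
Qed.

Lemma has_slope_id e x : has_slope e e x 1.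
Proof.
by exists (fun=> 1); split=> // [|y]; [exact: contC|rewrite mul1r].
Qed.

Lemma has_slopeD e F G x d d' : has_slope e F x d -> has_slope e G x d' ->
  has_slope e (fun y => F y + G y) x (d + d').
Proof.
move=> [p [cp pd pE]] [q [cq qd qE]]; exists (fun y => p y + q y); split.
- exact: contD.
- by rewrite pd qd.
- by move=> y; rewrite mulrDl -pE -qE; ring.
Qed.

Lemma has_slopeM e F G x d d' : contc e x ->
  has_slope e F x d -> has_slope e G x d' ->
  has_slope e (fun y => F y * G y) x (d * G x + F x * d').
Proof.
move=> ce hF hG; have cG := has_slope_cont ce hG.
move: hF hG => [p [cp pd pE]] [q [cq qd qE]].
exists (fun y => p y * G y + F x * q y); split.
- apply: contD; first exact: contM.
  by apply: contM; first exact: contC.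
- by rewrite pd qd.
- move=> y; have -> : F y * G y - F x * G x =
    (F y - F x) * G y + F x * (G y - G x) by ring.
  by rewrite pE qE; ring.
Qed.

Lemma has_slopeZ e F (c : C) x d :
  has_slope e F x d -> has_slope e (fun y => c * F y) x (c * d).
Proof.
move=> [p [cp pd pE]]; exists (fun y => c * p y); split.
- by apply: contM; first exact: contC.
- by rewrite pd.
- by move=> y; rewrite -mulrA -pE mulrBr.
Qed.

Lemma has_slopeN e F x d :
  has_slope e F x d -> has_slope e (fun y => - F y) x (- d).
Proof.
move=> /(has_slopeZ (-1)); rewrite mulN1r.
by under [X in has_slope _ X]eq_fun do rewrite mulN1r.
Qed.

Lemma has_slopeB e F G x d d' : has_slope e F x d -> has_slope e G x d' ->
  has_slope e (fun y => F y - G y) x (d - d').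
Proof. by move=> hF /has_slopeN; exact: has_slopeD. Qed.

Lemma has_slope_comp e (f : C -> C) G x d d' :
  contc e x ->
  has_slope (id : C^o -> C) f (G x) d -> has_slope e G x d' ->
  has_slope e (fun y => f (G y)) x (d * d').
Proof.
move=> ce [p [cp pd pE]] hG; have cG := has_slope_cont ce hG.
move: hG => [q [cq qd qE]]; exists (fun y => p (G y) * q y); split.
- by apply: contM cq; exact: cont_comp.
- by rewrite pd qd.
- by move=> y; rewrite -mulrA -qE -pE.
Qed.

Lemma has_slope_eq e F x d d' : has_slope e F x d -> d = d' -> has_slope e F x d'.
Proof. by move=> H <-. Qed.
End Rules.

Lemma contid (z : C) : contc (id : C^o -> C) z.
Proof. apply: Contc; exact: cvg_id. Qed.

Lemma contreal (x : R) : contc (real_complex R) x.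
Proof. by apply: contRC; exact: cvg_id. Qed.

Definition cder (f : C -> C) (z d : C) := has_slope (id : C^o -> C) f z d.
Definition vder (f : R -> C) (x : R) (d : C) := has_slope (real_complex R) f x d.

Lemma cder_cont (f : C -> C) z d : cder f z d -> contc (f : C^o -> C) z.
Proof. by move=> H; exact: (@has_slope_cont _ _ _ _ _ (@contid z) H). Qed.

Lemma vder_cont (f : R -> C) x d : vder f x d -> contc f x.
Proof. by move=> H; exact: (@has_slope_cont _ _ _ _ _ (@contreal x) H). Qed.

Lemma vder_is_derive (f : R -> C) x d : vder f x d ->
  is_derive x (1:R) (fun y => Re (f y)) (Re d) /\ is_derive x (1:R) (fun y => Im (f y)) (Im d).
Proof.
move=> [p [cp pd pE]].
have aux (g : C -> R) : (forall z w, g (z + w) = g z + g w) ->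
    (forall z (a : R), g (z * a%:C) = g z * a) -> (forall z, g (- z) = - g z) ->
    g (p y) @[y --> x] --> g d -> is_derive (x : R) (1 : R) (fun y => g (f y)) (g d).
  move=> gD gM gN cg.
  have H : (fun h => h^-1 *: (g (f (h *: 1 + x)) - g (f x))) @ 0^'
      --> g d.
    have ch : g (p (h + x)) @[h --> 0^'] --> g d.
      apply: cvg_within_filter.
      have : (h + x) @[h --> (0:R)] --> x.
        rewrite -[X in _ --> X]add0r; apply: cvgD; [exact: cvg_id|exact: cvg_cst].
      by move=> hx; exact: (@cvg_comp _ _ _ (fun h : R => h + x) (fun y => g (p y)) _ _ _ hx cg).
    apply: cvg_trans ch; apply: near_eq_cvg; near=> h.
    have h0 : h != 0 by near: h; exact: nbhs_dnbhs_neq.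
    rewrite /= /GRing.scale /= mulr1 -gN -gD pE.
    rewrite (_ : _ - _ = h%:C); last by rewrite -rmorphB addrK.
    by rewrite gM mulrC mulfK.
  split; first by apply/cvg_ex; exists (g d).
  by apply/cvg_lim.
split; apply: aux.
- exact: ReD.
- by move=> z a; rewrite ReM /= mulr0 subr0.
- exact: ReN.
- by rewrite -pd; apply: cvg_Re; exact: contcE.
- exact: ImD.
- by move=> z a; rewrite ImM /= mulr0 add0r.
- exact: ImN.
- by rewrite -pd; apply: cvg_Im; exact: contcE.
Unshelve. all: by end_near. Qed.

Lemma is_derive_slope (f : R -> R) x d : is_derive (x : R) (1 : R) f d ->
  exists p : R -> R, [/\ p y @[y --> x] --> p x, p x = d &
    forall y, f y - f x = p y * (y - x)].
Proof.
move=> [df fd].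
exists (fun y => if y == x then d else (f y - f x) / (y - x)); split.
- rewrite eqxx.
  apply/cvgrPdist_lt => e e0.
  have /cvgrPdist_lt/(_ e e0) : (fun h => h^-1 *: ((f \o shift x) (h *: 1) - f x)) @ 0^'
      --> d by rewrite -fd; exact: df.
  move=> /nbhs_normP[r /= r0 hr]; apply/nbhs_normP; exists r => // y /= yr.
  case: (eqVneq y x) => [_|yx]; first by rewrite subrr normr0.
  have := hr (y - x); rewrite /= sub0r opprB subr_eq0 => /(_ yr yx).
  by rewrite /= /GRing.scale /= mulr1 subrK mulrC.
- by rewrite eqxx.
- move=> y; have [->|yx] := eqVneq y x; first by rewrite !subrr mulr0.
  by rewrite divfK// subr_eq0.
Qed.

Lemma is_derive_vder (f : R -> R) x d : is_derive (x : R) (1 : R) f d ->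
  vder (fun y => (f y)%:C) x d%:C.
Proof.
move=> /is_derive_slope[p [cp pd pE]]; exists (fun y => (p y)%:C); split.
- exact: contRC.
- by rewrite pd.
- by move=> y; rewrite -!rmorphB pE rmorphM.
Qed.

Lemma cder_derivable (f : C -> C) z d : cder f z d ->
  differentiable (f : C^o -> C^o) (z : C^o).
Proof.
move=> [p [cp pd pE]]; apply/(derivable1_diffP (f : C^o -> C^o)).
apply/cvg_ex; exists d => /=.
move: cp => /contcP cp; apply/cvgCP => e e0; have /nbhsCP[r r0 hr] := cp e e0.
near=> h.
have h0 : h != 0 by near: h; rewrite near_withinE; exact: nearW.
have hh : nc h < r.
  by near: h; apply: cvg_within; apply: (nearC r0) => w; rewrite subr0.
have := hr (h + z); rewrite addrK => /(_ hh).
by rewrite /GRing.scale /= mulr1 pE addrK [h^-1 * _]mulrC mulfK// pd.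
Unshelve. all: by end_near. Qed.

Lemma derivable_cder (f : C -> C) z :
  differentiable (f : C^o -> C^o) (z : C^o) -> exists d, cder f z d.
Proof.
move=> /(derivable1_diffP (f : C^o -> C^o))/cvg_ex[d /= H]; exists d.
exists (fun y => if y == z then d else (f y - f z) / (y - z)); split.
- apply/contcP => e e0; rewrite eqxx.
  move: H => /cvgCP/(_ e e0)/(@nbhs_normP _ C^o)[r /= r0 hr].
  apply/(@nbhs_normP _ C^o); exists r => // y /= yr.
  case: (eqVneq y z) => [_|yx]; first by rewrite subrr nc0.
  have := hr (y - z); rewrite /= sub0r opprB subr_eq0 => /(_ yr yx).
  by rewrite /= /GRing.scale /= mulr1 subrK mulrC.
- by rewrite eqxx.
- move=> y; have [->|yx] := eqVneq y z; first by rewrite !subrr mulr0.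
  by rewrite divfK// subr_eq0.
Qed.

Lemma cderV (z : C) : z != 0 -> cder (fun w => w^-1) z (- z^-2).
Proof.
move=> z0; apply: (@has_slope_near _ (id : C^o -> C) (fun w => if w == 0 then z^-1 + z^-2 * z else w^-1)) => //.
  apply: (@nearC _ _ (nc z)); first by rewrite nc_gt0.
  by move=> w; case: ifPn => // /eqP->; rewrite sub0r ncN ltxx.
exists (fun w => if w == 0 then - z^-2 else - (w * z)^-1); split=> [||w].
- apply: Contc; rewrite (negbTE z0).
  have : (fun w : C^o => (- (w * z)^-1 : C^o)) @ (z : C^o) --> (- (z * z)^-1 : C^o).
    apply: contcE; apply: contN; apply: contV; last by rewrite mulf_neq0.
    by apply: contM; [exact: contid|exact: contC].
  apply: cvg_trans; apply: near_eq_cvg; first exact: nbhs_filter.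
  apply: (@nearC _ _ (nc z)); first by rewrite nc_gt0.
  by move=> w; case: ifPn => // /eqP->; rewrite sub0r ncN ltxx.
- by rewrite (negbTE z0) expr2.
- rewrite (negbTE z0); case: ifPn => [/eqP->|w0]; first by rewrite /=; field.
  by rewrite /=; field; rewrite w0 z0.
Qed.

Lemma has_slopeV {T : topologicalType} (e G : T -> C) x d :
  contc e x -> G x != 0 -> has_slope e G x d ->
  has_slope e (fun y => (G y)^-1) x (- (G x) ^- 2 * d).
Proof. by move=> ce G0 hG; exact: has_slope_comp (cderV G0) hG. Qed.

Lemma has_slopeX {T : topologicalType} (e G : T -> C) x d n :
  contc e x -> has_slope e G x d ->
  has_slope e (fun y => G y ^+ n) x (n%:R * G x ^+ n.-1 * d).
Proof.
move=> ce hG; elim: n => [|n IH].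
  by rewrite !mul0r; exact: has_slope_cst.
under [X in has_slope _ X]eq_fun do rewrite exprS.
apply: has_slope_eq (has_slopeM ce hG IH) _ => /=.
by case: n {IH} => [|n] /=; rewrite ?expr0 ?exprS -!natr1; ring.
Qed.
End Caratheodory.

(** * Integrals of complex functions *)

Section ComplexIntegral.
Context {R : realType} {d : measure_display} {T : measurableType d}.
Variable mu : {measure set T -> \bar R}.
Local Notation C := (R[i]).
Implicit Types (D : set T) (f g : T -> C) (c : C).

Definition cint D f : C :=
  (\int[mu]_(x in D) Re (f x)) +i* (\int[mu]_(x in D) Im (f x)).

Definition cintegrable D f :=
  mu.-integrable D (EFin \o (fun x => Re (f x))) /\
  mu.-integrable D (EFin \o (fun x => Im (f x))).

Definition cmeasurable D f :=
  measurable_fun D (fun x => Re (f x)) /\ measurable_fun D (fun x => Im (f x)).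

Lemma Rinteg_eq D (f g : T -> R) : (forall x, D x -> f x = g x) ->
  mu.-integrable D (EFin \o f) -> measurable D -> mu.-integrable D (EFin \o g).
Proof.
move=> fg fi mD; apply: (@eq_integrable _ _ _ mu D mD _ _ _ fi) => x /set_mem Dx /=.
by rewrite fg.
Qed.

Lemma integrableRD D (f g : T -> R) : measurable D ->
  mu.-integrable D (EFin \o f) -> mu.-integrable D (EFin \o g) ->
  mu.-integrable D (EFin \o (fun x => f x + g x)).
Proof. by move=> mD fi gi; have := integrableD mD fi gi. Qed.

Lemma integrableRB D (f g : T -> R) : measurable D ->
  mu.-integrable D (EFin \o f) -> mu.-integrable D (EFin \o g) ->
  mu.-integrable D (EFin \o (fun x => f x - g x)).
Proof. by move=> mD fi gi; have := integrableB mD fi gi. Qed.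

Lemma integrableRZ D (k : R) (f : T -> R) : measurable D ->
  mu.-integrable D (EFin \o f) -> mu.-integrable D (EFin \o (fun x => k * f x)).
Proof. by move=> mD fi; have := integrableZl mD k fi. Qed.

Lemma integrableR_le D (f g : T -> R) : measurable D -> measurable_fun D f ->
  mu.-integrable D (EFin \o g) -> (forall x, D x -> `|f x| <= g x) ->
  mu.-integrable D (EFin \o f).
Proof.
move=> mD mf gi fg; apply: (le_integrable mD _ _ gi).
  by apply/measurable_EFinP.
by move=> x Dx /=; rewrite lee_fin (le_trans (fg x Dx))// ler_norm.
Qed.

Lemma integrableR_measurable D (f : T -> R) :
  mu.-integrable D (EFin \o f) -> measurable_fun D f.
Proof. by move=> /measurable_int/measurable_EFinP. Qed.

Lemma cmeasurable_eq D f g : (forall x, D x -> f x = g x) ->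
  cmeasurable D f -> cmeasurable D g.
Proof.
move=> fg [mr mi]; split.
  by apply: eq_measurable_fun mr => x /set_mem Dx; rewrite fg.
by apply: eq_measurable_fun mi => x /set_mem Dx; rewrite fg.
Qed.

Lemma cmeasurableD D f g : cmeasurable D f -> cmeasurable D g ->
  cmeasurable D (fun x => f x + g x).
Proof.
move=> [fr fi] [gr gi]; split.
  by under eq_fun do rewrite ReD; exact: measurable_funD.
by under eq_fun do rewrite ImD; exact: measurable_funD.
Qed.

Lemma cmeasurableM D f g : cmeasurable D f -> cmeasurable D g ->
  cmeasurable D (fun x => f x * g x).
Proof.
move=> [fr fi] [gr gi]; split.
  under eq_fun do rewrite ReM.
  by apply: measurable_funB; exact: measurable_funM.
under eq_fun do rewrite ImM.
by apply: measurable_funD; exact: measurable_funM.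
Qed.

Lemma cmeasurable_cst D c : cmeasurable D (fun=> c).
Proof. by split; exact: measurable_cst. Qed.

Lemma cmeasurableR D (f : T -> R) : measurable_fun D f ->
  cmeasurable D (fun x => (f x)%:C).
Proof. by move=> mf; split => //=; exact: measurable_cst. Qed.

Lemma cmeasurable_conj D f : cmeasurable D f ->
  cmeasurable D (fun x => (f x)^*).
Proof.
move=> [fr fi]; split.
  by apply: eq_measurable_fun fr => x _; case: (f x).
apply: (@eq_measurable_fun _ _ _ _ _ (fun x => - Im (f x))).
  by move=> x _; case: (f x).
exact: measurableT_comp.
Qed.

Lemma measurable_nc D f : cmeasurable D f -> measurable_fun D (fun x => nc (f x)).
Proof.
move=> [fr fi]; under eq_fun do rewrite ncE.
apply: (@measurableT_comp _ _ _ _ _ _ (@Num.sqrt R)).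
  apply: continuous_measurable_fun; exact: sqrt_continuous.
by apply: measurable_funD; exact: measurable_funX.
Qed.

Section OnMeasurable.
Variables (D : set T) (mD : measurable D).

Lemma cintegrable_measurable f : cintegrable D f -> cmeasurable D f.
Proof. by move=> [fr fi]; split; exact: integrableR_measurable. Qed.

Lemma cintegrable_le f (g : T -> R) : cmeasurable D f ->
  mu.-integrable D (EFin \o g) -> (forall x, D x -> nc (f x) <= g x) ->
  cintegrable D f.
Proof.
move=> [fr fi] gi fg; split; apply: (integrableR_le mD _ gi) => // x Dx.
  exact: le_trans (ge_nc_Re _) (fg x Dx).
exact: le_trans (ge_nc_Im _) (fg x Dx).
Qed.

Lemma cintegrable_eq f g : (forall x, D x -> f x = g x) ->
  cintegrable D f -> cintegrable D g.
Proof.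
by move=> fg [fr fi]; split; [apply: Rinteg_eq fr mD|apply: Rinteg_eq fi mD];
  move=> x Dx /=; rewrite fg.
Qed.

Lemma cintegrableD f g : cintegrable D f -> cintegrable D g ->
  cintegrable D (fun x => f x + g x).
Proof.
move=> [fr fi] [gr gi]; split; under eq_fun do rewrite ?ReD ?ImD.
  exact: integrableRD.
exact: integrableRD.
Qed.

Lemma cintegrableZ c f : cintegrable D f -> cintegrable D (fun x => c * f x).
Proof.
move=> [fr fi]; split; under eq_fun do rewrite ?ReM ?ImM.
  by apply: integrableRB => //; exact: integrableRZ.
by apply: integrableRD => //; exact: integrableRZ.
Qed.

Lemma cintegrable_nc f : cintegrable D f ->
  mu.-integrable D (EFin \o (fun x => nc (f x))).
Proof.
move=> fi; have mf := cintegrable_measurable fi; case: fi => fr fi.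
apply: (@integrableR_le _ _ (fun x => `|Re (f x)| + `|Im (f x)|)) => //.
- exact: measurable_nc.
- by apply: integrableRD => //; exact: integrable_norm.
- by move=> x _; rewrite ger0_norm ?nc_ge0// nc_le.
Qed.

Lemma cintegrable0 : cintegrable D (fun=> 0).
Proof. by split; exact: integrable0. Qed.

Lemma cintegrable_sum n (f : nat -> T -> C) :
  (forall i, (i < n)%N -> cintegrable D (f i)) ->
  cintegrable D (fun x => \sum_(i < n) f i x).
Proof.
elim: n => [|n IH] H.
  by under eq_fun do rewrite big_ord0; exact: cintegrable0.
under eq_fun do rewrite big_ord_recr /=.
apply: cintegrableD; last exact: H.
by apply: IH => i ltin; apply: H; exact: ltnW.
Qed.

Lemma eq_cint f g : (forall x, D x -> f x = g x) -> cint D f = cint D g.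
Proof.
by move=> fg; congr (_ +i* _); apply: eq_Rintegral => x /set_mem Dx; rewrite fg.
Qed.

Lemma cintD f g : cintegrable D f -> cintegrable D g ->
  cint D (fun x => f x + g x) = cint D f + cint D g.
Proof.
move=> [fr fi] [gr gi]; rewrite /cint.
under eq_Rintegral do rewrite ReD.
under [X in _ +i* X]eq_Rintegral do rewrite ImD.
by rewrite !RintegralD.
Qed.

Lemma cintZ c f : cintegrable D f -> cint D (fun x => c * f x) = c * cint D f.
Proof.
move=> [fr fi]; rewrite /cint.
under eq_Rintegral do rewrite ReM.
under [X in _ +i* X]eq_Rintegral do rewrite ImM.
rewrite RintegralB ?RintegralD//; try exact: integrableRZ.
by rewrite !RintegralZl//; case: c.
Qed.

Lemma cintZr c f : cintegrable D f -> cint D (fun x => f x * c) = cint D f * c.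
Proof.
by move=> fi; rewrite mulrC -cintZ//; apply: eq_cint => x _; rewrite mulrC.
Qed.

Lemma cintN f : cintegrable D f -> cint D (fun x => - f x) = - cint D f.
Proof.
move=> fi; rewrite -mulN1r -cintZ//.
by apply: eq_cint => x _; rewrite mulN1r.
Qed.

Lemma cintB f g : cintegrable D f -> cintegrable D g ->
  cint D (fun x => f x - g x) = cint D f - cint D g.
Proof.
move=> fi gi; rewrite -cintN// -cintD//.
by apply: cintegrable_eq (cintegrableZ (-1) gi) => x _; rewrite mulN1r.
Qed.

Lemma cintegrableB f g : cintegrable D f -> cintegrable D g ->
  cintegrable D (fun x => f x - g x).
Proof.
move=> fi gi; apply: cintegrableD => //.
by apply: cintegrable_eq (cintegrableZ (-1) gi) => x _; rewrite mulN1r.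
Qed.

Lemma cint0 : cint D (fun=> 0) = 0.
Proof. by rewrite /cint /Rintegral /= !integral0. Qed.

Lemma cint_sum n (f : nat -> T -> C) :
  (forall i, (i < n)%N -> cintegrable D (f i)) ->
  cint D (fun x => \sum_(i < n) f i x) = \sum_(i < n) cint D (f i).
Proof.
elim: n => [|n IH] H.
  rewrite big_ord0; under eq_fun do rewrite big_ord0; exact: cint0.
rewrite big_ord_recr /=; under eq_fun do rewrite big_ord_recr /=.
have H' i : (i < n)%N -> cintegrable D (f i) by move=> /ltnW; exact: H.
by rewrite cintD ?IH//; [exact: cintegrable_sum|exact: H].
Qed.

Lemma cint_conj f : cintegrable D f -> cint D (fun x => (f x)^*) = (cint D f)^*.
Proof.
move=> [fr fi]; rewrite /cint; congr (_ +i* _).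
  by apply: eq_Rintegral => x _; case: (f x).
rewrite -[RHS]mulN1r -RintegralZl//.
by apply: eq_Rintegral => x _; rewrite mulN1r; case: (f x).
Qed.

Lemma cintR (f : T -> R) : cint D (fun x => (f x)%:C) = (\int[mu]_(x in D) f x)%:C.
Proof. by rewrite /cint /Rintegral /= integral0. Qed.

(** Rotating the value of the integral onto the positive axis reduces the
    triangle inequality to monotonicity of the real integral. *)
Lemma nc_cint_le f : cintegrable D f ->
  nc (cint D f) <= \int[mu]_(x in D) nc (f x).
Proof.
move=> fi; have [->|I0] := eqVneq (cint D f) 0.
  by rewrite nc0; apply: Rintegral_ge0 => x _; exact: nc_ge0.
pose u : C := (nc (cint D f))%:C / cint D f.
have ufi := cintegrableZ u fi.
have -> : nc (cint D f) = Re (cint D (fun x => u * f x)).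
  by rewrite cintZ// /u divfK.
apply: le_Rintegral => //; first by case: ufi.
  exact: cintegrable_nc.
move=> x _; rewrite (le_trans (ler_norm _))// (le_trans (ge_nc_Re _))//.
by rewrite ncM /u ncM ncV ncR ger0_norm ?nc_ge0// divff ?mul1r ?nc_eq0.
Qed.

Lemma nc_cint_bound f (g : T -> R) : cintegrable D f ->
  mu.-integrable D (EFin \o g) -> (forall x, D x -> nc (f x) <= g x) ->
  nc (cint D f) <= \int[mu]_(x in D) g x.
Proof.
move=> fi gi fg; rewrite (le_trans (nc_cint_le fi))//.
by apply: le_Rintegral => //; exact: cintegrable_nc.
Qed.
End OnMeasurable.
End ComplexIntegral.

Arguments cint : simpl never.

(** Countably many measurable sets, among which every neighbourhood of a
    point contains one around this point; open sets are then countable unions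
    of measurable sets. This property is stable by products, hence continuous
    functions on products of lines are measurable for the product
    sigma-algebra. The maps [i] and [j] identify the topological and the
    measurable space. *)
Definition measurable_basis {d} (T : measurableType d) (tT : topologicalType)
    (i : tT -> T) (j : T -> tT) :=
  exists B : nat -> set T, (forall n, measurable (B n)) /\
    forall x (U : set tT), nbhs (j x) U ->
      exists n, B n x /\ forall y, B n y -> U (j y).

Section MeasurableBasis.
Context {R : realType}.

Lemma measurable_basisR :
  @measurable_basis _ (measurableTypeR R) R id id.
Proof.
pose B n : set R := if unpickle n is Some pq then
  `](ratr (pq : rat * rat).1), (ratr pq.2)[%classic else set0.
exists B; split=> [n|x U /nbhs_normP[e /= e0 eU]].
  by rewrite /B; case: (unpickle n) => // pq; exact: measurable_itv.
have [p] := @rat_in_itvoo R (x - e) x ltac:(by rewrite ltrBlDr ltrDl).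
rewrite in_itv /= => /andP[p1 p2].
have [q] := @rat_in_itvoo R x (x + e) ltac:(by rewrite ltrDl).
rewrite in_itv /= => /andP[q1 q2].
exists (pickle (p, q)); rewrite /B pickleK /=; split=> [|y].
  by rewrite in_itv /= p2 q1.
rewrite in_itv /= => /andP[py yq]; apply: eU => /=.
by rewrite ltr_distlC; apply/andP; split; lra.
Qed.

Lemma measurable_basis_prod {d1 d2} (T1 : measurableType d1)
    (T2 : measurableType d2) (t1 t2 : topologicalType) i1 j1 i2 j2 :
  @measurable_basis _ T1 t1 i1 j1 -> @measurable_basis _ T2 t2 i2 j2 ->
  @measurable_basis _ (T1 * T2)%type (t1 * t2)%type
    (fun p => (i1 p.1, i2 p.2)) (fun p => (j1 p.1, j2 p.2)).
Proof.
move=> [B1 [mB1 HB1]] [B2 [mB2 HB2]].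
pose B n : set (T1 * T2) := if unpickle n is Some ab then
  B1 (ab : nat * nat).1 `*` B2 ab.2 else set0.
exists B; split=> [n|x U [[U1 U2] /= [nU1 nU2] UU]].
  by rewrite /B; case: (unpickle n) => // ab; exact: measurableX.
have [a [aB aU]] := HB1 _ _ nU1; have [b [bB bU]] := HB2 _ _ nU2.
exists (pickle (a, b)); rewrite /B pickleK; split=> // y [/= y1 y2].
by apply: UU; split => /=; [exact: aU|exact: bU].
Qed.

Lemma measurable_basis_fun {d} (T : measurableType d) (tT : topologicalType)
    i j (D : set T) (f : T -> R) : @measurable_basis _ T tT i j -> cancel j i ->
  measurable D ->
  (forall x, D x -> f (i y) @[y --> (j x)] --> f x) -> measurable_fun D f.
Proof.
move=> [B [mB HB]] ji mD cf.
apply: (measurability _ (RGenOpens.measurableE R)) => //.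
move=> _ [_ [a [b ->] <-]].
set O := `]a, b[%classic.
have -> : D `&` f @^-1` O =
    D `&` \bigcup_(n in [set n | forall y, B n y -> O (f y)]) B n.
  apply/seteqP; split=> x [Dx Ox]; split => //.
    have [n [nx nU]] : exists n, B n x /\ forall y, B n y -> O (f (i (j y))).
      apply: (HB x (fun y => O (f (i y)))); apply: (cf x Dx); apply: open_nbhs_nbhs; split => //.
    by exists n => // y /nU; rewrite ji.
  by case: Ox => n nO Bx; exact: nO.
by apply: measurableI => //; apply: bigcup_measurable => n _; exact: mB.
Qed.

Local Notation RM := (measurableTypeR R).
Lemma measurable_cont1 (D : set RM) (f : RM -> R) : measurable D ->
  (forall x : R, D x -> (f : R -> R) y @[y --> x] --> f x) -> measurable_fun D f.
Proof. by move=> mD cf; exact: (measurable_basis_fun measurable_basisR). Qed.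

Lemma measurable_cont2 (D : set (RM * RM)) (f : RM * RM -> R) : measurable D ->
  (forall x : R * R, D x -> (f : R * R -> R) y @[y --> x] --> f x) -> measurable_fun D f.
Proof.
move=> mD cf; apply: (measurable_basis_fun
  (measurable_basis_prod measurable_basisR measurable_basisR)) => //.
  by case.
by move=> [x1 x2] Dx; under eq_fun do rewrite -surjective_pairing; exact: cf.
Qed.

Lemma measurable_cont4 (D : set ((RM * RM) * (RM * RM)))
    (f : (RM * RM) * (RM * RM) -> R) : measurable D ->
  (forall x : (R * R) * (R * R), D x ->
     (f : (R * R) * (R * R) -> R) y @[y --> x] --> f x) -> measurable_fun D f.
Proof.
pose b2 := measurable_basis_prod measurable_basisR measurable_basisR.
move=> mD cf; apply: (measurable_basis_fun (measurable_basis_prod b2 b2)) => //.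
  by case=> [[? ?] [? ?]].
move=> [[x1 x2] [x3 x4]] Dx; rewrite /=.
under eq_fun do rewrite -!surjective_pairing; exact: cf.
Qed.
End MeasurableBasis.

Section Fubini.
Context {R : realType} {d1 d2 : measure_display}.
Context {T1 : measurableType d1} {T2 : measurableType d2}.
Variables (m1 : {sigma_finite_measure set T1 -> \bar R})
          (m2 : {sigma_finite_measure set T2 -> \bar R}).
Variables (A : set T1) (B : set T2) (mA : measurable A) (mB : measurable B).

Lemma Rfubini1 (f : T1 * T2 -> R) :
  (m1 \x m2)%E.-integrable (A `*` B) (EFin \o f) ->
  (forall x, A x -> m2.-integrable B (EFin \o (fun y => f (x, y)))) ->
  \int[m1]_(x in A) \int[m2]_(y in B) f (x, y) =
  \int[(m1 \x m2)%E]_(z in A `*` B) f z.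
Proof.
move=> fi gi; have mAB : measurable (A `*` B) by exact: measurableX.
rewrite /Rintegral; congr fine.
rewrite [RHS]integral_mkcond -integral12_prod_meas1; last by apply/(integrable_mkcond _ mAB).
rewrite [LHS]integral_mkcond; apply: eq_integral => x _.
rewrite /fubini_F patchE; case: ifPn => [/set_mem Ax|/negP nAx].
  rewrite fineK; last by apply: integrable_fin_num => //; exact: gi.
  rewrite integral_mkcond; apply: eq_integral => y _.
  rewrite !patchE; case: ifPn => [/set_mem By|/negP nBy].
    by rewrite mem_set.
  by rewrite memNset// => -[_ /= By]; apply: nBy; rewrite mem_set.
rewrite integral0_eq// => y _; rewrite patchE memNset// => -[/= Ax _].
by apply: nAx; rewrite mem_set.
Qed.

Lemma Rfubini2 (f : T1 * T2 -> R) :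
  (m1 \x m2)%E.-integrable (A `*` B) (EFin \o f) ->
  (forall y, B y -> m1.-integrable A (EFin \o (fun x => f (x, y)))) ->
  \int[m2]_(y in B) \int[m1]_(x in A) f (x, y) =
  \int[(m1 \x m2)%E]_(z in A `*` B) f z.
Proof.
move=> fi gi; have mAB : measurable (A `*` B) by exact: measurableX.
rewrite /Rintegral; congr fine.
rewrite [RHS]integral_mkcond -integral21_prod_meas1; last by apply/(integrable_mkcond _ mAB).
rewrite [LHS]integral_mkcond; apply: eq_integral => y _.
rewrite /fubini_G patchE; case: ifPn => [/set_mem By|/negP nBy].
  rewrite fineK; last by apply: integrable_fin_num => //; exact: gi.
  rewrite integral_mkcond; apply: eq_integral => x _.
  rewrite !patchE; case: ifPn => [/set_mem Ax|/negP nAx].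
    by rewrite mem_set.
  by rewrite memNset// => -[/= Ax _]; apply: nAx; rewrite mem_set.
rewrite integral0_eq// => x _; rewrite patchE memNset// => -[_ /= By].
by apply: nBy; rewrite mem_set.
Qed.

Lemma cfubini1 (f : T1 * T2 -> R[i]) :
  cintegrable (m1 \x m2)%E (A `*` B) f ->
  (forall x, A x -> cintegrable m2 B (fun y => f (x, y))) ->
  cint m1 A (fun x => cint m2 B (fun y => f (x, y))) =
  cint (m1 \x m2)%E (A `*` B) f.
Proof.
move=> [fr fi] g; rewrite /cint /=; congr (_ +i* _).
  by apply: (Rfubini1 fr) => x /g[].
by apply: (Rfubini1 fi) => x /g[].
Qed.

Lemma cfubini2 (f : T1 * T2 -> R[i]) :
  cintegrable (m1 \x m2)%E (A `*` B) f ->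
  (forall y, B y -> cintegrable m1 A (fun x => f (x, y))) ->
  cint m2 B (fun y => cint m1 A (fun x => f (x, y))) =
  cint (m1 \x m2)%E (A `*` B) f.
Proof.
move=> [fr fi] g; rewrite /cint /=; congr (_ +i* _).
  by apply: (Rfubini2 fr) => x /g[].
by apply: (Rfubini2 fi) => x /g[].
Qed.

Lemma integrableX (f : T1 -> R) (g : T2 -> R) :
  m1.-integrable A (EFin \o f) -> m2.-integrable B (EFin \o g) ->
  (m1 \x m2)%E.-integrable (A `*` B) (EFin \o (fun z => f z.1 * g z.2)).
Proof.
move=> fi gi; have mAB : measurable (A `*` B) by exact: measurableX.
apply/integrable_mkcond => //.
have fi' : m1.-integrable setT (EFin \o (f \_ A)).
  by rewrite -restrict_EFin; apply/(integrable_mkcond _ mA).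
have gi' : m2.-integrable setT (EFin \o (g \_ B)).
  by rewrite -restrict_EFin; apply/(integrable_mkcond _ mB).
have E : (EFin \o (fun z => f z.1 * g z.2)) \_ (A `*` B) =
    EFin \o (fun z => (f \_ A) z.1 * (g \_ B) z.2).
  apply/funext => -[x y] /=; rewrite !patchE.
  case: (pselect (A x)) => Ax; last first.
    rewrite (memNset Ax) memNset; first by rewrite mul0r.
    by case.
  case: (pselect (B y)) => By; last first.
    rewrite (memNset By) memNset; first by rewrite mulr0.
    by case.
  by rewrite (mem_set Ax) (mem_set By) mem_set.
have mf' : measurable_fun setT (f \_ A) by exact: integrableR_measurable fi'.
have mg' : measurable_fun setT (g \_ B) by exact: integrableR_measurable gi'.
rewrite E; apply/integrable12ltyP.
  apply/measurable_EFinP/measurable_funM.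
    by apply: (measurableT_comp mf'); exact: measurable_fst.
  by apply: (measurableT_comp mg'); exact: measurable_snd.
have -> : (\int[m1]_x \int[m2]_y `|((f \_ A) x * (g \_ B) y)%R%:E| =
  \int[m1]_x (`|(f \_ A) x|%:E * (\int[m2]_y `|(g \_ B) y|%:E)))%E.
  apply: eq_integral => x _ /=.
  under eq_integral do rewrite normrM EFinM.
  rewrite ge0_integralZl//.
    by apply/measurable_EFinP; apply: measurableT_comp.
have g0 : (0 <= \int[m2]_y `|(g \_ B) y|%:E)%E.
  by apply: integral_ge0 => y _; rewrite lee_fin.
have f0 : (0 <= \int[m1]_y `|(f \_ A) y|%:E)%E.
  by apply: integral_ge0 => y _; rewrite lee_fin.
have gf : (\int[m2]_y `|(g \_ B) y|%:E)%E \is a fin_num.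
  by have /integrableP[_] := gi'; rewrite ge0_fin_numE.
rewrite ge0_integralZr//; last by apply/measurable_EFinP; apply: measurableT_comp.
have /integrableP[_ flty] := fi'.
apply: lte_mul_pinfty => //; first by rewrite ge0_fin_numE.
by rewrite -ge0_fin_numE.
Qed.
End Fubini.

(** * Curve integrals and the complex exponential *)

Section CurveIntegrals.
Context {R : realType}.
Local Notation C := (R[i]).
Local Notation leb := (@lebesgue_measure R).
Local Notation RM := (measurableTypeR R).
Implicit Types (a b c : R) (f F : R -> C).

Lemma cRintegralE (D : set R) f : cRintegral D f = cint leb D f.
Proof. by []. Qed.

Lemma contc_Re {T : topologicalType} (f : T -> C) x : contc f x ->
  Re (f y) @[y --> x] --> Re (f x).
Proof. by move=> /contcE; exact: cvg_Re. Qed.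

Lemma contc_Im {T : topologicalType} (f : T -> C) x : contc f x ->
  Im (f y) @[y --> x] --> Im (f x).
Proof. by move=> /contcE; exact: cvg_Im. Qed.

Definition contcI a b f := forall x, a <= x <= b -> contc f x.

Lemma contcI_within a b f (g : C -> R) :
  (forall x, contc f x -> g (f y) @[y --> x] --> g (f x)) ->
  contcI a b f -> {within `[a, b], continuous (fun x => g (f x))}.
Proof.
move=> gc cf; apply: continuous_in_subspaceT => x /set_mem /=.
by rewrite in_itv /= => /cf; exact: gc.
Qed.

Lemma contcI_Re a b f : contcI a b f -> {within `[a, b], continuous (fun x => Re (f x))}.
Proof. by apply: contcI_within => x; exact: contc_Re. Qed.

Lemma contcI_Im a b f : contcI a b f -> {within `[a, b], continuous (fun x => Im (f x))}.
Proof. by apply: contcI_within => x; exact: contc_Im. Qed.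

Lemma contcI_cintegrable a b f : contcI a b f -> cintegrable leb `[a, b] f.
Proof.
move=> cf; split; apply: continuous_compact_integrable; first exact: segment_compact.
- exact: contcI_Re.
- exact: segment_compact.
- exact: contcI_Im.
Qed.

Lemma contcI_sub a b a' b' f : a <= a' -> b' <= b -> contcI a b f -> contcI a' b' f.
Proof.
move=> aa bb cf x /andP[ax xb]; apply: cf.
by rewrite (le_trans aa ax) (le_trans xb bb).
Qed.

Lemma cint_derivative a b f F : a <= b -> contcI a b f ->
  (forall x, a <= x <= b -> vder F x (f x)) -> cint leb `[a, b] f = F b - F a.
Proof.
rewrite le_eqVlt => /predU1P[<- _ _|ab cf dF].
  by rewrite subrr set_itv1 /cint !Rintegral_set1.
have aux (g : C -> R) : {within `[a, b], continuous (fun x => g (f x))} ->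
    (forall x, a <= x <= b -> is_derive x (1:R) (fun x => g (F x)) (g (f x))) ->
    \int[leb]_(x in `[a, b]) g (f x) = g (F b) - g (F a).
  move=> cg dg; rewrite /Rintegral.
  rewrite (@continuous_FTC2 _ (fun x => g (f x)) (fun x => g (F x)))//.
    have cgF x : a <= x <= b -> {for x, continuous (fun x => g (F x))}.
      move=> xab; apply: differentiable_continuous; apply/derivable1_diffP.
      by have [] := dg x xab.
    split=> [x||].
    - rewrite in_itv /= => /andP[ax xb].
      by have [] := dg x; rewrite ?(ltW ax) ?(ltW xb).
    - by apply: cvg_at_right_filter; apply: cgF; rewrite lexx ltW.
    - by apply: cvg_at_left_filter; apply: cgF; rewrite lexx ltW.
  move=> x; rewrite in_itv /= => /andP[ax xb].
  have xab : a <= x <= b by rewrite !ltW.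
  by have [_ <-] := dg x xab; rewrite derive1E.
have eR := aux (@complex.Re R) (contcI_Re cf) (fun x xab => proj1 (vder_is_derive (dF x xab))).
have eI := aux (@complex.Im R) (contcI_Im cf) (fun x xab => proj2 (vder_is_derive (dF x xab))).
by rewrite /cint eR eI; apply: eqC; rewrite ?ReB ?ImB.
Qed.

Lemma cint_split a b c f : a <= b <= c -> contcI a c f ->
  cint leb `[a, c] f = cint leb `[a, b] f + cint leb `[b, c] f.
Proof.
move=> /andP[ab bc] cf; have ac := le_trans ab bc.
have aux (g : R -> R) : leb.-integrable `[a, c] (EFin \o g) ->
    \int[leb]_(x in `[a, c]) g x =
    \int[leb]_(x in `[a, b]) g x + \int[leb]_(x in `[b, c]) g x.
  move=> gi.
  have gS a' b' : a <= a' -> b' <= c -> leb.-integrable `[a', b'] (EFin \o g).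
    move=> aa bb; apply: integrableS gi => //.
    by apply: subset_itvScc; rewrite bnd_simp.
  have := @Rintegral_itvB _ g (BLeft a) (BRight c) b gi.
  rewrite !bnd_simp => /(_ ab bc).
  rewrite Rintegral_itv_obnd_cbnd.
    by move=> <-; rewrite addrC subrK.
  by apply: integrableS (gS b c ab (lexx _)) => //; exact: subset_itv_oc_cc.
have [fr fi] := contcI_cintegrable cf.
by rewrite /cint aux// (aux _ fi).
Qed.

Lemma integrable_cst_fin d (T : measurableType d) (mu : {measure set T -> \bar R})
    (D : set T) (k : R) : measurable D -> (mu D < +oo)%E ->
  mu.-integrable D (EFin \o (fun=> k)).
Proof.
by move=> mD muD; apply: measurable_bounded_integrable => //; exact: bounded_cst.
Qed.

Lemma leb_itv a b : a <= b -> leb (`[a, b] : set RM) = (b - a)%:E.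
Proof.
move=> ab; etransitivity; first exact: lebesgue_measure_itv.
rewrite /= lte_fin; case: ltP => // ba.
by rewrite (@le_anti _ _ a b) ?ab// subrr.
Qed.

Lemma cint_itv_bound a b f (M : R) : a <= b -> contcI a b f ->
  (forall x, a <= x <= b -> nc (f x) <= M) -> nc (cint leb `[a, b] f) <= M * (b - a).
Proof.
move=> ab cf fM; have mI : measurable (`[a, b] : set RM) by exact: measurable_itv.
have -> : M * (b - a) = \int[leb]_(x in `[a, b]) M.
  by rewrite Rintegral_cst//= leb_itv.
apply: (nc_cint_bound mI); first exact: contcI_cintegrable.
- by apply: integrable_cst_fin => //; rewrite /= leb_itv// ltry.
- by move=> x /=; rewrite in_itv; exact: fM.
Qed.

Lemma eq_cint_itv a b f F : (forall x, a <= x <= b -> f x = F x) ->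
  cint leb `[a, b] f = cint leb `[a, b] F.
Proof. by move=> fF; apply: eq_cint => x /=; rewrite in_itv => /fF. Qed.

Lemma contc_compact_bounded {T : topologicalType} (A : set T) (f : T -> C) : compact A ->
  (forall x, A x -> contc f x) -> exists M : R, forall x, A x -> nc (f x) <= M.
Proof.
move=> cA cf.
have : compact ((fun x => nc (f x)) @` A).
  apply: continuous_compact cA; apply: continuous_in_subspaceT => x /set_mem.
  by move=> /cf/contcE; exact: (cvg_nc (nbhs_filter _)).
move=> /compact_bounded[M [_ HM]]; exists (M + 1) => x Ax.
rewrite -[nc _]ger0_norm ?nc_ge0//; apply: (HM (M + 1)); first by rewrite ltrDl.
by exists x.
Qed.

Lemma cont_slice1 (k : R * R -> C) s t : contc k (s, t) -> contc (fun t => k (s, t)) t.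
Proof.
move=> ck; apply: Contc.
apply: (@cvg_comp _ _ _ (fun t : R => (s, t)) (k : R * R -> C^o) _ _ _ _ (contcE ck)).
by apply: (@cvg_pair _ _ _ (nbhs t) (nbhs s) (nbhs t)) => /=; [exact: cvg_cst|exact: cvg_id].
Qed.

Lemma cont_slice2 (k : R * R -> C) s t : contc k (s, t) -> contc (fun s => k (s, t)) s.
Proof.
move=> ck; apply: Contc.
apply: (@cvg_comp _ _ _ (fun s : R => (s, t)) (k : R * R -> C^o) _ _ _ _ (contcE ck)).
by apply: (@cvg_pair _ _ _ (nbhs s) (nbhs s) (nbhs t)) => /=; [exact: cvg_id|exact: cvg_cst].
Qed.

Lemma itv_setX (a b c d : R) (P : R * R -> Prop) :
  (forall s t, a <= s <= b -> c <= t <= d -> P (s, t)) ->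
  forall x, (`[a, b] `*` `[c, d])%classic x -> P x.
Proof. by move=> H [s t] [/=]; rewrite !in_itv; exact: H. Qed.

Lemma compact_rect (a b c d : R) : compact ((`[a, b] `*` `[c, d]) : set (R * R)).
Proof. by apply: compact_setX; exact: segment_compact. Qed.

Lemma cintegrable_rect a b c d (k : R * R -> C) : a <= b -> c <= d ->
  (forall s t, a <= s <= b -> c <= t <= d -> contc k (s, t)) ->
  cintegrable (leb \x leb)%E (`[a, b] `*` `[c, d]) k.
Proof.
move=> ab cd /itv_setX ck.
have mAB : measurable ((`[a, b] `*` `[c, d]) : set (RM * RM)).
  by apply: measurableX; exact: measurable_itv.
have mk : cmeasurable ((`[a, b] `*` `[c, d]) : set (RM * RM)) k.
  by split; apply: measurable_cont2 => // x /ck; [exact: contc_Re|exact: contc_Im].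
have [M kM] := contc_compact_bounded (@compact_rect a b c d) ck.
apply: (@cintegrable_le _ _ _ _ _ mAB _ (fun=> M) mk _ kM).
apply: integrable_cst_fin => //.
rewrite [X in (X < _)%E](_ : _ = ((b - a) * (d - c))%:E) ?ltry//.
by rewrite EFinM -(leb_itv ab) -(leb_itv cd); apply: product_measure1E; exact: measurable_itv.
Qed.

Lemma cint_rect1 a b c d (k : R * R -> C) : a <= b -> c <= d ->
  (forall s t, a <= s <= b -> c <= t <= d -> contc k (s, t)) ->
  cint (leb \x leb)%E (`[a, b] `*` `[c, d]) k =
  cint leb `[a, b] (fun s => cint leb `[c, d] (fun t => k (s, t))).
Proof.
move=> ab cd ck; rewrite cfubini1//; try exact: measurable_itv.
  exact: cintegrable_rect.
move=> s /=; rewrite in_itv => ss; apply: contcI_cintegrable => t tt.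
by apply: cont_slice1; exact: ck.
Qed.

Lemma cint_rect2 a b c d (k : R * R -> C) : a <= b -> c <= d ->
  (forall s t, a <= s <= b -> c <= t <= d -> contc k (s, t)) ->
  cint (leb \x leb)%E (`[a, b] `*` `[c, d]) k =
  cint leb `[c, d] (fun t => cint leb `[a, b] (fun s => k (s, t))).
Proof.
move=> ab cd ck; rewrite cfubini2//; try exact: measurable_itv.
  exact: cintegrable_rect.
move=> t /=; rewrite in_itv => tt; apply: contcI_cintegrable => s ss.
by apply: cont_slice2; exact: ck.
Qed.

Lemma cint_swap a b c d (k : R * R -> C) : a <= b -> c <= d ->
  (forall s t, a <= s <= b -> c <= t <= d -> contc k (s, t)) ->
  cint leb `[a, b] (fun s => cint leb `[c, d] (fun t => k (s, t))) =
  cint leb `[c, d] (fun t => cint leb `[a, b] (fun s => k (s, t))).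
Proof. by move=> ab cd ck; rewrite -cint_rect1// cint_rect2. Qed.

End CurveIntegrals.

Section Exponential.
Context {R : realType}.
Local Notation C := (R[i]).

Lemma nc_cexp (z : C) : nc (cexp z) = expR (Re z).
Proof.
rewrite ncE /= !exprMn -mulrDr cos2Dsin2 mulr1 sqrtr_sqr ger0_norm// expR_ge0.
Qed.

Lemma cexp_neq0 (z : C) : cexp z != 0.
Proof. by rewrite -nc_gt0 nc_cexp expR_gt0. Qed.

(** The exponential is given by its real and imaginary parts, so that its
    complex derivative at 0 has to be computed from the real derivatives of
    exp, cos and sin; the functional equation moves it to the other points. *)
Lemma cexp_cder0 : cder (@cexp R) 0 1.
Proof.
have /is_derive_slope[p [cp p0 pE]] := @is_derive_expR R 0.
have /is_derive_slope[q [cq q0 qE]] := @is_derive_cos R 0.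
have /is_derive_slope[r [cr r0 rE]] := @is_derive_sin R 0.
rewrite expR0 in p0 pE; rewrite cos0 in qE r0; rewrite sin0 oppr0 in q0; rewrite sin0 in rE.
pose u (h : C) := p (Re h) - 1.
pose v (h : C) : C := (expR (Re h) * q (Im h)) +i* (expR (Re h) * r (Im h) - 1).
have hE (h : C) : cexp h - 1 = h + ((u h * Re h)%:C + v h * (Im h)%:C).
  case: h => a b; rewrite /u /v /cexp /=.
  have e1 : expR a = 1 + p a * a by have := pE a; rewrite subr0 => <-; ring.
  have e2 : cos b = 1 + q b * b by have := qE b; rewrite subr0 => <-; ring.
  have e3 : sin b = r b * b by have := rE b; rewrite !subr0.
  apply: eqC; rewrite /= ?mulr0 ?addr0 ?subr0 ?oppr0 ?add0r.
    by rewrite {1}e2 mulrDr mulr1 {1}e1; ring.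
  by rewrite e3; ring.
pose w (h : C) : C := if h == 0 then 0 else ((u h * Re h)%:C + v h * (Im h)%:C) / h.
exists (fun h => 1 + w h); split; last 2 first.
- by rewrite /w eqxx addr0.
- move=> y; rewrite /= cexp0 hE subr0 /w.
  case: ifPn => [/eqP->|y0]; first by rewrite /= !mulr0 !addr0.
  have aux (h X : C) : h != 0 -> h + X = (1 + X / h) * h.
    by move=> h0; rewrite mulrDl divfK// mul1r.
  exact: aux.
apply: contD; first exact: contC.
have cRe : Re h @[h --> (0 : C^o)] --> (0:R).
  by have := contc_Re (@contid R 0); apply.
have cI : Im h @[h --> (0 : C^o)] --> (0:R).
  by have := contc_Im (@contid R 0); apply.
have cpr : p (Re h) @[h --> (0 : C^o)] --> p 0 by exact: (@cvg_comp _ _ _ (fun h : C^o => Re h) p _ _ _ cRe cp).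
have cqi : q (Im h) @[h --> (0 : C^o)] --> q 0 by exact: (@cvg_comp _ _ _ (fun h : C^o => Im h) q _ _ _ cI cq).
have cri : r (Im h) @[h --> (0 : C^o)] --> r 0 by exact: (@cvg_comp _ _ _ (fun h : C^o => Im h) r _ _ _ cI cr).
have cR : expR (Re h) @[h --> (0 : C^o)] --> expR (0:R).
  by apply: (@cvg_comp _ _ _ (fun h : C^o => Re h) expR _ _ _ cRe); exact: continuous_expR.
rewrite p0 in cpr; rewrite q0 in cqi; rewrite r0 in cri; rewrite expR0 in cR.
have cu : `|u h| @[h --> (0 : C^o)] --> (0:R).
  have : u h @[h --> (0 : C^o)] --> (1 - 1:R) by apply: (cvgB cpr); exact: cvg_cst.
  by rewrite subrr => /cvg_norm; rewrite normr0.
have cv : nc (v h) @[h --> (0 : C^o)] --> (0:R).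
  have v1 : Re (v h) @[h --> (0 : C^o)] --> (1 * 0:R) by exact: (cvgM cR cqi).
  have v2 : Im (v h) @[h --> (0 : C^o)] --> (1 * 1 - 1:R).
    have v3 : (expR (Re h) * r (Im h)) @[h --> (0 : C^o)] --> (1 * 1 : R).
      exact: (cvgM cR cri).
    by apply: (cvgB v3); exact: cvg_cst.
  rewrite mul1r in v1; rewrite mul1r subrr in v2.
  have H : (v : C^o -> C^o) h @[h --> (0 : C^o)] --> ((0 +i* 0) : C^o).
    exact: (@cvg_cplx _ _ _ _ v (0 +i* 0) v1 v2).
  by have := cvg_nc (nbhs_filter (0 : C^o)) H; rewrite (_ : 0 +i* 0 = 0)// nc0.
have cs : `|u h| + nc (v h) @[h --> (0 : C^o)] --> (0:R).
  by have := cvgD cu cv; rewrite addr0; apply.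
apply/contcP => e e0; near=> h.
rewrite [X in _ - X](_ : _ = 0) ?subr0; last by rewrite /w eqxx.
apply: (@le_lt_trans _ _ (`|u h| + nc (v h))); last first.
  near: h; move: cs => /cvgrPdist_lt/(_ e e0); apply: filterS => h.
  by rewrite sub0r normrN; apply: le_lt_trans; rewrite ler_norm.
rewrite /w; case: ifPn => [_|h0].
  by rewrite nc0 addr_ge0// nc_ge0.
rewrite ncM ncV ler_pdivrMr ?nc_gt0// (le_trans (ncD _ _))// ncM !ncR.
rewrite normrM mulrDl lerD// ler_wpM2l ?nc_ge0 ?normr_ge0//.
- exact: ge_nc_Re.
- exact: ge_nc_Im.
Unshelve. all: by end_near. Qed.

Lemma cexp_cder (z : C) : cder (@cexp R) z (cexp z).
Proof.
have [p [cp p0 pE]] := cexp_cder0.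
exists (fun w => cexp z * p (w - z)); split.
- apply: contM; first exact: contC.
  apply: (@cont_comp _ (C^o) p (fun w => w - z)); first by rewrite subrr.
  by apply: contD; [exact: contid|exact: contC].
- by rewrite subrr p0 mulr1.
- move=> w; have := pE (w - z); rewrite cexp0 subr0 -mulrA => <-.
  by rewrite mulrBr mulr1 -cexpD subrKC.
Qed.

Lemma has_slope_cexp {T : topologicalType} (e G : T -> C) x d :
  contc e x -> has_slope e G x d ->
  has_slope e (fun y => cexp (G y)) x (cexp (G x) * d).
Proof. by move=> ce; apply: has_slope_comp => //; exact: cexp_cder. Qed.

Lemma cont_cexp {T : topologicalType} (G : T -> C) x : contc G x ->
  contc (fun y => cexp (G y)) x.
Proof.
apply: cont_comp; apply: has_slope_cont (cexp_cder _); exact: contid.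
Qed.

Lemma cexp_R (x : R) : cexp x%:C = (expR x)%:C.
Proof. by rewrite /cexp /= cos0 sin0 mulr1 mulr0. Qed.

Lemma cexpMn (z : C) n : cexp (n%:R * z) = cexp z ^+ n.
Proof.
elim: n => [|n IH]; first by rewrite mul0r cexp0 expr0.
by rewrite exprS -IH -cexpD -natr1 mulrDl mul1r addrC.
Qed.

Lemma cexp_conj (z : C) : cexp z^* = (cexp z)^*.
Proof. by case: z => a b; rewrite /cexp /= cosN sinN mulrN. Qed.
End Exponential.

Arguments cexp : simpl never.

(** * Goursat's theorem and primitives *)

Section Goursat.
Context {R : realType}.
Local Notation C := (R[i]).
Local Notation leb := (@lebesgue_measure R).
Implicit Types (f F : C -> C) (x y a b c d : R).

Lemma vder_horizontal x y : vder (fun s : R => s +i* y) x 1.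
Proof.
exists (fun=> 1); split=> // [|s]; first exact: contC.
by apply: eqC => /=; ring.
Qed.

Lemma vder_vertical x y : vder (fun s : R => x +i* s) y 'i.
Proof.
exists (fun=> 'i); split=> // [|s]; first exact: contC.
by apply: eqC => /=; ring.
Qed.

Definition hint f a b y : C := cint leb `[a, b] (fun x => f (x +i* y)).
Definition vint f c d x : C := cint leb `[c, d] (fun y => f (x +i* y)).

(** The counterclockwise integral of [f] along the boundary of a rectangle. *)
Definition rint f (Q : R * R * R * R) : C :=
  let: (a, b, c, d) := Q in
  hint f a b c - hint f a b d + 'i * (vint f c d b - vint f c d a).

Definition cont_rect f a b c d :=
  forall x y, a <= x <= b -> c <= y <= d -> contc (f : C^o -> C) (x +i* y).

Lemma cont_rect_h f a b c d y : c <= y <= d -> cont_rect f a b c d ->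
  contcI a b (fun x => f (x +i* y)).
Proof.
move=> cyd cf x axb; apply: cont_comp; first exact: cf.
exact: (vder_cont (vder_horizontal x y)).
Qed.

Lemma cont_rect_v f a b c d x : a <= x <= b -> cont_rect f a b c d ->
  contcI c d (fun y => f (x +i* y)).
Proof.
move=> axb cf y cyd; apply: cont_comp; first exact: cf.
exact: (vder_cont (vder_vertical x y)).
Qed.

Lemma cont_rect_sub f a b c d a' b' c' d' : a <= a' -> b' <= b -> c <= c' ->
  d' <= d -> cont_rect f a b c d -> cont_rect f a' b' c' d'.
Proof.
move=> aa bb cc dd cf x y /andP[ax xb] /andP[cy yd]; apply: cf.
  by rewrite (le_trans aa ax) (le_trans xb bb).
by rewrite (le_trans cc cy) (le_trans yd dd).
Qed.

Lemma rint_primitive f F a b c d : a <= b -> c <= d -> cont_rect f a b c d ->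
  (forall x y, a <= x <= b -> c <= y <= d -> cder F (x +i* y) (f (x +i* y))) ->
  rint f (a, b, c, d) = 0.
Proof.
move=> ab cd cf dF.
have h y : c <= y <= d -> hint f a b y = F (b +i* y) - F (a +i* y).
  move=> cyd; apply: (@cint_derivative _ a b _ (fun x => F (x +i* y))) => //.
    exact: cont_rect_h cf.
  move=> x axb; apply: has_slope_eq (mulr1 _).
  apply: has_slope_comp (vder_horizontal x y); first exact: contreal.
  exact: dF.
have v x : a <= x <= b -> 'i * vint f c d x = F (x +i* d) - F (x +i* c).
  move=> axb; rewrite /vint -cintZ; last 2 first.
  - exact: measurable_itv.
  - by apply: contcI_cintegrable; exact: cont_rect_v cf.
  apply: (@cint_derivative _ c d _ (fun y => F (x +i* y))) => //.
    by move=> y cyd; apply: contM; [exact: contC|exact: (cont_rect_v axb cf)].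
  move=> y cyd; apply: has_slope_eq (mulrC _ _).
  apply: has_slope_comp (vder_vertical x y); first exact: contreal.
  exact: dF.
rewrite /rint mulrBr !v ?h ?lexx ?ab ?cd//; ring.
Qed.

Lemma rint_bound f a b c d (M : R) : a <= b -> c <= d -> cont_rect f a b c d ->
  (forall x y, a <= x <= b -> c <= y <= d -> nc (f (x +i* y)) <= M) ->
  nc (rint f (a, b, c, d)) <= M * (2 * ((b - a) + (d - c))).
Proof.
move=> ab cd cf fM.
have h y : c <= y <= d -> nc (hint f a b y) <= M * (b - a).
  move=> cyd; apply: cint_itv_bound => //; first exact: cont_rect_h cf.
  by move=> x axb; exact: fM.
have v x : a <= x <= b -> nc (vint f c d x) <= M * (d - c).
  move=> axb; apply: cint_itv_bound => //; first exact: cont_rect_v cf.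
  by move=> y cyd; exact: fM.
have h1 := h c; have h2 := h d; have v1 := v a; have v2 := v b.
rewrite !lexx ab cd /= in h1 h2 v1 v2.
rewrite /rint (le_trans (ncD _ _))// (le_trans (lerD (ncD _ _) (lexx _)))//.
rewrite ncM nci mul1r ncN.
have := ncD (vint f c d b) (- vint f c d a); rewrite ncN => v3.
have := h1 isT; have := h2 isT; have := v1 isT; have := v2 isT.
have -> : M * (2 * (b - a + (d - c))) = 2 * (M * (b - a)) + 2 * (M * (d - c)) by ring.
lra.
Qed.

Lemma rintD f F a b c d : a <= b -> c <= d -> cont_rect f a b c d ->
  cont_rect F a b c d ->
  rint (fun z => f z + F z) (a, b, c, d) = rint f (a, b, c, d) + rint F (a, b, c, d).
Proof.
move=> ab cd cf cF.
have h y : c <= y <= d ->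
    hint (fun z => f z + F z) a b y = hint f a b y + hint F a b y.
  move=> cyd; apply: cintD; first exact: measurable_itv.
    by apply: contcI_cintegrable; exact: cont_rect_h cf.
  by apply: contcI_cintegrable; exact: cont_rect_h cF.
have v x : a <= x <= b ->
    vint (fun z => f z + F z) c d x = vint f c d x + vint F c d x.
  move=> axb; apply: cintD; first exact: measurable_itv.
    by apply: contcI_cintegrable; exact: cont_rect_v cf.
  by apply: contcI_cintegrable; exact: cont_rect_v cF.
rewrite /rint !h ?v ?lexx ?ab ?cd//; ring.
Qed.

Arguments hint : simpl never.
Arguments vint : simpl never.

Definition quadrants (Q : R * R * R * R) :=
  let: (a, b, c, d) := Q in let m := (a + b) / 2 in let n := (c + d) / 2 in
  ((a, m, c, n), (m, b, c, n), (a, m, n, d), (m, b, n, d)).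

Lemma rint_quadrants f a b c d : a <= b -> c <= d -> cont_rect f a b c d ->
  let: (Q1, Q2, Q3, Q4) := quadrants (a, b, c, d) in
  rint f (a, b, c, d) = rint f Q1 + rint f Q2 + rint f Q3 + rint f Q4.
Proof.
move=> ab cd cf /=; set m := (a + b) / 2; set n := (c + d) / 2.
have am : a <= m by rewrite /m; lra.
have mb : m <= b by rewrite /m; lra.
have cn : c <= n by rewrite /n; lra.
have nd : n <= d by rewrite /n; lra.
have h y : c <= y <= d -> hint f a b y = hint f a m y + hint f m b y.
  by move=> cyd; apply: cint_split; rewrite ?am//; exact: cont_rect_h cf.
have v x : a <= x <= b -> vint f c d x = vint f c n x + vint f n d x.
  by move=> axb; apply: cint_split; rewrite ?cn//; exact: cont_rect_v cf.
rewrite /rint !h ?v ?lexx ?ab ?cd//; ring.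
Qed.

Definition next_rect f (Q : R * R * R * R) :=
  let: (Q1, Q2, Q3, Q4) := quadrants Q in
  if nc (rint f Q) <= 4 * nc (rint f Q1) then Q1 else
  if nc (rint f Q) <= 4 * nc (rint f Q2) then Q2 else
  if nc (rint f Q) <= 4 * nc (rint f Q3) then Q3 else Q4.

Definition subrect (Q' Q : R * R * R * R) :=
  let: (a, b, c, d) := Q in let: (a', b', c', d') := Q' in
  [/\ a <= a', b' <= b, c <= c' & d' <= d].

Let quarters_lt (u y1 y2 y3 y4 t2 t3 : R) : 4 * y1 < u -> 4 * y2 < u -> 4 * y3 < u ->
  4 * y4 < u -> t2 <= y1 + y2 -> t3 <= t2 + y3 -> u <= t3 + y4 -> False.
Proof. lra. Qed.

Lemma next_rectP f a b c d : a <= b -> c <= d -> cont_rect f a b c d ->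
  let: (a', b', c', d') := next_rect f (a, b, c, d) in
  [/\ b' - a' = (b - a) / 2, d' - c' = (d - c) / 2,
      subrect (a', b', c', d') (a, b, c, d) &
      nc (rint f (a, b, c, d)) <= 4 * nc (rint f (a', b', c', d'))].
Proof.
move=> ab cd cf; have := rint_quadrants ab cd cf.
rewrite /next_rect /quadrants; set m := (a + b) / 2; set n := (c + d) / 2 => E.
have m1 : m - a = (b - a) / 2 by rewrite /m; field.
have m2 : b - m = (b - a) / 2 by rewrite /m; field.
have n1 : n - c = (d - c) / 2 by rewrite /n; field.
have n2 : d - n = (d - c) / 2 by rewrite /n; field.
clearbody m n; rewrite /subrect.
have am : a <= m by lra.
have mb : m <= b by lra.
have cn : c <= n by lra.
have nd : n <= d by lra.
case: ifPn => [H1|/negP H1]; first by split.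
case: ifPn => [H2|/negP H2]; first by split.
case: ifPn => [H3|/negP H3]; first by split.
split => //.
rewrite leNgt; apply/negP => H4.
move/negP: H1; move/negP: H2; move/negP: H3; rewrite -!ltNge => H3 H2 H1.
have := ncD (rint f (a, m, c, n) + rint f (m, b, c, n) + rint f (a, m, n, d)) (rint f (m, b, n, d)).
have := ncD (rint f (a, m, c, n) + rint f (m, b, c, n)) (rint f (a, m, n, d)).
have := ncD (rint f (a, m, c, n)) (rint f (m, b, c, n)).
rewrite -E => e1 e2 e3.
exact: (quarters_lt H1 H2 H3 H4 e1 e2 e3).
Qed.

(** Bisecting keeps at least a quarter of the integral, so that the integral
    over the [n]th of the nested rectangles is at least a constant times the
    square of its diameter. At the common point of the rectangles [f] is
    affine up to an error that is small compared with the diameter, which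
    makes the integrals smaller than that. *)
Lemma goursat f a b c d : a <= b -> c <= d ->
  (forall x y, a <= x <= b -> c <= y <= d -> exists e, cder f (x +i* y) e) ->
  rint f (a, b, c, d) = 0.
Proof.
move=> ab cd df.
have cf : cont_rect f a b c d.
  move=> x y axb cyd; have [e de] := df x y axb cyd.
  exact: (cder_cont de).
pose Q n := iter n (next_rect f) (a, b, c, d).
pose A n := (Q n).1.1.1; pose B n := (Q n).1.1.2.
pose G n := (Q n).1.2; pose D n := (Q n).2.
have QE n : Q n = (A n, B n, G n, D n).
  by rewrite /A /B /G /D; case: (Q n) => [[[? ?] ?] ?].
have nextE n : next_rect f (A n, B n, G n, D n) = (A n.+1, B n.+1, G n.+1, D n.+1).
  by rewrite -!QE.
have inv n : [/\ B n - A n = (b - a) / 2 ^+ n, D n - G n = (d - c) / 2 ^+ n,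
    subrect (A n, B n, G n, D n) (a, b, c, d) &
    nc (rint f (a, b, c, d)) <= 4 ^+ n * nc (rint f (A n, B n, G n, D n))].
  elim: n => [|n [IH1 IH2 IH3 IH4]].
    by rewrite /A /B /G /D /Q /= !expr0 !divr1 mul1r.
  have p2 : 0 < (2:R) ^+ n by rewrite exprn_gt0.
  have ABn : A n <= B n by rewrite -subr_ge0 IH1 divr_ge0 ?subr_ge0// ltW.
  have GDn : G n <= D n by rewrite -subr_ge0 IH2 divr_ge0 ?subr_ge0// ltW.
  have [i1 i2 i3 i4] := IH3.
  have := next_rectP ABn GDn (cont_rect_sub i1 i2 i3 i4 cf).
  rewrite nextE => -[n1 n2 [s1 s2 s3 s4] n4].
  split.
  - by rewrite n1 IH1 exprS invfM mulrCA mulrC.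
  - by rewrite n2 IH2 exprS invfM mulrCA mulrC.
  - by split; lra.
  - apply: (le_trans IH4); rewrite exprS -mulrA mulrCA ler_pM2l ?exprn_gt0//.
have sub1 n : subrect (Q n.+1) (Q n).
  have [IH1 IH2 [i1 i2 i3 i4] _] := inv n.
  have p2 : 0 < (2:R) ^+ n by rewrite exprn_gt0.
  have ABn : A n <= B n by rewrite -subr_ge0 IH1 divr_ge0 ?subr_ge0// ltW.
  have GDn : G n <= D n by rewrite -subr_ge0 IH2 divr_ge0 ?subr_ge0// ltW.
  have := next_rectP ABn GDn (cont_rect_sub i1 i2 i3 i4 cf).
  by rewrite nextE !QE => -[_ _].
have subm m n : subrect (Q (m + n)%N) (Q n).
  elim: m => [|m IH]; first by rewrite QE; split.
  rewrite addSn; move: (sub1 (m + n)%N) IH; rewrite !QE => -[? ? ? ?] [? ? ? ?].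
  by split; lra.
have le_AB n : A n <= B n /\ G n <= D n.
  have [IH1 IH2 _ _] := inv n.
  have p2 : 0 < (2:R) ^+ n by rewrite exprn_gt0.
  by split; rewrite -subr_ge0 ?IH1 ?IH2 divr_ge0 ?subr_ge0// ltW.
have cross m n : A m <= B n /\ G m <= D n.
  have [mn|/ltnW nm] := leqP m n.
    have := subm (n - m)%N m; rewrite subnK// !QE => -[? ? ? ?].
    by have [? ?] := le_AB n; split; lra.
  have := subm (m - n)%N n; rewrite subnK// !QE => -[? ? ? ?].
  by have [? ?] := le_AB m; split; lra.
pose xs := sup (range A); pose ys := sup (range G).
have xsP n : A n <= xs <= B n.
  apply/andP; split.
    apply: ub_le_sup; last by exists n.
    by exists (B 0%N) => _ [m _ <-]; have [] := cross m 0%N.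
  apply: ge_sup; first by exists (A 0%N); exists 0%N.
  by move=> _ [m _ <-]; have [] := cross m n.
have ysP n : G n <= ys <= D n.
  apply/andP; split.
    apply: ub_le_sup; last by exists n.
    by exists (D 0%N) => _ [m _ <-]; have [] := cross m 0%N.
  apply: ge_sup; first by exists (G 0%N); exists 0%N.
  by move=> _ [m _ <-]; have [] := cross m n.
have [e de] := df xs ys (xsP 0%N) (ysP 0%N).
have [p [cp pe pE]] := de.
set zs := xs +i* ys in cp pe pE de.
pose L := (b - a) + (d - c).
have L0 : 0 <= L by rewrite /L; lra.
apply/eqP; rewrite -nc_eq0 eq_le nc_ge0 andbT.
apply/ler_addgt0Pr => eps eps0; rewrite add0r.
pose et := eps / (2 * (L ^+ 2 + 1)).
have L2 : 0 < L ^+ 2 + 1 by rewrite ltr_wpDl// sqr_ge0.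
have et0 : 0 < et by rewrite divr_gt0// mulr_gt0.
have /contcP/(_ et et0)/nbhsCP[r r0 hr] := cp.
have [n nr] : exists n, L / 2 ^+ n < r.
  exists (Num.bound (L / r)); rewrite ltr_pdivrMr ?exprn_gt0// mulrC -ltr_pdivrMr//.
  have := archi_boundP (divr_ge0 L0 (ltW r0)); move=> /lt_le_trans; apply.
  by rewrite -natrX ler_nat ltnW// ltn_expl.
have [I1 I2 [i1 i2 i3 i4] I4] := inv n.
have [ABn GDn] := le_AB n.
(* The affine part of [f] at the common point has a primitive, hence zero
   integral. *)
pose af w : C := f zs + e * (w - zs).
have caf w : cder (fun w => (f zs - e * zs) * w + e / 2 * w ^+ 2) w (af w).
  apply: has_slope_eq (_ : (f zs - e * zs) * 1 + e / 2 * (2%:R * w ^+ 1 * 1) = _).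
    apply: has_slopeD; first by apply: has_slopeZ; exact: has_slope_id.
    apply: has_slopeZ; apply: has_slopeX; first exact: contid.
    exact: has_slope_id.
  by rewrite /af expr1; field.
have cont_af w : contc (af : C^o -> C) w.
  apply: contD; first exact: contC.
  apply: contM; first exact: contC.
  by apply: contD; [exact: contid|exact: contC].
have cfn := cont_rect_sub i1 i2 i3 i4 cf.
have rf : rint f (A n, B n, G n, D n) = rint (fun w => f w - af w) (A n, B n, G n, D n).
  have := @rint_primitive af _ _ _ _ _ ABn GDn (fun x y _ _ => cont_af _)
    (fun x y _ _ => caf _) => raf.
  rewrite -[RHS]addr0 -raf -rintD//; last first.
    by move=> x y xx yy; apply: contD; [exact: cfn|apply: contN; exact: cont_af].
  by congr (rint _ _); apply/funext => w; rewrite subrK.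
have diam x y : A n <= x <= B n -> G n <= y <= D n -> nc ((x +i* y) - zs) <= L / 2 ^+ n.
  move=> xx yy; rewrite (le_trans (nc_le _))//=.
  have := xsP n; have := ysP n; move: xx yy => /andP[? ?] /andP[? ?] /andP[? ?] /andP[? ?].
  have -> : L / 2 ^+ n = (B n - A n) + (D n - G n) by rewrite I1 I2 -mulrDl.
  have dist (s t u v : R) : u <= s -> s <= v -> u <= t -> t <= v -> `|s - t| <= v - u.
    by clear; move=> ? ? ? ?; rewrite ler_norml; apply/andP; split; lra.
  by apply: lerD; exact: dist.
have bnd : nc (rint f (A n, B n, G n, D n)) <= et * (L / 2 ^+ n) * (2 * (L / 2 ^+ n)).
  have -> : 2 * (L / 2 ^+ n) = 2 * ((B n - A n) + (D n - G n)).
    by rewrite I1 I2 -mulrDl.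
  rewrite rf; apply: rint_bound => //.
    by move=> x y xx yy; apply: contD; [exact: cfn|apply: contN; exact: cont_af].
  move=> x y xx yy; have dxy := diam x y xx yy.
  have -> : f (x +i* y) - af (x +i* y) = (p (x +i* y) - e) * ((x +i* y) - zs).
    by rewrite /af mulrBl -pE /=; ring.
  rewrite ncM ler_pM ?nc_ge0//.
  by rewrite -pe ltW//; apply: hr; exact: le_lt_trans dxy nr.
apply: (le_trans I4); apply: (@le_trans _ _ (4 ^+ n * (et * (L / 2 ^+ n) * (2 * (L / 2 ^+ n))))).
  by rewrite ler_pM2l ?exprn_gt0.
have -> : 4 ^+ n * (et * (L / 2 ^+ n) * (2 * (L / 2 ^+ n))) = 2 * et * L ^+ 2.
  have -> : (4:R) = 2 ^+ 2 by rewrite expr2; ring.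
  have p2 : (2:R) ^+ n != 0 by rewrite expf_neq0.
  by rewrite -exprM mulnC exprM; field.
have -> : 2 * et * L ^+ 2 = eps * (L ^+ 2 / (L ^+ 2 + 1)).
  by rewrite /et; field; rewrite lt0r_neq0.
apply: ler_piMr; first exact: ltW.
by rewrite ler_pdivrMr// mul1r lerDl.
Qed.

Lemma cint_increment a u v f (al : C) (eps : R) (g : R -> C) : a <= u -> a <= v ->
  contcI a (Num.max u v) g ->
  (forall t, Num.min u v <= t <= Num.max u v -> nc (g t - al) <= eps) ->
  nc (cint leb `[a, v] g - cint leb `[a, u] g - al * (v - u)%:C) <= eps * `|v - u|.
Proof.
wlog uv : u v / u <= v.
  move=> H au av cg gal; have [uv|/ltW vu] := leP u v; first exact: H.
  rewrite -ncN distrC (_ : - _ = cint leb `[a, u] g - cint leb `[a, v] g - al * (u - v)%:C).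
    by apply: H => //; rewrite ?[Num.max v u]maxC ?[Num.min v u]minC.
  by rewrite !RBC; ring.
move=> au av; rewrite (max_idPr uv) (min_idPl uv) => cg gal.
have cuv : contcI u v g by apply: contcI_sub cg.
rewrite (@cint_split _ a u v) ?au// (addrC (cint leb `[a, u] g)) addrK.
have -> : al * (v - u)%:C = cint leb `[u, v] (fun=> al).
  rewrite RBC mulrBr; apply/esym.
  apply: (@cint_derivative _ u v (fun=> al) (fun t => al * t%:C)) => //.
    by move=> x _; exact: contC.
  move=> x _; rewrite -[X in vder _ _ X]mulr1.
  by apply: has_slopeZ; exact: has_slope_id.
rewrite -cintB; last 3 first.
- exact: measurable_itv.
- exact: contcI_cintegrable.
- by apply: contcI_cintegrable => x _; exact: contC.
rewrite ger0_norm ?subr_ge0//; apply: cint_itv_bound => //.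
by move=> x xx; apply: contD; [exact: cuv|exact: contC].
Qed.

(** By Goursat's theorem the integrals of [f] along the two L-shaped paths
    from the corner of the quadrant to a point agree; the first gives the
    derivative of the primitive in the vertical direction, the second in the
    horizontal direction. *)
Lemma primitive f (X0 Y0 : R) : 0 < Y0 -> (forall z, halfplane z -> exists e, cder f z e) ->
  exists P, forall z, X0 < Re z -> Y0 < Im z -> cder P z (f z).
Proof.
move=> Y0_gt0 df.
have dfQ b d x y : X0 <= x <= b -> Y0 <= y <= d -> exists e, cder f (x +i* y) e.
  by move=> _ /andP[yy _]; apply: df; rewrite /halfplane /= (lt_le_trans Y0_gt0).
have cfQ b d : cont_rect f X0 b Y0 d.
  move=> x y xx yy; have [e de] := dfQ b d x y xx yy.
  exact: (cder_cont de).
pose P (z : C) : C := hint f X0 (Re z) Y0 + 'i * vint f Y0 (Im z) (Re z).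
have PE z : X0 <= Re z -> Y0 <= Im z ->
    P z = 'i * vint f Y0 (Im z) X0 + hint f X0 (Re z) (Im z).
  move=> xx yy; have := goursat xx yy (dfQ _ _).
  rewrite /rint /P mulrBr => /eqP; rewrite addrAC addrA subr_eq0 subr_eq.
  by move=> /eqP H; rewrite [hint f X0 (Re z) Y0 + _]addrC addrC in H; rewrite addrC [RHS]addrC addrC H; ring.
exists P => z Xz Yz.
exists (fun w => if w == z then f z else (P w - P z) / (w - z)).
split; last 2 first.
- by rewrite eqxx.
- move=> w; case: eqVneq => [->|wz]; first by rewrite /= !subrr mulr0.
  by rewrite divfK// subr_eq0.
apply/contcP => eps eps0; rewrite eqxx.
have [e de] : exists e, cder f z e by apply: df; rewrite /halfplane /= (lt_trans Y0_gt0).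
have /contcP/(_ (eps / 3)) := cder_cont de.
rewrite divr_gt0// => /(_ isT)/nbhsCP[r1 r10 hr1].
pose r := Num.min r1 (Num.min (Re z - X0) (Im z - Y0)).
have r0 : 0 < r by rewrite /r !lt_min r10 !subr_gt0 Xz Yz.
apply: (nearC r0) => w wr; case: eqVneq => [_|wz].
  by rewrite subrr nc0.
move: wr; rewrite /r !lt_min => /andP[wr1 /andP[wr2 wr3]].
have reb := le_trans (ler_norm _) (ge_nc_Re (z - w)).
have imb := le_trans (ler_norm _) (ge_nc_Im (z - w)).
rewrite ncB ReB in reb; rewrite ncB ImB in imb.
have Xw : X0 <= Re w by lra.
have Yw : Y0 <= Im w by lra.
have wz0 : w - z != 0 by rewrite subr_eq0.
rewrite (_ : _ - f z = (P w - P z - f z * (w - z)) / (w - z)); last by field.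
rewrite ncM ncV ltr_pdivrMr ?nc_gt0//.
pose m := Re w +i* Im z.
have E1 : P w - P m = 'i * (vint f Y0 (Im w) (Re w) - vint f Y0 (Im z) (Re w)).
  by rewrite /P /m /=; ring.
have E2 : P m - P z = hint f X0 (Re w) (Im z) - hint f X0 (Re z) (Im z).
  have -> : P m = 'i * vint f Y0 (Im z) X0 + hint f X0 (Re w) (Im z).
    by apply: (PE m) => //; exact: ltW.
  have -> : P z = 'i * vint f Y0 (Im z) X0 + hint f X0 (Re z) (Im z).
    by apply: (PE z); exact: ltW.
  ring.
have near_f x y : Num.min (Re z) (Re w) <= x <= Num.max (Re z) (Re w) ->
    Num.min (Im z) (Im w) <= y <= Num.max (Im z) (Im w) -> nc (f (x +i* y) - f z) <= eps / 3.
  move=> xx yy; apply/ltW/hr1; apply: le_lt_trans wr1.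
  rewrite !ncE ler_wsqrtr//= !ReB !ImB /=.
  have aux (u v t : R) : Num.min u v <= t <= Num.max u v -> (t - u) ^+ 2 <= (v - u) ^+ 2.
    by case: (leP u v) => uv /andP[t1 t2]; nra.
  by apply: lerD; apply: aux.
have mono (u v : R) : Num.min u v <= u <= Num.max u v /\ Num.min u v <= v <= Num.max u v.
  by case: (leP u v) => uv; split; apply/andP; split => //; exact: ltW.
have V1 : nc (vint f Y0 (Im w) (Re w) - vint f Y0 (Im z) (Re w) - f z * (Im w - Im z)%:C)
    <= eps / 3 * `|Im w - Im z|.
  apply: cint_increment => //; first exact: ltW.
    by apply: (@cont_rect_v f X0 (Re w)); rewrite ?Xw ?lexx.
  by move=> t tt; apply: near_f => //; have [] := mono (Re z) (Re w).
have H1 : nc (hint f X0 (Re w) (Im z) - hint f X0 (Re z) (Im z) - f z * (Re w - Re z)%:C)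
    <= eps / 3 * `|Re w - Re z|.
  apply: cint_increment => //; first exact: ltW.
    by apply: (@cont_rect_h f _ _ Y0 (Im z)); rewrite ?lexx ?ltW.
  by move=> t tt; apply: near_f => //; have [] := mono (Im z) (Im w).
have -> : P w - P z - f z * (w - z) =
    'i * (vint f Y0 (Im w) (Re w) - vint f Y0 (Im z) (Re w) - f z * (Im w - Im z)%:C)
    + (hint f X0 (Re w) (Im z) - hint f X0 (Re z) (Im z) - f z * (Re w - Re z)%:C).
  rewrite (_ : P w - P z = (P w - P m) + (P m - P z)); last by ring.
  have wzE : w - z = 'i * (Im w - Im z)%:C + (Re w - Re z)%:C.
    by apply: eqC; rewrite ?ReB ?ImB ?ReD ?ImD ?ReM ?ImM /=; ring.
  by rewrite E1 E2 wzE; ring.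
rewrite (le_lt_trans (ncD _ _))// ncM nci mul1r.
have n1 := ge_nc_Re (w - z); have n2 := ge_nc_Im (w - z).
rewrite ReB in n1; rewrite ImB in n2.
have n3 : 0 < nc (w - z) by rewrite nc_gt0.
have : eps / 3 * `|Im w - Im z| <= eps / 3 * nc (w - z) by rewrite ler_pM2l// divr_gt0.
have : eps / 3 * `|Re w - Re z| <= eps / 3 * nc (w - z) by rewrite ler_pM2l// divr_gt0.
have : 0 < eps * nc (w - z) by rewrite mulr_gt0.
lra.
Qed.
End Goursat.

(** * Cauchy's integral formula *)

Section Cauchy.
Context {R : realType}.
Local Notation C := (R[i]).
Local Notation leb := (@lebesgue_measure R).
Local Notation T2pi := (2 * pi : R).

Definition hol (f : C -> C) := forall z, halfplane z -> exists e, cder f z e.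

Lemma OPi_hol (f : C -> C) : OPi f -> hol f.
Proof. by move=> Of z hz; apply: derivable_cder; exact: Of. Qed.

Lemma hol_OPi (f : C -> C) : hol f -> OPi f.
Proof. by move=> hf z hz; have [e de] := hf z hz; exact: cder_derivable de. Qed.

Lemma cont_compR {T : topologicalType} (F : R -> C) (g : T -> R) x :
  contc F (g x) -> g y @[y --> x] --> g x -> contc (fun y => F (g y)) x.
Proof.
move=> /contcE cF cg; apply: Contc.
exact: (@cvg_comp _ _ _ g (F : R -> C^o) _ _ _ cg cF).
Qed.

Lemma cont_fst {T U : topologicalType} (F : T -> C) (p : T * U) :
  contc F p.1 -> contc (fun q : T * U => F q.1) p.
Proof.
move=> /contcE cF; apply: Contc.
exact: (@cvg_comp _ _ _ (@fst T U) (F : T -> C^o) _ _ _ cvg_fst cF).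
Qed.

Lemma cont_snd {T U : topologicalType} (F : U -> C) (p : T * U) :
  contc F p.2 -> contc (fun q : T * U => F q.2) p.
Proof.
move=> /contcE cF; apply: Contc.
exact: (@cvg_comp _ _ _ (@snd T U) (F : U -> C^o) _ _ _ cvg_snd cF).
Qed.

Lemma cder_uniq (f : C -> C) z d d' : cder f z d -> cder f z d' -> d = d'.
Proof.
move=> [p [cp <- pE]] [q [cq <- qE]].
apply/eqP; rewrite -subr_eq0 -nc_eq0 eq_le nc_ge0 andbT.
apply/ler_addgt0Pr => eps eps0; rewrite add0r.
have /contcP/(_ (eps / 2)) := cp; rewrite divr_gt0// => /(_ isT)/nbhsCP[r r0 hr].
have /contcP/(_ (eps / 2)) := cq; rewrite divr_gt0// => /(_ isT)/nbhsCP[s s0 hs].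
pose m := Num.min r s; have m0 : 0 < m by rewrite lt_min r0.
pose w := z + (m / 2)%:C.
have wzE : w - z = (m / 2)%:C by rewrite /w addrC addKr.
have wz : nc (w - z) < m by rewrite wzE ncR ger0_norm; lra.
move: wz; rewrite lt_min => /andP[/hr wr /hs ws].
have pq : p w = q w.
  have m2 : (m / 2)%:C != 0 :> C by rewrite -nc_gt0 ncR normr_gt0 gt_eqF// divr_gt0.
  by apply: (mulIf m2); rewrite -wzE -[LHS]pE -[RHS]qE.
have -> : p z - q z = (q w - q z) - (p w - p z) by rewrite pq; ring.
by rewrite (le_trans (ncD _ _))// ncN; lra.
Qed.

(** The homotopy principle behind the integral formulas below: [k] is the
    derivative of an integrand in the homotopy parameter [s], and is also
    exact in the variable [t] of integration; therefore the integral over [t]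
    does not vary with [s]. *)
Lemma fubini_zero (a b c d : R) (k : R * R -> C) (K : R -> C) : a <= b -> c <= d ->
  (forall s t, a <= s <= b -> c <= t <= d -> contc k (s, t)) ->
  (forall s, a <= s <= b -> cint leb `[c, d] (fun t => k (s, t)) = 0) ->
  (forall t, c <= t <= d -> cint leb `[a, b] (fun s => k (s, t)) = K t) ->
  cint leb `[c, d] K = 0.
Proof.
move=> ab cd ck k0 kK; have sw := cint_swap ab cd ck.
have <- : cint leb `[c, d] (fun t => cint leb `[a, b] (fun s => k (s, t))) =
    cint leb `[c, d] K by apply: eq_cint_itv.
rewrite -sw; have -> : cint leb `[a, b] (fun s => cint leb `[c, d] (fun t => k (s, t))) =
    cint leb `[a, b] (fun=> 0) by apply: eq_cint_itv.
exact: cint0.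
Qed.

Definition cis (t : R) : C := cexp ('i * t%:C).

Lemma cisE t : cis t = cos t +i* sin t.
Proof.
have e : 'i * t%:C = 0 +i* t by apply: eqC => /=; ring.
by rewrite /cis e /cexp /= expR0 !mul1r.
Qed.

Lemma nc_cis t : nc (cis t) = 1.
Proof. by rewrite cisE ncE /= cos2Dsin2 sqrtr1. Qed.

Lemma vder_cis t : vder cis t ('i * cis t).
Proof.
rewrite mulrC; apply: has_slope_cexp; first exact: contreal.
by apply: has_slope_eq (mulr1 _); apply: has_slopeZ; exact: has_slope_id.
Qed.

Lemma cis0 : cis 0 = 1.
Proof. by rewrite cisE cos0 sin0. Qed.

Lemma cis2pi : cis T2pi = 1.
Proof. by rewrite cisE mulr_natl mulr2n cosDpi sinDpi cospi sinpi opprK oppr0. Qed.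

Section Circle.
Variables (f : C -> C) (z0 : C) (rho : R).
Hypotheses (hf : hol f) (rho0 : 0 < rho) (rhoI : rho < Im z0).

Definition cir (t : R) : C := z0 + rho%:C * cis t.
Definition dcir (t : R) : C := 'i * (rho%:C * cis t).

Lemma vder_cir t : vder cir t (dcir t).
Proof.
apply: has_slope_eq (_ : 0 + rho%:C * ('i * cis t) = _); last by rewrite /dcir; ring.
by apply: has_slopeD; [exact: has_slope_cst|apply: has_slopeZ; exact: vder_cis].
Qed.

Lemma vder_dcir t : vder dcir t ('i * dcir t).
Proof.
apply: has_slopeZ; apply: has_slope_eq (_ : rho%:C * ('i * cis t) = _).
  by apply: has_slopeZ; exact: vder_cis.
by rewrite /dcir; ring.
Qed.

Lemma cont_cir t : contc cir t.
Proof. exact: vder_cont (vder_cir t). Qed.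

Lemma cont_dcir t : contc dcir t.
Proof. exact: vder_cont (vder_dcir t). Qed.

Lemma cir_per : cir T2pi = cir 0.
Proof. by rewrite /cir cis0 cis2pi. Qed.

Lemma nc_cir t : nc (cir t - z0) = rho.
Proof. by rewrite /cir addrC addKr ncM nc_cis mulr1 ncR gtr0_norm. Qed.

Lemma disc_halfplane w : nc (w - z0) <= rho -> halfplane w.
Proof.
move=> wr; have := le_trans (ler_norm _) (ge_nc_Im (z0 - w)).
rewrite ImB (ncB z0) => h; rewrite /halfplane /=; have := rhoI; lra.
Qed.

Lemma disc_segment w t th : nc (w - z0) <= rho -> 0 <= t <= 1 ->
  nc (w + t%:C * (cir th - w) - z0) <= rho.
Proof.
move=> wr /andP[t0 t1].
have -> : w + t%:C * (cir th - w) - z0 = (1 - t)%:C * (w - z0) + t%:C * (cir th - z0).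
  by rewrite RBC; ring.
rewrite (le_trans (ncD _ _))// !ncM nc_cir !ncR !ger0_norm ?subr_ge0//.
have := ler_wpM2l (_ : 0 <= 1 - t) wr; rewrite subr_ge0 => /(_ t1); lra.
Qed.

Lemma hol_cont w : nc (w - z0) <= rho -> contc (f : C^o -> C) w.
Proof. by move=> /disc_halfplane/hf[e /cder_cont]. Qed.

Lemma pi2_ge0 : (0 : R) <= T2pi.
Proof. by rewrite mulr_ge0// pi_ge0. Qed.

Lemma cir_neq w t : nc (w - z0) < rho -> cir t - w != 0.
Proof.
move=> wr; rewrite -nc_gt0; have := ncDB (cir t - z0) (w - z0).
rewrite nc_cir (_ : _ - _ - (w - z0) = cir t - w); last by ring.
by apply: lt_le_trans; rewrite subr_gt0.
Qed.

Lemma cir_dist w t : rho - nc (w - z0) <= nc (cir t - w).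
Proof.
have := ncDB (cir t - z0) (w - z0).
by rewrite nc_cir (_ : _ - _ - (w - z0) = cir t - w)//; ring.
Qed.

Lemma cont_kernel w t : nc (w - z0) < rho ->
  contc (fun t => dcir t / (cir t - w)) t.
Proof.
move=> wr; apply: contM; first exact: cont_dcir.
apply: contV; last exact: cir_neq.
by apply: contD; [exact: cont_cir|exact: contC].
Qed.

(** Homotopy of the centre to the point [w]. The derivative of the integrand
    with respect to [s] is the derivative with respect to [t] of a function
    on the closed curve. *)
Lemma winding w : nc (w - z0) < rho ->
  cint leb `[0, T2pi] (fun t => dcir t / (cir t - w)) = 'i * T2pi%:C.
Proof.
move=> wr.
have N0 : cint leb `[0, T2pi] (fun t => dcir t / (cir t - z0)) = 'i * T2pi%:C.
  rewrite (@eq_cint_itv _ _ _ _ (fun=> 'i)); last first.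
    move=> t _; rewrite /dcir /cir [z0 + _]addrC addrK mulfK// mulf_neq0//.
      by rewrite -nc_gt0 ncR normr_gt0 gt_eqF.
    exact: cexp_neq0.
  rewrite (@cint_derivative _ 0 _ (fun=> 'i) (fun t => 'i * t%:C) pi2_ge0).
  - by rewrite mulr0 subr0.
  - by move=> x _; exact: contC.
  - move=> x _; apply: has_slope_eq (mulr1 _).
    by apply: has_slopeZ; exact: has_slope_id.
pose a := w - z0.
pose pt (t : R) : C := z0 + t%:C * a.
have ptr t : 0 <= t <= 1 -> nc (pt t - z0) < rho.
  move=> /andP[t0 t1]; rewrite /pt [z0 + _]addrC addrK ncM ncR ger0_norm//.
  by apply: le_lt_trans wr; rewrite ler_piMl ?nc_ge0.
pose k (p : R * R) : C := a * dcir p.2 * (cir p.2 - pt p.1) ^- 2.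
have cont_pt t : contc pt t.
  apply: contD; first exact: contC.
  by apply: contM; [exact: contreal|exact: contC].
have H : cint leb `[0, T2pi]
    (fun t => dcir t / (cir t - w) - dcir t / (cir t - z0)) = 0.
  apply: (@fubini_zero 0 1 0 T2pi k); [exact: ler01|exact: pi2_ge0| | | ].
  - move=> s t s01 _; apply: contM.
      by apply: contM; [exact: contC|by apply: (@cont_snd R R dcir (s, t)); exact: cont_dcir].
    apply: contV; last by rewrite expf_neq0//= cir_neq// ptr.
    apply: contX; apply: contD; first by apply: (@cont_snd R R cir (s, t)); exact: cont_cir.
    by apply: contN; apply: (@cont_fst R R pt (s, t)); exact: cont_pt.
  - move=> s s01.
    rewrite (@cint_derivative _ 0 _ _ (fun t => - (a * (cir t - pt s)^-1)) pi2_ge0).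
    + by rewrite cir_per subrr.
    + move=> t _; rewrite /k /=; apply: contM.
        by apply: contM; [exact: contC|exact: cont_dcir].
      apply: contV; last by rewrite expf_neq0// cir_neq// ptr.
      by apply: contX; apply: contD; [exact: cont_cir|exact: contC].
    + move=> t _; apply: has_slope_eq.
        apply: has_slopeN; apply: has_slopeZ; apply: has_slopeV.
        - exact: contreal.
        - by rewrite cir_neq// ptr.
        - by apply: has_slopeB; [exact: vder_cir|exact: has_slope_cst].
      by rewrite /k /= subr0; ring.
  - move=> t _.
    rewrite (@cint_derivative _ 0 1 _ (fun s => dcir t * (cir t - pt s)^-1) ler01).
    + by rewrite /pt mul0r addr0 mul1r /a subrKC.
    + move=> s s01; rewrite /k /=; apply: contM; first exact: contC.
      apply: contV; last by rewrite expf_neq0// cir_neq// ptr.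
      by apply: contX; apply: contD; [exact: contC|apply: contN; exact: cont_pt].
    + move=> s s01; apply: has_slope_eq.
        apply: has_slopeZ; apply: has_slopeV.
        - exact: contreal.
        - by rewrite cir_neq// ptr.
        - apply: has_slopeB; first exact: has_slope_cst.
          apply: has_slopeD; first exact: has_slope_cst.
          apply: has_slopeM; first exact: contreal.
            exact: has_slope_id.
          exact: has_slope_cst.
      by rewrite /k /=; ring.
apply/eqP; rewrite -N0 -subr_eq0; apply/eqP; rewrite -[RHS]H cintB//.
- by apply: contcI_cintegrable => t _; exact: cont_kernel.
- apply: contcI_cintegrable => t _; apply: cont_kernel.
  by rewrite subrr nc0.
Qed.

Section WithPrimitive.
Variable P : C -> C.
Hypothesis dP : forall z, nc (z - z0) <= rho -> cder P z (f z).

Let cont_P z : nc (z - z0) <= rho -> contc (P : C^o -> C) z.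
Proof. by move=> /dP/cder_cont. Qed.

Lemma nc_cir_le t : nc (cir t - z0) <= rho.
Proof. by rewrite nc_cir. Qed.

Let cont_Pcir t : contc (fun t => P (cir t)) t.
Proof. by apply: cont_comp; [exact: (cont_P (nc_cir_le t))|exact: cont_cir]. Qed.

(** Homotopy of the circle to the point [w]. The derivative of the integrand
    in the homotopy parameter involves the derivative [f] of [P], which is
    continuous; this is why Cauchy's formula is first proved for functions
    that are derivatives. *)
Lemma cauchy_primitive w : nc (w - z0) < rho ->
  cint leb `[0, T2pi] (fun t => P (cir t) * (dcir t / (cir t - w))) =
  'i * T2pi%:C * P w.
Proof.
move=> wr; have wr' := ltW wr.
pose g (s t : R) : C := w + s%:C * (cir t - w).
pose k (p : R * R) : C := f (g p.1 p.2) * dcir p.2.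
have gin s t : 0 <= s <= 1 -> nc (g s t - z0) <= rho by exact: disc_segment.
have cg (s t : R) : contc (fun p : R * R => g p.1 p.2) (s, t).
  apply: contD; first exact: contC.
  apply: contM; first by apply: (@cont_fst R R (real_complex R) (s, t)); exact: contreal.
  by apply: contD; [by apply: (@cont_snd R R cir (s, t)); exact: cont_cir|exact: contC].
have H : cint leb `[0, T2pi]
    (fun t => (P (cir t) - P w) * (dcir t / (cir t - w))) = 0.
  apply: (@fubini_zero 0 1 0 T2pi k); [exact: ler01|exact: pi2_ge0| | | ].
  - move=> s t s01 _; apply: contM; last by apply: (@cont_snd R R dcir (s, t)); exact: cont_dcir.
    apply: (@cont_comp _ _ f (fun p : R * R => g p.1 p.2)) => //.
    exact: (hol_cont (gin s t s01)).
  - move=> s s01.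
    have dg t : vder (g s) t (s%:C * dcir t).
      apply: has_slope_eq (_ : 0 + s%:C * (dcir t - 0) = _); last by rewrite subr0 add0r.
      apply: has_slopeD; first exact: has_slope_cst.
      by apply: has_slopeZ; apply: has_slopeB; [exact: vder_cir|exact: has_slope_cst].
    have ck : contcI 0 T2pi (fun t => k (s, t)).
      move=> t _; apply: contM; last exact: cont_dcir.
      apply: cont_comp; first exact: (hol_cont (gin s t s01)).
      exact: vder_cont (dg t).
    have [s0|s0] := eqVneq s 0.
      rewrite (@cint_derivative _ 0 _ _ (fun t => f w * cir t) pi2_ge0)//.
      + by rewrite cir_per subrr.
      + move=> t _; rewrite /k /= /g s0 mul0r addr0.
        by apply: has_slopeZ; exact: vder_cir.
    have sC : s%:C != 0 :> C by rewrite -nc_gt0 ncR normr_gt0.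
    rewrite (@cint_derivative _ 0 _ _ (fun t => s%:C^-1 * P (g s t)) pi2_ge0)//.
    + by rewrite /g cir_per subrr.
    + move=> t _; apply: has_slope_eq.
        apply: has_slopeZ; apply: has_slope_comp (dg t); first exact: contreal.
        exact: dP (gin s t s01).
      by rewrite /k /=; field.
  - move=> t _; have ctw := cir_neq t wr.
    have dg s : vder (fun s => g s t) s (cir t - w).
      apply: has_slope_eq (_ : 0 + (1 * (cir t - w) + s%:C * 0) = _); last first.
        by rewrite mulr0 addr0 add0r mul1r.
      apply: has_slopeD; first exact: has_slope_cst.
      apply: has_slopeM; first exact: contreal.
        exact: has_slope_id.
      exact: has_slope_cst.
    rewrite (@cint_derivative _ 0 1 _ (fun s => P (g s t) * (dcir t / (cir t - w))) ler01).
    + rewrite /g mul1r mul0r addr0 (_ : w + (cir t - w) = cir t); last by ring.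
      by rewrite mulrBl.
    + move=> s s01; rewrite /k /=; apply: contM; last exact: contC.
      apply: (@cont_comp _ _ f (fun s => g s t)); first exact: (hol_cont (gin s t s01)).
      exact: vder_cont (dg s).
    + move=> s s01; apply: has_slope_eq.
        apply: has_slopeM; first exact: contreal.
          apply: has_slope_comp (dg s); first exact: contreal.
          exact: dP (gin s t s01).
        exact: has_slope_cst.
      by rewrite /k /= mulr0 addr0; field.
rewrite -(winding wr) -cintZr; last 2 first.
- exact: measurable_itv.
- by apply: contcI_cintegrable => t _; exact: cont_kernel.
apply/eqP; rewrite -subr_eq0 -cintB; last 3 first.
- exact: measurable_itv.
- apply: contcI_cintegrable => t _; apply: contM; first exact: cont_Pcir.
  exact: cont_kernel.
- apply: contcI_cintegrable => t _; apply: contM; last exact: contC.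
  exact: cont_kernel.
apply/eqP; rewrite -[RHS]H; apply: eq_cint_itv => t _; ring.
Qed.
End WithPrimitive.

Definition cauchy_type (h : R -> C) n (w : C) : C :=
  cint leb `[0, T2pi] (fun t => h t * (cir t - w) ^- n).

Lemma cont_cauchy h n w t : contc h t -> nc (w - z0) < rho ->
  contc (fun t => h t * (cir t - w) ^- n) t.
Proof.
move=> ch wr; apply: contM ch _; apply: contV; last by rewrite expf_neq0// cir_neq.
by apply: contX; apply: contD; [exact: cont_cir|exact: contC].
Qed.

(** The quadratic remainder gives the complex differentiability of integrals
    of Cauchy type, and its uniformity on smaller discs allows
    differentiation under integral signs later. *)
Lemma cauchy_type_taylor (h : R -> C) (M rho1 : R) : (forall t, contc h t) ->
  (forall t, 0 <= t <= T2pi -> nc (h t) <= M) -> rho1 < rho ->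
  exists K, 0 <= K /\ forall w w', nc (w - z0) <= rho1 -> nc (w' - z0) <= rho1 ->
    nc (cauchy_type h 1 w' - cauchy_type h 1 w - cauchy_type h 2 w * (w' - w))
      <= K * nc (w' - w) ^+ 2.
Proof.
move=> ch hM r1; pose dl := (rho - rho1)^-1.
have M0 : 0 <= M by apply: le_trans (hM 0 _); rewrite ?nc_ge0// lexx pi2_ge0.
have dl0 : 0 <= dl by rewrite invr_ge0 subr_ge0 ltW.
exists (M * dl ^+ 3 * T2pi); split; first by rewrite !mulr_ge0 ?exprn_ge0// pi_ge0.
move=> w w' wr wr'.
have wrl := le_lt_trans wr r1; have wrl' := le_lt_trans wr' r1.
have mI : measurable (`[0, T2pi] : set (measurableTypeR R)) by exact: measurable_itv.
have ci n v : nc (v - z0) < rho ->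
    cintegrable leb `[0, T2pi] (fun t => h t * (cir t - v) ^- n).
  by move=> vr; apply: contcI_cintegrable => t _; exact: cont_cauchy.
have -> : cauchy_type h 1 w' - cauchy_type h 1 w - cauchy_type h 2 w * (w' - w) =
    cint leb `[0, T2pi] (fun t => h t * (w' - w) ^+ 2 *
      ((cir t - w) ^- 2 * (cir t - w') ^- 1)).
  rewrite /cauchy_type -cintZr//; last exact: ci.
  rewrite -cintB//; last 2 first.
  - exact: ci.
  - exact: ci.
  rewrite -cintB//; last 2 first.
  - by apply: cintegrableB => //; exact: ci.
  - by apply: contcI_cintegrable => t _; apply: contM; [exact: cont_cauchy|exact: contC].
  apply: eq_cint_itv => t _.
  have := cir_neq t wrl; have := cir_neq t wrl'.
  have -> : cir t - w' = (cir t - w) - (w' - w) by ring.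
  move: (cir t - w) (w' - w) (h t) => q r x q1 q2.
  by rewrite !expr1; field; rewrite q1 q2.
have -> : M * dl ^+ 3 * T2pi * nc (w' - w) ^+ 2 =
    M * nc (w' - w) ^+ 2 * dl ^+ 3 * (T2pi - 0) by rewrite subr0; ring.
apply: cint_itv_bound; first exact: pi2_ge0.
  move=> t _; have -> : (fun t => h t * (w' - w) ^+ 2 * ((cir t - w) ^- 2 * (cir t - w') ^- 1))
    = (fun t => (h t * (cir t - w) ^- 2) * ((w' - w) ^+ 2 * (cir t - w') ^- 1)).
    by apply/funext => s; ring.
  apply: contM; first exact: cont_cauchy.
  by have := cont_cauchy 1 (contC ((w' - w) ^+ 2) t) wrl'.
move=> t tt; have -> : nc (h t * (w' - w) ^+ 2 * ((cir t - w) ^- 2 * (cir t - w') ^- 1)) =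
    nc (h t) * (nc (w' - w) ^+ 2 * ((nc (cir t - w))^-1 ^+ 2 * (nc (cir t - w'))^-1)).
  by rewrite ncM (ncM (h t)) ncX ncM expr1 !ncV ncX -exprVn -!mulrA.
rewrite -[M * _ * _]mulrA.
have inv_le v : nc (v - z0) <= rho1 -> (nc (cir t - v))^-1 <= dl.
  move=> vr; have vd := cir_dist v t.
  rewrite /dl lef_pV2 ?posrE; [|by rewrite nc_gt0 cir_neq// (le_lt_trans vr)|by rewrite subr_gt0].
  by apply: le_trans vd; rewrite lerB.
have i0 v : 0 <= (nc (cir t - v))^-1 by rewrite invr_ge0 nc_ge0.
have s0 v : 0 <= (nc (cir t - v))^-1 ^+ 2 by exact: sqr_ge0.
have q0 : 0 <= nc (w' - w) ^+ 2 by exact: sqr_ge0.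
apply: ler_pM; [exact: nc_ge0|by apply: mulr_ge0 => //; exact: mulr_ge0|exact: hM|].
apply: ler_wpM2l => //; rewrite [dl ^+ 3]exprSr; apply: ler_pM => //; last exact: inv_le.
by apply: lerXn2r; rewrite ?nnegrE//; exact: inv_le.
Qed.

Lemma cder_of_taylor (F : C -> C) (w d : C) (K r : R) : 0 < r -> 0 <= K ->
  (forall w', nc (w' - w) < r -> nc (F w' - F w - d * (w' - w)) <= K * nc (w' - w) ^+ 2) ->
  cder F w d.
Proof.
move=> r0 K0 H.
exists (fun v => if v == w then d else (F v - F w) / (v - w)); split; last 2 first.
- by rewrite eqxx.
- move=> v; case: eqVneq => [->|vw]; first by rewrite /= !subrr mulr0.
  by rewrite divfK// subr_eq0.
apply/contcP => eps eps0; rewrite eqxx.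
pose s := Num.min r (eps / (K + 1)).
have K1 : 0 < K + 1 by rewrite ltr_wpDl.
have s0 : 0 < s by rewrite lt_min r0 divr_gt0.
apply: (nearC s0) => v; rewrite lt_min => /andP[vr vs].
case: eqVneq => [_|vw]; first by rewrite subrr nc0.
have vw0 : v - w != 0 by rewrite subr_eq0.
rewrite (_ : _ - d = (F v - F w - d * (v - w)) / (v - w)); last by field.
rewrite ncM ncV ltr_pdivrMr ?nc_gt0//; apply: le_lt_trans (H v vr) _.
rewrite expr2 mulrA ltr_pM2r ?nc_gt0//.
apply: (@le_lt_trans _ _ ((K + 1) * nc (v - w))).
  by apply: ler_wpM2r; rewrite ?nc_ge0// lerDl.
by rewrite mulrC -ltr_pdivlMr.
Qed.

Lemma cauchy_type_cder (h : R -> C) (M : R) w : (forall t, contc h t) ->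
  (forall t, 0 <= t <= T2pi -> nc (h t) <= M) -> nc (w - z0) < rho ->
  cder (cauchy_type h 1) w (cauchy_type h 2 w).
Proof.
move=> ch hM wr; pose rho1 := (rho + nc (w - z0)) / 2.
have r1 : rho1 < rho by rewrite /rho1; lra.
have [K [K0 HK]] := cauchy_type_taylor ch hM r1.
apply: (@cder_of_taylor _ _ _ K (rho1 - nc (w - z0))) => //.
  by rewrite /rho1; lra.
move=> w' ww; apply: HK; first by rewrite /rho1; lra.
have := ncD (w' - w) (w - z0); rewrite subrKA; lra.
Qed.

Lemma cont_bounded (h : R -> C) : (forall t, contc h t) ->
  exists M, forall t, 0 <= t <= T2pi -> nc (h t) <= M.
Proof.
move=> ch; have [M HM] := contc_compact_bounded (@segment_compact R 0 T2pi) (fun x _ => ch x).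
by exists M => t t02; apply: HM; rewrite /= in_itv.
Qed.

(** A primitive [P] of [f] satisfies Cauchy's formula; differentiating this
    formula with respect to [w] and integrating by parts around the circle
    gives the formula for [f]. *)
Lemma cauchy_formula w : nc (w - z0) < rho ->
  cauchy_type (fun t => f (cir t) * dcir t) 1 w = 'i * T2pi%:C * f w.
Proof.
move=> wr.
have [P dP0] := @primitive R f (Re z0 - rho - 1) ((Im z0 - rho) / 2)
  ltac:(by rewrite divr_gt0// subr_gt0) hf.
have dP z : nc (z - z0) <= rho -> cder P z (f z).
  move=> zr; apply: dP0.
    by have := le_trans (ler_norm _) (ge_nc_Re (z0 - z)); rewrite ReB (ncB z0); lra.
  have := le_trans (ler_norm _) (ge_nc_Im (z0 - z)); rewrite ImB (ncB z0).
  by have := rhoI; lra.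
have cP t : contc (fun t => P (cir t)) t.
  by apply: cont_comp; [exact: (cder_cont (dP _ (nc_cir_le t)))|exact: cont_cir].
have cf t : contc (fun t => f (cir t)) t.
  by apply: cont_comp; [exact: (hol_cont (nc_cir_le t))|exact: cont_cir].
pose h t : C := P (cir t) * dcir t.
have ch t : contc h t by apply: contM; [exact: cP|exact: cont_dcir].
have [M hM] := cont_bounded ch.
have d1 := cauchy_type_cder ch hM wr.
have E : forall v, nc (v - z0) < rho -> cauchy_type h 1 v = 'i * T2pi%:C * P v.
  move=> v vr; rewrite -(cauchy_primitive dP vr); apply: eq_cint_itv => t _.
  by rewrite /h expr1 mulrA.
have d2 : cder (fun v => 'i * T2pi%:C * P v) w (cauchy_type h 2 w).
  apply: (has_slope_near _ _ d1) => //.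
  apply: (@nearC _ _ (rho - nc (w - z0))); first by rewrite subr_gt0.
  move=> v vw; apply: E; have := ncD (v - w) (w - z0); rewrite subrKA; lra.
have d3 : cder (fun v => 'i * T2pi%:C * P v) w ('i * T2pi%:C * f w).
  by apply: has_slopeZ; exact: dP (ltW wr).
rewrite (cder_uniq d3 d2) /cauchy_type.
apply/eqP; rewrite -subr_eq0 -cintB; last 3 first.
- exact: measurable_itv.
- apply: contcI_cintegrable => t _; apply: cont_cauchy => //.
  by apply: contM; [exact: cf|exact: cont_dcir].
- by apply: contcI_cintegrable => t _; exact: cont_cauchy.
apply/eqP.
rewrite (@cint_derivative _ 0 _ _ (fun t => P (cir t) * (cir t - w)^-1) pi2_ge0).
- by rewrite cir_per subrr.
- move=> t _; apply: contD; last apply: contN; apply: cont_cauchy => //.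
  by apply: contM; [exact: cf|exact: cont_dcir].
- move=> t _; apply: has_slope_eq.
    apply: has_slopeM; first exact: contreal.
      apply: has_slope_comp (vder_cir t); first exact: contreal.
      exact: dP (nc_cir_le t).
    apply: has_slopeV; first exact: contreal.
      exact: cir_neq.
    by apply: has_slopeB; [exact: vder_cir|exact: has_slope_cst].
  rewrite /h subr0; have := cir_neq t wr; move: (cir t - w) => q q0.
  by field.
Qed.
End Circle.
End Cauchy.

(** * Holomorphic functions on the half-plane *)

Section HolomorphicFunctions.
Context {R : realType}.
Local Notation C := (R[i]).
Local Notation leb := (@lebesgue_measure R).
Local Notation T2pi := (2 * pi : R).
Implicit Types (f : C -> C).

Lemma cder_near (f g : C -> C) z d (e : R) : 0 < e ->
  (forall w, nc (w - z) < e -> f w = g w) -> cder f z d -> cder g z d.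
Proof.
move=> e0 fg; apply: (@has_slope_near _ _ (id : C^o -> C)); first by [].
exact: nearC e0 fg.
Qed.

(** The derivative as a function; it is only meaningful at the points of
    complex differentiability. *)
Definition cd f (z : C) : C := xget 0 [set e | cder f z e].

Lemma cdP f z : (exists e, cder f z e) -> cder f z (cd f z).
Proof. by move=> [e de]; rewrite /cd; case: xgetP => [_ -> //|/(_ e)]. Qed.

Lemma cdE f z e : cder f z e -> cd f z = e.
Proof. by move=> de; apply: (cder_uniq (cdP _) de); exists e. Qed.

Lemma hol_cd f z : hol f -> halfplane z -> cder f z (cd f z).
Proof. by move=> hf /hf; exact: cdP. Qed.

Lemma hol_contc f z : hol f -> halfplane z -> contc (f : C^o -> C) z.
Proof. by move=> hf /(hol_cd hf)/cder_cont. Qed.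

Lemma twopii_neq0 : 'i * T2pi%:C != 0 :> C.
Proof.
by rewrite -nc_gt0 ncM nci mul1r ncR normr_gt0 gt_eqF// mulr_gt0// pi_gt0.
Qed.

Section OnDisc.
Variables (f : C -> C) (z0 : C) (rho1 rho : R).
Hypotheses (hf : hol f) (r0 : 0 < rho) (r1 : rho1 < rho) (rI : rho < Im z0).

Let h (t : R) : C := f (cir z0 rho t) * dcir rho t.

Let ch t : contc h t.
Proof.
apply: contM; last exact: cont_dcir.
apply: cont_comp; last exact: cont_cir.
apply: hol_contc => //; apply: (disc_halfplane rI).
by rewrite nc_cir.
Qed.

Let fE w : nc (w - z0) < rho -> f w = ('i * T2pi%:C)^-1 * cauchy_type z0 rho h 1 w.
Proof.
by move=> wr; have := cauchy_formula hf r0 rI wr; rewrite -/h => ->; rewrite mulKf// twopii_neq0.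
Qed.

Lemma cd_cauchy w : nc (w - z0) < rho ->
  cd f w = ('i * T2pi%:C)^-1 * cauchy_type z0 rho h 2 w.
Proof.
move=> wr; have [M hM] := cont_bounded ch; apply: cdE.
apply: (@cder_near (fun w => ('i * T2pi%:C)^-1 * cauchy_type z0 rho h 1 w)
    _ _ _ (rho - nc (w - z0))); first by rewrite subr_gt0.
  move=> v vw; apply/esym/fE; have := ncD (v - w) (w - z0); rewrite subrKA; lra.
by apply: has_slopeZ; exact: cauchy_type_cder ch hM wr.
Qed.

Lemma taylor_disc : exists K, 0 <= K /\
  forall w w', nc (w - z0) <= rho1 -> nc (w' - z0) <= rho1 ->
    nc (f w' - f w - cd f w * (w' - w)) <= K * nc (w' - w) ^+ 2.
Proof.
have [M hM] := cont_bounded ch.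
have [K [K0 HK]] := cauchy_type_taylor z0 r0 ch hM r1.
have p0 := nc_ge0 ('i * T2pi%:C : C)^-1.
exists (nc ('i * T2pi%:C : C)^-1 * K); split; first exact: mulr_ge0.
move=> w w' wr wr'; have wrl := le_lt_trans wr r1; have wrl' := le_lt_trans wr' r1.
rewrite !fE// cd_cauchy// (_ : _ - _ * (w' - w) = ('i * T2pi%:C)^-1 *
  (cauchy_type z0 rho h 1 w' - cauchy_type z0 rho h 1 w -
   cauchy_type z0 rho h 2 w * (w' - w))); last by ring.
by rewrite ncM -mulrA; apply: ler_wpM2l => //; exact: HK.
Qed.

(** The geometric expansion of the Cauchy kernel around the centre converges
    uniformly on smaller discs. *)
Lemma poly_approx (eps : R) : 0 <= rho1 -> 0 < eps ->
  exists n (a : nat -> C), forall w, nc (w - z0) <= rho1 ->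
    nc (f w - \sum_(k < n) a k * (w - z0) ^+ k) <= eps.
Proof.
move=> r10 eps0; have [M hM] := cont_bounded ch.
have M0 : 0 <= M by apply: le_trans (hM 0 _); rewrite ?nc_ge0// lexx pi2_ge0.
pose q := rho1 / rho; have q0 : 0 <= q by rewrite divr_ge0// ltW.
have q1 : q < 1 by rewrite ltr_pdivrMr// mul1r.
pose p := nc ('i * T2pi%:C : C)^-1; have p0 : 0 <= p := nc_ge0 _.
pose B := p * (M * (rho - rho1)^-1 * T2pi).
have dl0 : 0 <= (rho - rho1)^-1 by rewrite invr_ge0 subr_ge0 ltW.
have B0 : 0 <= B by rewrite !mulr_ge0// pi_ge0.
have [n hn] : exists n, B * q ^+ n <= eps.
  have /cvgrPdist_lt/(_ (eps / (B + 1))) : q ^+ n @[n --> \oo] --> (0:R).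
    by apply: cvg_expr; rewrite ger0_norm.
  rewrite divr_gt0 ?ltr_wpDl// => /(_ isT)[n _ /(_ n (leqnn n))].
  rewrite /= sub0r normrN ger0_norm ?exprn_ge0// => hn; exists n.
  apply: (@le_trans _ _ ((B + 1) * q ^+ n)).
    by apply: ler_wpM2r; rewrite ?exprn_ge0// lerDl.
  by rewrite mulrC -ler_pdivlMr ?ltr_wpDl// ltW.
pose a (k : nat) : C := ('i * T2pi%:C)^-1 * cauchy_type z0 rho h k.+1 z0.
exists n, a => w wr; have wrl := le_lt_trans wr r1.
have zr : nc (z0 - z0) < rho by rewrite subrr nc0.
have mI : measurable (`[0, T2pi] : set (measurableTypeR R)) by exact: measurable_itv.
have ci k v : nc (v - z0) < rho ->
    cintegrable leb `[0, T2pi] (fun t => h t * (cir z0 rho t - v) ^- k).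
  by move=> vr; apply: contcI_cintegrable => t _; exact: (cont_cauchy r0).
pose rem t : C := h t * (((w - z0) / (cir z0 rho t - z0)) ^+ n * (cir z0 rho t - w)^-1).
have crem t : contc rem t.
  apply: contM; first exact: ch.
  apply: contM.
    apply: contX; apply: contM; first exact: contC.
    apply: contV; last by rewrite (cir_neq r0).
    by apply: contD; [exact: cont_cir|exact: contC].
  apply: contV; last by rewrite (cir_neq r0).
  by apply: contD; [exact: cont_cir|exact: contC].
have E : f w - \sum_(k < n) a k * (w - z0) ^+ k =
    ('i * T2pi%:C)^-1 * cint leb `[0, T2pi] rem.
  rewrite fE// (_ : \sum_(k < n) _ = ('i * T2pi%:C)^-1 *
      cint leb `[0, T2pi] (fun t => \sum_(k < n)
        h t * (cir z0 rho t - z0) ^- k.+1 * (w - z0) ^+ k)).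
    rewrite -mulrBr -cintB//; last 2 first.
    - exact: ci.
    - apply: (@cintegrable_sum _ _ _ leb _ mI n (fun k t =>
        h t * (cir z0 rho t - z0) ^- k.+1 * (w - z0) ^+ k)) => k _.
      apply: contcI_cintegrable => t _.
      by apply: contM; [exact: (cont_cauchy r0)|exact: contC].
    congr (_ * _); apply: eq_cint_itv => t _.
    have := @cir_neq _ z0 rho r0 w t wrl; have := @cir_neq _ z0 rho r0 z0 t zr.
    rewrite /rem; have -> : cir z0 rho t - w = (cir z0 rho t - z0) - (w - z0) by ring.
    move: (cir z0 rho t - z0) (w - z0) (h t) => u v x u0 uv.
    have S : (u - v) * \sum_(k < n) u ^- k.+1 * v ^+ k = 1 - (v / u) ^+ n.
      elim: (n) => [|m IH]; first by rewrite big_ord0 mulr0 expr0 subrr.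
      rewrite big_ord_recr /= mulrDr IH !exprS !expr_div_n.
      by field; rewrite u0 expf_neq0.
    have -> : \sum_(k < n) x * u ^- k.+1 * v ^+ k = x * \sum_(k < n) u ^- k.+1 * v ^+ k.
      by rewrite mulr_sumr; apply: eq_bigr => k _; rewrite mulrA.
    have -> : \sum_(k < n) u ^- k.+1 * v ^+ k = (1 - (v / u) ^+ n) / (u - v).
      by rewrite -S mulrAC divff// mul1r.
    by rewrite expr1; ring.
  rewrite (@cint_sum _ _ _ leb _ mI n (fun k t =>
    h t * (cir z0 rho t - z0) ^- k.+1 * (w - z0) ^+ k)); last first.
    move=> k _; apply: contcI_cintegrable => t _.
    by apply: contM; [exact: (cont_cauchy r0)|exact: contC].
  rewrite mulr_sumr; apply: eq_bigr => k _; rewrite /a -mulrA; congr (_ * _).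
  by rewrite cintZr//; exact: ci.
rewrite E ncM; apply: le_trans hn; rewrite /B -/p -mulrA; apply: ler_wpM2l => //.
have -> : M * (rho - rho1)^-1 * T2pi * q ^+ n =
  M * (q ^+ n * (rho - rho1)^-1) * (T2pi - 0) by rewrite subr0; ring.
apply: cint_itv_bound; first exact: pi2_ge0.
  by move=> t _; exact: crem.
move=> t tt; rewrite /rem ncM; apply: ler_pM; [exact: nc_ge0|exact: nc_ge0|exact: hM|].
rewrite ncM ncX ncV ncM ncV (nc_cir _ r0).
have wq : 0 <= nc (w - z0) / rho by apply: divr_ge0; [exact: nc_ge0|exact: ltW].
apply: ler_pM; [exact: exprn_ge0|by rewrite invr_ge0 nc_ge0| |].
  apply: lerXn2r; rewrite ?nnegrE//.
  by apply: ler_wpM2r => //; rewrite invr_ge0 ltW.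
have vd := @cir_dist _ z0 rho r0 w t.
rewrite lef_pV2 ?posrE; [|by rewrite nc_gt0 (cir_neq r0)|by rewrite subr_gt0].
by apply: le_trans vd; rewrite lerB.
Qed.
End OnDisc.

Lemma cd_contc f z : hol f -> halfplane z -> contc (cd f : C^o -> C) z.
Proof.
move=> hf; rewrite /halfplane /= => hz.
have [K [K0 HK]] := @taylor_disc f z (Im z / 4) (Im z / 2) hf
  ltac:(lra) ltac:(lra) ltac:(lra).
apply/contcP => eps eps0.
pose s := Num.min (Im z / 4) (eps / (2 * K + 1)).
have K1 : 0 < 2 * K + 1 by rewrite ltr_wpDl// mulr_ge0.
have s0 : 0 < s by rewrite lt_min !divr_gt0.
apply: (nearC s0) => w; rewrite lt_min => /andP[w1 w2].
have [->|wz] := eqVneq w z; first by rewrite subrr nc0.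
have zz : nc (z - z) <= Im z / 4 by rewrite subrr nc0; lra.
have := HK z w zz (ltW w1); have := HK w z (ltW w1) zz; rewrite (ncB z) => H1 H2.
have n0 : 0 < nc (w - z) by rewrite nc_gt0 subr_eq0.
have : nc ((cd f w - cd f z) * (w - z)) <= 2 * K * nc (w - z) ^+ 2.
  rewrite (_ : (cd f w - cd f z) * (w - z) = (f w - f z - cd f z * (w - z)) +
    (f z - f w - cd f w * (z - w))); last by ring.
  by apply: le_trans (ncD _ _) _; lra.
rewrite ncM expr2 mulrA ler_pM2r// => /le_lt_trans; apply.
apply: (@le_lt_trans _ _ ((2 * K + 1) * nc (w - z))).
  by apply: ler_wpM2r; rewrite ?nc_ge0// lerDl.
by rewrite mulrC -ltr_pdivlMr.
Qed.

(** A disc with a high centre contains any given bounded set that stays away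
    from the real line, because large circles tangent to the real line are
    almost straight. Thus approximation on discs is enough to treat curves in
    the half-plane. *)
Lemma bounded_in_disc (m B : R) : 0 < m -> exists z0 rho1 rho,
  [/\ 0 < rho1, rho1 < rho, rho < Im z0 &
    forall z : C, m <= Im z -> nc z <= B -> nc (z - z0) <= rho1].
Proof.
move=> m0; pose Y := B ^+ 2 / m + m.
have Y0 : m <= Y by rewrite lerDr divr_ge0 ?sqr_ge0// ltW.
exists (0 +i* Y), (Y - m / 2), (Y - m / 4); split; rewrite /=; try lra.
move=> z mz zB; rewrite -ler_sqr ?nnegrE ?nc_ge0//; last by lra.
have zB2 : nc z ^+ 2 <= B ^+ 2 by rewrite ler_sqr ?nnegrE ?nc_ge0// (le_trans (nc_ge0 z)).
rewrite sqr_nc in zB2; rewrite sqr_nc ReB ImB /= subr0.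
have mY : m * Y = B ^+ 2 + m ^+ 2 by rewrite /Y; field; rewrite gt_eqF.
have : m * Y <= Im z * Y by rewrite ler_pM2r//; lra.
nra.
Qed.

(** Near [z0] the quotient is a Cauchy integral, hence complex differentiable
    at [z0] too. *)
Lemma removable f z0 : hol f -> halfplane z0 -> f z0 = 0 ->
  exists2 g, hol g & forall z, f z = (z - z0) * g z.
Proof.
move=> hf hz0 f0; pose g z := if z == z0 then cd f z0 else f z / (z - z0).
exists g; last first.
  move=> z; rewrite /g; case: eqVneq => [->|zz]; first by rewrite subrr mul0r.
  by rewrite mulrC divfK// subr_eq0.
move=> z hz; have [->|zz] := eqVneq z z0; last first.
  have zn : z - z0 != 0 by rewrite subr_eq0.
  exists (cd f z * (z - z0)^-1 + f z * (- (z - z0) ^- 2 * (1 - 0))).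
  apply: (@cder_near (fun z => f z / (z - z0)) _ _ _ (nc (z - z0))).
  - by rewrite nc_gt0.
  - move=> w wz; rewrite /g; case: eqVneq => // wz0.
    by move: wz; rewrite wz0 ncB ltxx.
  apply: has_slopeM; [exact: contid|exact: hol_cd|].
  apply: has_slopeV; [exact: contid|by []|].
  by apply: has_slopeB; [exact: has_slope_id|exact: has_slope_cst].
have hz0' : 0 < Im z0 by [].
pose rho := Im z0 / 2.
have r0 : 0 < rho by rewrite divr_gt0.
have rI : rho < Im z0 by rewrite /rho; lra.
pose h t : C := f (cir z0 rho t) * dcir rho t.
pose h1 t : C := h t * (cir z0 rho t - z0)^-1.
have zr : nc (z0 - z0) < rho by rewrite subrr nc0.
have ch t : contc h t.
  apply: contM; last exact: cont_dcir.
  apply: cont_comp; last exact: cont_cir.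
  apply: hol_contc => //; apply: (disc_halfplane rI).
  by rewrite nc_cir.
have ch1 t : contc h1 t by have := cont_cauchy r0 1 (ch t) zr.
have [M hM] := cont_bounded ch1.
exists (('i * T2pi%:C)^-1 * cauchy_type z0 rho h1 2 z0).
apply: (@cder_near (fun w => ('i * T2pi%:C)^-1 * cauchy_type z0 rho h1 1 w) _ _ _ rho) => //.
  move=> w wr; rewrite /g; case: eqVneq => [->|wz].
    rewrite (cd_cauchy hf r0 rI)//; congr (_ * _); apply: eq_cint_itv => t _.
    by rewrite /h1 expr1 -mulrA -invfM.
  have wz' : w - z0 != 0 by rewrite subr_eq0.
  apply: (mulIf wz'); rewrite divfK// -[LHS]mulrA.
  have E0 := cauchy_formula hf r0 rI zr; have E1 := cauchy_formula hf r0 rI wr.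
  rewrite f0 mulr0 in E0.
  suff -> : cauchy_type z0 rho h1 1 w * (w - z0) =
      cauchy_type z0 rho h 1 w - cauchy_type z0 rho h 1 z0.
    by rewrite E0 E1 subr0 mulKf// twopii_neq0.
  have mI : measurable (`[0, T2pi] : set (measurableTypeR R)) by exact: measurable_itv.
  rewrite /cauchy_type -cintZr//; last first.
    by apply: contcI_cintegrable => t _; exact: (cont_cauchy r0).
  rewrite -cintB//; last 2 first.
  - by apply: contcI_cintegrable => t _; exact: (cont_cauchy r0).
  - by apply: contcI_cintegrable => t _; exact: (cont_cauchy r0).
  apply: eq_cint_itv => t _; rewrite /h1 !expr1.
  have := @cir_neq _ z0 rho r0 w t wr; have := @cir_neq _ z0 rho r0 z0 t zr.
  have -> : cir z0 rho t - w = (cir z0 rho t - z0) - (w - z0) by ring.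
  move: (cir z0 rho t - z0) (w - z0) (h t) => u v x u0 uv.
  by field; rewrite u0 uv.
by apply: has_slopeZ; exact: cauchy_type_cder ch1 hM zr.
Qed.

End HolomorphicFunctions.

(** * Improper integrals and the Beta weight *)

Section ImproperIntegrals.
Context {R : realType}.
Local Notation C := (R[i]).
Local Notation leb := (@lebesgue_measure R).
Local Notation RM := (measurableTypeR R).

Lemma Rint_FTC (a b : R) (y Y : R -> R) : a <= b ->
  (forall x, a <= x <= b -> y t @[t --> x] --> y x) ->
  (forall x, a <= x <= b -> is_derive x (1 : R) Y (y x)) ->
  \int[leb]_(x in `[a, b]) y x = Y b - Y a.
Proof.
move=> ab cy dY.
have := @cint_derivative R a b (fun x => (y x)%:C) (fun x => (Y x)%:C) ab.
rewrite cintR -RBC => H; apply: (@complexI R); apply: H.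
  by move=> x /cy; exact: contRC.
by move=> x /dY; exact: is_derive_vder.
Qed.

(** On compact subintervals this is the fundamental theorem of calculus; the
    limits at both ends exist because the indefinite integral is continuous
    up to the boundary. *)
Lemma Rint_improper (a b l1 l2 : R) (y Y : R -> R) : a < b ->
  leb.-integrable `[a, b] (EFin \o y) ->
  (forall x, a < x < b -> y t @[t --> x] --> y x) ->
  (forall x, a < x < b -> is_derive x (1 : R) Y (y x)) ->
  Y x @[x --> a^'+] --> l1 -> Y x @[x --> b^'-] --> l2 ->
  \int[leb]_(x in `[a, b]) y x = l2 - l1.
Proof.
move=> ab yi cy dY Y1 Y2.
pose H x := \int[leb]_(t in `[a, x]) y t.
have := parameterized_integral_continuous (ltW ab) yi.
move=> /(continuous_within_itvP _ ab)[_ Ha Hb].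
have diff u x : a < u -> u <= x -> x < b -> H x - H u = Y x - Y u.
  move=> au ux xb; have ax := lt_le_trans au ux.
  have <- : \int[leb]_(t in `[u, x]) y t = Y x - Y u; first apply: (Rint_FTC ux).
  - by move=> t /andP[ut tx]; apply: cy; rewrite (lt_le_trans au ut) (le_lt_trans tx xb).
  - by move=> t /andP[ut tx]; apply: dY; rewrite (lt_le_trans au ut) (le_lt_trans tx xb).
  have yS : leb.-integrable `[a, x] (EFin \o y).
    apply: integrableS yi => //; apply: subset_itvScc; rewrite bnd_simp//; exact: ltW.
  have := @Rintegral_itvB _ y (BLeft a) (BRight x) u yS.
  rewrite !bnd_simp => /(_ (ltW au) ux) ->; rewrite Rintegral_itv_obnd_cbnd//.
  by apply: integrableS yS => //; apply: subset_itv => //; rewrite bnd_simp// ltW.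
pose c := (a + b) / 2; pose K := H c - Y c.
have HK x : a < x < b -> Y x + K = H x.
  move=> /andP[ax xb]; have ac : a < c by rewrite /c; lra.
  have cb : c < b by rewrite /c; lra.
  by have [xc|/ltW cx] := leP x c; [have := diff x c ax xc cb|have := diff c x ac cx xb];
    rewrite /K; lra.
have Ea : l1 + K = 0.
  have H0 : H a = 0 by rewrite /H set_itv1 Rintegral_set1.
  rewrite -H0; have YK : Y x + K @[x --> a^'+] --> l1 + K.
    by apply: cvgD Y1 _; exact: cvg_cst.
  apply: (cvg_unique _ YK) => //.
  apply: cvg_trans Ha; apply: near_eq_cvg; near=> x; apply/esym/HK/andP; split.
    by near: x; exact: nbhs_right_gt.
  by near: x; exact: nbhs_right_lt.
have Eb : l2 + K = H b.
  have YK : Y x + K @[x --> b^'-] --> l2 + K.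
    by apply: cvgD Y2 _; exact: cvg_cst.
  apply: (cvg_unique _ YK) => //.
  apply: cvg_trans Hb; apply: near_eq_cvg; near=> x; apply/esym/HK/andP; split.
    by near: x; exact: nbhs_left_gt.
  by near: x; exact: nbhs_left_lt.
rewrite -/(H b); lra.
Unshelve. all: by end_near. Qed.

Lemma cint_improper0 (a b : R) (y Y : R -> C) : a < b ->
  cintegrable leb `[a, b] y -> (forall x, a < x < b -> contc y x) ->
  (forall x, a < x < b -> vder Y x (y x)) ->
  nc (Y x) @[x --> a^'+] --> (0 : R) -> nc (Y x) @[x --> b^'-] --> (0 : R) ->
  cint leb `[a, b] y = 0.
Proof.
move=> ab [yr yi] cy dY Ya Yb.
have lim0 (F : set_system R) (FF : ProperFilter F) (g : C -> R) :
    (forall z, `|g z| <= nc z) -> nc (Y x) @[x --> F] --> (0 : R) ->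
    g (Y x) @[x --> F] --> (0 : R).
  move=> gn /cvgrPdist_lt H; apply/cvgrPdist_lt => e e0; near=> x.
  rewrite sub0r normrN (le_lt_trans (gn _))//.
  have : `|0 - nc (Y x)| < e by near: x; exact: H.
  by rewrite sub0r normrN ger0_norm ?nc_ge0.
apply: eqC => /=.
  rewrite -[RHS](subrr (0 : R)).
  apply: (@Rint_improper a b 0 0 _ (fun x => Re (Y x)) ab yr).
  - by move=> x /cy/contc_Re.
  - by move=> x /dY/vder_is_derive[].
  - by apply: lim0 => //; exact: ge_nc_Re.
  - by apply: lim0 => //; exact: ge_nc_Re.
rewrite -[RHS](subrr (0 : R)).
  apply: (@Rint_improper a b 0 0 _ (fun x => Im (Y x)) ab yi).
- by move=> x /cy/contc_Im.
- by move=> x /dY/vder_is_derive[].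
- by apply: lim0 => //; exact: ge_nc_Im.
- by apply: lim0 => //; exact: ge_nc_Im.
Unshelve. all: by end_near. Qed.

(** The integrals over the exhausting compact intervals are increments of
    [G], hence bounded, and they increase to the integral over [D]. *)
Lemma integrable_bounded_primitive (D : set RM) (f G : R -> R) (p q : nat -> R) (M : R) :
  (forall n, p n <= q n) ->
  (forall m n, (m <= n)%N -> p n <= p m /\ q m <= q n) ->
  D = \bigcup_n `[p n, q n]%classic ->
  (forall x, D x -> f t @[t --> x] --> f x) ->
  (forall x, D x -> vder (fun t => (G t)%:C) x (f x)%:C) ->
  (forall x, D x -> 0 <= f x) -> (forall x, D x -> `|G x| <= M) ->
  leb.-integrable D (EFin \o f).
Proof.
move=> pq mono DE cf dG f0 GM.
have mD : measurable D.
  by rewrite DE; apply: bigcup_measurable => n _; exact: measurable_itv.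
have sub n : `[p n, q n]%classic `<=` D.
  by move=> x xx; rewrite DE; exists n.
have mf : measurable_fun D f by exact: measurable_cont1.
have intn n : leb.-integrable `[p n, q n] (EFin \o f).
  apply: continuous_compact_integrable; first exact: segment_compact.
  by apply: continuous_in_subspaceT => x /set_mem/sub; exact: cf.
have bnd n : (\int[leb]_(x in `[p n, q n]) (f x)%:E <= (M + M)%:E)%E.
  have mI : measurable (`[p n, q n] : set RM) by exact: measurable_itv.
  have := integrable_fin_num mI (intn n).
  rewrite /comp => fn; rewrite -(fineK fn) lee_fin.
  have FT : fine (\int[leb]_(x in `[p n, q n]) (f x)%:E)%E = G (q n) - G (p n).
    apply: (@Rint_FTC (p n) (q n) f G (pq n)).
    - by move=> x xx; apply: cf; apply: (sub n); rewrite /= in_itv.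
    - move=> x xx; have := dG x (sub n x ltac:(by rewrite /= in_itv)).
      by move=> /vder_is_derive[].
  rewrite FT.
  have Dp : D (p n) by apply: (sub n); rewrite /= in_itv /= lexx pq.
  have Dq : D (q n) by apply: (sub n); rewrite /= in_itv /= lexx pq.
  by rewrite (le_trans (ler_norm _))// (le_trans (ler_normB _ _))// lerD// GM.
apply/integrableP; split; first exact/measurable_EFinP.
have -> : (\int[leb]_(x in D) `|(EFin \o f) x| = \int[leb]_(x in D) (f x)%:E)%E.
  by apply: eq_integral => x /set_mem Dx /=; rewrite ger0_norm// f0.
have H : ((\int[leb]_(x in `[p n, q n]) (f x)%:E) @[n --> \oo] -->
    \int[leb]_(x in D) (f x)%:E)%E.
  rewrite [X in _ --> (\int[leb]_(x in X) _)%E]DE.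
  apply: (@ge0_nondecreasing_set_cvg_integral _ RM R (fun n => `[p n, q n]%classic)
    (fun x => (f x)%:E) leb).
  - move=> m n mn; apply/subsetPset; have [pp qq] := mono _ _ mn.
    by apply: subset_itvScc; rewrite bnd_simp.
  - by move=> n; exact: measurable_itv.
  - by move=> n; apply/measurable_EFinP; apply: measurable_funS mf.
  - by move=> n x /sub Dx; rewrite lee_fin f0.
apply: (@le_lt_trans _ _ (M + M)%:E); last exact: ltry.
rewrite -(cvg_lim _ H)//; apply: lime_le; first by apply/cvg_ex; eexists; exact: H.
by apply: nearW => n; exact: bnd.
Qed.

(** Real powers of positive numbers; in contrast to [powR] no convention at
    zero has to be carried along. *)
Definition epow (s x : R) : R := expR (s * ln x).

Lemma epow_gt0 s x : 0 < epow s x.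
Proof. exact: expR_gt0. Qed.

Lemma vder_compR (F : R -> C) (g : R -> R) x d d' : vder F (g x) d ->
  vder (fun t => (g t)%:C) x d'%:C -> vder (fun t => F (g t)) x (d * d'%:C).
Proof.
move=> [p [cp <- pE]] Dg; have cg := contc_Re (vder_cont Dg).
move: Dg => [q [cq qd qE]]; exists (fun y => p (g y) * q y); split.
- by apply: contM cq; exact: cont_compR cp cg.
- by rewrite qd.
- by move=> y; rewrite -mulrA -qE -pE.
Qed.

Lemma vder_ln (g : R -> R) x dg : 0 < g x -> vder (fun t => (g t)%:C) x dg%:C ->
  vder (fun t => (ln (g t))%:C) x (dg / g x)%:C.
Proof.
move=> gx Dg; apply: has_slope_eq.
  apply: (@vder_compR (fun y => (ln y)%:C) _ _ _ _ _ Dg).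
  exact: is_derive_vder (is_derive1_ln gx).
by rewrite -RMC mulrC.
Qed.

Lemma vder_expR (g : R -> R) x dg : vder (fun t => (g t)%:C) x dg%:C ->
  vder (fun t => (expR (g t))%:C) x (expR (g x) * dg)%:C.
Proof.
move=> Dg; rewrite RMC -cexp_R.
rewrite (_ : (fun t => _) = fun t => cexp (g t)%:C); last first.
  by apply/funext => t; rewrite cexp_R.
by apply: has_slope_cexp => //; exact: contreal.
Qed.

Lemma vderZR (c : R) (g : R -> R) x dg : vder (fun t => (g t)%:C) x dg%:C ->
  vder (fun t => (c * g t)%:C) x (c * dg)%:C.
Proof.
move=> Dg; rewrite RMC (_ : (fun t => _) = fun t => c%:C * (g t)%:C).
  exact: has_slopeZ.
by apply/funext => t; rewrite RMC.
Qed.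

Lemma vder_epow s (g : R -> R) x dg : 0 < g x -> vder (fun t => (g t)%:C) x dg%:C ->
  vder (fun t => (epow s (g t))%:C) x (s * epow (s - 1) (g x) * dg)%:C.
Proof.
move=> gx Dg; have := vder_expR (vderZR s (vder_ln gx Dg)).
by move/has_slope_eq; apply; congr (_%:C); rewrite /epow mulrBl mul1r expRB lnK ?posrE//; ring.
Qed.

Lemma cont_epow s (g : R -> R) x : 0 < g x -> g t @[t --> x] --> g x ->
  epow s (g t) @[t --> x] --> epow s (g x).
Proof.
move=> gx cg; apply: (@cvg_comp _ _ _ (fun t => s * ln (g t)) expR).
  apply: cvgM; first exact: cvg_cst.
  by apply: (@cvg_comp _ _ _ g (@ln R) _ _ _ cg); exact: continuous_ln.
exact: continuous_expR.
Qed.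

Lemma epow_bound s x : 1 <= x <= 2 -> epow s x <= 1 + epow s 2.
Proof.
move=> /andP[x1 x2]; have l0 : 0 <= ln x by exact: ln_ge0.
have l2 : ln x <= ln 2 by rewrite ler_ln ?posrE//; lra.
have [s0|/ltW s0] := leP 0 s.
  apply: (@le_trans _ _ (epow s 2)); last by rewrite lerDr.
  by rewrite ler_expR ler_wpM2l.
apply: (@le_trans _ _ 1); last by rewrite lerDl ltW// epow_gt0.
by rewrite -expR0 ler_expR mulr_le0_ge0.
Qed.

Lemma epow_cvg0 s (g : R -> R) (F : set_system R) (FF : ProperFilter F) : 0 < s ->
  g x @[x --> F] --> (0 : R) -> (\forall x \near F, 0 < g x) ->
  epow s (g x) @[x --> F] --> (0 : R).
Proof.
move=> s0 g0 gp.
have := powR_cvg0 s0 => P0.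
have gr : g x @[x --> F] --> (0 : R)^'+.
  move=> A /=; rewrite /within /= /at_right => nA.
  have := g0 _ nA; rewrite /nbhs /=.
  by move: gp; apply: filterS2 => x gx; apply.
have := @cvg_comp _ _ _ g (fun a => a `^ s) _ _ _ gr P0.
apply: cvg_trans; apply: near_eq_cvg.
by move: gp; apply: filterS => x gx; rewrite /= /powR gt_eqF.
Qed.

Lemma epow_cpow s x : 0 < x -> nc (cpow x s) = epow (Re s) x.
Proof. by move=> x0; rewrite /cpow gt_eqF// nc_cexp ReM /= mulr0 subr0. Qed.

End ImproperIntegrals.

Section BetaWeight.
Context {R : realType}.
Local Notation C := (R[i]).
Local Notation leb := (@lebesgue_measure R).
Local Notation RM := (measurableTypeR R).
Implicit Types (al be s : C) (v : R).

(** The weight of the Beta integral on the interval from -1 to 1. *)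
Definition bw al be v : C := cpow (1 - v) (al - 1) * cpow (1 + v) (be - 1).

Lemma cpow_gt0 s (x : R) : 0 < x -> cpow x s = cexp (s * (ln x)%:C).
Proof. by move=> x0; rewrite /cpow gt_eqF. Qed.

Lemma cpowD s s' (x : R) : 0 < x -> cpow x (s + s') = cpow x s * cpow x s'.
Proof. by move=> x0; rewrite !cpow_gt0// mulrDl cexpD. Qed.

Lemma cpow_nat n (x : R) : 0 < x -> cpow x n%:R = x%:C ^+ n.
Proof. by move=> x0; rewrite cpow_gt0// cexpMn cexp_R lnK. Qed.

Lemma vder_cpow s (g : R -> R) x dg : 0 < g x -> vder (fun t => (g t)%:C) x dg%:C ->
  vder (fun t => cpow (g t) s) x (s * cpow (g x) (s - 1) * dg%:C).
Proof.
move=> gx Dg; have cg : g t @[t --> x] --> g x by exact: (contc_Re (vder_cont Dg)).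
apply: (@has_slope_near _ _ (real_complex R) (fun t => cexp (s * (ln (g t))%:C))).
- exact: complexI.
- have : \forall t \near x, 0 < g t.
    move/cvgrPdist_lt: cg => /(_ _ gx); apply: filterS => t.
    by rewrite ltr_norml => /andP[_ ?]; lra.
  by apply: filterS => t gt; rewrite cpow_gt0.
- apply: has_slope_eq.
    apply: has_slope_cexp; first exact: contreal.
    by apply: has_slopeZ; exact: vder_ln Dg.
  rewrite -cpow_gt0// cpowD// (_ : -1 = - (1%:R))//.
  have -> : cpow (g x) (- 1%:R) = (g x)%:C^-1.
    by rewrite cpow_gt0// mulNr cexpN mul1r cexp_R lnK.
  by rewrite RMC RVC; ring.
Qed.

Lemma vder_1B v : vder (fun t : R => (1 - t)%:C) v (-1)%:C.
Proof.
exists (fun=> (-1)%:C); split=> // [|y]; first exact: contC.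
by apply: eqC => /=; ring.
Qed.

Lemma vder_1D v : vder (fun t : R => (1 + t)%:C) v 1%:C.
Proof.
exists (fun=> 1%:C); split=> // [|y]; first exact: contC.
by apply: eqC => /=; ring.
Qed.

Lemma bw_nc al be v : -1 < v < 1 ->
  nc (bw al be v) = epow (Re al - 1) (1 - v) * epow (Re be - 1) (1 + v).
Proof.
move=> /andP[v1 v2]; rewrite ncM !epow_cpow ?ReB//; lra.
Qed.

Lemma cont_bw al be v : -1 < v < 1 -> contc (bw al be) v.
Proof.
move=> /andP[v1 v2].
have h1 : 0 < 1 - v by lra.
have h2 : 0 < 1 + v by lra.
apply: contM.
  exact: (vder_cont (@vder_cpow (al - 1) (fun t => 1 - t) v _ h1 (vder_1B v))).
exact: (vder_cont (@vder_cpow (be - 1) (fun t => 1 + t) v _ h2 (vder_1D v))).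
Qed.

Lemma vder_bw al be v : -1 < v < 1 ->
  vder (fun v => cpow (1 - v) al * cpow (1 + v) be) v
    (bw al be v * (be * (1 - v)%:C - al * (1 + v)%:C)).
Proof.
move=> /andP[v1 v2].
have h1 : 0 < 1 - v by lra.
have h2 : 0 < 1 + v by lra.
apply: has_slope_eq.
  apply: has_slopeM; first exact: contreal.
    exact: (@vder_cpow al (fun t => 1 - t) v _ h1 (vder_1B v)).
  exact: (@vder_cpow be (fun t => 1 + t) v _ h2 (vder_1D v)).
have e1 : cpow (1 - v) al = cpow (1 - v) (al - 1) * (1 - v)%:C.
  by rewrite -[X in _ * X]expr1 -(@cpow_nat 1)// -cpowD// subrK.
have e2 : cpow (1 + v) be = cpow (1 + v) (be - 1) * (1 + v)%:C.
  by rewrite -[X in _ * X]expr1 -(@cpow_nat 1)// -cpowD// subrK.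
by rewrite e1 e2 /bw RNC; ring.
Qed.

Lemma bw_shift al be m n v : -1 < v < 1 ->
  bw (al + m%:R) (be + n%:R) v = bw al be v * ((1 - v)%:C ^+ m * (1 + v)%:C ^+ n).
Proof.
move=> /andP[v1 v2].
have h1 : 0 < 1 - v by lra.
have h2 : 0 < 1 + v by lra.
rewrite /bw -!cpow_nat// addrAC [be + _ - 1]addrAC !cpowD//; ring.
Qed.

Lemma integrable_itv_oo (a b : R) (g : R -> R) : a < b ->
  leb.-integrable `]a, b[ (EFin \o g) ->
  leb.-integrable `[a, b] (EFin \o g) /\
  \int[leb]_(x in `[a, b]) g x = \int[leb]_(x in `]a, b[) g x.
Proof.
move=> ab /integrableP[mg gi].
have mg1 : measurable_fun `]a, b] (EFin \o g).
  by move/emeasurable_fun_itv_bndo_bndcP: mg.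
have mg2 : measurable_fun `[a, b] (EFin \o g).
  by move/emeasurable_fun_itv_obnd_cbndP: mg1.
have E (f : R -> \bar R) : measurable_fun `]a, b[ f ->
    (\int[leb]_(x in `[a, b]) f x = \int[leb]_(x in `]a, b[) f x)%E.
  move=> mf; have mf1 : measurable_fun `]a, b] f.
    by move/emeasurable_fun_itv_bndo_bndcP: mf.
  rewrite -(integral_itv_obnd_cbnd mf1).
  by rewrite -(integral_itv_bndo_bndc mf).
split; last by rewrite /Rintegral E.
apply/integrableP; split => //.
by rewrite E//; exact: measurableT_comp.
Qed.

Lemma cintegrable_oo (f : R -> C) :
  cintegrable leb `]-1, 1[ f -> cintegrable leb `[-1, 1] f.
Proof.
have ab : -1 < 1 :> R by lra.
by move=> [/(integrable_itv_oo ab)[fr _] /(integrable_itv_oo ab)[fi _]].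
Qed.

Lemma cint_oo (f : R -> C) : cintegrable leb `]-1, 1[ f ->
  cint leb `[-1, 1] f = cint leb `]-1, 1[ f.
Proof.
have ab : -1 < 1 :> R by lra.
move=> [/(integrable_itv_oo ab)[_ fr] /(integrable_itv_oo ab)[_ fi]].
by rewrite /cint fr fi.
Qed.

Lemma mem_oo (x : R) : `]-1, 1[%classic x = (-1 < x < 1).
Proof. by rewrite /= in_itv. Qed.

Lemma cintegrable_ooS (f : R -> C) :
  cintegrable leb `[-1, 1] f -> cintegrable leb `]-1, 1[ f.
Proof.
by move=> [fr fi]; split; [apply: integrableS fr|apply: integrableS fi] => //;
  exact: subset_itv_oo_cc.
Qed.

Lemma null_sequence : exists e : nat -> R,
  [/\ forall n, 0 < e n <= 1 / 2, forall m n, (m <= n)%N -> e n <= e m &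
      forall x, 0 < x -> exists n, e n <= x].
Proof.
exists (fun n => (n.+2%:R)^-1); split=> [n|m n mn|x x0].
- by rewrite invr_gt0 ltr0n /= div1r lef_pV2 ?posrE ?ltr0n// ler_nat.
- by rewrite lef_pV2 ?posrE ?ltr0n// ler_nat.
- exists (Num.bound (x^-1)).
  rewrite -[leRHS]invrK lef_pV2 ?posrE ?invr_gt0// ?ltr0n//.
  have := archi_boundP (ltW (_ : 0 < x^-1)); rewrite invr_gt0 => /(_ x0) h.
  by apply: (le_trans (ltW h)); rewrite ler_nat -addn2 leq_addr.
Qed.

Lemma oo_exhaustion : exists p q : nat -> R, [/\ forall n, p n <= q n,
  forall m n, (m <= n)%N -> p n <= p m /\ q m <= q n &
  (`]-1, 1[%classic : set RM) = \bigcup_n `[p n, q n]%classic].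
Proof.
have [e [e0 em earch]] := null_sequence.
exists (fun n => -1 + e n), (fun n => 1 - e n); split=> [n|m n /em ?|].
- by have /andP[? ?] := e0 n; lra.
- by split; lra.
- apply/seteqP; split=> [x|x [n _]].
    rewrite mem_oo => /andP[x1 x2].
    have [|n] := earch (Num.min (1 + x) (1 - x)).
      by rewrite lt_min; apply/andP; split; lra.
    rewrite le_min => /andP[h1 h2]; exists n => //=; rewrite in_itv /=.
    by apply/andP; split; lra.
  rewrite /= !in_itv /= => /andP[h1 h2]; have /andP[? ?] := e0 n.
  by apply/andP; split; lra.
Qed.

Lemma epow_bounded (b x : R) : 0 < b -> 0 < x < 2 -> `|b^-1 * epow b x| <= b^-1 * epow b 2.
Proof.
move=> b0 /andP[x0 x2].
have p0 : 0 <= b^-1 * epow b x.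
  by apply: mulr_ge0; [rewrite invr_ge0 ltW|exact: ltW (epow_gt0 _ _)].
rewrite ger0_norm// ler_pM2l ?invr_gt0// ler_expR ler_pM2l// ler_ln ?posrE; lra.
Qed.

Lemma integrable_1D (b : R) : 0 < b ->
  leb.-integrable `]-1, 1[ (EFin \o (fun v => epow (b - 1) (1 + v))).
Proof.
move=> b0; have [p [q [pq mono E]]] := oo_exhaustion.
apply: (@integrable_bounded_primitive _ _ _ (fun v => b^-1 * epow b (1 + v)) p q
  (b^-1 * epow b 2) pq mono E).
- move=> x; rewrite mem_oo => /andP[x1 x2]; apply: cont_epow; first by lra.
  by apply: cvgD; [exact: cvg_cst|exact: cvg_id].
- move=> x; rewrite mem_oo => /andP[x1 x2]; apply: has_slope_eq.
    apply: vderZR; apply: vder_epow; first by lra.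
    exact: vder_1D.
  by congr (_%:C); rewrite mulr1 mulKf// gt_eqF.
- by move=> x _; exact: ltW (epow_gt0 _ _).
- by move=> x; rewrite mem_oo => /andP[x1 x2]; apply: epow_bounded => //; lra.
Qed.

Lemma integrable_1B (a : R) : 0 < a ->
  leb.-integrable `]-1, 1[ (EFin \o (fun v => epow (a - 1) (1 - v))).
Proof.
move=> b0; have [p [q [pq mono E]]] := oo_exhaustion.
apply: (@integrable_bounded_primitive _ _ _ (fun v => - a^-1 * epow a (1 - v)) p q
  (a^-1 * epow a 2) pq mono E).
- move=> x; rewrite mem_oo => /andP[x1 x2]; apply: cont_epow; first by lra.
  by apply: cvgB; [exact: cvg_cst|exact: cvg_id].
- move=> x; rewrite mem_oo => /andP[x1 x2]; apply: has_slope_eq.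
    apply: vderZR; apply: vder_epow; first by lra.
    exact: vder_1B.
  by congr (_%:C); field; rewrite gt_eqF.
- by move=> x _; exact: ltW (epow_gt0 _ _).
- move=> x; rewrite mem_oo => /andP[x1 x2]; rewrite mulNr normrN.
  by apply: epow_bounded => //; lra.
Qed.

(** Each of the two factors is singular at one end only, and the other one is
    bounded near this end. *)
Lemma cintegrable_bw al be : 0 < Re al -> 0 < Re be ->
  cintegrable leb `[-1, 1] (bw al be).
Proof.
move=> a0 b0; apply: cintegrable_oo.
set a := Re al in a0 *; set b := Re be in b0 *.
have mI : measurable (`]-1, 1[ : set RM) by exact: measurable_itv.
have mw : cmeasurable (`]-1, 1[ : set RM) (bw al be).
  split; apply: measurable_cont1 => // x; rewrite mem_oo => /(cont_bw al be) cw.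
    exact: contc_Re cw.
  exact: contc_Im cw.
apply: (cintegrable_le mI mw (g := fun v => (1 + epow (a - 1) 2) * epow (b - 1) (1 + v) +
  (1 + epow (b - 1) 2) * epow (a - 1) (1 - v))).
  by apply: integrableRD => //; apply: integrableRZ => //;
    [exact: integrable_1D|exact: integrable_1B].
move=> v; rewrite mem_oo => v11; rewrite bw_nc// -/a -/b; have /andP[v1 v2] := v11.
have e1 := epow_gt0 (a - 1) (1 - v); have e2 := epow_gt0 (b - 1) (1 + v).
have e3 := epow_gt0 (a - 1) 2; have e4 := epow_gt0 (b - 1) 2.
(* On the left half the factor in [1 - v] is bounded, on the right half the
   factor in [1 + v]. *)
have [v0|v0] := leP v 0.
  have : epow (a - 1) (1 - v) <= 1 + epow (a - 1) 2 by apply: epow_bound; lra.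
  nra.
have : epow (b - 1) (1 + v) <= 1 + epow (b - 1) 2 by apply: epow_bound; lra.
nra.
Qed.

Lemma cintegrable_Mbw al be (f : R -> C) : 0 < Re al -> 0 < Re be ->
  contcI (-1) 1 f -> cintegrable leb `[-1, 1] (fun v => f v * bw al be v).
Proof.
move=> a0 b0 cf.
have mI : measurable (`[-1, 1] : set RM) by exact: measurable_itv.
have wi := cintegrable_bw a0 b0.
have [M fM] := @contc_compact_bounded R _ _ f (@segment_compact R (-1) 1)
  ltac:(by move=> x /=; rewrite in_itv; exact: cf).
apply: (cintegrable_le mI (g := fun v => M * nc (bw al be v))).
- apply: cmeasurableM; last exact: cintegrable_measurable wi.
  by apply: cintegrable_measurable; exact: contcI_cintegrable cf.
- by apply: integrableRZ => //; exact: cintegrable_nc.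
- by move=> v /fM; rewrite ncM; apply: ler_wpM2r; exact: nc_ge0.
Qed.
End BetaWeight.

(** * Feynman's parametric formula *)

Section Feynman.
Context {R : realType}.
Local Notation C := (R[i]).
Local Notation leb := (@lebesgue_measure R).
Local Notation RM := (measurableTypeR R).
Implicit Types (al be : C) (v t : R) (z : C).

Definition seg z1 z2 v : C := ((z2 - z1) * v%:C + (z1 + z2)) / 2.

Lemma segE z1 z2 v : seg z1 z2 v = ((1 - v) / 2)%:C * z1 + ((1 + v) / 2)%:C * z2.
Proof. by rewrite /seg !RMC !RVC natC RBC RDC; field. Qed.

Lemma seg_halfplane z1 z2 v : halfplane z1 -> halfplane z2 -> -1 <= v <= 1 ->
  halfplane (seg z1 z2 v).
Proof.
rewrite segE /halfplane /= => h1 h2 /andP[v1 v2]; rewrite ImD !ImM /= !mul0r !addr0.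
nra.
Qed.

Lemma vder_seg z1 z2 v : vder (seg z1 z2) v ((z2 - z1) / 2).
Proof.
exists (fun=> (z2 - z1) / 2); split=> // [|y]; first exact: contC.
by rewrite /seg; ring.
Qed.

Lemma cont_seg z1 z2 v : contc (seg z1 z2) v.
Proof. exact: vder_cont (vder_seg z1 z2 v). Qed.

Lemma curve_bounded (a b : R) (g : R -> C) : a <= b -> contcI a b g ->
  (forall v, a <= v <= b -> halfplane (g v)) ->
  exists m B : R, 0 < m /\ forall v, a <= v <= b -> m <= Im (g v) /\ nc (g v) <= B.
Proof.
move=> ab cg hg.
have [c] := EVT_min ab (contcI_Im cg); rewrite in_itv /= => cab cmin.
have cn : {within `[a, b], continuous (fun x => nc (g x))}.
  apply: continuous_in_subspaceT => x /set_mem /=; rewrite in_itv /= => /cg/contcE.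
  exact: (cvg_nc (nbhs_filter _)).
have [d] := EVT_max ab cn; rewrite in_itv /= => dab dmax.
exists (Im (g c)), (nc (g d)); split; first exact: hg.
by move=> v vab; split; [apply: cmin|apply: dmax]; rewrite in_itv.
Qed.

(** The homotopy principle of [fubini_zero], with the Beta weight in the
    variable of integration. *)
Lemma fubini_zero_bw al be (k : R * R -> C) (K : R -> C) : 0 < Re al -> 0 < Re be ->
  (forall s v, 0 <= s <= 1 -> -1 <= v <= 1 -> contc k (s, v)) ->
  (forall s, 0 <= s <= 1 -> cint leb `[-1, 1] (fun v => k (s, v) * bw al be v) = 0) ->
  (forall v, -1 <= v <= 1 -> cint leb `[0, 1] (fun s => k (s, v)) = K v) ->
  cint leb `[-1, 1] (fun v => K v * bw al be v) = 0.
Proof.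
move=> a0 b0 ck k0 kK.
have mA : measurable (`[0, 1] : set RM) by exact: measurable_itv.
have mB : measurable (`[-1, 1] : set RM) by exact: measurable_itv.
have mAB : measurable ((`[0, 1] `*` `[-1, 1]) : set (RM * RM)) by exact: measurableX.
have wi := cintegrable_bw a0 b0.
have ck' := itv_setX ck.
have k2 t : -1 <= t <= 1 -> contcI 0 1 (fun s => k (s, t)).
  by move=> tcd s sab; apply: cont_slice2; exact: ck.
have mk : cmeasurable ((`[0, 1] `*` `[-1, 1]) : set (RM * RM)) k.
  by split; apply: measurable_cont2 => // x /ck'; [exact: contc_Re|exact: contc_Im].
have [M kM] := contc_compact_bounded (@compact_rect R 0 1 (-1) 1) ck'.
pose k' (p : R * R) : C := k p * bw al be p.2.
have one_i : leb.-integrable `[0, 1] (EFin \o (fun=> M)).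
  by apply: integrable_cst_fin => //; rewrite /= leb_itv// ltry.
have ki : cintegrable (leb \x leb)%E (`[0, 1] `*` `[-1, 1]) k'.
  apply: (@cintegrable_le _ _ _ _ _ mAB _ (fun p => M * nc (bw al be p.2))).
  - apply: cmeasurableM => //; have [wr wi'] := cintegrable_measurable wi.
    have mS : measurable_fun ((`[0, 1] `*` `[-1, 1]) : set (RM * RM)) (@snd RM RM).
      exact: measurable_funTS measurable_snd.
    by split; [apply: (measurable_comp mB _ wr mS)|apply: (measurable_comp mB _ wi' mS)];
      move=> _ [[s t] [_ /= tt] <-].
  - exact: (@integrableX _ _ _ _ _ leb leb _ _ mA mB (fun=> M) (fun v => nc (bw al be v)) one_i
      (cintegrable_nc mB wi)).
  - by move=> x /kM xM; rewrite /k' ncM; apply: ler_wpM2r => //; exact: nc_ge0.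
have F1 := @cfubini1 _ _ _ _ _ leb leb _ _ mA mB k' ki.
have F2 := @cfubini2 _ _ _ _ _ leb leb _ _ mA mB k' ki.
have E : cint leb `[-1, 1] (fun v => K v * bw al be v) =
    cint leb `[-1, 1] (fun v => cint leb `[0, 1] (fun s => k' (s, v))).
  apply: eq_cint_itv => v vv; rewrite -kK// /k' /= cintZr//.
  exact: contcI_cintegrable (k2 v vv).
rewrite E F2; last first.
  move=> v /=; rewrite in_itv => vv; apply: contcI_cintegrable => s ss.
  have cs : contc (fun s : R => k (s, v)) s by exact: k2.
  have : contc (fun x : R => k (x, v) * bw al be v) s by apply: contM cs _; exact: contC.
  by [].
rewrite -F1; last first.
  move=> s /=; rewrite in_itv => ss; apply: (@cintegrable_Mbw _ al be (fun v => k (s, v))) => //.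
  by move=> v vv; apply: cont_slice1; exact: ck.
rewrite -[RHS](cint0 leb `[0, 1]); apply: eq_cint_itv => s ss; exact: k0.
Qed.

(** Only the exponential of [phi] is prescribed; this determines the
    derivative of [phi]. *)
Lemma cder_log (phi : C -> C) (c d : C) z : hol phi ->
  (forall z, halfplane z -> cexp (phi z) = c * z + d) -> halfplane z ->
  c * z + d != 0 /\ cder phi z (c / (c * z + d)).
Proof.
move=> hphi ephi hz.
have q0 : c * z + d != 0 by rewrite -ephi// cexp_neq0.
split=> //; have de := hol_cd hphi hz.
apply: has_slope_eq de _; apply: (mulIf q0); rewrite divfK// -ephi// mulrC.
have d1 : cder (fun w => cexp (phi w)) z (cexp (phi z) * cd phi z).
  by apply: has_slope_cexp; [exact: contid|exact: hol_cd].
apply: (cder_uniq d1); apply: (@cder_near _ (fun w => c * w + d) _ _ _ (Im z)) => //.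
- move=> w wz; rewrite ephi// /halfplane /=.
  have := le_trans (ler_norm _) (ge_nc_Im (z - w)); rewrite ImB (ncB z); lra.
- by exists (fun=> c); split=> // [|y]; [exact: contC|ring].
Qed.

Lemma cvg_near_eq {T : Type} (F : set_system T) (FF : Filter F) (f g : T -> R) (a : R) :
  (\forall x \near F, g x = f x) -> g x @[x --> F] --> a -> f x @[x --> F] --> a.
Proof.
move=> fg /cvgrPdist_lt ga; apply/cvgrPdist_lt => e e0.
by have := ga e e0; apply: filterS2 fg => x ->.
Qed.

Lemma bw_mul1 al be v : -1 < v < 1 ->
  cpow (1 - v) al * cpow (1 + v) be = bw al be v * ((1 - v)%:C * (1 + v)%:C).
Proof.
move=> v11; have := @bw_shift R al be 1 1 v v11; rewrite !expr1 => <-.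
by rewrite /bw !addrK.
Qed.

Section Formula.
Variables (al be c d : C) (phi : C -> C) (z1 z2 : C).
Hypotheses (a0 : 0 < Re al) (b0 : 0 < Re be) (hphi : hol phi).
Hypothesis ephi : forall z, halfplane z -> cexp (phi z) = c * z + d.
Hypotheses (hz1 : halfplane z1) (hz2 : halfplane z2).

(* The homotopy moves the second end point from [z1] to [z2] along [ze]. The
   integrand is normalized by its expected value, which gives [X]; the
   derivative [k] of [X] with respect to the homotopy parameter, multiplied
   by the Beta weight, is exact in [v] ([vder_Y]), and its primitive vanishes
   at both ends. *)
Let q z := c * z + d.
Let ze t : C := z1 + t%:C * (z2 - z1).
Let X t v := cexp (be * phi (ze t) - (al + be) * phi (seg z1 (ze t) v)).
Let k (p : R * R) : C := X p.1 p.2 *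
  (c * (z2 - z1) / (2 * q (ze p.1) * q (seg z1 (ze p.1) p.2)) *
   (be * q z1 * (1 - p.2)%:C - al * q (ze p.1) * (1 + p.2)%:C)).

Let hze t : 0 <= t <= 1 -> halfplane (ze t).
Proof.
move: hz1 hz2; rewrite /halfplane /= => y1 y2 /andP[t0 t1].
rewrite /ze ImD !ImM ImB /= mul0r addr0; nra.
Qed.

Let q0 z : halfplane z -> q z != 0.
Proof. by move=> hz; have [] := cder_log hphi ephi hz. Qed.

Let dphi z : halfplane z -> cder phi z (c / q z).
Proof. by move=> hz; have [] := cder_log hphi ephi hz. Qed.

Let q_seg t v : q (seg z1 (ze t) v) = (q z1 * (1 - v)%:C + q (ze t) * (1 + v)%:C) / 2.
Proof. by rewrite /q segE !RMC !RVC natC RBC RDC; field. Qed.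

Let vder_ze t : vder ze t (z2 - z1).
Proof.
by exists (fun=> z2 - z1); split=> // [|y]; [exact: contC|rewrite /ze; ring].
Qed.

Let cont_ze (p : R * R) : contc (fun p => ze p.1) p.
Proof. exact: (@cont_fst _ _ _ ze p (vder_cont (vder_ze p.1))). Qed.

Let cont_segze (p : R * R) : contc (fun p => seg z1 (ze p.1) p.2) p.
Proof.
rewrite /seg; apply: contM; last exact: contC.
apply: contD; last by apply: contD; [exact: contC|exact: cont_ze].
apply: contM; first by apply: contD; [exact: cont_ze|exact: contC].
exact: (@cont_snd _ _ _ (real_complex R) p (contreal p.2)).
Qed.

Let cont_q {T : topologicalType} (g : T -> C) x : contc g x -> contc (fun y => q (g y)) x.
Proof. by move=> cg; apply: contD; [apply: contM cg; exact: contC|exact: contC]. Qed.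

Let cont_k t v : 0 <= t <= 1 -> -1 <= v <= 1 -> contc k (t, v).
Proof.
move=> t01 v11; have h1 := hze t01; have h2 := seg_halfplane hz1 h1 v11.
have c1 := cont_ze (t, v); have c2 := cont_segze (t, v).
have cp z : halfplane z -> contc (phi : C^o -> C) z by exact: hol_contc.
rewrite /k /X /=; apply: contM.
  apply: cont_cexp; apply: contD.
    by apply: contM; [exact: contC|apply: (cont_comp (f := phi)) => //; exact: cp].
  apply: contN; apply: contM; [exact: contC|].
  by apply: (cont_comp (f := phi)) => //; exact: cp.
apply: contM.
  apply: contM; first exact: contC.
  apply: contV; last by rewrite /= !mulf_neq0 ?pnatr_eq0 ?q0.
  by apply: contM; [apply: contM; [exact: contC|exact: cont_q]|exact: cont_q].
have cv w : contc (fun p : R * R => (1 + w * p.2)%:C) (t, v).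
  apply: (@cont_snd _ _ _ (fun v => (1 + w * v)%:C) (t, v)).
  apply: contRC; apply: cvgD; first exact: cvg_cst.
  by apply: cvgM; [exact: cvg_cst|exact: cvg_id].
apply: contD.
  apply: contM; first exact: contC.
  by have := cv (-1); under [X in contc X]eq_fun do rewrite mulN1r.
apply: contN; apply: contM; first by apply: contM; [exact: contC|exact: cont_q].
by have := cv 1; under [X in contc X]eq_fun do rewrite mul1r.
Qed.

Let vder_X t v : 0 <= t <= 1 -> -1 <= v <= 1 -> vder (X^~ v) t (k (t, v)).
Proof.
move=> t01 v11; have h1 := hze t01; have h2 := seg_halfplane hz1 h1 v11.
have n1 := q0 h1; have n2 := q0 h2.
rewrite /X; apply: has_slope_eq.
  apply: has_slope_cexp; first exact: contreal.
  apply: has_slopeB; apply: has_slopeZ.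
    apply: (has_slope_comp (contreal t) _ (vder_ze t)); exact: dphi.
  apply: (@has_slope_comp _ _ _ phi (fun t => seg z1 (ze t) v) _ _ ((1 + v)%:C / 2 * (z2 - z1)) (contreal t)).
    exact: dphi.
  by exists (fun=> (1 + v)%:C / 2 * (z2 - z1)); split=> // [|y];
    [exact: contC|rewrite !segE !RMC !RVC natC /ze; ring].
rewrite /k /X /=; congr (_ * _); move: n2; rewrite q_seg => n2.
have n3 : q z1 * (1 - v)%:C + q (ze t) * (1 + v)%:C != 0.
  by apply: contraNneq n2 => ->; rewrite mul0r.
move: n1 n3; move: (q z1) (q (ze t)) (1 - v)%:C (1 + v)%:C => A B u w n1 n3.
by field; rewrite n1 n3.
Qed.

Let pref t := cexp (be * phi (ze t)) * (c * (z2 - z1) / (2 * q (ze t))).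
Let Ev t v := cexp (- (al + be) * phi (seg z1 (ze t) v)).

Let cont_Ev t v : 0 <= t <= 1 -> -1 <= v <= 1 -> contc (Ev t) v.
Proof.
move=> t01 v11; have h2 := seg_halfplane hz1 (hze t01) v11.
apply: cont_cexp; apply: contM; first exact: contC.
apply: (cont_comp (f := phi)); [exact: hol_contc|exact: cont_seg].
Qed.

Let vder_Y t v : 0 <= t <= 1 -> -1 < v < 1 ->
  vder (fun v => pref t * (Ev t v * (cpow (1 - v) al * cpow (1 + v) be))) v
    (k (t, v) * bw al be v).
Proof.
move=> t01 v11; have v11' : -1 <= v <= 1 by lra.
have h1 := hze t01; have h2 := seg_halfplane hz1 h1 v11'.
have n1 := q0 h1; have n2 := q0 h2.
apply: has_slope_eq.
  apply: has_slopeZ; apply: (has_slopeM (contreal v) _ (vder_bw al be v11)).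
  apply: has_slope_cexp; first exact: contreal.
  apply: has_slopeZ; apply: (has_slope_comp (contreal v) _ (vder_seg _ _ _)); exact: dphi.
move=> /=; rewrite bw_mul1// -/(Ev t v) /k /=.
have -> : X t v = cexp (be * phi (ze t)) * Ev t v.
  by rewrite /X /Ev -cexpD mulNr.
rewrite /pref.
have e : c * (ze t - z1) = q (ze t) - q z1 by rewrite /q; ring.
rewrite (_ : c / _ * ((ze t - z1) / 2) = (c * (ze t - z1)) / (2 * q (seg z1 (ze t) v))); last by field.
rewrite {}e; move: n1 n2; rewrite q_seg => n1 n2.
have n3 : q z1 * (1 - v)%:C + q (ze t) * (1 + v)%:C != 0.
  by apply: contraNneq n2 => ->; rewrite mul0r.
have : (1 - v)%:C = 2 - (1 + v)%:C :> C by rewrite RBC RDC; ring.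
move: n1 n3; move: (q z1) (q (ze t)) (1 - v)%:C (1 + v)%:C => A B u w n1 n3 eu.
rewrite {}eu in n3 *; by field; rewrite n1 n3.
Qed.

Let inner0 t : 0 <= t <= 1 -> cint leb `[-1, 1] (fun v => k (t, v) * bw al be v) = 0.
Proof.
move=> t01; have ck v : -1 <= v <= 1 -> contc (fun v => k (t, v)) v.
  by move=> v11; apply: cont_slice1; exact: cont_k.
have lim (u : R) (F : set_system R) (FF : ProperFilter F) : -1 <= u <= 1 ->
    (fun v => v) @ F --> u -> (\forall v \near F, -1 < v < 1) ->
    epow (Re al) (1 - v) * epow (Re be) (1 + v) @[v --> F] --> (0 : R) ->
    nc (pref t * (Ev t v * (cpow (1 - v) al * cpow (1 + v) be))) @[v --> F] --> (0 : R).
  move=> u11 Fu F11 lim0.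
  have l1 : nc (pref t) * nc (Ev t v) @[v --> F] --> nc (pref t) * nc (Ev t u).
    apply: cvgM; first exact: cvg_cst.
    apply: (@cvg_comp _ _ _ (fun v => v) (fun v => nc (Ev t v)) _ _ _ Fu).
    exact: (cvg_nc (nbhs_filter _) (contcE (cont_Ev t01 u11))).
  have L : nc (pref t) * nc (Ev t v) * (epow (Re al) (1 - v) * epow (Re be) (1 + v))
      @[v --> F] --> (0 : R).
    by rewrite -[X in _ --> X](mulr0 (nc (pref t) * nc (Ev t u))); apply: cvgM.
  apply: (cvg_near_eq _ _ L).
  apply: filterS F11 => v /andP[v1 v2] /=.
  rewrite !ncM !epow_cpow ?subr_gt0//; last lra.
  by rewrite !mulrA.
apply: (@cint_improper0 R (-1) 1 _ (fun v => pref t * (Ev t v * (cpow (1 - v) al * cpow (1 + v) be)))); first lra.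
- exact: cintegrable_Mbw.
- by move=> v v11; apply: contM; [apply: ck; lra|exact: cont_bw].
- by move=> v v11; exact: vder_Y.
- apply: (lim (-1)); [lra|exact: cvg_at_right_filter|near=> v; apply/andP; split|].
  + by near: v; exact: nbhs_right_gt.
  + by near: v; apply: nbhs_right_lt; lra.
  + rewrite -[X in _ --> X](mulr0 (epow (Re al) (1 - -1))); apply: cvgM.
      apply: cvg_at_right_filter; apply: cont_epow; first lra.
      by apply: cvgB; [exact: cvg_cst|exact: cvg_id].
    apply: epow_cvg0 => //.
      apply: cvg_at_right_filter; rewrite -[X in _ --> X](subrr (1 : R)).
      by apply: cvgD; [exact: cvg_cst|exact: cvg_id].
    near=> v; suff : -1 < v by lra.
    by near: v; exact: nbhs_right_gt.
- apply: (lim 1); [lra|exact: cvg_at_left_filter|near=> v; apply/andP; split|].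
  + by near: v; apply: nbhs_left_gt; lra.
  + by near: v; exact: nbhs_left_lt.
  + rewrite -[X in _ --> X](mul0r (epow (Re be) (1 + 1))); apply: cvgM.
      apply: epow_cvg0 => //.
        apply: cvg_at_left_filter; rewrite -[X in _ --> X](subrr (1 : R)).
        by apply: cvgB; [exact: cvg_cst|exact: cvg_id].
      near=> v; suff : v < 1 by lra.
      by near: v; exact: nbhs_left_lt.
    apply: cvg_at_left_filter; apply: cont_epow; first lra.
    by apply: cvgD; [exact: cvg_cst|exact: cvg_id].
Unshelve. all: by end_near. Qed.

(** Feynman's parametric formula, for complex exponents and for a branch
    [phi] of the logarithm of an affine function. At the start of the
    homotopy the segment is reduced to the point [z1], and the formula is
    obvious. *)
Lemma feynman :
  cint leb `[-1, 1] (fun v => cexp (- (al + be) * phi (seg z1 z2 v)) * bw al be v) =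
  cexp (- al * phi z1 - be * phi z2) * cint leb `[-1, 1] (bw al be).
Proof.
have kK v : -1 <= v <= 1 -> cint leb `[0, 1] (fun s => k (s, v)) = X 1 v - X 0 v.
  move=> v11; apply: (@cint_derivative R 0 1 (fun s => k (s, v)) (X^~ v)) => //.
    by move=> s s01; apply: cont_slice2; exact: cont_k.
  by move=> s s01; exact: vder_X.
have := fubini_zero_bw a0 b0 cont_k inner0 kK.
have ze1 : ze 1 = z2 by rewrite /ze mul1r addrC subrK.
have ze0 : ze 0 = z1 by rewrite /ze mul0r addr0.
have wi := cintegrable_bw a0 b0.
have mI : measurable (`[-1, 1] : set RM) by exact: measurable_itv.
pose F v := cexp (- (al + be) * phi (seg z1 z2 v)) * bw al be v.
have Fi : cintegrable leb `[-1, 1] F.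
  apply: cintegrable_Mbw => // v v11; have t11 : 0 <= (1 : R) <= 1 by rewrite lexx ler01.
  by have := cont_Ev t11 v11; rewrite /Ev ze1.
have E v : (X 1 v - X 0 v) * bw al be v =
    cexp (be * phi z2) * F v - cexp (- al * phi z1) * bw al be v.
  rewrite /X ze1 ze0 (_ : seg z1 z1 v = z1); last by rewrite /seg; field.
  rewrite mulrBl /F -(mulNr (al + be)) cexpD mulrA; congr (_ - cexp _ * _); ring.
under [X in cint _ _ X = _]eq_fun do rewrite E.
rewrite cintB//; last 2 first.
- exact: cintegrableZ.
- exact: cintegrableZ.
rewrite !cintZ// => /eqP; rewrite subr_eq0 => /eqP e.
apply: (mulfI (cexp_neq0 (be * phi z2))); rewrite -/F e mulrA -cexpD; congr (cexp _ * _); ring.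
Qed.
End Formula.
End Feynman.

(** * Equivariance of the Beta average *)

Section Moments.
Context {R : realType}.
Local Notation C := (R[i]).
Local Notation leb := (@lebesgue_measure R).
Local Notation RM := (measurableTypeR R).
Implicit Types (v : R) (z : C).

Let mI : measurable (`[-1, 1] : set RM).
Proof. exact: measurable_itv. Qed.

Lemma cint_Mbound (W g : R -> C) (eps : R) : cintegrable leb `[-1, 1] W ->
  cintegrable leb `[-1, 1] (fun v => g v * W v) ->
  (forall v, -1 <= v <= 1 -> nc (g v) <= eps) ->
  nc (cint leb `[-1, 1] (fun v => g v * W v)) <=
  eps * \int[leb]_(v in `[-1, 1]) nc (W v).
Proof.
move=> Wi gi ge.
have Wn := cintegrable_nc mI Wi.
rewrite -RintegralZl//.
apply: (nc_cint_bound mI gi (integrableRZ _ mI Wn)) => v /=; rewrite in_itv /= => v11.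
by rewrite ncM ler_wpM2r ?nc_ge0// ge.
Qed.

Section Curve.
Variables (al be c d : C) (phi : C -> C) (z1 z2 : C).
Hypotheses (a0 : 0 < Re al) (b0 : 0 < Re be) (hphi : hol phi).
Hypothesis ephi : forall z, halfplane z -> cexp (phi z) = c * z + d.
Hypotheses (hz1 : halfplane z1) (hz2 : halfplane z2).

Lemma cont_phi_seg (s : C) v : -1 <= v <= 1 ->
  contc (fun v => cexp (- s * phi (seg z1 z2 v))) v.
Proof.
move=> v11; apply: cont_cexp; apply: contM; first exact: contC.
apply: (cont_comp (f := phi)); last exact: cont_seg.
by apply: hol_contc => //; exact: seg_halfplane.
Qed.

(** The binomial theorem shifts the exponents of the Beta weight, and
    Feynman's formula applies to every term: the exponents of the terms add
    up to the same number [al + be + n]. *)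
Lemma feynman_moment n (y1 y2 : C) :
  cint leb `[-1, 1] (fun v => cexp (- (al + be + n%:R) * phi (seg z1 z2 v)) *
    (((1 - v) / 2)%:C * y1 + ((1 + v) / 2)%:C * y2) ^+ n * bw al be v) =
  cexp (- al * phi z1 - be * phi z2) * \sum_(i < n.+1) 'C(n, i)%:R * 2 ^- n *
    (y1 / cexp (phi z1)) ^+ (n - i) * (y2 / cexp (phi z2)) ^+ i *
    cint leb `[-1, 1] (bw (al + (n - i)%:R) (be + i%:R)).
Proof.
pose co (i : nat) : C := 'C(n, i)%:R * 2 ^- n * y1 ^+ (n - i) * y2 ^+ i.
pose F (i : nat) v := cexp (- (al + be + n%:R) * phi (seg z1 z2 v)) *
    bw (al + (n - i)%:R) (be + i%:R) v.
have ar (k : nat) : 0 < Re (al + k%:R).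
  by rewrite ReD -natC /= (lt_le_trans a0)// lerDl.
have br (k : nat) : 0 < Re (be + k%:R).
  by rewrite ReD -natC /= (lt_le_trans b0)// lerDl.
have Fi i : cintegrable leb `[-1, 1] (F i).
  by apply: cintegrable_Mbw => // v; exact: cont_phi_seg.
have Fe i : (i < n.+1)%N -> cint leb `[-1, 1] (F i) =
    cexp (- (al + (n - i)%:R) * phi z1 - (be + i%:R) * phi z2) *
    cint leb `[-1, 1] (bw (al + (n - i)%:R) (be + i%:R)).
  move=> ni; rewrite -(feynman (ar _) (br _) hphi ephi hz1 hz2).
  have -> // : al + (n - i)%:R + (be + i%:R) = al + be + n%:R.
  by rewrite -[in RHS](subnK (ni : (i <= n)%N)) natrD; ring.
pose G v := cexp (- (al + be + n%:R) * phi (seg z1 z2 v)) *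
    (((1 - v) / 2)%:C * y1 + ((1 + v) / 2)%:C * y2) ^+ n * bw al be v.
have cG : contcI (-1) 1 (fun v => cexp (- (al + be + n%:R) * phi (seg z1 z2 v)) *
    (((1 - v) / 2)%:C * y1 + ((1 + v) / 2)%:C * y2) ^+ n).
  move=> v v11; apply: contM; first exact: cont_phi_seg.
  apply: contX; rewrite (_ : (fun v => _) = seg y1 y2); first exact: cont_seg.
  by apply/funext => w; rewrite segE.
have Gi : cintegrable leb `[-1, 1] G by exact: cintegrable_Mbw.
rewrite -/G; have -> : cint leb `[-1, 1] G = cint leb `]-1, 1[ G.
  by apply: cint_oo; apply: cintegrable_ooS.
have SFi : cintegrable leb `[-1, 1] (fun v => \sum_(i < n.+1) co i * F i v).
  by apply: (cintegrable_sum mI (f := fun i v => co i * F i v)) => i _; exact: cintegrableZ.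
have -> : cint leb `]-1, 1[ G = cint leb `]-1, 1[ (fun v => \sum_(i < n.+1) co i * F i v).
  apply: eq_cint => v /=; rewrite in_itv /= => v11.
  rewrite /G exprDn mulr_sumr mulr_suml.
  apply: eq_bigr => i _; have iN : (i <= n)%N by rewrite -ltnS.
  rewrite /F bw_shift// /co !exprMn !RMC !RVC natC !exprMn !exprVn.
  have e : (2 : C) ^- n = 2 ^- (n - i) * 2 ^- i by rewrite -invfM -exprD subnK.
  by rewrite e -mulr_natl; ring.
rewrite -cint_oo; last exact: cintegrable_ooS.
rewrite (cint_sum mI (f := fun i v => co i * F i v)); last by move=> i _; exact: cintegrableZ.
rewrite mulr_sumr; apply: eq_bigr => i _; rewrite cintZ// Fe//.
rewrite /co !exprMn !exprVn -!cexpMn.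
have -> : - (al + (n - i)%:R) * phi z1 - (be + i%:R) * phi z2 =
  (- al * phi z1 - be * phi z2) - (n - i)%:R * phi z1 - i%:R * phi z2 by ring.
by rewrite !(cexpD _ (- _)) !cexpN; ring.
Qed.
End Curve.

Section Mobius.
Variables (al be a b c d : C) (phi : C -> C) (z1 z2 : C).
Hypotheses (a0 : 0 < Re al) (b0 : 0 < Re be) (hphi : hol phi).
Hypothesis ephi : forall z, halfplane z -> cexp (phi z) = c * z + d.
Hypotheses (hz1 : halfplane z1) (hz2 : halfplane z2).
Let M z := (a * z + b) / (c * z + d).
Hypothesis hM : forall z, halfplane z -> halfplane (M z).

Let q0 z : halfplane z -> c * z + d != 0.
Proof. by move=> hz; have [] := cder_log hphi ephi hz. Qed.

Let hol0 : hol (fun=> 0 : C).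
Proof. by move=> z _; exists 0; exact: has_slope_cst. Qed.

(** The moments of both sides are given by [feynman_moment], with the branch
    of the logarithm of [c * z + d] on the left and with the trivial branch
    on the right; they have the same values [M z1 - z0] and [M z2 - z0] of
    the linear forms. *)
Lemma mobius_moment n z0 :
  cint leb `[-1, 1] (fun v => cexp (- (al + be) * phi (seg z1 z2 v)) *
    (M (seg z1 z2 v) - z0) ^+ n * bw al be v) =
  cexp (- al * phi z1 - be * phi z2) *
  cint leb `[-1, 1] (fun v => (seg (M z1) (M z2) v - z0) ^+ n * bw al be v).
Proof.
pose y z := a * z + b - z0 * (c * z + d).
have yq z : halfplane z -> y z / cexp (phi z) = M z - z0.
  by move=> hz; rewrite ephi// /M /y; field; exact: q0.
(* The trivial branch is the logarithm 0 of the constant function 1. *)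
have e0 z : halfplane z -> cexp 0 = 0 * z + 1 :> C.
  by rewrite cexp0 mul0r add0r.
have := feynman_moment a0 b0 hphi ephi hz1 hz2 n (y z1) (y z2).
have := feynman_moment a0 b0 hol0 e0 hz1 hz2 n (M z1 - z0) (M z2 - z0).
rewrite !yq// !mulr0 subrr !cexp0 !divr1 mul1r => <- E.
transitivity (cint leb `[-1, 1] (fun v => cexp (- (al + be + n%:R) * phi (seg z1 z2 v)) *
    (((1 - v) / 2)%:C * y z1 + ((1 + v) / 2)%:C * y z2) ^+ n * bw al be v)).
  apply: eq_cint_itv => v v11; congr (_ * _).
  have hs := seg_halfplane hz1 hz2 v11; rewrite -yq// exprMn exprVn -cexpMn.
  have -> : - (al + be + n%:R) * phi (seg z1 z2 v) =
    - (al + be) * phi (seg z1 z2 v) - n%:R * phi (seg z1 z2 v) by ring.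
  rewrite cexpD cexpN -!mulrA; congr (_ * _); rewrite mulrC; congr (_ * _).
  by congr (_ ^+ _); rewrite /y segE !RMC !RVC natC RBC RDC; field.
rewrite E; congr (_ * _); apply: eq_cint_itv => v v11; congr (_ * _).
rewrite mul1r; congr (_ ^+ _).
by rewrite segE !RMC !RVC natC RBC RDC; field.
Qed.

Let cM v : -1 <= v <= 1 -> contc (fun v => M (seg z1 z2 v)) v.
Proof.
move=> v11; have hs := seg_halfplane hz1 hz2 v11; rewrite /M.
have cs u w : contc (fun v => u * seg z1 z2 v + w) v.
  by apply: contD (contC _ _); apply: contM (contC _ _) _; exact: cont_seg.
by apply: contM; [exact: cs|apply: contV; [exact: cs|exact: q0]].
Qed.

(** Equivariance of the Beta average. It holds for the powers of [z - z0] by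
    [mobius_moment], and the general case follows by approximating [f] by
    polynomials on a disc that contains both the image of the segment and the
    segment between the images of its ends. *)
Lemma mobius_equivariance (f : C -> C) : hol f ->
  cint leb `[-1, 1] (fun v => cexp (- (al + be) * phi (seg z1 z2 v)) *
    f (M (seg z1 z2 v)) * bw al be v) =
  cexp (- al * phi z1 - be * phi z2) *
  cint leb `[-1, 1] (fun v => f (seg (M z1) (M z2) v) * bw al be v).
Proof.
move=> hf.
have h1 : forall v, -1 <= v <= 1 -> halfplane (M (seg z1 z2 v)).
  by move=> v v11; apply: hM; exact: seg_halfplane.
have h2 : forall v, -1 <= v <= 1 -> halfplane (seg (M z1) (M z2) v).
  by move=> v v11; apply: seg_halfplane => //; exact: hM.
have ab : -1 <= 1 :> R by lra.
have c2 : contcI (-1) 1 (seg (M z1) (M z2)) by move=> v _; exact: cont_seg.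
have [m1 [B1 [m10 H1]]] := curve_bounded ab cM h1.
have [m2 [B2 [m20 H2]]] := curve_bounded ab c2 h2.
have m0 : 0 < Num.min m1 m2 by rewrite lt_min m10.
have [z0 [r1 [r [r10 r1r rz Hd]]]] := bounded_in_disc (Num.max B1 B2) m0.
pose W1 v := cexp (- (al + be) * phi (seg z1 z2 v)) * bw al be v.
have W1i : cintegrable leb `[-1, 1] W1.
  by apply: cintegrable_Mbw => // v; exact: cont_phi_seg.
have W2i := cintegrable_bw a0 b0.
pose E := cexp (- al * phi z1 - be * phi z2).
pose K := \int[leb]_(v in `[-1, 1]) nc (W1 v) + nc E * \int[leb]_(v in `[-1, 1]) nc (bw al be v).
have cfg (g : C -> C) (u : R -> C) : hol g -> contcI (-1) 1 u ->
    (forall v, -1 <= v <= 1 -> halfplane (u v)) -> contcI (-1) 1 (fun v => g (u v)).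
  move=> hg cu hu v v11; apply: (cont_comp (f := g)); last exact: cu.
  by apply: hol_contc => //; exact: hu.
have int1 g : hol g -> cintegrable leb `[-1, 1] (fun v => g (M (seg z1 z2 v)) * W1 v).
  move=> hg; have := @cintegrable_Mbw R al be
    (fun v => g (M (seg z1 z2 v)) * cexp (- (al + be) * phi (seg z1 z2 v))) a0 b0.
  move=> H; apply: (cintegrable_eq mI _ (H _)) => [v _|]; first by rewrite /W1 mulrA.
  by move=> v v11; apply: contM; [exact: (cfg _ _ hg cM h1)|exact: cont_phi_seg].
have int2 g : hol g -> cintegrable leb `[-1, 1] (fun v => g (seg (M z1) (M z2) v) * bw al be v).
  by move=> hg; apply: cintegrable_Mbw => //; exact: cfg hg c2 h2.
(* The defect of equivariance is linear in [g], vanishes for polynomials and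
   is bounded by the supremum of [g] on the disc. *)
pose D g := cint leb `[-1, 1] (fun v => g (M (seg z1 z2 v)) * W1 v) -
  E * cint leb `[-1, 1] (fun v => g (seg (M z1) (M z2) v) * bw al be v).
suff : D f = 0.
  move=> /eqP; rewrite subr_eq0 => /eqP <-; apply: eq_cint => v _; rewrite /W1; ring.
have holX n : hol (fun z => (z - z0) ^+ n).
  move=> z _; eexists; apply: has_slopeX; first exact: contid.
  by apply: has_slopeB; [exact: has_slope_id|exact: has_slope_cst].
have DP n (p : nat -> C) : D (fun z => \sum_(k < n) p k * (z - z0) ^+ k) = 0.
  have -> : D (fun z => \sum_(k < n) p k * (z - z0) ^+ k) =
      \sum_(k < n) p k * D (fun z => (z - z0) ^+ k).
    rewrite /D.
    under eq_cint do rewrite mulr_suml; under eq_cint do under eq_bigr do rewrite -mulrA.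
    under [X in _ * X]eq_cint do rewrite mulr_suml.
    under [X in _ * X]eq_cint do under eq_bigr do rewrite -mulrA.
    rewrite (cint_sum mI (f := fun i v => p i * ((M (seg z1 z2 v) - z0) ^+ i * W1 v))); last first.
      by move=> i _; apply: cintegrableZ => //; exact: (int1 _ (holX i)).
    rewrite (cint_sum mI (f := fun i v => p i * ((seg (M z1) (M z2) v - z0) ^+ i * bw al be v))); last first.
      by move=> i _; apply: cintegrableZ => //; exact: (int2 _ (holX i)).
    rewrite mulr_sumr -sumrB; apply: eq_bigr => i _.
    rewrite !cintZ//; [ring|exact: (int2 _ (holX i))|exact: (int1 _ (holX i))].
  rewrite big1// => i _; rewrite /D /E -mobius_moment.
  under [X in X - _]eq_cint do rewrite mulrA [_ * cexp _]mulrC.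
  by rewrite subrr mulr0.
have K0 : 0 <= K.
  rewrite /K addr_ge0 ?mulr_ge0 ?nc_ge0//; apply: Rintegral_ge0 => v _; exact: nc_ge0.
have small (eps : R) : 0 < eps -> nc (D f) <= eps * K.
  move=> e0; have [n [p Hp]] := poly_approx hf (lt_trans r10 r1r) r1r rz (ltW r10) e0.
  pose P z := \sum_(k < n) p k * (z - z0) ^+ k.
  have holP : hol P.
    move=> z hz; rewrite /P; elim: n {Hp P} => [|n [e IH]].
      exists 0; under [X in cder X]eq_fun do rewrite big_ord0; exact: has_slope_cst.
    have [e' He'] := holX n z hz.
    exists (e + p n * e'); under [X in cder X]eq_fun do rewrite big_ord_recr /=.
    by apply: has_slopeD IH _; exact: has_slopeZ.
  have -> : D f = D (fun z => f z - P z).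
    rewrite -[LHS]subr0 -[in LHS](DP n p) -/P /D.
    under [X in _ = X - _]eq_cint do rewrite mulrBl.
    under [X in _ = _ - _ * X]eq_cint do rewrite mulrBl.
    rewrite !cintB//; [ring|exact: int2|exact: int2|exact: int1|exact: int1].
  have holB : hol (fun z => f z - P z).
    by move=> z hz; have [u hu] := hf z hz; have [w hw] := holP z hz;
      exists (u - w); exact: has_slopeB.
  have inD z : Num.min m1 m2 <= Im z -> nc z <= Num.max B1 B2 -> nc (f z - P z) <= eps.
    by move=> i1 i2; apply: Hp; exact: Hd.
  have n1 := cint_Mbound W1i (int1 _ holB) (eps := eps).
  have n2 := cint_Mbound W2i (int2 _ holB) (eps := eps).
  rewrite /D /K mulrDr (le_trans (ncD _ _))// ncN ncM lerD//.
    apply: n1 => v v11; have [i1 i2] := H1 v v11; apply: inD.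
      by rewrite ge_min i1.
    by rewrite le_max i2.
  rewrite mulrCA ler_wpM2l ?nc_ge0//.
  apply: n2 => v v11; have [i1 i2] := H2 v v11; apply: inD.
    by rewrite ge_min i1 orbT.
  by rewrite le_max i2 orbT.
apply/eqP; rewrite -nc_eq0 eq_le nc_ge0 andbT; apply/ler_addgt0Pr => e e0; rewrite add0r.
have K1 : 0 < K + 1 by rewrite ltr_wpDl.
apply: le_trans (small (e / (K + 1)) _) _; first exact: divr_gt0.
by rewrite mulrAC ler_pdivrMr// ler_wpM2l ?ltW// ltrDl.
Qed.
End Mobius.

(** The exponents of the Beta weight add up to [lam3]; the factor [(z1 - z2)
    ^+ l] accounts for the difference between these exponents and [lam1],
    [lam2], since a Moebius transformation divides [z1 - z2] by the
    denominators at [z1] and [z2]. *)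
Lemma Psi_intertwines (lam1 lam2 lam3 : C) (l : nat) (g : SL2cover R) (f : C -> C) p :
  (lam3 - lam1 - lam2) / 2 = l%:R -> 0 < Re (lam1 + l%:R) -> 0 < Re (lam2 + l%:R) ->
  OPi f -> (halfplane `*` halfplane) p ->
  Psi lam1 lam2 l (pi_rep lam3 g f) p = pi_tensor lam1 lam2 g (Psi lam1 lam2 l f) p.
Proof.
move=> hl h1 h2 Of; case: p => z1 z2 [/= hz1 hz2].
set al := lam1 + l%:R in h1 *; set be := lam2 + l%:R in h2 *.
have e3 : lam3 = al + be.
  have : lam3 - lam1 - lam2 = 2 * l%:R by rewrite -hl mulrC divfK// pnatr_eq0.
  by move=> e; rewrite /al /be -[lam3](subrK lam1) -[lam3 - _](subrK lam2) e; ring.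
pose h := (g^-1)%g; pose A := cover_mx h; pose phi := cover_phi h.
have hphi : hol phi by apply: OPi_hol; exact: (@cover_holo _ h).
have ephi z : halfplane z -> cexp (phi z) = mobius_den A z by exact: (@cover_exp _ h).
have dA : \det A = 1 by exact: (cover_det h).
have hM z : halfplane z -> halfplane (mobius A z) by exact: mobius_halfplane.
have := mobius_equivariance h1 h2 hphi ephi hz1 hz2 hM (OPi_hol Of).
rewrite -/(mobius A z1) -/(mobius A z2) => E.
have q1 := mobius_den_neq0 dA hz1; have q2 := mobius_den_neq0 dA hz2.
have eD : mobius A z1 - mobius A z2 = (z1 - z2) / (mobius_den A z1 * mobius_den A z2).
  apply: (mulIf (mulf_neq0 q1 q2)); rewrite divfK ?mulf_neq0//.
  rewrite /mobius; transitivity (((A 0 0)%:C * z1 + (A 0 1)%:C) * mobius_den A z2 -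
    ((A 0 0)%:C * z2 + (A 0 1)%:C) * mobius_den A z1); first by field; rewrite q1 q2.
  rewrite /mobius_den; transitivity ((\det A)%:C * (z1 - z2)); last by rewrite dA mul1r.
  by rewrite det2 RBC !RMC; ring.
rewrite /pi_tensor /Psi /= -/h -/A -/phi !cRintegralE.
rewrite -/A -/phi (_ : cint leb _ _ = cint leb `[-1, 1] (fun v =>
  cexp (- (al + be) * phi (seg z1 z2 v)) * f (mobius A (seg z1 z2 v)) * bw al be v)); last first.
  by apply: eq_cint => v _; rewrite -mulrA -e3.
rewrite [X in _ = _ * (_ * X)](_ : _ = cint leb `[-1, 1] (fun v =>
  f (seg (mobius A z1) (mobius A z2) v) * bw al be v)); last first.
  by apply: eq_cint => v _; rewrite -mulrA.
rewrite E eD expr_div_n exprMn -!ephi// -!cexpMn.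
have -> : - al * phi z1 - be * phi z2 = (- lam1 * phi z1 - lam2 * phi z2) -
  (l%:R * phi z1 + l%:R * phi z2) by rewrite /al /be; ring.
change (cover_inv_phi g) with phi.
rewrite [in LHS](cexpD (- lam1 * phi z1 - lam2 * phi z2) (- _)) cexpN (cexpD (l%:R * phi z1)).
set I := cint _ _ _; set c2 := cpow _ _.
move: (cexp (- lam1 * phi z1 - lam2 * phi z2)) (cexp (l%:R * phi z1)) (cexp (l%:R * phi z2)) => E0 u w.
by rewrite !invfM; ring.
Qed.
End Moments.

(** * Holomorphy of the holographic operator *)

Section PsiHolomorphic.
Context {R : realType}.
Local Notation C := (R[i]).
Local Notation leb := (@lebesgue_measure R).
Local Notation RM := (measurableTypeR R).
Implicit Types (v : R) (z : C).

Section Linear2.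
Variables A B : C.
(** The Frechet derivative of a function of two complex variables, given its
    partial derivatives. *)
Definition lin2 (h : C^o * C^o) : C^o := A * h.1 + B * h.2.
Fact lin2_linear : linear lin2.
Proof.
move=> a [x1 x2] [y1 y2]; rewrite /lin2 /=.
rewrite -[a *: x1]/(a * x1) -[a *: x2]/(a * x2).
rewrite -[a *: (A * x1 + B * x2)]/(a * (A * x1 + B * x2)); ring.
Qed.
HB.instance Definition _ := GRing.isLinear.Build C (C^o * C^o)%type C^o *:%R lin2 lin2_linear.

Lemma lin2_continuous : continuous (lin2 : (C^o * C^o)%type -> C^o).
Proof.
move=> x; apply: (@cvgD _ C^o).
  by apply: cvgM; [exact: cvg_cst|exact: cvg_fst].
by apply: cvgM; [exact: cvg_cst|exact: cvg_snd].
Qed.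

Lemma lin2_differentiable x : differentiable (lin2 : (C^o * C^o)%type -> C^o) x.
Proof. by apply: linear_differentiable; exact: lin2_continuous. Qed.

Lemma prod_nc (h : C^o * C^o) : `|h| = (Num.max (nc h.1) (nc h.2))%:C.
Proof. by rewrite prod_normE !normcE /Order.max ltcR; case: ifP. Qed.

Lemma differentiable_taylor2 (F : C * C -> C) (p : C^o * C^o) (K r : R) : 0 < r -> 0 <= K ->
  (forall h1 h2, nc h1 < r -> nc h2 < r ->
     nc (F (p.1 + h1, p.2 + h2) - F p - (A * h1 + B * h2)) <= K * (nc h1 + nc h2) ^+ 2) ->
  differentiable (F : (C^o * C^o)%type -> C^o) p.
Proof.
move=> r0 K0 H.
pose G : (C^o * C^o)%type -> C^o := F.
have lc := lin2_continuous; have E : G \o shift (p : (C^o * C^o)%type) = cst (G p) + lin2 +o_ (0 : (C^o * C^o)%type) id.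
  apply/eqaddoP => _/posnumP[e].
  have [e1 e10 ee] : exists2 e1 : R, 0 < e1 & e%:num = e1%:C.
    have : 0 < e%:num by []. rewrite ltcE => /andP[/eqP i0 r0'].
    by exists (Re e%:num) => //; apply: eqC => //=; rewrite -i0.
  pose s := Num.min r (e1 / (4 * K + 1)).
  have K1 : 0 < 4 * K + 1 by lra.
  have s0 : 0 < s by rewrite lt_min r0 divr_gt0.
  near=> h.
  have h1 : nc h.1 < s.
    near: h; have /cvgCP/(_ _ s0) : (fun h : C^o * C^o => h.1) @ (0 : C^o * C^o) --> (0 : C^o).
      exact: cvg_fst.
    by apply: filterS => x; rewrite subr0.
  have h2 : nc h.2 < s.
    near: h; have /cvgCP/(_ _ s0) : (fun h : C^o * C^o => h.2) @ (0 : C^o * C^o) --> (0 : C^o).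
      exact: cvg_snd.
    by apply: filterS => x; rewrite subr0.
  have sr : s <= r by rewrite ge_min lexx.
  have := H h.1 h.2 (lt_le_trans h1 sr) (lt_le_trans h2 sr).
  rewrite prod_nc ee -RMC normcE lecR /=.
  have -> : (G \o +%R^~ p - (cst (G p) + lin2)) h =
      F (p.1 + h.1, p.2 + h.2) - F p - (A * h.1 + B * h.2).
    rewrite -[LHS]/(F (h + p) - (F p + (A * h.1 + B * h.2))) opprD addrA.
    have -> // : h + p = (p.1 + h.1, p.2 + h.2).
    by case: (h) (p) => [a b] [c d]; exact: (f_equal2 pair (addrC a c) (addrC b d)).
  move/le_trans; apply.
  set m := Num.max (nc h.1) (nc h.2).
  have m1 : nc h.1 <= m by rewrite le_max lexx.
  have m2 : nc h.2 <= m by rewrite le_max lexx orbT.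
  have ms : m < e1 / (4 * K + 1).
    have se : s <= e1 / (4 * K + 1) by rewrite ge_min lexx orbT.
    by rewrite gt_max !(lt_le_trans _ se).
  have n1 := nc_ge0 h.1; have n2 := nc_ge0 h.2.
  have m0 : 0 <= m by lra.
  have sq : (nc h.1 + nc h.2) ^+ 2 <= (2 * m) ^+ 2 by rewrite ler_pXn2r ?nnegrE//; lra.
  apply: (@le_trans _ _ (K * (2 * m) ^+ 2)); first exact: ler_wpM2l.
  have : m * (4 * K + 1) <= e1 by rewrite -ler_pdivlMr// ltW.
  rewrite exprMn => me; have := ler_wpM2r m0 me; nra.
have D := diff_unique lc E.
apply/diff_locallyP; split; first by rewrite D; exact: lc.
by rewrite D; exact: E.
Unshelve. all: by end_near. Qed.
End Linear2.

Variables (al be : C) (f : C -> C).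
Hypotheses (a0 : 0 < Re al) (b0 : 0 < Re be) (hf : hol f).

Let mI : measurable (`[-1, 1] : set RM).
Proof. exact: measurable_itv. Qed.

Definition beta_average (p : C * C) : C :=
  cint leb `[-1, 1] (fun v => f (seg p.1 p.2 v) * bw al be v).

Lemma cintegrable_average z1 z2 (g : C -> C) : hol g -> halfplane z1 -> halfplane z2 ->
  cintegrable leb `[-1, 1] (fun v => g (seg z1 z2 v) * bw al be v).
Proof.
move=> hg h1 h2; apply: cintegrable_Mbw => // v v11.
apply: (cont_comp (f := g)); last exact: cont_seg.
by apply: hol_contc => //; exact: seg_halfplane.
Qed.

(** Along the segment the first order expansions of [f] have a uniform
    quadratic remainder by [taylor_disc], because the segments with nearby
    end points lie in one disc. *)
Lemma beta_average_holo z1 z2 : halfplane z1 -> halfplane z2 ->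
  differentiable (beta_average : (C^o * C^o)%type -> C^o) (z1 : C^o, z2 : C^o).
Proof.
move=> hz1 hz2; have ab : -1 <= 1 :> R by lra.
have cs : contcI (-1) 1 (seg z1 z2) by move=> v _; exact: cont_seg.
have hs v : -1 <= v <= 1 -> halfplane (seg z1 z2 v) by exact: seg_halfplane.
have [m [B [m0 H]]] := curve_bounded ab cs hs.
have m20 : 0 < m / 2 by lra.
have [z0 [r1 [r [r10 r1r rz Hd]]]] := bounded_in_disc (B + m) m20.
have [K [K0 HK]] := taylor_disc hf (lt_trans r10 r1r) r1r rz.
have wi := cintegrable_bw a0 b0.
pose W := \int[leb]_(v in `[-1, 1]) nc (bw al be v).
have W0 : 0 <= W by apply: Rintegral_ge0 => v _; exact: nc_ge0.
(* The partial derivatives of [f (seg z1 z2 v)] with respect to [z1] and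
   [z2], for [x = -1] and [x = 1]. *)
pose g (x : R) v : C := cd f (seg z1 z2 v) * ((1 + x * v) / 2)%:C.
have gi x : cintegrable leb `[-1, 1] (fun v => g x v * bw al be v).
  apply: cintegrable_Mbw => // v v11; apply: contM.
    apply: (cont_comp (f := cd f)); last exact: cont_seg.
    by apply: cd_contc => //; exact: hs.
  apply: contRC; apply: cvgMl; apply: cvgD; first exact: cvg_cst.
  by apply: cvgM; [exact: cvg_cst|exact: cvg_id].
pose A := cint leb `[-1, 1] (fun v => g (-1) v * bw al be v).
pose A' := cint leb `[-1, 1] (fun v => g 1 v * bw al be v).
have KW : 0 <= K * W by exact: mulr_ge0.
apply: (@differentiable_taylor2 A A' beta_average (z1 : C^o, z2 : C^o) (K * W) (m / 2)) => // h1 h2 n1 n2 /=.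
have im v : -1 <= v <= 1 -> nc (seg h1 h2 v) <= nc h1 + nc h2.
  move=> /andP[v1 v2]; rewrite segE (le_trans (ncD _ _))// !ncM !ncR.
  have := nc_ge0 h1; have := nc_ge0 h2 => p1 p2.
  by rewrite !ger0_norm; nra.
have im2 v : -1 <= v <= 1 -> nc (seg h1 h2 v) <= m / 2.
  move=> /andP[v1 v2]; rewrite segE (le_trans (ncD _ _))// !ncM !ncR.
  have := nc_ge0 h1; have := nc_ge0 h2 => p1 p2.
  by rewrite !ger0_norm; nra.
have hsh v : seg (z1 + h1) (z2 + h2) v = seg z1 z2 v + seg h1 h2 v.
  by rewrite /seg; field.
have ind v : -1 <= v <= 1 ->
    nc (seg z1 z2 v - z0) <= r1 /\ nc (seg (z1 + h1) (z2 + h2) v - z0) <= r1.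
  move=> v11; have [Hm HB] := H v v11; have h2v := im2 v v11; split; apply: Hd; try lra.
    rewrite hsh ImD; have := le_trans (ler_norm _) (ge_nc_Im (- seg h1 h2 v)).
    by rewrite ImN ncN; lra.
  by rewrite hsh (le_trans (ncD _ _))//; lra.
have hz1' : halfplane (z1 + h1).
  have := H (-1) ltac:(lra); have -> : seg z1 z2 (-1) = z1 by rewrite /seg RNC; field.
  move=> [Hm _]; rewrite /halfplane /= ImD.
  by have := le_trans (ler_norm _) (ge_nc_Im (- h1)); rewrite ImN ncN; lra.
have hz2' : halfplane (z2 + h2).
  have := H 1 ltac:(lra); have -> : seg z1 z2 1 = z2 by rewrite /seg; field.
  move=> [Hm _]; rewrite /halfplane /= ImD.
  by have := le_trans (ler_norm _) (ge_nc_Im (- h2)); rewrite ImN ncN; lra.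
pose D v := f (seg (z1 + h1) (z2 + h2) v) - f (seg z1 z2 v) - cd f (seg z1 z2 v) * seg h1 h2 v.
have i1 := cintegrable_average hf hz1' hz2'; have i2 := cintegrable_average hf hz1 hz2.
have i3 : cintegrable leb `[-1, 1] (fun v => g (-1) v * bw al be v * h1 + g 1 v * bw al be v * h2).
  apply: cintegrableD => //.
    by apply: (cintegrable_eq mI _ (cintegrableZ mI h1 (gi (-1)))) => v _; rewrite mulrC.
  by apply: (cintegrable_eq mI _ (cintegrableZ mI h2 (gi 1))) => v _; rewrite mulrC.
have DE v : D v * bw al be v = f (seg (z1 + h1) (z2 + h2) v) * bw al be v -
    f (seg z1 z2 v) * bw al be v - (g (-1) v * bw al be v * h1 + g 1 v * bw al be v * h2).
  rewrite /D /g (segE h1 h2) !mul1r !mulN1r; move: ((1 - v) / 2)%:C ((1 + v) / 2)%:C => x y; ring.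
have Di : cintegrable leb `[-1, 1] (fun v => D v * bw al be v).
  have i4 := cintegrableB mI (cintegrableB mI i1 i2) i3.
  by apply: (cintegrable_eq mI _ i4) => v _; rewrite DE.
have E : beta_average (z1 + h1, z2 + h2) - beta_average (z1, z2) - (A * h1 + A' * h2) =
    cint leb `[-1, 1] (fun v => D v * bw al be v).
  transitivity (cint leb `[-1, 1] (fun v => f (seg (z1 + h1) (z2 + h2) v) * bw al be v -
    f (seg z1 z2 v) * bw al be v - (g (-1) v * bw al be v * h1 + g 1 v * bw al be v * h2))).
    rewrite cintB//; last exact: cintegrableB.
    rewrite cintB// cintD ?cintZr//.
      by apply: (cintegrable_eq mI _ (cintegrableZ mI h1 (gi (-1)))) => v _; rewrite mulrC.
    by apply: (cintegrable_eq mI _ (cintegrableZ mI h2 (gi 1))) => v _; rewrite mulrC.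
  by apply: eq_cint => v _; rewrite DE.
rewrite E mulrAC; apply: (cint_Mbound wi Di) => v v11.
have [d1 d2] := ind v v11; have := HK _ _ d1 d2.
have e : seg (z1 + h1) (z2 + h2) v - seg z1 z2 v = seg h1 h2 v.
  by rewrite hsh [_ + seg h1 h2 v]addrC addrK.
rewrite e => /le_trans; apply.
by rewrite ler_wpM2l// ler_pXn2r ?nnegrE ?nc_ge0 ?addr_ge0 ?nc_ge0//; exact: im.
Qed.
End PsiHolomorphic.

Section PsiMap.
Context {R : realType}.
Local Notation C := (R[i]).
Local Notation leb := (@lebesgue_measure R).
Local Notation RM := (measurableTypeR R).
Variables (lam1 lam2 : C) (l : nat).
Hypotheses (h1 : 0 < Re (lam1 + l%:R)) (h2 : 0 < Re (lam2 + l%:R)).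

Definition Psi_cst : C := (cpow 2 (lam1 + lam2 + (2 * l)%:R - 1) * l`!%:R)^-1.

Lemma PsiE f p : Psi lam1 lam2 l f p =
  (p.1 - p.2) ^+ l * (Psi_cst * beta_average (lam1 + l%:R) (lam2 + l%:R) f p).
Proof.
rewrite /Psi cRintegralE /Psi_cst mulrA; congr (_ * _).
by apply: eq_cint => v _; rewrite -mulrA.
Qed.

Lemma Psi_OPiPi f : OPi f -> OPiPi (Psi lam1 lam2 l f).
Proof.
move=> Of [z1 z2] [/= hz1 hz2].
have -> : Psi lam1 lam2 l f = fun p => (p.1 - p.2) ^+ l * (Psi_cst *
    beta_average (lam1 + l%:R) (lam2 + l%:R) f p) by apply/funext => p; exact: PsiE.
pose P := (C^o * C^o)%type.
have dB : differentiable ((fun p : P => p.1 - p.2) : P -> C^o) ((z1, z2) : P).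
  have := @lin2_differentiable R 1 (-1) (z1, z2).
  by rewrite (_ : (lin2 1 (-1) : _ -> _) = fun p : P => p.1 - p.2)//;
    apply/funext => p; rewrite /lin2 mul1r mulN1r.
apply: (@differentiableM _ P (fun p : P => (p.1 - p.2) ^+ l) _).
  elim: (l) => [|n IH]; first exact: (@differentiable_cst _ P C^o).
  have -> : (fun p : P => (p.1 - p.2) ^+ n.+1 : C^o) = fun p : P => (p.1 - p.2) * (p.1 - p.2) ^+ n.
    by apply/funext => p; rewrite exprS.
  by apply: (@differentiableM _ P (fun p : P => p.1 - p.2) _).
apply: (@differentiableM _ P (fun=> Psi_cst) _); first exact: (@differentiable_cst _ P C^o).
exact: beta_average_holo h1 h2 (OPi_hol Of) _ _ hz1 hz2.
Qed.

Lemma Psi_linear (a : C) f g p : OPi f -> OPi g -> (halfplane `*` halfplane) p ->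
  Psi lam1 lam2 l (fun z => a * f z + g z) p =
  a * Psi lam1 lam2 l f p + Psi lam1 lam2 l g p.
Proof.
case: p => z1 z2 Of Og [/= hz1 hz2]; rewrite !PsiE /=.
have mI : measurable (`[-1, 1] : set RM) by exact: measurable_itv.
have i1 := cintegrable_average h1 h2 (OPi_hol Of) hz1 hz2.
have i2 := cintegrable_average h1 h2 (OPi_hol Og) hz1 hz2.
have -> : beta_average (lam1 + l%:R) (lam2 + l%:R) (fun z => a * f z + g z) (z1, z2) =
  a * beta_average (lam1 + l%:R) (lam2 + l%:R) f (z1, z2) +
  beta_average (lam1 + l%:R) (lam2 + l%:R) g (z1, z2).
  rewrite /beta_average -cintZ// -cintD//; last exact: cintegrableZ.
  by apply: eq_cint => v _; rewrite mulrDl mulrA.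
ring.
Qed.
End PsiMap.

(** * Logarithm and kernels on the half-plane *)

Section Logarithm.
Context {R : realType}.
Local Notation C := (R[i]).
Implicit Types (z w : C) (s t : R).

(** A logarithm of [-'i * z] on the half-plane; the argument of [-'i * z] is
    minus the angle between the imaginary axis and [z]. *)
Definition clog z : C := (ln (nc z)) +i* (- atan (Re z / Im z)).

Lemma hp_nc z : halfplane z -> 0 < nc z.
Proof.
rewrite /halfplane /= nc_gt0 => hz; apply: contraTneq hz => ->.
by rewrite ltxx.
Qed.

Lemma cexp_clog z : halfplane z -> cexp (clog z) = - 'i * z.
Proof.
move=> hz; have y0 : 0 < Im z by []. have n0 := hp_nc hz.
have sq : Num.sqrt (1 + (Re z / Im z) ^+ 2) = nc z / Im z.
  have -> : 1 + (Re z / Im z) ^+ 2 = (nc z / Im z) ^+ 2.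
    by rewrite !expr_div_n sqr_nc; field; exact: lt0r_neq0.
  by rewrite sqrtr_sqr ger0_norm// divr_ge0 ?ltW.
have co : cos (atan (Re z / Im z)) = Im z / nc z.
  by rewrite cos_atan sq invf_div.
have si : sin (atan (Re z / Im z)) = Re z / nc z.
  have := atanK (Re z / Im z); rewrite /tan co => e.
  have d0 : Im z / nc z != 0 by rewrite mulf_neq0 ?invr_neq0 ?lt0r_neq0.
  by rewrite -[LHS](divfK d0) e; field; rewrite !lt0r_neq0.
rewrite /cexp /clog /= cosN sinN co si lnK//.
have -> : - 'i * z = Im z +i* (- Re z) by case: (z) => a b; apply: eqC => /=; ring.
by congr (_ +i* _); field; exact: lt0r_neq0.
Qed.

Lemma cont_clog z : halfplane z -> contc (clog : C^o -> C) z.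
Proof.
move=> hz; have y0 : 0 < Im z by [].
have ci : (id : C^o -> C^o) @ (z : C^o) --> (z : C^o) by exact: cvg_id.
have cr := @cvg_Re R _ _ (nbhs_filter (z : C^o)) _ _ ci.
have cim := @cvg_Im R _ _ (nbhs_filter (z : C^o)) _ _ ci.
have cn := @cvg_nc R _ _ (nbhs_filter (z : C^o)) _ _ ci.
apply: Contc; apply: (cvg_cplx (nbhs_filter _)) => /=.
  by apply: (@cvg_comp _ _ _ (fun w : C^o => nc w) (@ln R) _ _ _ cn); apply: continuous_ln; exact: hp_nc.
apply: cvgN; apply: (@cvg_comp _ _ _ (fun w : C^o => Re w / Im w) (@atan R)); last exact: continuous_atan.
by apply: cvgM; [exact: cr|apply: cvgV; [exact: lt0r_neq0|exact: cim]].
Qed.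

Lemma hp_near z w : halfplane z -> nc (w - z) < Im z -> halfplane w.
Proof.
rewrite /halfplane /= => hz; rewrite ncB => wz.
have := le_trans (ler_norm _) (ge_nc_Im (z - w)); rewrite ImB; lra.
Qed.

(** A continuous right inverse of the exponential is differentiable: the
    slope of [clog] is the inverse of the slope of the exponential between
    the values of [clog]. *)
Lemma hol_clog : hol clog.
Proof.
move=> z hz; have y0 : 0 < Im z by [].
have [p [cp pd pE]] := cexp_cder (clog z).
exists (- 'i / p (clog z)).
pose q w : C := if 0 < Im w then - 'i / p (clog w) else 0.
(* Outside the half-plane [clog] has no prescribed slope; it is replaced by a
   constant there. *)
apply: (@cder_near R (fun w => if 0 < Im w then clog w else clog z) _ _ _ (Im z)) => //.
  by move=> w /(hp_near hz); rewrite /halfplane /= => ->.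
have p0 w : halfplane w -> p (clog w) != 0.
  move=> hw; apply/eqP => e; have := pE (clog w); rewrite e mul0r => /eqP.
  rewrite subr_eq0 !cexp_clog// => /eqP/mulfI ew.
  have /ew wz : - 'i != 0 :> C by rewrite oppr_eq0 neq0Ci.
  by move: e; rewrite wz pd; apply/eqP; exact: cexp_neq0.
exists (fun w => if 0 < Im w then - 'i / p (clog w) else (clog z - clog z) / (w - z)); split => [||w].
- have : contc ((fun w => - 'i / p (clog w)) : C^o -> C) z.
    apply: contM; first exact: contC.
    apply: contV; last exact: p0.
    by apply: (cont_comp (f := p)) => //; exact: cont_clog.
  move=> [cq]; apply: Contc; rewrite y0; apply: cvg_trans cq; apply: near_eq_cvg.
    exact: nbhs_filter.
  apply: (@nearC _ _ (Im z)) => // w /(hp_near hz); rewrite /halfplane /= => -> //.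
- by rewrite y0.
- rewrite y0; case: ifPn => [hw|hw]; last by rewrite !subrr mul0r mul0r.
  apply: (mulfI (p0 _ hw)); rewrite -pE !cexp_clog//.
  by field; exact: p0.
Qed.

Lemma clog_herm z : clog (- z^*) = (clog z)^*.
Proof.
rewrite /clog ncN nc_conj; apply: eqC => //=.
by rewrite opprK; case: z => a b /=; rewrite opprK mulNr atanN opprK.
Qed.
End Logarithm.

Section Kernel.
Context {R : realType}.
Local Notation C := (R[i]).
Implicit Types (z w : C) (s t : R).

(** The power of exponent [- s] of [-'i] times [z - w^*]. Up to a constant it
    is the reproducing kernel at [w] of the weighted Bergman space of
    parameter [s]. *)
Definition ker s w z : C := cexp (- s%:C * clog (z - w^*)).

Lemma hpB z w : halfplane z -> halfplane w -> halfplane (z - w^*).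
Proof.
by rewrite /halfplane /= ImB => hz hw; case: w hw => a b /= hw; rewrite opprK addr_gt0.
Qed.

Lemma ker_neq0 s w z : ker s w z != 0.
Proof. exact: cexp_neq0. Qed.

Lemma kerD s t w z : ker (s + t) w z = ker s w z * ker t w z.
Proof. by rewrite /ker -cexpD RDC; congr cexp; ring. Qed.

Lemma ker1 w z : halfplane z -> halfplane w -> ker 1 w z = (- 'i * (z - w^*))^-1.
Proof. by move=> hz hw; rewrite /ker mulN1r cexpN cexp_clog//; exact: hpB. Qed.

Lemma nc_ker s w z : nc (ker s w z) = epow (- s) (nc (z - w^*)).
Proof. by rewrite /ker nc_cexp ReM /= oppr0 mul0r subr0. Qed.

Lemma ker_herm s w z : (ker s w z)^* = ker s z w.
Proof.
rewrite /ker -cexp_conj; congr cexp.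
have conjM (a b : C) : (a * b)^* = a^* * b^* by exact: rmorphM.
have -> : w - z^* = - (z - w^*)^* by case: w z => a b [e d]; apply: eqC => /=; ring.
by rewrite conjM clog_herm; congr (_ * _); apply: eqC => //=; rewrite !oppr0.
Qed.

Lemma ker_diag s w : halfplane w -> ker s w w = (epow (- s) (2 * Im w))%:C.
Proof.
rewrite /halfplane /= => hw; have -> : ker s w w = (nc (ker s w w))%:C.
  have e := ker_herm s w w; have i0 : Im (ker s w w) = 0.
    by move: e; case: (ker s w w) => a b [/=] /eqP; rewrite eqNr => /eqP.
  have r0 : 0 <= Re (ker s w w).
    have e0 : Re (w - w^*) = 0 by case: (w) => a b /=; rewrite subrr.
    have e1 : Im (- s%:C * clog (w - w^*)) = 0.
      by rewrite ImM /clog [Im (_ +i* _)]/= e0 mul0r atan0 /= !oppr0 mulr0 mul0r addr0.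
    by rewrite /ker /cexp e1 cos0 sin0 /= mulr1 expR_ge0.
  rewrite [LHS](_ : _ = (Re (ker s w w))%:C); last exact: eqC.
  by rewrite ncE i0 expr0n addr0 sqrtr_sqr ger0_norm.
rewrite nc_ker; congr (epow _ _)%:C.
have -> : w - w^* = 'i * (2 * Im w)%:C by case: (w) => a b; apply: eqC => /=; ring.
by rewrite ncM nci mul1r ncR ger0_norm// mulr_ge0// ltW.
Qed.

Lemma cder_ker s w z : halfplane z -> halfplane w ->
  cder (ker s w) z ('i * s%:C * ker (s + 1) w z).
Proof.
move=> hz hw; have hzw := hpB hz hw.
have [n0 dl] := cder_log (c := - 'i) (d := 0) hol_clog ltac:(by move=> u hu; rewrite addr0 cexp_clog) hzw.
apply: has_slope_eq.
  apply: has_slope_cexp; first exact: contid.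
  apply: has_slopeZ; apply: (@has_slope_comp R C^o id clog (fun z => z - w^*) z _ 1 (contid z) dl).
  by rewrite -(subr0 1); apply: has_slopeB; [exact: has_slope_id|exact: has_slope_cst].
rewrite -/(ker s w z) kerD ker1//; move: n0; rewrite !addr0; set u := - 'i * _ => n0.
by rewrite mulr1 mulrA; ring.
Qed.

Lemma hol_ker s w : halfplane w -> hol (ker s w).
Proof. by move=> hw z hz; eexists; exact: cder_ker. Qed.
End Kernel.

(** * Square integrability of the kernels *)

Section RealPowers.
Context {R : realType}.
Implicit Types (s x y : R).

Lemma epowD s t x : epow (s + t) x = epow s x * epow t x.
Proof. by rewrite /epow mulrDl expRD. Qed.

Lemma epowM s x y : 0 < x -> 0 < y -> epow s (x * y) = epow s x * epow s y.
Proof. by move=> x0 y0; rewrite /epow lnM ?posrE// mulrDr expRD. Qed.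

Lemma epow1 x : 0 < x -> epow 1 x = x.
Proof. by move=> x0; rewrite /epow mul1r lnK. Qed.

Lemma epow0 x : epow 0 x = 1.
Proof. by rewrite /epow mul0r expR0. Qed.

Lemma epowN s x : epow (- s) x = (epow s x)^-1.
Proof. by rewrite /epow mulNr expRN. Qed.

Lemma ler_epow s x y : 0 <= s -> 0 < x -> x <= y -> epow s x <= epow s y.
Proof.
move=> s0 x0 xy; rewrite ler_expR ler_wpM2l// ler_ln// posrE//.
exact: lt_le_trans xy.
Qed.

Lemma ler_epowN s x y : 0 <= s -> 0 < x -> x <= y -> epow (- s) y <= epow (- s) x.
Proof.
move=> s0 x0 xy; rewrite !epowN lef_pV2 ?posrE ?epow_gt0//.
exact: ler_epow.
Qed.

Lemma ler_epowe s t x : s <= t -> 1 <= x -> epow s x <= epow t x.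
Proof. by move=> st x1; rewrite ler_expR ler_wpM2r// ln_ge0. Qed.
End RealPowers.

Section RealCurves.
Context {R : realType}.
Implicit Types (f g : R -> R) (x : R).

Lemma vderMR f g x df dg : vder (fun t => (f t)%:C) x df%:C ->
  vder (fun t => (g t)%:C) x dg%:C ->
  vder (fun t => (f t * g t)%:C) x (df * g x + f x * dg)%:C.
Proof.
move=> hf hg; rewrite (_ : (fun t => _) = fun t => (f t)%:C * (g t)%:C); last first.
  by apply/funext => t; rewrite RMC.
by apply: has_slope_eq (has_slopeM (contreal x) hf hg) _; rewrite RDC !RMC.
Qed.

Lemma vderDR f g x df dg : vder (fun t => (f t)%:C) x df%:C ->
  vder (fun t => (g t)%:C) x dg%:C -> vder (fun t => (f t + g t)%:C) x (df + dg)%:C.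
Proof.
move=> hf hg; rewrite (_ : (fun t => _) = fun t => (f t)%:C + (g t)%:C); last first.
  by apply/funext => t; rewrite RDC.
by apply: has_slope_eq (has_slopeD hf hg) _; rewrite RDC.
Qed.

Lemma vder_cstR (c x : R) : vder (fun=> c%:C) x 0%:C.
Proof. exact: has_slope_cst. Qed.

Lemma vder_idR x : vder (fun t : R => t%:C) x 1%:C.
Proof. exact: has_slope_id. Qed.

Lemma vder_eqR (f : R -> R) x (d d' : R) : vder (fun t => (f t)%:C) x d%:C -> d = d' ->
  vder (fun t => (f t)%:C) x d'%:C.
Proof. by move=> h <-. Qed.
End RealCurves.

Section Integrability.
Context {R : realType}.
Local Notation C := (R[i]).
Local Notation leb := (@lebesgue_measure R).
Local Notation RM := (measurableTypeR R).

Lemma integrable_cauchy : leb.-integrable (setT : set RM) (EFin \o (fun x : R => (1 + x ^+ 2)^-1)).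
Proof.
apply: (@integrable_bounded_primitive R setT _ (@atan R) (fun n => - n%:R) (fun n => n%:R) pi).
- by move=> n; rewrite lerN10 lexx || (have := ler0n R n; lra).
- by move=> m n mn; have : (m%:R : R) <= n%:R; [rewrite ler_nat|lra].
- apply/seteqP; split=> // x _; have [n xn] : exists n : nat, `|x| < n%:R.
    by exists (Num.truncn `|x|).+1; rewrite truncnS_gt.
  by exists n => //=; rewrite in_itv /= -ler_norml ltW.
- move=> x _; apply: cvgV; first by rewrite gt_eqF// ltr_wpDr// sqr_ge0.
  by apply: cvgD; [exact: cvg_cst|apply: (@cvgM _ _ _ _ id id); exact: cvg_id].
- by move=> x _; apply: is_derive_vder; exact: is_derive1_atan.
- by move=> x _; rewrite invr_ge0 addr_ge0// sqr_ge0.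
- move=> x _; have := atan_ltpi2 x; have := atan_gtNpi2 x; have := pi_gt0 R.
  by rewrite ler_norml => *; apply/andP; split; lra.
Qed.

(** The function has an elementary primitive [G] that is bounded on the
    half-line. *)
Lemma integrable_vertical (lam : R) : 1 < lam -> leb.-integrable (`]0, +oo[ : set RM)
  (EFin \o (fun y : R => (1 + epow (lam - 2) y) * epow (- lam) (1 + y))).
Proof.
move=> l1.
pose G (y : R) := (lam - 1)^-1 * ((epow (lam - 1) y - 1) * epow (1 - lam) (1 + y)).
have gt1 (y : R) : 0 < y -> 0 < 1 + y by lra.
apply: (@integrable_bounded_primitive R _ _ G (fun n => n.+1%:R^-1) (fun n => n.+1%:R) (2 / (lam - 1))).
- move=> n; apply: (@le_trans _ _ 1); last by rewrite ler1n.
  by rewrite invf_le1 ?ler1n// ltr0n.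
- by move=> m n mn; rewrite lef_pV2 ?posrE ?ltr0n// !ler_nat !ltnS.
- apply/seteqP; split=> y /=.
    rewrite in_itv /= andbT => y0.
    have [n yn] : exists n : nat, y + y^-1 < n%:R.
      by exists (Num.truncn (y + y^-1)).+1; rewrite truncnS_gt.
    exists n => //=; rewrite in_itv /=.
    have iy0 : 0 < y^-1 by rewrite invr_gt0.
    have nS : (n%:R : R) <= n.+1%:R by rewrite ler_nat.
    apply/andP; split; last lra.
    by rewrite -[y]invrK lef_pV2 ?posrE ?ltr0n//; lra.
  move=> [n _] /=; rewrite !in_itv /= andbT => /andP[y1 _].
  by rewrite (lt_le_trans _ y1)// invr_gt0 ltr0n.
- move=> y; rewrite /= in_itv /= andbT => y0; apply: cvgM.
    by apply: cvgD; [exact: cvg_cst|apply: cont_epow => //; exact: cvg_id].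
  apply: cont_epow; first exact: gt1.
  by apply: cvgD; [exact: cvg_cst|exact: cvg_id].
- move=> y; rewrite /= in_itv /= andbT => y0; have y1 := gt1 _ y0.
  have d1 := vder_epow (lam - 1) y0 (vder_idR y).
  have d2 := vder_epow (1 - lam) y1 (vder_1D y).
  apply: (vder_eqR (vderZR _ (vderMR (vderDR d1 (vder_cstR (-1) y)) d2))).
  have -> : lam - 1 - 1 = lam - 2 by ring.
  have -> : 1 - lam - 1 = - lam by ring.
  have -> : epow (lam - 1) y = epow (lam - 2) y * y.
    by rewrite (_ : lam - 1 = lam - 2 + 1); [rewrite epowD epow1|ring].
  have -> : epow (1 - lam) (1 + y) = epow (- lam) (1 + y) * (1 + y).
    by rewrite (_ : 1 - lam = - lam + 1); [rewrite epowD epow1|ring].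
  by field; rewrite subr_eq0 gt_eqF.
- by move=> y _; rewrite mulr_ge0 ?addr_ge0 ?ltW ?epow_gt0.
- move=> y; rewrite /= in_itv /= andbT => y0; have y1 := gt1 _ y0.
  have l0 : 0 < lam - 1 by lra.
  have i0 : 0 <= (lam - 1)^-1 by rewrite invr_ge0 ltW.
  rewrite normrM (ger0_norm i0) [leRHS]mulrC ler_pM2l ?invr_gt0//.
  have e1 : epow (lam - 1) y * epow (1 - lam) (1 + y) <= 1.
    rewrite -(opprB lam) epowN ler_pdivrMr ?epow_gt0// mul1r ler_epow//; lra.
  have e2 : epow (1 - lam) (1 + y) <= 1.
    by rewrite -[leRHS](epow0 (1 + y)) ler_epowe; lra.
  have p1 := epow_gt0 (lam - 1) y; have p2 := epow_gt0 (1 - lam) (1 + y).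
  rewrite mulrBl mul1r (le_trans (ler_normB _ _))// !gtr0_norm ?mulr_gt0//; lra.
Qed.

Local Notation leb2 := (leb \x leb)%E.

Lemma upperE : (upper : set (RM * RM)) = (setT : set RM) `*` `]0, +oo[%classic.
Proof.
by apply/seteqP; split=> -[x y] /=; rewrite /upper /= in_itv /= andbT; [move=> ?; split|case].
Qed.

Lemma measurable_upper : measurable (upper : set (RM * RM)).
Proof. by rewrite upperE; apply: measurableX => //; exact: measurable_itv. Qed.

Lemma toC_halfplane (p : R * R) : upper p -> halfplane (toC p).
Proof. by []. Qed.

Lemma cont_toC (p : R * R) : contc (toC : R * R -> C) p.
Proof. by apply: Contc; apply: (cvg_cplx (nbhs_filter _)) => /=; [exact: cvg_fst|exact: cvg_snd]. Qed.

Lemma weightE lam (p : R * R) : upper p -> weight lam p = epow (lam - 2) p.2.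
Proof. by rewrite /upper /weight /powR /= => p0; rewrite gt_eqF. Qed.

Lemma weight_ge0 lam (p : R * R) : 0 <= weight lam p.
Proof. exact: powR_ge0. Qed.

Lemma measurable_weight lam : measurable_fun (upper : set (RM * RM)) (weight lam : RM * RM -> R).
Proof.
apply: (@eq_measurable_fun _ _ _ _ _ (fun p : RM * RM => epow (lam - 2) p.2)).
  by move=> p /set_mem up; rewrite weightE.
apply: measurable_cont2 => [|[x y] xy]; first exact: measurable_upper.
apply: (@cvg_comp _ _ _ (snd : R * R -> R) (epow (lam - 2))); first exact: cvg_snd.
by apply: cont_epow => //; exact: cvg_id.
Qed.

Lemma cmeasurable_hol (f : C -> C) : hol f ->
  cmeasurable (upper : set (RM * RM)) (fun p => f (toC p)).
Proof.
move=> hf; have cf (p : R * R) : upper p -> contc (fun p => f (toC p)) p.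
  move=> up; apply: (cont_comp (f := f)); last exact: cont_toC.
  by apply: hol_contc => //; exact: toC_halfplane.
by split; apply: measurable_cont2 (measurable_upper) _ => p /cf; [exact: contc_Re|exact: contc_Im].
Qed.

Lemma halfplane_i : halfplane ('i : C).
Proof. by rewrite /halfplane /=. Qed.

(** The quotient of the moduli of [z - 'i^*] and [z - w^*] is bounded on the
    half-plane, which makes kernels at different points comparable; the
    additional exponent [s - lam] costs a constant because [z - w^*] is
    bounded away from 0. *)
Lemma nc_ker_le (lam s : R) (w : C) : 0 <= lam <= s -> halfplane w ->
  exists K : R, 0 <= K /\ forall z, halfplane z -> nc (ker s w z) <= K * nc (ker lam 'i z).
Proof.
move=> /andP[l0 ls] hw; have iw : 0 < Im w by [].
pose c := Im w / (Im w + nc (w - 'i)).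
have n0 := nc_ge0 (w - 'i).
have c0 : 0 < c by rewrite divr_gt0//; lra.
exists (epow (lam - s) (Im w) * epow (- lam) c); split.
  by rewrite mulr_ge0 ?ltW ?epow_gt0.
move=> z hz; have iz : 0 < Im z by [].
have wI : Im (z - w^*) = Im z + Im w by rewrite ImB; case: (w) => a b /=; rewrite opprK.
have nI : Im w <= nc (z - w^*).
  by have := le_trans (ler_norm _) (ge_nc_Im (z - w^*)); rewrite wI; lra.
have nw0 : 0 < nc (z - w^*) by lra.
have ni0 : 0 < nc (z - 'i^*) by apply: hp_nc; apply: hpB => //; exact: halfplane_i.
rewrite !nc_ker.
have -> : epow (- s) (nc (z - w^*)) = epow (lam - s) (nc (z - w^*)) * epow (- lam) (nc (z - w^*)).
  by rewrite -epowD (_ : lam - s - lam = - s)//; ring.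
apply: (@le_trans _ _ (epow (lam - s) (Im w) * epow (- lam) (c * nc (z - 'i^*)))); last first.
  by rewrite (epowM _ c0 ni0) mulrA.
apply: ler_pM; [exact: ltW (epow_gt0 _ _)|exact: ltW (epow_gt0 _ _)| |].
  by rewrite -(opprB s) ler_epowN ?subr_ge0.
apply: ler_epowN => //; first exact: mulr_gt0.
rewrite /c mulrAC ler_pdivrMr; last lra.
have tri : nc (z - 'i^*) <= nc (z - w^*) + nc (w - 'i).
  rewrite -(nc_conj (w - 'i)); apply: le_trans (ncD _ _); rewrite le_eqVlt; apply/orP; left.
  by apply/eqP; congr nc; case: (z) (w) => a b [e d]; apply: eqC => /=; ring.
nra.
Qed.

(** The squared modulus of the kernel is the power [- lam] of [x ^+ 2 + (1 +
    y) ^+ 2]. A factor of exponent -1 is used for the integrability in [x],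
    and the remaining exponent [1 - lam] for that in [y]. *)
Lemma integrable_ker_i (lam : R) : 1 < lam ->
  leb2.-integrable (upper : set (RM * RM))
    (EFin \o (fun p => nc (ker lam 'i (toC p)) ^+ 2 * weight lam p)).
Proof.
move=> l1; have mU := measurable_upper.
have hi := halfplane_i; have hk := hol_ker lam hi.
apply: (@integrableR_le _ _ _ leb2 _ _ (fun p : RM * RM => (1 + p.1 ^+ 2)^-1 *
    (2 * ((1 + epow (lam - 2) p.2) * epow (- lam) (1 + p.2))))) => //.
- apply: measurable_funM; last exact: measurable_weight.
  by apply: measurable_funX; apply: measurable_nc; exact: cmeasurable_hol.
- rewrite upperE; apply: (@integrableX _ _ _ _ _ leb leb _ _ measurableT _ (fun x : R => (1 + x ^+ 2)^-1)
    (fun y : R => 2 * ((1 + epow (lam - 2) y) * epow (- lam) (1 + y)))).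
  + exact: measurable_itv.
  + exact: integrable_cauchy.
  + by apply: integrableRZ; [exact: measurable_itv|exact: integrable_vertical].
move=> [x y] xy; rewrite ger0_norm; last by rewrite mulr_ge0 ?weight_ge0 ?sqr_ge0.
rewrite weightE// nc_ker [(x, y).2]/= [(x, y).1]/=; have y0 : 0 < y by [].
set n := nc _; have n0 : 0 < n by apply: hp_nc; apply: hpB; first exact: (toC_halfplane xy).
have nE : n ^+ 2 = x ^+ 2 + (1 + y) ^+ 2 by rewrite /n sqr_nc /=; ring.
have nn : 0 < n ^+ 2 by rewrite exprn_gt0.
have -> : epow (- lam) n ^+ 2 = epow (- 1) (n ^+ 2) * epow (1 - lam) (n ^+ 2).
  rewrite -epowD (_ : -1 + (1 - lam) = - lam); last by ring.
  by rewrite [in RHS]expr2 (epowM _ n0 n0) -expr2.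
rewrite -mulrA; apply: ler_pM.
- by rewrite ltW ?epow_gt0.
- by rewrite mulr_ge0 ?ltW ?epow_gt0.
- rewrite epowN epow1// lef_pV2 ?posrE ?ltr_wpDr ?sqr_ge0// nE.
  have : 1 <= (1 + y) ^+ 2 by apply: exprn_ege1; lra.
  lra.
have y1 : 0 < 1 + y by lra.
have m1 : epow (1 - lam) (n ^+ 2) <= epow (1 - lam) (1 + y) * epow (1 - lam) (1 + y).
  rewrite -epowM// -(opprB lam) ler_epowN ?mulr_gt0//; first lra.
  by rewrite nE expr2 lerDr sqr_ge0.
have e : epow (1 - lam) (1 + y) * epow (1 - lam) (1 + y) = epow (2 - lam) (1 + y) * epow (- lam) (1 + y).
  by rewrite -!epowD (_ : 1 - lam + (1 - lam) = 2 - lam - lam)//; ring.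
have p1 := epow_gt0 (- lam) (1 + y); have p2 := epow_gt0 (lam - 2) y.
apply: (@le_trans _ _ (epow (2 - lam) (1 + y) * epow (- lam) (1 + y) * epow (lam - 2) y)).
  by rewrite -e ler_wpM2r// ltW.
suff : epow (2 - lam) (1 + y) * epow (lam - 2) y <= 2 * (1 + epow (lam - 2) y).
  move=> h; have := ler_wpM2r (ltW p1) h; nra.
have le2 (r : R) : 1 <= r <= 2 -> epow (2 - lam) r <= 2.
  move=> /andP[r1 r2]; apply: (@le_trans _ _ (epow 1 r)); last by rewrite epow1//; lra.
  by apply: ler_epowe => //; lra.
have [y2|y2] := leP y 1.
  have : epow (2 - lam) (1 + y) <= 2 by apply: le2; lra.
  nra.
have -> : epow (lam - 2) y = epow (2 - lam) y^-1.
  by rewrite /epow lnV ?posrE//; congr expR; ring.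
rewrite -epowM ?invr_gt0//.
have : epow (2 - lam) ((1 + y) / y) <= 2.
  by apply: le2; rewrite ler_pdivlMr// ler_pdivrMr//; lra.
have := epow_gt0 (2 - lam) y^-1; lra.
Qed.

Lemma integrable_ker (lam s : R) (w : C) : 1 < lam <= s -> halfplane w ->
  leb2.-integrable (upper : set (RM * RM))
    (EFin \o (fun p => nc (ker s w (toC p)) ^+ 2 * weight lam p)).
Proof.
move=> /andP[l1 ls] hw; have mU := measurable_upper.
have l0s : 0 <= lam <= s by rewrite ls andbT; lra.
have [K [K0 HK]] := nc_ker_le l0s hw.
apply: (@integrableR_le _ _ _ leb2 _ _ (fun p : RM * RM =>
    K ^+ 2 * (nc (ker lam 'i (toC p)) ^+ 2 * weight lam p))) => //.
- apply: measurable_funM; last exact: measurable_weight.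
  by apply: measurable_funX; apply: measurable_nc; apply: cmeasurable_hol; exact: hol_ker.
- by apply: integrableRZ => //; exact: integrable_ker_i.
move=> p up; rewrite ger0_norm; last by rewrite mulr_ge0 ?weight_ge0 ?sqr_ge0.
rewrite mulrA ler_wpM2r ?weight_ge0// -exprMn ler_pXn2r ?nnegrE ?nc_ge0 ?mulr_ge0 ?nc_ge0//.
exact: HK.
Qed.
End Integrability.

(** * Weighted square integrable functions *)

Section SquareIntegrable.
Context {R : realType} {d : measure_display} {T : measurableType d}.
Local Notation C := (R[i]).
Variables (mu : {measure set T -> \bar R}) (D : set T) (w : T -> R).
Hypotheses (mD : measurable D) (mw : measurable_fun D w).
Hypothesis w0 : forall x, D x -> 0 <= w x.
Implicit Types f g h : T -> C.

Definition L2 f := cmeasurable D f /\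
  mu.-integrable D (EFin \o (fun x => nc (f x) ^+ 2 * w x)).

Definition ip f g : C := cint mu D (fun x => f x * (g x)^* * (w x)%:C).

Definition sqn f : R := \int[mu]_(x in D) (nc (f x) ^+ 2 * w x).

Lemma inL2P f : inL2 mu D w f <-> L2 f.
Proof.
split=> [[mr mi fin]|[[mr mi] /integrableP[_ fin]]].
  split; first by [].
  apply/integrableP; split.
    apply/measurable_EFinP; apply: measurable_funM => //.
    by apply: measurable_funX; exact: measurable_nc.
  rewrite (le_lt_trans _ fin)// /sqnormL2 le_eqVlt; apply/orP; left; apply/eqP.
  apply: eq_integral => x /set_mem Dx /=; rewrite ger0_norm//.
  by rewrite mulr_ge0 ?sqr_ge0 ?w0.
split=> //; rewrite (le_lt_trans _ fin)// /sqnormL2 le_eqVlt; apply/orP; left; apply/eqP.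
apply: eq_integral => x /set_mem Dx /=; rewrite ger0_norm//.
by rewrite mulr_ge0 ?sqr_ge0 ?w0.
Qed.

Lemma sqn_ge0 f : 0 <= sqn f.
Proof. by apply: Rintegral_ge0 => x Dx; rewrite mulr_ge0 ?sqr_ge0 ?w0. Qed.

Lemma L2_eq f g : (forall x, D x -> f x = g x) -> L2 f -> L2 g.
Proof.
move=> fg [mf fi]; split; first exact: cmeasurable_eq fg mf.
by apply: Rinteg_eq mD => [x Dx|]; [rewrite -fg|exact: fi].
Qed.

Lemma eq_sqn f g : (forall x, D x -> f x = g x) -> sqn f = sqn g.
Proof. by move=> fg; apply: eq_Rintegral => x /set_mem Dx; rewrite fg. Qed.

Lemma L2_scale (c : C) f : L2 f -> L2 (fun x => c * f x).
Proof.
move=> [mf fi]; split; first by apply: cmeasurableM => //; exact: cmeasurable_cst.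
apply: (Rinteg_eq _ (integrableRZ (nc c ^+ 2) mD fi) mD) => x _.
by rewrite ncM exprMn mulrA.
Qed.

Lemma L2_add f g : L2 f -> L2 g -> L2 (fun x => f x + g x).
Proof.
move=> [mf fi] [mg gi]; split; first exact: cmeasurableD.
apply: (integrableR_le mD (g := fun x => 2 * (nc (f x) ^+ 2 * w x + nc (g x) ^+ 2 * w x))).
- apply: measurable_funM => //; apply: measurable_funX; apply: measurable_nc.
  exact: cmeasurableD.
- by apply: integrableRZ => //; exact: integrableRD.
move=> x Dx; rewrite ger0_norm; last by rewrite mulr_ge0 ?sqr_ge0 ?w0.
rewrite -mulrDl mulrA ler_wpM2r ?w0//.
have := ncD (f x) (g x); have := nc_ge0 (f x); have := nc_ge0 (g x).
have := nc_ge0 (f x + g x); move: (nc (f x)) (nc (g x)) (nc (f x + g x)) => a b c c0 b0 a0 cab.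
have : c * c <= (a + b) * (a + b) by apply: ler_pM.
by have := sqr_ge0 (a - b); nra.
Qed.

Lemma L2_opp f : L2 f -> L2 (fun x => - f x).
Proof. by move/(L2_scale (-1)); apply: L2_eq => x _; rewrite mulN1r. Qed.

Lemma L2_sub f g : L2 f -> L2 g -> L2 (fun x => f x - g x).
Proof. by move=> hf /L2_opp; exact: L2_add. Qed.

Lemma cintegrable_ip f g : L2 f -> L2 g -> cintegrable mu D (fun x => f x * (g x)^* * (w x)%:C).
Proof.
move=> [mf fi] [mg gi].
apply: (cintegrable_le mD _ (integrableRD mD fi gi)).
  by apply: cmeasurableM; [apply: cmeasurableM => //; exact: cmeasurable_conj|exact: cmeasurableR].
move=> x Dx; rewrite !ncM nc_conj ncR ger0_norm ?w0// -mulrDl ler_wpM2r ?w0//.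
have := nc_ge0 (f x); have := nc_ge0 (g x); move: (nc (f x)) (nc (g x)) => a b; nra.
Qed.

Lemma ip_add f g h : L2 f -> L2 g -> L2 h -> ip (fun x => f x + g x) h = ip f h + ip g h.
Proof.
move=> hf hg hh; rewrite /ip -cintD//; try exact: cintegrable_ip.
by apply: eq_cint => x _; rewrite !mulrDl.
Qed.

Lemma ip_scale (c : C) f h : L2 f -> L2 h -> ip (fun x => c * f x) h = c * ip f h.
Proof.
move=> hf hh; rewrite /ip -cintZ//; last exact: cintegrable_ip.
by apply: eq_cint => x _; rewrite !mulrA.
Qed.

Lemma ip_sub f g h : L2 f -> L2 g -> L2 h -> ip (fun x => f x - g x) h = ip f h - ip g h.
Proof.
move=> hf hg hh; rewrite /ip -cintB//; try exact: cintegrable_ip.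
by apply: eq_cint => x _; rewrite !mulrBl.
Qed.

Lemma ip_conj f g : L2 f -> L2 g -> ip g f = (ip f g)^*.
Proof.
move=> hf hg; rewrite /ip -cint_conj//; last exact: cintegrable_ip.
apply: eq_cint => x _; case: (f x) (g x) => a b [a' b'].
by apply: eqC => /=; ring.
Qed.

Lemma eq_ip f f' g g' : (forall x, D x -> f x = f' x) -> (forall x, D x -> g x = g' x) ->
  ip f g = ip f' g'.
Proof. by move=> ff gg; apply: eq_cint => x Dx; rewrite ff// gg. Qed.

Lemma ip_sqn f : ip f f = (sqn f)%:C.
Proof.
rewrite /ip -cintR; apply: eq_cint => x _; rewrite RMC; congr (_ * _).
by case: (f x) => a b; rewrite sqr_nc; apply: eqC => /=; ring.
Qed.

Lemma sqn_addZ f h (t : R) : L2 f -> L2 h ->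
  sqn (fun x => f x + t%:C * h x) = sqn f + 2 * t * Re (ip f h) + t ^+ 2 * sqn h.
Proof.
move=> hf hh; have hth := L2_scale t%:C hh; have hs := L2_add hf hth.
apply: (@complexI R); rewrite -ip_sqn ip_add// ip_scale//.
rewrite (ip_conj hs hf) (ip_conj hs hh) !ip_add// !ip_scale// (ip_conj hf hh) !ip_sqn.
by case: (ip f h) => a b; apply: eqC => /=; ring.
Qed.

Lemma sqn_parallelogram f h : L2 f -> L2 h ->
  sqn (fun x => f x + h x) + sqn (fun x => f x - h x) = 2 * sqn f + 2 * sqn h.
Proof.
move=> hf hh; have := sqn_addZ 1 hf hh; have := sqn_addZ (-1) hf hh.
rewrite (eq_sqn (f := fun x => f x + (-1)%:C * h x) (g := fun x => f x - h x)); last first.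
  by move=> x _; rewrite RNC mulN1r.
rewrite (eq_sqn (f := fun x => f x + 1%:C * h x) (g := fun x => f x + h x)); last first.
  by move=> x _; rewrite mul1r.
lra.
Qed.

Lemma sqn_scale (c : C) f : L2 f -> sqn (fun x => c * f x) = nc c ^+ 2 * sqn f.
Proof.
move=> [_ fi]; rewrite /sqn -RintegralZl//.
by apply: eq_Rintegral => x _; rewrite ncM exprMn -mulrA.
Qed.

(** A sequence in [V] that minimizes the distance to [f] is a Cauchy sequence
    by the parallelogram identity, and its difference with [f] becomes
    orthogonal to [V]. This serves as an orthogonal projection, without
    completeness of the space. *)
Lemma minimizing_sequence (V : (T -> C) -> Prop) f : L2 f -> (exists g, V g) ->
  (forall g, V g -> L2 g) ->
  (forall g h (t : R), V g -> V h -> V (fun x => g x + t%:C * h x)) ->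
  exists g : nat -> T -> C, [/\ forall k, V (g k),
    forall k h, V h -> Re (ip (fun x => f x - g k x) h) ^+ 2 <= sqn h / k.+1%:R &
    forall m k, sqn (fun x => g m x - g k x) <= 2 / m.+1%:R + 2 / k.+1%:R].
Proof.
move=> hf [g0 Vg0] VL2 Vlin.
pose E : set R := [set sqn (fun x => f x - g x) | g in V].
have E0 : has_inf E.
  split; first by exists (sqn (fun x => f x - g0 x)), g0.
  by exists 0 => _ [g _ <-]; exact: sqn_ge0.
pose dd := inf E.
have low g : V g -> dd <= sqn (fun x => f x - g x).
  by move=> Vg; apply: ge_inf; [exact: E0.2|exists g].
have /choice[g Hg] : forall k : nat, exists g, V g /\
    sqn (fun x => f x - g x) < dd + k.+1%:R^-1.
  move=> k; have k0 : (0 : R) < k.+1%:R^-1 by rewrite invr_gt0 ltr0n.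
  by have [_ [g Vg <-] lt] := inf_adherent k0 E0; exists g.
have gL k : L2 (g k) by apply: VL2; exact: (Hg k).1.
exists g; split=> [k|k h Vh|m k]; first exact: (Hg k).1.
  have [Vg lt] := Hg k; have hh := VL2 _ Vh; have hs := L2_sub hf (gL k).
  set r := Re _; set e := k.+1%:R^-1 in lt *.
  have e0 : 0 < e by rewrite invr_gt0 ltr0n.
  have H t : 2 * t * r - t ^+ 2 * sqn h <= e.
    have := low _ (Vlin _ _ t Vg Vh).
    rewrite (eq_sqn (g := fun x => (f x - g k x) + (- t)%:C * h x)); last first.
      by move=> x _; rewrite RNC; ring.
    rewrite sqn_addZ// -/r; move: lt; set a := sqn _; set b := sqn h => lt1 lt2.
    by move: lt2; rewrite sqrrN; lra.
  have := sqn_ge0 h; rewrite le_eqVlt => /orP[/eqP h0|h0].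
    rewrite -h0 mul0r; have [->|r0] := eqVneq r 0; first by rewrite expr0n.
    have := H (e / r); rewrite -h0 mulr0 subr0; have -> : 2 * (e / r) * r = 2 * e by field.
    by lra.
  have := H (r / sqn h).
  have -> : 2 * (r / sqn h) * r - (r / sqn h) ^+ 2 * sqn h = r ^+ 2 / sqn h.
    by field; rewrite gt_eqF.
  by rewrite ler_pdivrMr// mulrC.
have [Vm ltm] := Hg m; have [Vk ltk] := Hg k.
have Vmid : V (fun x => g m x + (2^-1)%:C * (g k x + (-1)%:C * g m x)).
  exact: (Vlin _ _ _ Vm (Vlin _ _ _ Vk Vm)).
have := low _ Vmid.
have hm := L2_sub hf (gL m); have hk := L2_sub hf (gL k).
have := sqn_parallelogram hk hm.
rewrite (eq_sqn (f := fun x => f x - g k x - (f x - g m x)) (g := fun x => g m x - g k x)); last first.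
  by move=> x _; ring.
rewrite (eq_sqn (f := fun x => f x - g k x + (f x - g m x))
  (g := fun x => 2%:C * (f x - (g m x + (2^-1)%:C * (g k x + (-1)%:C * g m x))))); last first.
  by move=> x _; rewrite RNC RVC; field.
rewrite sqn_scale; last by apply: L2_sub => //; exact: VL2.
rewrite ncR ger0_norm//; move: ltm ltk; set a := sqn _; set b := sqn _; set c := sqn _.
set q := sqn _; clearbody a b c q dd.
by move: (m.+1%:R^-1) (k.+1%:R^-1) => x y; rewrite expr2; lra.
Qed.

(** Together with pointwise convergence this turns a Cauchy sequence into a
    convergent one, by applying it to the differences of its terms. *)
Lemma fatou_sqn (u : nat -> T -> C) v (e : R) : (forall m, L2 (u m)) -> cmeasurable D v ->
  (forall x, D x -> nc (u m x) @[m --> \oo] --> nc (v x)) ->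
  (forall m, sqn (u m) <= e) -> L2 v /\ sqn v <= e.
Proof.
move=> hu mv uv ue.
pose F f x := (nc (f x) ^+ 2 * w x)%:E.
have mF f : cmeasurable D f -> measurable_fun D (F f).
  move=> mf; apply/measurable_EFinP; apply: measurable_funM => //.
  by apply: measurable_funX; exact: measurable_nc.
have F0 f x : D x -> (0 <= F f x)%E by move=> Dx; rewrite lee_fin mulr_ge0 ?sqr_ge0 ?w0.
have Fu m : (\int[mu]_(x in D) F (u m) x = (sqn (u m))%:E)%E.
  rewrite /sqn /Rintegral fineK//; apply: integrable_fin_num => //; exact: (hu m).2.
have H := fatou mu mD (fun m => mF _ (hu m).1) (fun m x => F0 (u m) x).
have le1 : (\int[mu]_(x in D) F v x <= e%:E)%E.
  apply: le_trans (le_trans H _).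
    rewrite le_eqVlt; apply/orP; left; apply/eqP; apply: eq_integral => x /set_mem Dx.
    have cF : F (u m) x @[m --> \oo] --> F v x.
      by apply: cvg_EFin; [exact: nearW|apply: cvgMl; apply: cvgM; exact: uv].
    rewrite is_cvg_limn_einfE; last by apply/cvg_ex; exists (F v x).
    by apply/esym/cvg_lim.
  rewrite limn_einf_lim; apply: lime_le; first exact: is_cvg_einfs.
  apply: nearW => n; apply: ereal_inf_le; exists (\int[mu]_(x in D) F (u n) x)%E.
    by exists n => /=.
  by rewrite Fu lee_fin.
have iv : mu.-integrable D (F v).
  apply/integrableP; split; first exact: mF.
  rewrite (le_lt_trans _ (ltry e))// (le_trans _ le1)// le_eqVlt; apply/orP; left; apply/eqP.
  by apply: eq_integral => x /set_mem Dx; rewrite gee0_abs// F0.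
split; first by split.
rewrite /sqn /Rintegral -lee_fin fineK//.
exact: integrable_fin_num.
Qed.
End SquareIntegrable.

Section LinearSums.
Context {R : realType} {d : measure_display} {T : measurableType d}.
Local Notation C := (R[i]).
Variables (mu : {measure set T -> \bar R}) (D : set T) (w : T -> R).
Hypotheses (mD : measurable D) (mw : measurable_fun D w).
Hypothesis w0 : forall x, D x -> 0 <= w x.
Local Notation L2 := (L2 mu D w).
Local Notation ip := (ip mu D w).

Lemma L2_0 : L2 (fun=> 0).
Proof.
split; first exact: cmeasurable_cst.
rewrite (_ : _ \o _ = cst 0%E); first exact: integrable0.
by apply/funext => x; rewrite /= nc0 expr0n mul0r.
Qed.

Lemma L2_sum n (f : nat -> T -> C) : (forall i, L2 (f i)) ->
  L2 (fun x => \sum_(i < n) f i x).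
Proof.
move=> Lf; elim: n => [|n IH].
  by apply: (L2_eq mD _ L2_0) => x _; rewrite big_ord0.
by apply: (L2_eq mD _ (L2_add mD mw w0 IH (Lf n))) => x _; rewrite big_ord_recr.
Qed.

Lemma ip_0 h : ip (fun=> 0) h = 0.
Proof.
rewrite /ip -[RHS](cint0 mu D); apply: eq_cint => x _; by rewrite !mul0r.
Qed.

Lemma ip_sum n (f : nat -> T -> C) h : (forall i, L2 (f i)) -> L2 h ->
  ip (fun x => \sum_(i < n) f i x) h = \sum_(i < n) ip (f i) h.
Proof.
move=> Lf Lh; elim: n => [|n IH].
  rewrite big_ord0 -[RHS](ip_0 h); apply: eq_cint => x _; by rewrite big_ord0.
rewrite big_ord_recr /= -IH -ip_add//; last exact: L2_sum.
by apply: eq_cint => x _; rewrite big_ord_recr.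
Qed.

Lemma ip_addr f g h : L2 f -> L2 g -> L2 h -> ip h (fun x => f x + g x) = ip h f + ip h g.
Proof.
move=> Lf Lg Lh; rewrite (ip_conj mD mw w0 (L2_add mD mw w0 Lf Lg) Lh) ip_add//.
by rewrite (ip_conj mD mw w0 Lf Lh) (ip_conj mD mw w0 Lg Lh) rmorphD.
Qed.

Lemma ip_scaler (c : C) f h : L2 f -> L2 h -> ip h (fun x => c * f x) = c^* * ip h f.
Proof.
move=> Lf Lh; rewrite (ip_conj mD mw w0 (L2_scale mD c Lf) Lh) ip_scale//.
by rewrite (ip_conj mD mw w0 Lf Lh) rmorphM.
Qed.

Lemma ip_sumr n (f : nat -> T -> C) h : (forall i, L2 (f i)) -> L2 h ->
  ip h (fun x => \sum_(i < n) f i x) = \sum_(i < n) ip h (f i).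
Proof.
move=> Lf Lh; rewrite (ip_conj mD mw w0 (L2_sum n Lf) Lh) ip_sum// rmorph_sum.
by apply: eq_bigr => i _; rewrite [RHS](ip_conj mD mw w0 (Lf i) Lh).
Qed.

Lemma cauchy_schwarz f h : L2 f -> L2 h ->
  Re (ip f h) ^+ 2 <= sqn mu D w f * sqn mu D w h.
Proof.
move=> Lf Lh; set r := Re _.
have H t : 0 <= sqn mu D w f + 2 * t * r + t ^+ 2 * sqn mu D w h.
  by rewrite -sqn_addZ//; exact: sqn_ge0.
have f0 := sqn_ge0 mu w0 f; have := sqn_ge0 mu w0 h.
rewrite le_eqVlt => /orP[/eqP h0|h0].
  have [->|r0] := eqVneq r 0; first by rewrite expr0n mulr_ge0// -h0.
  have := H (- (sqn mu D w f + 1) / (2 * r)); rewrite -h0.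
  have -> : 2 * (- (sqn mu D w f + 1) / (2 * r)) * r = - (sqn mu D w f + 1) by field.
  by rewrite !mulr0; lra.
have := H (- r / sqn mu D w h).
have -> : sqn mu D w f + 2 * (- r / sqn mu D w h) * r + (- r / sqn mu D w h) ^+ 2 * sqn mu D w h
  = (sqn mu D w f * sqn mu D w h - r ^+ 2) / sqn mu D w h by field; rewrite gt_eqF.
by rewrite pmulr_lge0 ?invr_gt0// subr_ge0.
Qed.

Lemma sqn_cvg f (g : nat -> T -> C) (M : R) : L2 f -> (forall k, L2 (g k)) ->
  (forall k, sqn mu D w (fun x => f x - g k x) <= M / k.+1%:R) ->
  sqn mu D w (g k) @[k --> \oo] --> sqn mu D w f.
Proof.
move=> Lf Lg H; have Lu k := L2_sub mD mw w0 Lf (Lg k).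
set s := sqn mu D w f; have s0 : 0 <= s by exact: sqn_ge0.
pose b (k : nat) := 2 * Num.sqrt (s * (M / k.+1%:R)) + M / k.+1%:R.
have hb : b k @[k --> \oo] --> (0 : R).
  have h1 : M / k.+1%:R @[k --> \oo] --> (M * 0 : R).
    by apply: cvgM; [exact: cvg_cst|exact: cvg_harmonic].
  have h2 : s * (M / k.+1%:R) @[k --> \oo] --> (s * (M * 0) : R).
    by apply: cvgM; [exact: cvg_cst|exact: h1].
  have h3 : Num.sqrt (s * (M / k.+1%:R)) @[k --> \oo] --> Num.sqrt (s * (M * 0) : R).
    by apply: (@cvg_comp _ _ _ (fun k : nat => s * (M / k.+1%:R)) Num.sqrt _ _ _ h2); exact: sqrt_continuous.
  have e : 2 * Num.sqrt (s * (M * 0)) + M * 0 = 0 :> R by rewrite !mulr0 sqrtr0 mulr0 addr0.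
  by rewrite -[X in _ --> X]e; apply: cvgD h1; apply: cvgM; [exact: cvg_cst|exact: h3].
have bk k : `|s - sqn mu D w (g k)| <= b k.
  set u := fun x => f x - g k x.
  have -> : sqn mu D w (g k) = s + 2 * (-1) * Re (ip f u) + (-1) ^+ 2 * sqn mu D w u.
    rewrite /s -sqn_addZ//; last exact: Lu.
    by apply: eq_sqn => x _; rewrite /u RNC; ring.
  have cs := cauchy_schwarz Lf (Lu k); have uM := H k; rewrite -/u -/s in cs uM *.
  have u0 : 0 <= sqn mu D w u by exact: sqn_ge0.
  have r1 : `|Re (ip f u)| <= Num.sqrt (s * (M / k.+1%:R)).
    rewrite -sqrtr_sqr ler_wsqrtr// (le_trans cs)// ler_wpM2l//.
  rewrite /b; move: r1; rewrite ler_norml => /andP[r1 r2].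
  move: (Num.sqrt _) r1 r2 => q r1 r2; move: (Re _) r1 r2 => r r1 r2.
  move: (sqn mu D w u) (M / k.+1%:R) u0 uM => y e u0 uM.
  by rewrite sqrrN expr1n ler_norml; apply/andP; split; lra.
apply/cvgrPdist_lt => e e0.
move/cvgrPdist_lt: hb => /(_ e e0); apply: filterS => k; rewrite sub0r normrN => bk1.
by rewrite (le_lt_trans (bk k))// (le_lt_trans (ler_norm _)).
Qed.
End LinearSums.

(** * Stokes' theorem on the half-plane *)

Lemma epow_pred {R : realType} (s x : R) : 0 < x -> epow s x = epow (s - 1) x * x.
Proof. by move=> x0; have := epowD (s - 1) 1 x; rewrite subrK epow1. Qed.

Section Cutoff.
Context {R : realType}.
Implicit Types (x y u t N : R).

Definition pos u : R := (u + `|u|) / 2.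

Lemma pos_ge0 u : 0 <= pos u.
Proof. by rewrite /pos; have := ler_norm (- u); rewrite normrN; lra. Qed.

Lemma pos_id u : 0 <= u -> pos u = u.
Proof. by move=> u0; rewrite /pos ger0_norm//; lra. Qed.

Lemma pos_0 u : u <= 0 -> pos u = 0.
Proof. by move=> u0; rewrite /pos ler0_norm// subrr mul0r. Qed.

Lemma cvg_pos {T : topologicalType} (g : T -> R) (x : T) : g y @[y --> x] --> g x ->
  pos (g y) @[y --> x] --> pos (g x).
Proof. by move=> cg; apply: cvgMl; apply: cvgD => //; exact: cvg_norm. Qed.

(** The square of the positive part is a cutoff function of class C^1, which
    is all that the integrations by parts need. *)
Lemma vder_pos2 u : vder (fun t => (pos t ^+ 2)%:C) u (2 * pos u)%:C.
Proof.
have [u0|u0|->] := ltgtP u 0.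
- rewrite pos_0 ?ltW// mulr0.
  apply: (@has_slope_near _ _ (real_complex R) (fun=> 0%:C)).
  + exact: complexI.
  + near=> t; rewrite pos_0 ?expr0n//; apply: ltW.
    by near: t; exact: lt_nbhsl.
  + exact: vder_cstR.
- rewrite pos_id ?ltW//.
  apply: (@has_slope_near _ _ (real_complex R) (fun t => (t * t)%:C)).
  + exact: complexI.
  + near=> t; rewrite pos_id ?expr2//; apply: ltW.
    by near: t; exact: lt_nbhsr.
  + by apply: vder_eqR (vderMR (vder_idR u) (vder_idR u)) _; ring.
- exists (fun t => (pos t)%:C); split.
  + by apply: contRC; apply: (@cvg_pos _ id); exact: cvg_id.
  + by rewrite pos_0// mulr0.
  + move=> t; rewrite -RBC -RBC -RMC (pos_0 (lexx _)) expr0n subr0 subr0 /=.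
    congr (_%:C); have [t0|t0] := leP 0 t; first by rewrite pos_id// expr2.
    by rewrite (pos_0 (ltW t0)) expr0n mul0r.
Unshelve. all: by end_near. Qed.

(** [dst] is [2 * ln (cosh (r / 2))], with [r] the hyperbolic distance to
    ['i]. It tends to infinity at the boundary, while its gradient stays
    bounded for the hyperbolic metric. *)
Definition dstQ x y : R := x ^+ 2 + (y + 1) ^+ 2.
Definition dst x y : R := ln (dstQ x y) - ln (4 * y).
Definition dst_x x y : R := 2 * x / dstQ x y.
Definition dst_y x y : R := 2 * (y + 1) / dstQ x y - y^-1.

Lemma dstQ_gt0 x y : 0 < y -> 0 < dstQ x y.
Proof. by move=> y0; rewrite /dstQ ltr_wpDl ?sqr_ge0// exprn_gt0//; lra. Qed.

Lemma vder_dst_x x y : 0 < y -> vder (fun t => (dst t y)%:C) x (dst_x x y)%:C.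
Proof.
move=> y0; have Q0 := dstQ_gt0 x y0.
have dQ : vder (fun t => (dstQ t y)%:C) x (2 * x)%:C.
  apply: (vder_eqR (vderDR (vderMR (vder_idR x) (vder_idR x)) (vder_cstR ((y + 1) ^+ 2) x))).
  by ring.
apply: (vder_eqR (vderDR (@vder_ln R (fun t => dstQ t y) x _ Q0 dQ) (vder_cstR (- ln (4 * y)) x))).
by rewrite addr0.
Qed.

Lemma vder_dst_y x y : 0 < y -> vder (fun t => (dst x t)%:C) y (dst_y x y)%:C.
Proof.
move=> y0; have Q0 := dstQ_gt0 x y0.
have d1 := vderDR (vder_idR y) (vder_cstR 1 y).
have dQ : vder (fun t => (dstQ x t)%:C) y (2 * (y + 1))%:C.
  by apply: (vder_eqR (vderDR (vder_cstR (x ^+ 2) y) (vderMR d1 d1))); ring.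
have y40 : 0 < 4 * y by lra.
have d4 := vderZR (-1) (@vder_ln R (fun t => 4 * t) y _ y40 (vderZR 4 (vder_idR y))).
have := vderDR (@vder_ln R (fun t => dstQ x t) y _ Q0 dQ) d4.
rewrite (_ : (fun t => _) = fun t => (dst x t)%:C); last first.
  by apply/funext => t; rewrite /dst mulN1r.
by move/vder_eqR; apply; rewrite /dst_y; field; rewrite !gt_eqF.
Qed.

Lemma dst_ge0 x y : 0 < y -> 0 <= dst x y.
Proof.
move=> y0; rewrite /dst subr_ge0 ler_ln ?posrE ?dstQ_gt0//; last lra.
by rewrite /dstQ; have := sqr_ge0 x; have := sqr_ge0 (y - 1); nra.
Qed.

Lemma dst_grad x y : 0 < y -> nc ((dst_x x y) +i* (dst_y x y)) <= y^-1.
Proof.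
move=> y0; have Q0 := dstQ_gt0 x y0; have iy : 0 <= y^-1 by rewrite invr_ge0 ltW.
rewrite -(ler_pXn2r (n := 2)) ?nnegrE ?nc_ge0// sqr_nc /=.
have -> : dst_x x y ^+ 2 + dst_y x y ^+ 2 = y^-1 ^+ 2 - 4 / (dstQ x y * y).
  rewrite /dst_x /dst_y; transitivity (4 * dstQ x y / (dstQ x y ^+ 2) - 4 * (y + 1) / (dstQ x y * y) + y^-1 ^+ 2).
    by rewrite {3}/dstQ; field; rewrite !gt_eqF.
  by field; rewrite !gt_eqF.
by rewrite gerBl divr_ge0// mulr_ge0// ltW.
Qed.

(** The cutoffs vanish outside a compact rectangle. *)
Lemma dst_proper N x y : 0 < y -> dst x y < N ->
  [/\ - (4 * expR N) < x < 4 * expR N & (4 * expR N)^-1 < y < 4 * expR N].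
Proof.
move=> y0 dN; have Q0 := dstQ_gt0 x y0; have e0 := expR_gt0 N.
have : dstQ x y < expR N * (4 * y).
  have y40 : 0 < 4 * y by lra.
  rewrite -ltr_ln ?posrE ?mulr_gt0// lnM ?posrE// expRK.
  by move: dN; rewrite /dst; lra.
rewrite /dstQ; set e := expR N in e0 * => H.
have x2 := sqr_ge0 x; have y1 := sqr_ge0 y.
have ye : y < 4 * e by rewrite -(ltr_pM2r y0); nra.
have x2e : x ^+ 2 < (4 * e) ^+ 2 by nra.
have xe : `|x| < 4 * e.
  by rewrite -(ltr_pXn2r (n := 2)) ?nnegrE ?real_normK ?num_real//; lra.
split; first by rewrite -ltr_norml.
rewrite ye andbT invf_plt ?posrE//; last lra.
by rewrite -(ltr_pM2r y0) mulVf ?gt_eqF//; nra.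
Qed.
End Cutoff.

Section Stokes.
Context {R : realType}.
Local Notation C := (R[i]).
Local Notation leb := (@lebesgue_measure R).
Local Notation leb2 := (leb \x leb)%E.
Local Notation RM := (measurableTypeR R).
Implicit Types (x y N : R) (p : R * R).

Lemma vder_conj (F : R -> C) x d : vder F x d -> vder (fun t => (F t)^*) x d^*.
Proof.
move=> [q [cq qd qE]]; exists (fun t => (q t)^*); split; first exact: cont_conj.
  by rewrite qd.
move=> t; transitivity ((F t - F x)^*); first by rewrite rmorphB.
rewrite qE; transitivity ((q t)^* * (t%:C - x%:C)^*); first by rewrite rmorphM.
by rewrite -RBC conjc_real.
Qed.

Lemma cint_supported (A : set (RM * RM)) (f : RM * RM -> C) :
  measurable A -> A `<=` upper -> (forall p, upper p -> ~ A p -> f p = 0) ->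
  cint leb2 upper f = cint leb2 A f.
Proof.
move=> mA AU f0; have aux (g : C -> R) : g 0 = 0 ->
    \int[leb2]_(p in upper) g (f p) = \int[leb2]_(p in A) g (f p).
  move=> g0; rewrite [LHS]Rintegral_mkcond [RHS]Rintegral_mkcond.
  apply: eq_Rintegral => p _; rewrite /patch.
  have [Ap|nA] := pselect (A p).
    by rewrite !mem_set//; exact: AU.
  rewrite [p \in A]memNset//; case: ifPn => // /set_mem up.
  by rewrite f0.
by rewrite /cint (aux (@complex.Re R))// (aux (@complex.Im R)).
Qed.

Variables (mu sig : R) (G : C -> C) (w : C).
Hypotheses (hG : hol G) (hw : halfplane w).

(* The form is [W dz], with [W] the product of a holomorphic function, of a
   conjugate kernel and of a power of [y]. By [WE] its exterior derivative is
   a multiple of [H1 * B]. *)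
Let kap s p : C := ker s (toC p) w.
Let H1 p : C := G (toC p) * kap sig p * (epow (mu - 1) p.2)%:C.
Let B p : C := (mu - sig)%:C + 'i * sig%:C * (toC p - w) * kap 1 p.
Let W p : C := G (toC p) * (kap sig p * (epow mu p.2)%:C).
Let Wx p : C := cd G (toC p) * (kap sig p * (epow mu p.2)%:C) +
  G (toC p) * (- ('i * sig%:C) * kap (sig + 1) p * (epow mu p.2)%:C).
Let Wy p : C := 'i * cd G (toC p) * (kap sig p * (epow mu p.2)%:C) +
  G (toC p) * (- sig%:C * kap (sig + 1) p * (epow mu p.2)%:C +
               kap sig p * (mu * epow (mu - 1) p.2)%:C).

Let kap_conj s p : kap s p = (ker s w (toC p))^*.
Proof. by rewrite ker_herm. Qed.

Let kapS p : upper p -> kap (sig + 1) p = kap sig p * kap 1 p.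
Proof. by move=> _; rewrite /kap kerD. Qed.

Let WE p : upper p -> Wx p + 'i * Wy p = 'i * (H1 p * B p).
Proof.
move=> up; have hz := toC_halfplane up.
have y0 : 0 < p.2 by [].
have e : epow mu p.2 = epow (mu - 1) p.2 * p.2.
  exact: epow_pred.
have k0 : kap 1 p != 0 by exact: ker_neq0.
have ek : 2 * p.2%:C * kap 1 p = 1 - 'i * (toC p - w) * kap 1 p.
  rewrite -[X in _ = X - _](mulVf k0) -mulrBl; congr (_ * _); rewrite /kap ker1// invrK.
  have -> : 2 * p.2%:C = (p.2 + p.2)%:C :> C by rewrite RDC; ring.
  case: (p) (w) => x y [a b]; by rewrite /toC; apply: eqC => /=; ring.
rewrite /Wx /Wy /H1 /B kapS// e !RMC RBC.
move: (cd G (toC p)) (G (toC p)) (kap sig p) (epow (mu - 1) p.2)%:C ek => g' g k q ek.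
have i2 : 'i * 'i = -1 :> C by rewrite -expr2 sqr_i.
transitivity ('i * (g * k * q * (mu%:C - sig%:C * (2 * p.2%:C * kap 1 p))) +
   g' * k * q * p.2%:C * (1 + 'i * 'i)); first by ring.
by rewrite i2 ek; ring.
Qed.

Let vder_Wx x y : 0 < y -> vder (fun t => W (t, y)) x (Wx (x, y)).
Proof.
move=> y0; have hz : halfplane (toC (x, y)) by [].
have dG : vder (fun t => G (t +i* y)) x (cd G (toC (x, y)) * 1).
  apply: (@has_slope_comp _ _ _ G (fun t => t +i* y) x _ _ (contreal x)).
    exact: hol_cd.
  exact: vder_horizontal.
have dk : vder (fun t => kap sig (t, y)) x (- ('i * sig%:C) * kap (sig + 1) (x, y)).
  rewrite (_ : (fun t => _) = fun t => (ker sig w (t +i* y))^*); last first.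
    by apply/funext => t; rewrite kap_conj.
  apply: has_slope_eq.
    apply: vder_conj; apply: (@has_slope_comp _ _ _ (ker sig w) (fun t => t +i* y) x _ _ (contreal x)).
      exact: (cder_ker sig hz hw).
    exact: vder_horizontal.
  rewrite mulr1 kap_conj; case: (ker (sig + 1) w (toC (x, y))) => a b.
  by apply: eqC => /=; ring.
have := has_slopeM (contreal x) dG (has_slopeM (contreal x) dk (has_slope_cst _ (epow mu y)%:C x)).
by move/has_slope_eq; apply; rewrite /Wx /= /toC /=; ring.
Qed.

Let vder_Wy x y : 0 < y -> vder (fun t => W (x, t)) y (Wy (x, y)).
Proof.
move=> y0; have hz : halfplane (toC (x, y)) by [].
have dG : vder (fun t => G (x +i* t)) y (cd G (toC (x, y)) * 'i).
  apply: (@has_slope_comp _ _ _ G (fun t => x +i* t) y _ _ (contreal y)).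
    exact: hol_cd.
  exact: vder_vertical.
have dk : vder (fun t => kap sig (x, t)) y (- sig%:C * kap (sig + 1) (x, y)).
  rewrite (_ : (fun t => _) = fun t => (ker sig w (x +i* t))^*); last first.
    by apply/funext => t; rewrite kap_conj.
  apply: has_slope_eq.
    apply: vder_conj; apply: (@has_slope_comp _ _ _ (ker sig w) (fun t => x +i* t) y _ _ (contreal y)).
      exact: (cder_ker sig hz hw).
    exact: vder_vertical.
  rewrite kap_conj; case: (ker (sig + 1) w (toC (x, y))) => a b.
  by apply: eqC => /=; ring.
have := has_slopeM (contreal y) dG (has_slopeM (contreal y) dk (vder_epow mu y0 (vder_idR y))).
by move/has_slope_eq; apply; rewrite /Wy /= /toC /= !RMC; ring.
Qed.

(* The cutoff [chi N] tends to 1 as [N] grows, and its gradient is at most [2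
   / N] times that of [dst]. The definitions after it are its partial
   derivatives. *)
Let u N p := 1 - dst p.1 p.2 / N.
Let chi N p := pos (u N p) ^+ 2.
Let chx N p := - (2 * pos (u N p) * (dst_x p.1 p.2 / N)).
Let chy N p := - (2 * pos (u N p) * (dst_y p.1 p.2 / N)).

Let vder_chx N x y : 0 < y -> vder (fun t => (chi N (t, y))%:C) x (chx N (x, y))%:C.
Proof.
move=> y0; have d1 := vderDR (vder_cstR 1 x) (vderMR (vder_dst_x x y0) (vder_cstR (- N^-1) x)).
rewrite /chi (_ : (fun t => _) = fun t => (pos (1 + dst t y * (- N^-1)) ^+ 2)%:C); last first.
  by apply/funext => t; rewrite /u /= mulrN.
apply: has_slope_eq (vder_compR (vder_pos2 _) d1) _.
by rewrite -RMC /chx /u /= mulrN; congr (_%:C); ring.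
Qed.

Let vder_chy N x y : 0 < y -> vder (fun t => (chi N (x, t))%:C) y (chy N (x, y))%:C.
Proof.
move=> y0; have d1 := vderDR (vder_cstR 1 y) (vderMR (vder_dst_y x y0) (vder_cstR (- N^-1) y)).
rewrite /chi (_ : (fun t => _) = fun t => (pos (1 + dst x t * (- N^-1)) ^+ 2)%:C); last first.
  by apply/funext => t; rewrite /u /= mulrN.
apply: has_slope_eq (vder_compR (vder_pos2 _) d1) _.
by rewrite -RMC /chy /u /= mulrN; congr (_%:C); ring.
Qed.

Let fst_cvg p : (q.1 @[q --> p]) --> p.1. Proof. exact: cvg_fst. Qed.
Let snd_cvg p : (q.2 @[q --> p]) --> p.2. Proof. exact: cvg_snd. Qed.

Let cont_dst p : upper p -> dst q.1 q.2 @[q --> p] --> dst p.1 p.2.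
Proof.
move=> up; have y0 : 0 < p.2 by []. have Q0 := dstQ_gt0 p.1 y0.
have cQ : dstQ q.1 q.2 @[q --> p] --> dstQ p.1 p.2.
  apply: cvgD; first by apply: cvgM; exact: fst_cvg.
  by apply: cvgM; (apply: cvgD; [exact: snd_cvg|exact: cvg_cst]).
apply: cvgB.
  by apply: (@cvg_comp _ _ _ (fun q : R * R => dstQ q.1 q.2) (@ln R) _ _ _ cQ); exact: continuous_ln.
apply: (@cvg_comp _ _ _ (fun q : R * R => 4 * q.2) (@ln R)).
  by apply: cvgM; [exact: cvg_cst|exact: snd_cvg].
by apply: continuous_ln; lra.
Qed.

Let cont_dst_x p : upper p -> dst_x q.1 q.2 @[q --> p] --> dst_x p.1 p.2.
Proof.
move=> up; have y0 : 0 < p.2 by []. have Q0 := dstQ_gt0 p.1 y0.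
apply: cvgM; first by apply: cvgM; [exact: cvg_cst|exact: fst_cvg].
apply: cvgV; first by rewrite gt_eqF.
apply: cvgD; first by apply: cvgM; exact: fst_cvg.
by apply: cvgM; (apply: cvgD; [exact: snd_cvg|exact: cvg_cst]).
Qed.

Let cont_dst_y p : upper p -> dst_y q.1 q.2 @[q --> p] --> dst_y p.1 p.2.
Proof.
move=> up; have y0 : 0 < p.2 by []. have Q0 := dstQ_gt0 p.1 y0.
apply: cvgB; last by apply: cvgV; [rewrite gt_eqF|exact: snd_cvg].
apply: cvgM.
  by apply: cvgM; [exact: cvg_cst|apply: cvgD; [exact: snd_cvg|exact: cvg_cst]].
apply: cvgV; first by rewrite gt_eqF.
apply: cvgD; first by apply: cvgM; exact: fst_cvg.
by apply: cvgM; (apply: cvgD; [exact: snd_cvg|exact: cvg_cst]).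
Qed.

Let cont_u N p : upper p -> pos (u N q) @[q --> p] --> pos (u N p).
Proof.
move=> up; apply: cvg_pos; apply: cvgB; first exact: cvg_cst.
by apply: cvgMl; exact: cont_dst.
Qed.

Let cont_chi N p : upper p -> contc (fun p => (chi N p)%:C) p.
Proof. by move=> up; apply: contRC; apply: cvgM; exact: cont_u. Qed.

Let cont_chx N p : upper p -> contc (fun p => (chx N p)%:C) p.
Proof.
move=> up; apply: contRC; apply: cvgN; apply: cvgM.
  by apply: cvgM; [exact: cvg_cst|exact: cont_u].
by apply: cvgMl; exact: cont_dst_x.
Qed.

Let cont_chy N p : upper p -> contc (fun p => (chy N p)%:C) p.
Proof.
move=> up; apply: contRC; apply: cvgN; apply: cvgM.
  by apply: cvgM; [exact: cvg_cst|exact: cont_u].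
by apply: cvgMl; exact: cont_dst_y.
Qed.

Let cont_kap s p : upper p -> contc (kap s) p.
Proof.
move=> up; rewrite (_ : kap s = fun p => (ker s w (toC p))^*); last first.
  by apply/funext => q; rewrite kap_conj.
apply: cont_conj; apply: (cont_comp (f := ker s w)); last exact: cont_toC.
by apply: hol_contc; [exact: hol_ker|exact: toC_halfplane].
Qed.

Let cont_ep s p : upper p -> contc (fun p => (epow s p.2)%:C) p.
Proof.
move=> up; apply: contRC; apply: (@cvg_comp _ _ _ (snd : R * R -> R) (epow s)); first exact: cvg_snd.
by apply: cont_epow => //; exact: cvg_id.
Qed.

Let cont_G p : upper p -> contc (fun p => G (toC p)) p.
Proof.
move=> up; apply: (cont_comp (f := G)); last exact: cont_toC.
by apply: hol_contc => //; exact: toC_halfplane.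
Qed.

Let cont_cdG p : upper p -> contc (fun p => cd G (toC p)) p.
Proof.
move=> up; apply: (cont_comp (f := cd G)); last exact: cont_toC.
by apply: cd_contc => //; exact: toC_halfplane.
Qed.

Let cont_W p : upper p -> contc W p.
Proof. by move=> up; apply: contM; [exact: cont_G|apply: contM; [exact: cont_kap|exact: cont_ep]]. Qed.

Let cont_Wx p : upper p -> contc Wx p.
Proof.
move=> up; apply: contD.
  by apply: contM; [exact: cont_cdG|apply: contM; [exact: cont_kap|exact: cont_ep]].
apply: contM; first exact: cont_G.
by apply: contM; [apply: contM; [exact: contC|exact: cont_kap]|exact: cont_ep].
Qed.

Let cont_Wy p : upper p -> contc Wy p.
Proof.
move=> up; apply: contD.
  apply: contM; first by apply: contM; [exact: contC|exact: cont_cdG].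
  by apply: contM; [exact: cont_kap|exact: cont_ep].
apply: contM; first exact: cont_G.
apply: contD; first by apply: contM; [apply: contM; [exact: contC|exact: cont_kap]|exact: cont_ep].
apply: contM; first exact: cont_kap.
rewrite (_ : (fun p => _) = fun p : R * R => mu%:C * (epow (mu - 1) p.2)%:C); last first.
  by apply/funext => q; rewrite RMC.
by apply: contM; [exact: contC|exact: cont_ep].
Qed.

Let cont_H1 p : upper p -> contc H1 p.
Proof. by move=> up; apply: contM; [apply: contM; [exact: cont_G|exact: cont_kap]|exact: cont_ep]. Qed.

Let cont_B p : upper p -> contc B p.
Proof.
move=> up; apply: contD; first exact: contC.
apply: contM; last exact: cont_kap.
apply: contM; first exact: contC.
by apply: contD; [exact: cont_toC|exact: contC].
Qed.

(* The partial derivatives of the product of the cutoff function and of [W]. *)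
Let Vx N p := (chx N p)%:C * W p + (chi N p)%:C * Wx p.
Let Vy N p := (chy N p)%:C * W p + (chi N p)%:C * Wy p.

Let cont_Vx N p : upper p -> contc (Vx N) p.
Proof.
move=> up; apply: contD; first by apply: contM; [exact: cont_chx|exact: cont_W].
by apply: contM; [exact: cont_chi|exact: cont_Wx].
Qed.

Let cont_Vy N p : upper p -> contc (Vy N) p.
Proof.
move=> up; apply: contD; first by apply: contM; [exact: cont_chy|exact: cont_W].
by apply: contM; [exact: cont_chi|exact: cont_Wy].
Qed.

Let pos_out N x y : 0 < N -> 0 < y ->
  ~ ((- (4 * expR N) < x < 4 * expR N) /\ ((4 * expR N)^-1 < y < 4 * expR N)) ->
  pos (u N (x, y)) = 0.
Proof.
move=> N0 y0 out; apply: pos_0; rewrite /u /= subr_le0 ler_pdivlMr// mul1r leNgt.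
by apply/negP => /(dst_proper y0)[]; move=> *; apply: out.
Qed.

(** [chi N * W] has compact support, so that the integrals of its partial
    derivatives vanish. *)
Let exact_zero N : 0 < N -> cint leb2 upper (fun p => Vx N p + 'i * Vy N p) = 0.
Proof.
move=> N0; set X := 4 * expR N; have e0 : 0 < X by rewrite mulr_gt0 ?expR_gt0.
have e1 : 1 <= expR N by rewrite -expR0 ler_expR ltW.
have X1 : 1 <= X by rewrite /X; lra.
have iX : X^-1 <= X by apply: (le_trans _ X1); rewrite invf_le1.
have iX0 : 0 < X^-1 by rewrite invr_gt0.
have XX : - X <= X by lra.
have up x y : X^-1 <= y <= X -> upper (x, y).
  by move=> /andP[y1 _]; rewrite /upper /=; lra.
have cx s t : - X <= s <= X -> X^-1 <= t <= X -> contc (Vx N) (s, t).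
  by move=> _ /(up s); exact: cont_Vx.
have cy s t : - X <= s <= X -> X^-1 <= t <= X -> contc (Vy N) (s, t).
  by move=> _ /(up s); exact: cont_Vy.
rewrite (@cint_supported (`[- X, X] `*` `[X^-1, X])); last 3 first.
- by apply: measurableX; exact: measurable_itv.
- by move=> [x y] [_ /=]; rewrite in_itv; exact: up.
- move=> [x y] uxy out; have p0 : pos (u N (x, y)) = 0.
    apply: pos_out => // -[/andP[x1 x2] /andP[y1 y2]]; apply: out.
    by split; rewrite /= in_itv /= !ltW.
  by rewrite /Vx /Vy /chx /chy /chi p0 expr0n /= !(mulr0, mul0r, oppr0, addr0).
rewrite cintD; last 3 first.
- by apply: measurableX; exact: measurable_itv.
- exact: cintegrable_rect.
- apply: cintegrableZ; first by apply: measurableX; exact: measurable_itv.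
  exact: cintegrable_rect.
rewrite cintZ; last 2 first.
- by apply: measurableX; exact: measurable_itv.
- exact: cintegrable_rect.
rewrite cint_rect2// cint_rect1//.
have -> : cint leb `[X^-1, X] (fun t => cint leb `[- X, X] (fun s => Vx N (s, t))) = 0.
  rewrite -[RHS](cint0 leb `[X^-1, X]); apply: eq_cint_itv => t tt.
  have t0 : 0 < t by have := up 0 t tt.
  rewrite (@cint_derivative R (- X) X _ (fun s => (chi N (s, t))%:C * W (s, t)) XX).
  - have z s : s = X \/ s = - X -> chi N (s, t) = 0.
      move=> sX; rewrite /chi pos_out ?expr0n//; rewrite -/X => -[/andP[s1 s2] _].
      by case: sX => e; move: s1 s2; rewrite e; lra.
    by rewrite !z ?mul0r ?subrr//; [right|left].
  - by move=> s ss; apply: cont_slice2; exact: cx.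
  - by move=> s ss; exact: (has_slopeM (contreal s) (vder_chx N s t0) (vder_Wx s t0)).
have -> : cint leb `[- X, X] (fun s => cint leb `[X^-1, X] (fun t => Vy N (s, t))) = 0.
  rewrite -[RHS](cint0 leb `[- X, X]); apply: eq_cint_itv => s ss.
  rewrite (@cint_derivative R X^-1 X _ (fun t => (chi N (s, t))%:C * W (s, t)) iX).
  - have z t : 0 < t -> t = X \/ t = X^-1 -> chi N (s, t) = 0.
      move=> t0 tX; rewrite /chi pos_out ?expr0n//; rewrite -/X => -[_ /andP[t1 t2]].
      by case: tX => e; move: t1 t2; rewrite e; lra.
    by rewrite !z ?mul0r ?subrr//; [right|left].
  - by move=> t tt; apply: cont_slice1; exact: cy.
  - move=> t tt; have t0 : 0 < t by have := up 0 t tt.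
    exact: (has_slopeM (contreal t) (vder_chy N s t0) (vder_Wy s t0)).
by rewrite mulr0 addr0.
Qed.

Let nc_B p : upper p -> nc (B p) <= `|mu - sig| + `|sig|.
Proof.
move=> up; have hz := toC_halfplane up; rewrite /B (le_trans (ncD _ _))// !ncM !ncR nci mul1r.
rewrite lerD2l -mulrA ler_piMr//.
rewrite /kap ker1// ncV ncM ncN nci mul1r ler_pdivrMr ?mul1r; last first.
  by apply: hp_nc; exact: hpB.
rewrite -(ler_pXn2r (n := 2)) ?nnegrE ?nc_ge0// !sqr_nc /toC.
have iw : 0 < Im w by []. have iz : 0 < p.2 by [].
by case: (w) iw => a b /=; nra.
Qed.

Let mU := @measurable_upper R.

Let contc_meas (f : R * R -> C) : (forall p, upper p -> contc f p) ->
  cmeasurable (upper : set (RM * RM)) f.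
Proof.
by move=> cf; split; apply: measurable_cont2 mU _ => p /cf; [exact: contc_Re|exact: contc_Im].
Qed.

Hypothesis iH : cintegrable leb2 upper H1.
Let inH := cintegrable_nc mU iH.
Let HB p := H1 p * B p.

Let cont_HB p : upper p -> contc HB p.
Proof. by move=> up; apply: contM; [exact: cont_H1|exact: cont_B]. Qed.

Let iHB : cintegrable leb2 upper HB.
Proof.
apply: (cintegrable_le mU _ (integrableRZ (`|mu - sig| + `|sig|) mU inH)).
  exact: contc_meas cont_HB.
by move=> p up; rewrite /HB ncM mulrC; apply: ler_wpM2r; [exact: nc_ge0|exact: nc_B].
Qed.
Let inHB := cintegrable_nc mU iHB.

Let pos01 N p : 0 < N -> upper p -> 0 <= pos (u N p) <= 1.
Proof.
move=> N0 up; rewrite pos_ge0 /=; have d0 := @dst_ge0 R p.1 p.2 up.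
have u1 : u N p <= 1 by rewrite /u gerBl divr_ge0// ltW.
by have [u0|u0] := leP 0 (u N p); [rewrite pos_id|rewrite pos_0// ltW].
Qed.

Let chi01 N p : 0 < N -> upper p -> 0 <= chi N p <= 1.
Proof.
move=> N0 up; have /andP[u0 u1] := pos01 N0 up; rewrite /chi sqr_ge0 /=.
exact: exprn_ile1.
Qed.

Let Dn N p := (chx N p)%:C * W p + 'i * ((chy N p)%:C * W p).
Let En N p := (chi N p)%:C * ('i * HB p).

(** The gradient of [dst] is at most [y^-1], and [y^-1] times [W] is [H1] in
    modulus; therefore the term with the derivatives of the cutoff is small
    although [H1] is merely integrable. *)
Let nc_Dn N p : 0 < N -> upper p -> nc (Dn N p) <= 2 / N * nc (H1 p).
Proof.
move=> N0 up; have y0 : 0 < p.2 by []. have /andP[u0 u1] := pos01 N0 up.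
set gr := (dst_x p.1 p.2) +i* (dst_y p.1 p.2).
have eW : H1 p * p.2%:C = W p by rewrite /H1 /W (epow_pred mu y0) RMC; ring.
have -> : Dn N p = - (2 * pos (u N p) / N)%:C * (gr * (H1 p * p.2%:C)).
  rewrite eW /Dn /chx /chy; have -> : gr = (dst_x p.1 p.2)%:C + 'i * (dst_y p.1 p.2)%:C.
    by apply: eqC => /=; ring.
  by rewrite !RNC !RMC; ring.
have g := dst_grad p.1 y0; rewrite -/gr in g.
have -> : nc (- (2 * pos (u N p) / N)%:C * (gr * (H1 p * p.2%:C))) =
    2 * pos (u N p) / N * (nc gr * (nc (H1 p) * p.2)).
  rewrite (ncM (- _)) (ncM gr) (ncM (H1 p)) ncN !ncR (ger0_norm (ltW y0)) ger0_norm//.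
  by apply: divr_ge0; [apply: mulr_ge0|exact: ltW].
have n1 := nc_ge0 (H1 p); have n2 := nc_ge0 gr.
move: (nc (H1 p)) (nc gr) (pos (u N p)) (p.2) n1 n2 u0 u1 y0 g => h q r y h0 q0 r0 r1 y0 g.
have qy : q * y <= 1 by rewrite -ler_pdivlMr// div1r.
have iN : 0 <= N^-1 by rewrite invr_ge0 ltW.
have -> : 2 * r / N * (q * (h * y)) = (r * (q * y)) * (2 / N * h) by ring.
apply: ler_piMl; first by apply: mulr_ge0 => //; apply: mulr_ge0.
by apply: mulr_ile1 => //; apply: mulr_ge0 => //; exact: ltW.
Qed.

Let stokes_bound N : 0 < N -> nc (cint leb2 upper HB) <=
  \int[leb2]_(p in upper) ((1 - chi N p) * nc (HB p)) +
  2 / N * \int[leb2]_(p in upper) nc (H1 p).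
Proof.
move=> N0.
have DE p : upper p -> Vx N p + 'i * Vy N p = Dn N p + En N p.
  by move=> up; rewrite /En /HB -WE// /Dn /Vx /Vy; ring.
have iD : cintegrable leb2 upper (Dn N).
  apply: (cintegrable_le mU _ (integrableRZ (2 / N) mU inH)) => [|p up].
    apply: contc_meas => p up; apply: contD.
      by apply: contM; [exact: cont_chx|exact: cont_W].
    by apply: contM; [exact: contC|apply: contM; [exact: cont_chy|exact: cont_W]].
  exact: nc_Dn.
have iI : cintegrable leb2 upper (fun p => 'i * HB p) by exact: cintegrableZ.
have niHB p : nc ('i * HB p) = nc (HB p) by rewrite (ncM 'i) nci mul1r.
have nEn p : upper p -> nc (En N p) = chi N p * nc (HB p).
  move=> up; have /andP[c0 c1] := chi01 N0 up.
  by rewrite /En (ncM (chi N p)%:C) niHB ncR (ger0_norm c0).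
have iE : cintegrable leb2 upper (En N).
  apply: (cintegrable_le mU _ inHB) => [|p up].
    apply: contc_meas => p up; apply: contM; first exact: cont_chi.
    by apply: contM; [exact: contC|exact: cont_HB].
  have /andP[c0 c1] := chi01 N0 up.
  by rewrite nEn//; apply: ler_piMl; [exact: nc_ge0|].
have := exact_zero N0; rewrite (eq_cint leb2 (g := fun p => Dn N p + En N p) DE) cintD//.
move=> /eqP; rewrite addrC addr_eq0 => /eqP ED.
have -> : nc (cint leb2 upper HB) = nc (cint leb2 upper (fun p => 'i * HB p)).
  by rewrite cintZ// (ncM 'i) nci mul1r.
have -> : cint leb2 upper (fun p => 'i * HB p) =
    cint leb2 upper (fun p => 'i * HB p - En N p) + cint leb2 upper (En N).
  by rewrite cintB// subrK.
apply: le_trans (ncD _ _) _; apply: lerD.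
  apply: (nc_cint_bound mU (cintegrableB mU iI iE)).
    apply: (integrableR_le mU _ inHB).
      apply: measurable_funM; last by apply: measurable_nc; exact: contc_meas cont_HB.
      apply: measurable_cont2 mU _ => p up; apply: cvgB; first exact: cvg_cst.
      by apply: cvgM; exact: cont_u.
    move=> p up; have /andP[c0 c1] := chi01 N0 up.
    have n0 := nc_ge0 (HB p); rewrite ger0_norm; last by apply: mulr_ge0 => //; lra.
    by apply: ler_piMl => //; lra.
  move=> p up; have /andP[c0 c1] := chi01 N0 up.
  have -> : 'i * HB p - En N p = (1 - chi N p)%:C * ('i * HB p) by rewrite /En RBC; ring.
  by rewrite (ncM (1 - chi N p)%:C) niHB ncR ger0_norm// subr_ge0.
rewrite ED ncN -RintegralZl//.
apply: (nc_cint_bound mU iD (integrableRZ _ mU inH)) => p; exact: nc_Dn.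
Qed.

Let chi_lim p : upper p -> chi n.+1%:R p @[n --> \oo] --> (1 : R).
Proof.
move=> up; have iN : (n.+1%:R : R)^-1 @[n --> \oo] --> (0 : R) by exact: cvg_harmonic.
have ul : u n.+1%:R p @[n --> \oo] --> (1 : R).
  rewrite -[X in _ --> X](subr0 (1 : R)) -[X in _ --> _ - X](mulr0 (dst p.1 p.2)).
  by apply: cvgB; [exact: cvg_cst|apply: cvgM; [exact: cvg_cst|exact: iN]].
have pl : pos (u n.+1%:R p) @[n --> \oo] --> (1 : R).
  rewrite -[X in _ --> X](@pos_id R 1)//; apply: cvgMl; apply: cvgD => //.
  exact: cvg_norm.
by rewrite -[X in _ --> X](mulr1 (1 : R)); apply: cvgM.
Qed.

Let tail_lim : \int[leb2]_(p in upper) ((1 - chi n.+1%:R p) * nc (HB p)) @[n --> \oo] --> (0 : R).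
Proof.
pose F (n : nat) (p : RM * RM) : \bar R := ((1 - chi n.+1%:R p) * nc (HB p))%:E.
have N0 (n : nat) : (0 : R) < n.+1%:R by rewrite ltr0n.
have mF n : measurable_fun (upper : set (RM * RM)) (F n).
  apply/measurable_EFinP; apply: measurable_funM; last first.
    by apply: measurable_nc; exact: contc_meas cont_HB.
  apply: measurable_cont2 mU _ => p up; apply: cvgB; first exact: cvg_cst.
  by apply: cvgM; exact: cont_u.
have limF : {ae leb2, forall p, upper p -> F n p @[n --> \oo] --> 0%E}.
  apply: aeW => p up; apply: cvg_EFin; first exact: nearW.
  rewrite -[X in _ --> X](mul0r (nc (HB p))); apply: cvgMl.
  rewrite -[X in _ --> X](subrr (1 : R)); apply: cvgB; first exact: cvg_cst.
  exact: chi_lim.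
have bF n p : upper p -> 0 <= (1 - chi n.+1%:R p) * nc (HB p) <= nc (HB p).
  move=> up; have /andP[c0 c1] := chi01 (N0 n) up; have n0 := nc_ge0 (HB p).
  apply/andP; split; first by apply: mulr_ge0 => //; lra.
  by apply: ler_piMl => //; lra.
have domF : {ae leb2, forall p (n : nat), upper p -> (`|F n p| <= (EFin \o (fun p => nc (HB p))) p)%E}.
  apply: aeW => p n up; have /andP[b0 b1] := bF n p up.
  by rewrite /F /= lee_fin ger0_norm.
have [_ _] := dominated_convergence mU mF (measurable_cst 0%E) limF inHB domF.
rewrite integral0 => /fine_cvgP[_].
by [].
Qed.

(** Stokes' theorem on the half-plane without boundary terms, under the sole
    hypothesis that [H1] is integrable. As [N] tends to infinity the term
    with the derivatives of the cutoff vanishes by [nc_Dn], and the other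
    term converges by dominated convergence. *)
Lemma stokes : cint leb2 upper (fun p => G (toC p) * ker sig (toC p) w *
   (epow (mu - 1) p.2)%:C * ((mu - sig)%:C + 'i * sig%:C * (toC p - w) * ker 1 (toC p) w)) = 0.
Proof.
rewrite -[LHS]/(cint leb2 upper HB).
set K := \int[leb2]_(p in upper) nc (H1 p).
have lim : (\int[leb2]_(p in upper) ((1 - chi n.+1%:R p) * nc (HB p)) + 2 * n.+1%:R^-1 * K)
    @[n --> \oo] --> (0 : R).
  have l2 : 2 * n.+1%:R^-1 * K @[n --> \oo] --> (2 * 0 * K : R).
    by apply: cvgMl; apply: cvgM; [exact: cvg_cst|exact: cvg_harmonic].
  have e : 0 + 2 * 0 * K = 0 :> R by ring.
  by rewrite -[X in _ --> X]e; exact: cvgD tail_lim l2.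
have : nc (cint leb2 upper HB) <= 0.
  apply: (ler_cvg_to (cvg_cst (nc (cint leb2 upper HB))) lim).
  by apply: nearW => n; apply: stokes_bound; rewrite ltr0n.
by move=> h; apply/eqP; rewrite -nc_eq0 eq_le h nc_ge0.
Qed.
End Stokes.

(** * The reproducing formula *)

Section Bergman.
Context {R : realType}.
Local Notation C := (R[i]).
Local Notation leb := (@lebesgue_measure R).
Local Notation leb2 := (leb \x leb)%E.
Local Notation RM := (measurableTypeR R).

Lemma sqn_gt0 {d : measure_display} {T : measurableType d} (mu : {measure set T -> \bar R})
    (D A : set T) (w : T -> R) (f : T -> C) :
  measurable D -> measurable_fun D w -> (forall x, D x -> 0 <= w x) ->
  measurable A -> A `<=` D -> (0 < mu A)%E ->
  (forall x, A x -> 0 < w x /\ f x != 0) -> L2 mu D w f -> 0 < sqn mu D w f.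
Proof.
move=> mD mw w0 mA AD A0 nz [mf fi].
rewrite lt_neqAle sqn_ge0// andbT eq_sym; apply/eqP => s0.
have e0 : (\int[mu]_(x in D) `|(nc (f x) ^+ 2 * w x)%:E| = 0)%E.
  rewrite (eq_integral (fun x => (nc (f x) ^+ 2 * w x)%:E)); last first.
    by move=> x /set_mem Dx; rewrite /= ger0_norm// mulr_ge0 ?sqr_ge0 ?w0.
  rewrite -[LHS]fineK; last by apply: integrable_fin_num.
  by rewrite -[fine _]/(sqn mu D w f) s0.
have mF : measurable_fun D (fun x => (nc (f x) ^+ 2 * w x)%:E).
  by apply/measurable_EFinP; exact: integrableR_measurable fi.
have [N [mN N0 sN]] := (ae_eq_integral_abs mu mD mF).1 e0.
have AN : A `<=` N.
  move=> x Ax; apply: sN => /(_ (AD _ Ax)) /=; have [wx fx] := nz x Ax.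
  move=> [/eqP]; rewrite mulf_eq0 sqrf_eq0 nc_eq0 (negbTE fx) /= gt_eqF//.
have : (mu A <= 0)%E by rewrite -N0; apply: le_measure; rewrite ?inE.
by move=> /(lt_le_trans A0); rewrite ltxx.
Qed.

Lemma measurable_box (a b c d : R) : measurable ((`[a, b] `*` `[c, d])%classic : set (RM * RM)).
Proof. by apply: measurableX; exact: measurable_itv. Qed.

Lemma box_measure (a b c d : R) : a <= b -> c <= d ->
  leb2 (`[a, b] `*` `[c, d] : set (RM * RM))%classic = ((b - a) * (d - c))%:E.
Proof.
move=> ab cd; rewrite EFinM -(leb_itv ab) -(leb_itv cd).
by apply: product_measure1E; exact: measurable_itv.
Qed.

Lemma box_upper (a b c d : R) : 0 < c -> (`[a, b] `*` `[c, d])%classic `<=` (upper : set (R * R)).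
Proof. by move=> c0 [x y] [_ /=]; rewrite in_itv /upper /= => /andP[+ _]; exact: lt_le_trans. Qed.

Variable lam : R.
Hypothesis l1 : 1 < lam.
Let mU := @measurable_upper R.
Let mw := @measurable_weight R lam.
Let w0 (p : RM * RM) : upper p -> 0 <= weight lam p. Proof. by move=> _; exact: weight_ge0. Qed.

Definition L2up (f : C -> C) := L2 leb2 (upper : set (RM * RM)) (weight lam) (fun p => f (toC p)).
Definition ipup (f g : C -> C) :=
  ip leb2 (upper : set (RM * RM)) (weight lam) (fun p => f (toC p)) (fun p => g (toC p)).
Definition sqnup (f : C -> C) := sqn leb2 (upper : set (RM * RM)) (weight lam) (fun p => f (toC p)).

Lemma L2up_ker s w : lam <= s -> halfplane w -> L2up (ker s w).
Proof.
move=> ls hw; split; first by apply: cmeasurable_hol; exact: hol_ker.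
by apply: integrable_ker => //; rewrite l1.
Qed.

Lemma sqnup_ker_gt0 w : halfplane w -> 0 < sqnup (ker lam w).
Proof.
move=> hw; apply: (@sqn_gt0 _ _ leb2 _ (`[0, 1] `*` `[1, 2])%classic) => //.
- exact: measurable_box.
- exact: box_upper.
- have h01 : (0 : R) <= 1 by []. have h12 : (1 : R) <= 2 by rewrite ler1n.
  rewrite [X in (_ < X)%E](_ : _ = ((1 - 0) * (2 - 1))%:E); last exact: box_measure.
  by rewrite lte_fin; lra.
- move=> p /(box_upper ltr01) up; split; first by rewrite weightE// epow_gt0.
  exact: ker_neq0.
- exact: L2up_ker.
Qed.

(** The integrand of a pairing with a kernel, in the form in which Stokes'
    theorem produces it. *)
Lemma ip_kerE s w (f : C -> C) : ipup f (ker s w) =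
  cint leb2 (upper : set (RM * RM)) (fun p => f (toC p) * ker s (toC p) w * (epow (lam - 2) p.2)%:C).
Proof.
by apply: eq_cint => p up; rewrite ker_herm weightE.
Qed.

Let l2E : lam - 1 - 1 = lam - 2. Proof. ring. Qed.

Section Orthogonality.
Variables (w : C) (F g : C -> C).
Hypotheses (hw : halfplane w) (hg : hol g) (LF : L2up F).
Hypothesis Fg : forall z, F z = (z - w) * g z.

(** Away from [w] the quotient of [z - w^*] by [z - w] is bounded and [g] is
    a multiple of [F]; near [w] everything is bounded and the kernel is
    bounded below. *)
Let bound : exists K : R, forall z, halfplane z ->
  nc (g z * ker (lam - 1) z w) <= K * (nc (F z) ^+ 2 + nc (ker lam w z) ^+ 2).
Proof.
have iw : 0 < Im w by []. have ll := l1.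
have /contcP/(_ 1 ltr01)/nbhsCP[r0 r00 Hr] := hol_contc hg hw.
(* [r] is the radius of the neighbourhood of [w] on which [g] is bounded by
   [M]; there [I2] bounds [z - w^*] and [m0] bounds the kernel from below. *)
pose r := Num.min r0 1; have rp : 0 < r by rewrite lt_min r00 ltr01.
pose M := nc (g w) + 1; pose I2 := 1 + 2 * Im w; pose m0 := epow (- lam) I2.
have m0p : 0 < m0 by exact: epow_gt0.
have M0 : 0 <= M by rewrite /M addr_ge0 ?nc_ge0.
exists (M * I2 / m0 + (1 + 2 * Im w / r)) => z hz.
have zw : nc (z - w^*) <= nc (z - w) + 2 * Im w.
  have -> : z - w^* = (z - w) + 'i * (2 * Im w)%:C.
    by case: (z) (w) => a b [e d]; apply: eqC => /=; ring.
  by rewrite (le_trans (ncD _ _))// (ncM 'i) nci mul1r ncR ger0_norm//; lra.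
have zw0 : 0 < nc (z - w^*) by apply: hp_nc; exact: hpB.
have kE : nc (ker (lam - 1) z w) = nc (ker lam w z) * nc (z - w^*).
  rewrite -(ker_herm (lam - 1) w z) nc_conj !nc_ker.
  by rewrite (epow_pred (- (lam - 1)) zw0) (_ : - (lam - 1) - 1 = - lam)//; ring.
set k := nc (ker lam w z) in kE *; have k0 : 0 < k by rewrite nc_gt0 ker_neq0.
rewrite ncM kE; have f0 := nc_ge0 (F z); have g0 := nc_ge0 (g z).
have A0 : 0 <= M * I2 / m0 by rewrite divr_ge0 ?mulr_ge0 ?(ltW m0p)// /I2; lra.
have B0 : 0 <= 1 + 2 * Im w / r by rewrite addr_ge0// divr_ge0 ?(ltW rp)//; lra.
have [zr|zr] := ltP (nc (z - w)) r.
  have gM : nc (g z) <= M.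
    have zr0 : nc (z - w) < r0 by rewrite (lt_le_trans zr)// ge_min lexx.
    have := Hr z zr0; have := ncDB (g z) (g w); rewrite /M; lra.
  have r1 : r <= 1 by rewrite ge_min lexx orbT.
  have zI : nc (z - w^*) <= I2 by rewrite /I2; lra.
  have km : m0 <= k.
    by rewrite /k nc_ker /m0; apply: ler_epowN => //; lra.
  apply: (@le_trans _ _ (M * I2 / m0 * k ^+ 2)).
    have -> : M * I2 / m0 * k ^+ 2 = M * I2 * k * (k / m0) by rewrite expr2; ring.
    apply: (@le_trans _ _ (M * I2 * k)).
      have -> : nc (g z) * (k * nc (z - w^*)) = nc (g z) * nc (z - w^*) * k by ring.
      by rewrite ler_pM2r//; apply: ler_pM => //; exact: ltW.
    rewrite ler_peMr//; first by rewrite !mulr_ge0 ?(ltW k0)// /I2; lra.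
    by rewrite ler_pdivlMr// mul1r.
  by apply: ler_pM => //; [exact: sqr_ge0|rewrite lerDl|rewrite lerDr sqr_ge0].
have zn : 0 < nc (z - w) by lra.
have gE : nc (g z) = nc (F z) / nc (z - w) by rewrite Fg ncM mulrAC divff ?gt_eqF// mul1r.
have q : nc (z - w^*) / nc (z - w) <= 1 + 2 * Im w / r.
  rewrite ler_pdivrMr// mulrDl mul1r (le_trans zw)// lerD2l mulrAC ler_pdivlMr//.
  by rewrite ler_wpM2l//; lra.
have -> : nc (g z) * (k * nc (z - w^*)) = nc (F z) * k * (nc (z - w^*) / nc (z - w)).
  by rewrite gE; ring.
have fk : nc (F z) * k <= nc (F z) ^+ 2 + k ^+ 2 by nra.
apply: (@le_trans _ _ ((nc (F z) ^+ 2 + k ^+ 2) * (1 + 2 * Im w / r))).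
  apply: ler_pM => //; first by rewrite mulr_ge0// ltW.
  by rewrite divr_ge0// ltW.
by rewrite mulrC; apply: ler_wpM2r; [rewrite addr_ge0 ?sqr_ge0|rewrite lerDr].
Qed.

(** Let [F = (z - w) * g]. Up to a constant, the integrand of the pairing of
    [F] with the kernel is the one of [stokes] for the function [g] and the
    exponent [lam - 1], in which [mu = sig]. *)
Lemma orthogonal_vanishing : ipup F (ker lam w) = 0.
Proof.
have [K HK] := bound; have ll := l1.
have LK := L2up_ker (lexx lam) hw.
have cm : cmeasurable (upper : set (RM * RM)) (fun p => ker (lam - 1) (toC p) w).
  apply: (@cmeasurable_eq _ _ _ _ (fun p : RM * RM => (ker (lam - 1) w (toC p))^*)).
    by move=> p _; exact: ker_herm.
  by apply: cmeasurable_conj; apply: cmeasurable_hol; exact: hol_ker.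
have iH : cintegrable leb2 (upper : set (RM * RM)) (fun p : RM * RM =>
    g (toC p) * ker (lam - 1) (toC p) w * (epow (lam - 1 - 1) p.2)%:C).
  rewrite l2E; apply: (cintegrable_le mU _ (integrableRZ K mU (integrableRD mU LF.2 LK.2))).
    apply: (@cmeasurable_eq _ _ _ _ (fun p : RM * RM =>
      g (toC p) * ker (lam - 1) (toC p) w * (weight lam p)%:C)).
      by move=> p up; rewrite weightE.
    apply: cmeasurableM; last exact: cmeasurableR mw.
    by apply: cmeasurableM => //; exact: cmeasurable_hol.
  move=> p up; rewrite ncM ncR -weightE// ger0_norm ?weight_ge0// -mulrDl mulrA.
  apply: ler_wpM2r; first exact: weight_ge0.
  exact: HK.
have := stokes hg hw iH; rewrite l2E ip_kerE.
have l0 : 'i * (lam - 1)%:C != 0 :> C.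
  rewrite mulf_neq0 ?neq0Ci//; apply/eqP => /(congr1 (@complex.Re R)) /=; lra.
rewrite subrr => H; apply: (mulfI l0); rewrite mulr0 -[RHS]H -cintZ//; last first.
  apply: (cintegrable_eq mU _ (cintegrable_ip mU mw w0 LF LK)) => p up.
  by rewrite ker_herm weightE.
apply: eq_cint => p up; rewrite Fg; have -> : ker lam (toC p) w = ker (lam - 1) (toC p) w * ker 1 (toC p) w.
  by rewrite -kerD subrK.
by ring.
Qed.
End Orthogonality.

Lemma L2up_sub_ker f (c : C) w : L2up f -> halfplane w -> L2up (fun z => f z - c * ker lam w z).
Proof.
move=> Lf hw; apply: L2_sub => //; apply: L2_scale => //; exact: L2up_ker.
Qed.

(** Subtracting a multiple of the kernel makes [f] vanish at [w]. *)
Lemma reproducing_at f w : hol f -> L2up f -> halfplane w ->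
  ipup f (ker lam w) = (sqnup (ker lam w))%:C / ker lam w w * f w.
Proof.
move=> hf Lf hw; have hk := hol_ker lam hw.
have LK := L2up_ker (lexx lam) hw.
pose c := f w / ker lam w w.
have hF : hol (fun z => f z - c * ker lam w z).
  by move=> z hz; have [a Ha] := hf z hz; have [b Hb] := hk z hz;
    exists (a - c * b); apply: has_slopeB => //; exact: has_slopeZ.
have F0 : f w - c * ker lam w w = 0 by rewrite /c divfK ?ker_neq0// subrr.
have [g hg Fg] := removable hF hw F0.
have := orthogonal_vanishing hw hg (L2up_sub_ker c Lf hw) Fg.
rewrite /ipup ip_sub// ?ip_scale//; last by apply: L2_scale.
rewrite ip_sqn => /eqP; rewrite subr_eq0 => /eqP ->.
by rewrite /c -/(sqnup (ker lam w)); ring.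
Qed.

Definition bergman_cst : R := sqnup (ker lam 'i) / Re (ker lam 'i 'i).

Lemma ker_diag_gt0 s (w : C) : halfplane w -> 0 < Re (ker s w w).
Proof. by move=> hw; rewrite ker_diag//= epow_gt0. Qed.

Lemma bergman_cst_gt0 : 0 < bergman_cst.
Proof. by rewrite divr_gt0 ?sqnup_ker_gt0 ?ker_diag_gt0//; exact: halfplane_i. Qed.

(** The constant of [reproducing_at] is the same at all points: pairing two
    kernels in both orders compares the constants at their points. *)
Lemma reproducing f w : hol f -> L2up f -> halfplane w ->
  ipup f (ker lam w) = bergman_cst%:C * f w.
Proof.
move=> hf Lf hw; rewrite reproducing_at//; congr (_ * _).
have hi := @halfplane_i R.
pose c v := (sqnup (ker lam v))%:C / ker lam v v.
have cR v : halfplane v -> c v = (sqnup (ker lam v) / Re (ker lam v v))%:C.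
  by move=> hv; rewrite /c {1}ker_diag// RMC RVC ker_diag.
rewrite -/(c w) /bergman_cst cR//.
have Lw := L2up_ker (lexx lam) hw; have Li := L2up_ker (lexx lam) hi.
have e1 := reproducing_at (hol_ker lam hi) Li hw.
have e2 := reproducing_at (hol_ker lam hw) Lw hi.
have e3 : ipup (ker lam w) (ker lam 'i) = (ipup (ker lam 'i) (ker lam w))^* by exact: ip_conj.
move: e3; rewrite e1 e2 -/(c w) -/(c 'i) !cR// => e3.
have e4 : ((sqnup (ker lam w) / Re (ker lam w w))%:C * ker lam 'i w)^* =
  (sqnup (ker lam w) / Re (ker lam w w))%:C * ker lam w 'i.
  by rewrite -[ker lam w 'i]ker_herm; case: (ker lam 'i w) => a b; apply: eqC => /=; ring.
by apply: (mulIf (ker_neq0 lam w 'i)); rewrite [RHS]e3.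
Qed.

(** For a kernel of exponent [lam] this is the reproducing formula. Stokes'
    theorem for a kernel of exponent [lam + b] relates the pairings with
    exponents ([a + 1], [b + 1]), ([a + 1], [b]) and ([a], [b + 1]), which
    gives the general case by induction. *)
Lemma ker_pairing (a b : nat) : exists c : R, forall w' w, halfplane w' -> halfplane w ->
  ipup (ker (lam + a%:R) w') (ker (lam + b%:R) w) = c%:C * ker (lam + a%:R + b%:R) w' w.
Proof.
have Lk (n : nat) v : halfplane v -> L2up (ker (lam + n%:R) v).
  by move=> hv; apply: L2up_ker => //; rewrite lerDl.
have base (n : nat) w' w : halfplane w' -> halfplane w ->
    ipup (ker (lam + n%:R) w') (ker lam w) = bergman_cst%:C * ker (lam + n%:R) w' w.
  by move=> hw' hw; apply: reproducing => //; [exact: hol_ker|exact: Lk].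
have ll := l1; elim: a b => [|a IHa] b.
  exists bergman_cst => w' w hw' hw; rewrite addr0.
  have Lk0 := L2up_ker (lexx lam) hw'.
  have -> : ipup (ker lam w') (ker (lam + b%:R) w) = (ipup (ker (lam + b%:R) w) (ker lam w'))^*.
    by apply: ip_conj => //; exact: Lk.
  by rewrite base// -(ker_herm _ w w'); case: (ker _ w w') => x y; apply: eqC => /=; ring.
elim: b => [|b [c1 IHb]].
  by exists bergman_cst => w' w hw' hw; rewrite !addr0; exact: base.
have [c2 IH] := IHa b.+1.
pose sig : R := lam + b%:R.
have sig0 : 0 < sig by rewrite /sig ltr_wpDr//; lra.
exists (c2 + b.+1%:R / sig * c1) => w' w hw' hw.
have La := Lk a w' hw'; have La1 := Lk a.+1 w' hw'; have Lb := Lk b w hw; have Lb1 := Lk b.+1 w hw.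
have hG := hol_ker (lam + a.+1%:R) hw'.
have ii s t (f := ker s w') (g := ker t w) : L2up f -> L2up g -> cintegrable leb2 (upper : set (RM * RM))
    (fun p : RM * RM => f (toC p) * ker t (toC p) w * (epow (lam - 2) p.2)%:C).
  move=> Lf Lg; apply: (cintegrable_eq mU _ (cintegrable_ip mU mw w0 Lf Lg)) => p up.
  by rewrite ker_herm weightE.
have iH : cintegrable leb2 (upper : set (RM * RM)) (fun p : RM * RM =>
    ker (lam + a.+1%:R) w' (toC p) * ker sig (toC p) w * (epow (lam - 1 - 1) p.2)%:C).
  by rewrite l2E; exact: ii.
have := stokes hG hw iH; rewrite l2E.
have k0 := ker_neq0 1 w' w.
have eE : 'i * (w - w'^*) = - (ker 1 w' w)^-1.
  by rewrite ker1// invrK mulNr opprK.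
have i2 : 'i * 'i = -1 :> C by rewrite -expr2 sqr_i.
rewrite (eq_cint leb2 (g := fun p : RM * RM =>
    (- b.+1%:R)%:C * (ker (lam + a.+1%:R) w' (toC p) * ker (lam + b%:R) (toC p) w * (epow (lam - 2) p.2)%:C) +
    (sig%:C / ker 1 w' w * (ker (lam + a.+1%:R) w' (toC p) * ker (lam + b.+1%:R) (toC p) w * (epow (lam - 2) p.2)%:C) -
     sig%:C * (ker (lam + a%:R) w' (toC p) * ker (lam + b.+1%:R) (toC p) w * (epow (lam - 2) p.2)%:C)))); last first.
  move=> p up; have hz := toC_halfplane up.
  rewrite -(natr1 a) -(natr1 b) !addrA !(kerD _ 1) -/sig.
  have -> : lam - 1 - sig = - (b%:R + 1) by rewrite /sig; ring.
  have eZ : 'i * (toC p - w) * ker 1 w' (toC p) = (ker 1 w' w)^-1 * ker 1 w' (toC p) - 1.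
    have k1 := ker_neq0 1 w' (toC p).
    have -> : (ker 1 w' w)^-1 = - 'i * (w - w'^*) by rewrite mulNr eE opprK.
    have e1 : - 'i * (toC p - w'^*) * ker 1 w' (toC p) = 1.
      by rewrite -(invrK (- 'i * _)) -ker1// mulVf.
    by rewrite -[X in _ = _ - X]e1; ring.
  move: eZ; move: (ker 1 w' (toC p)) (ker 1 w' w)^-1 => k1 q eZ.
  rewrite -/sig; set k := ker _ w' _; set kk := ker sig _ w; set k1' := ker 1 _ w.
  set e := (epow _ _)%:C.
  transitivity (k * kk * e * ((- (b%:R + 1))%:C * k1) + sig%:C * (k * kk * e * k1') * ('i * (toC p - w) * k1)).
    by ring.
  by rewrite eZ; ring.
rewrite cintD//; last 2 first.
- by apply: cintegrableZ => //; exact: ii.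
- by apply: cintegrableB => //; apply: cintegrableZ => //; exact: ii.
rewrite cintB//; try by apply: cintegrableZ => //; exact: ii.
rewrite !cintZ//; try exact: ii.
rewrite -!ip_kerE IH// IHb// => H.
have s0 : sig%:C != 0 :> C by apply/eqP => /(congr1 (@complex.Re R)) /=; lra.
have r1 : lam + a%:R + b.+1%:R + 1 = lam + a.+1%:R + b.+1%:R by rewrite -(natr1 a); ring.
have r2 : lam + a.+1%:R + b%:R = lam + a%:R + b.+1%:R by rewrite -(natr1 a) -(natr1 b); ring.
have eK1 : ker (lam + a.+1%:R + b.+1%:R) w' w = ker (lam + a%:R + b.+1%:R) w' w * ker 1 w' w.
  by rewrite -r1 kerD.
have s1 : sig%:C / ker 1 w' w != 0 by rewrite mulf_neq0 ?invr_neq0.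
apply: (mulfI s1); set I := ipup _ _ in H *.
have -> : sig%:C / ker 1 w' w * I = sig%:C * (c2%:C * ker (lam + a%:R + b.+1%:R) w' w) +
    b.+1%:R%:C * (c1%:C * ker (lam + a.+1%:R + b%:R) w' w).
  apply/eqP; rewrite -subr_eq0; apply/eqP; rewrite -[RHS]H RNC; ring.
have eD : (c2 + b.+1%:R / sig * c1)%:C = c2%:C + b.+1%:R%:C / sig%:C * c1%:C :> C.
  by rewrite RDC !RMC RVC.
rewrite eD eK1 r2.
by field; rewrite s0 k0.
Qed.
End Bergman.

(** * Products of half-planes and images of kernels *)

Section PlaneMeasure.
Context {R : realType}.
Local Notation RM := (measurableTypeR R).

(** The Lebesgue measure of the plane, under a name to which a sigma-finite
    structure can be attached; Fubini's theorem on the product of two planes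
    requires it. *)
Definition lebp : set (RM * RM)%type -> \bar R :=
  (@lebesgue_measure R \x @lebesgue_measure R)%E.

HB.instance Definition _ := Measure.on lebp.

Fact lebp_sigma_finite : sigma_finite setT lebp.
Proof.
have /sigma_finiteP[F [TF ndF Foo]] := sigma_finiteT (@lebesgue_measure R).
exists (fun n => F n `*` F n).
  rewrite -setXTT TF predeqE => -[x y]; split=> [[[n _ Fn] [k _ Fk]]|[n _ [Fx Fy]]].
    exists (maxn n k) => //; split.
      by have /subsetPset H := ndF _ _ (leq_maxl n k); exact: H.
    by have /subsetPset H := ndF _ _ (leq_maxr n k); exact: H.
  by split; exists n.
move=> k; have [mk fk] := Foo k; split; first exact: measurableX.
rewrite [X in (X < _)%E](_ : _ = @lebesgue_measure R (F k) * @lebesgue_measure R (F k))%E.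
  by rewrite lte_mul_pinfty// ge0_fin_numE.
exact: product_measure1E.
Qed.

HB.instance Definition _ := Measure_isSigmaFinite.Build _ _ _ lebp lebp_sigma_finite.
End PlaneMeasure.

Section Tensor.
Context {R : realType}.
Local Notation C := (R[i]).
Local Notation leb := (@lebesgue_measure R).
Local Notation leb2 := (leb \x leb)%E.
Local Notation leb4 := (@lebp R \x @lebp R)%E.
Local Notation RM := (measurableTypeR R).
Local Notation RM2 := (RM * RM)%type.
Variables (l1 l2 : R).
Let mU := @measurable_upper R.

Definition upper2 : set (RM2 * RM2) := upper `*` upper.

Lemma measurable_upper2 : measurable upper2.
Proof. by apply: measurableX; exact: measurable_upper. Qed.

Lemma measurable_weight2 : measurable_fun upper2 (weight2 l1 l2 : RM2 * RM2 -> R).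
Proof.
apply: measurable_funM.
  apply: (measurable_comp mU _ (measurable_weight l1) (measurable_funTS measurable_fst)).
  by move=> _ [[p q] [/= hp _] <-].
apply: (measurable_comp mU _ (measurable_weight l2) (measurable_funTS measurable_snd)).
by move=> _ [[p q] [/= _ hq] <-].
Qed.

Lemma weight2_ge0 (p : RM2 * RM2) : upper2 p -> 0 <= weight2 l1 l2 p.
Proof. by move=> _; apply: mulr_ge0; exact: weight_ge0. Qed.

Definition L22 (F : C * C -> C) := L2 leb4 upper2 (weight2 l1 l2) (fun p => F (toCC p)).
Definition ip22 (F G : C * C -> C) :=
  ip leb4 upper2 (weight2 l1 l2) (fun p => F (toCC p)) (fun p => G (toCC p)).
Definition sqn22 (F : C * C -> C) := sqn leb4 upper2 (weight2 l1 l2) (fun p => F (toCC p)).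

Lemma cmeasurable_fst (f : RM2 -> C) : cmeasurable (upper : set RM2) f ->
  cmeasurable upper2 (fun p => f p.1).
Proof.
by move=> [mr mi]; split; [apply: (measurable_comp mU _ mr (measurable_funTS measurable_fst))|
  apply: (measurable_comp mU _ mi (measurable_funTS measurable_fst))]; move=> _ [[p q] [/= hp _] <-].
Qed.

Lemma cmeasurable_snd (f : RM2 -> C) : cmeasurable (upper : set RM2) f ->
  cmeasurable upper2 (fun p => f p.2).
Proof.
by move=> [mr mi]; split; [apply: (measurable_comp mU _ mr (measurable_funTS measurable_snd))|
  apply: (measurable_comp mU _ mi (measurable_funTS measurable_snd))]; move=> _ [[p q] [/= _ hq] <-].
Qed.

Lemma cint_tensor (u v : RM2 -> C) : cintegrable leb2 (upper : set RM2) u ->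
  cintegrable leb2 (upper : set RM2) v ->
  cint leb4 upper2 (fun p => u p.1 * v p.2) = cint leb2 upper u * cint leb2 upper v.
Proof.
move=> iu iv.
have i4 : cintegrable leb4 upper2 (fun p => u p.1 * v p.2).
  apply: (cintegrable_le measurable_upper2 _
    (@integrableX _ _ _ _ _ lebp lebp _ _ mU mU _ _ (cintegrable_nc mU iu) (cintegrable_nc mU iv))).
    by apply: cmeasurableM; [apply: (cmeasurable_fst (cintegrable_measurable iu))|
      apply: (cmeasurable_snd (cintegrable_measurable iv))].
  by move=> p _; rewrite ncM.
rewrite -(@cfubini1 _ _ _ _ _ lebp lebp _ _ mU mU _ i4); last first.
  by move=> x ux; exact: (cintegrableZ mU (u x) iv).
rewrite -(cintZr mU (cint leb2 upper v) iu).
by apply: eq_cint => x ux; exact: (cintZ mU (u x) iv).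
Qed.

Lemma L22_tensor f g : L2up l1 f -> L2up l2 g -> L22 (fun p => f p.1 * g p.2).
Proof.
move=> [mf fi] [mg gi]; split.
  by apply: cmeasurableM; [apply: (cmeasurable_fst mf)|apply: (cmeasurable_snd mg)].
apply: (Rinteg_eq _ (@integrableX _ _ _ _ _ lebp lebp _ _ mU mU _ _ fi gi) measurable_upper2) => -[p q] _.
by rewrite /= /weight2 ncM exprMn /=; ring.
Qed.

Lemma ip22_tensor f g f' g' : L2up l1 f -> L2up l2 g -> L2up l1 f' -> L2up l2 g' ->
  ip22 (fun p => f p.1 * g p.2) (fun p => f' p.1 * g' p.2) = ipup l1 f f' * ipup l2 g g'.
Proof.
move=> Lf Lg Lf' Lg'.
have w1 := fun p (_ : upper p) => @weight_ge0 R l1 p.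
have w2 := fun p (_ : upper p) => @weight_ge0 R l2 p.
rewrite /ipup /ip -cint_tensor; last 2 first.
- exact: (cintegrable_ip mU (measurable_weight l1) w1 Lf Lf').
- exact: (cintegrable_ip mU (measurable_weight l2) w2 Lg Lg').
apply: eq_cint => -[p q] _; rewrite /= /weight2 RMC /= rmorphM /=; ring.
Qed.
End Tensor.

Section PsiKernel.
Context {R : realType}.
Local Notation C := (R[i]).
Local Notation leb := (@lebesgue_measure R).
Local Notation RM := (measurableTypeR R).
Variables (l1 l2 : R) (l : nat).
Hypotheses (l11 : 1 < l1) (l21 : 1 < l2).
Local Notation l3 := (l1 + l2 + (2 * l)%:R).
Local Notation Ps := (Psi l1%:C l2%:C l).

Definition Psi_ker_cst : C := Psi_cst l1%:C l2%:C l *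
  cint leb `[-1, 1] (bw (l1%:C + l%:R) (l2%:C + l%:R)).

Lemma Re_shift_gt0 (r : R) : 1 < r -> 0 < Re (r%:C + l%:R).
Proof. by move=> r1; rewrite ReD -natC /= ltr_wpDr//; lra. Qed.

(** The image of a kernel is a product of two kernels with a power of [z1 -
    z2], by Feynman's formula for the logarithm that defines the kernel. *)
Lemma Psi_ker w p : halfplane w -> (halfplane `*` halfplane) p ->
  Ps (ker l3 w) p = Psi_ker_cst * ((p.1 - p.2) ^+ l *
    (ker (l1 + l%:R) w p.1 * ker (l2 + l%:R) w p.2)).
Proof.
case: p => z1 z2 hw [/= h1 h2]; rewrite PsiE /beta_average /=.
have hphi : hol (fun z => clog (z - w^*)).
  move=> z hz; have [a Ha] := hol_clog (hpB hz hw); exists (a * 1).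
  apply: (@has_slope_comp R C^o id clog (fun z => z - w^*) z _ 1 (contid z) Ha).
  by rewrite -(subr0 1); apply: has_slopeB; [exact: has_slope_id|exact: has_slope_cst].
have ephi z : halfplane z -> cexp (clog (z - w^*)) = (- 'i) * z + 'i * w^*.
  by move=> hz; rewrite cexp_clog; [ring|exact: hpB].
have := feynman (Re_shift_gt0 l11) (Re_shift_gt0 l21) hphi ephi h1 h2.
rewrite (eq_cint leb (g := fun v => ker l3 w (seg z1 z2 v) * bw (l1%:C + l%:R) (l2%:C + l%:R) v)); last first.
  move=> v _; rewrite /ker; have -> // : (l3)%:C = l1%:C + l%:R + (l2%:C + l%:R) :> C.
  by rewrite !RDC natC natrM; ring.
move=> ->; rewrite /Psi_ker_cst cexpD -mulNr /ker !RDC natC; ring.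
Qed.

Definition Psi_ker_coef (j : nat) : C := Psi_ker_cst * 'i ^+ l * ((-1) ^+ j * 'C(l, j)%:R).

(** [z1 - z2] is a difference of inverses of kernels, and the binomial
    theorem turns its power into a change of exponents. *)
Lemma Psi_ker_sum w p : halfplane w -> (halfplane `*` halfplane) p ->
  Ps (ker l3 w) p = \sum_(j < l.+1) Psi_ker_coef j *
    (ker (l1 + j%:R) w p.1 * ker (l2 + (l - j)%:R) w p.2).
Proof.
move=> hw hp; rewrite Psi_ker//; case: p hp => z1 z2 [/= h1 h2].
set E1 := (ker 1 w z1)^-1; set E2 := (ker 1 w z2)^-1.
have eE1 : E1 = - 'i * (z1 - w^*) by rewrite /E1 ker1// invrK.
have eE2 : E2 = - 'i * (z2 - w^*) by rewrite /E2 ker1// invrK.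
have i2 : 'i * 'i = -1 :> C by rewrite -expr2 sqr_i.
have -> : z1 - z2 = 'i * (E1 - E2).
  rewrite eE1 eE2; transitivity (- ('i * 'i) * (z1 - z2)); last by ring.
  by rewrite i2 opprK mul1r.
rewrite exprMn exprDn.
have kn (n : nat) z : ker n%:R w z = ker 1 w z ^+ n.
  elim: n => [|n IH]; last by rewrite -natr1 kerD IH exprSr.
  by rewrite /ker oppr0 mul0r cexp0.
rewrite mulr_sumr mulr_suml mulr_sumr; apply: eq_bigr => j _; have jl : (j <= l)%N by rewrite -ltnS.
have e1 : ker (l1 + l%:R) w z1 * E1 ^+ (l - j) = ker (l1 + j%:R) w z1.
  have -> : l1 + l%:R = l1 + j%:R + (l - j)%:R by rewrite -addrA -natrD subnKC.
  rewrite (kerD (l1 + j%:R)) kn /E1 exprVn mulfK//.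
  by rewrite expf_neq0// ker_neq0.
have e2 : ker (l2 + l%:R) w z2 * E2 ^+ j = ker (l2 + (l - j)%:R) w z2.
  have -> : l2 + l%:R = l2 + (l - j)%:R + j%:R by rewrite -addrA -natrD subnK.
  rewrite (kerD (l2 + (l - j)%:R)) kn /E2 exprVn mulfK//.
  by rewrite expf_neq0// ker_neq0.
rewrite -e1 -e2 /Psi_ker_coef -mulr_natl [(- E2) ^+ _]exprNn; ring.
Qed.
End PsiKernel.

(** * The isometry on the span of the kernels *)

Section SequenceLimits.
Context {R : realType}.
Local Notation C := (R[i]).

Lemma sqrt_harmonic (M : R) : Num.sqrt (M / k.+1%:R) @[k --> \oo] --> (0 : R).
Proof.
have h1 : M / k.+1%:R @[k --> \oo] --> (M * 0 : R).
  by apply: cvgM; [exact: cvg_cst|exact: cvg_harmonic].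
have -> : (0 : R) = Num.sqrt (M * 0) by rewrite mulr0 sqrtr0.
by apply: (@cvg_comp _ _ _ (fun k : nat => M / k.+1%:R) Num.sqrt _ _ _ h1); exact: sqrt_continuous.
Qed.

Lemma cvg_shiftk (e : nat -> R) k (a : R) : e m @[m --> \oo] --> a ->
  e (m + k)%N @[m --> \oo] --> a.
Proof. by move=> ea; rewrite (cvg_shiftn k). Qed.

Lemma nc_cvg (a : nat -> C) (b : C) (e : nat -> R) : (forall m, nc (b - a m) <= e m) ->
  e m @[m --> \oo] --> (0 : R) -> nc (a m) @[m --> \oo] --> nc b.
Proof.
move=> H /cvgrPdist_lt e0; apply/cvgrPdist_lt => d d0.
apply: filterS (e0 d d0) => m; rewrite sub0r normrN => em.
apply: (@le_lt_trans _ _ (nc (b - a m))).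
  by have := ncDB b (a m); have := ncDB (a m) b; rewrite (ncB (a m)) ler_norml; lra.
by rewrite (le_lt_trans (H m))// (le_lt_trans (ler_norm _)).
Qed.
End SequenceLimits.

Section PsiIsometry.
Context {R : realType}.
Local Notation C := (R[i]).
Local Notation leb := (@lebesgue_measure R).
Local Notation leb2 := (leb \x leb)%E.
Local Notation leb4 := (@lebp R \x @lebp R)%E.
Local Notation RM := (measurableTypeR R).
Variables (l1 l2 : R) (l : nat).
Hypotheses (l11 : 1 < l1) (l21 : 1 < l2).
Local Notation l3 := (l1 + l2 + (2 * l)%:R).
Local Notation Ps := (Psi l1%:C l2%:C l).
Local Notation ip22 := (ip22 l1 l2).
Local Notation sqn22 := (sqn22 l1 l2).
Local Notation L22 := (L22 l1 l2).
Let mU := @measurable_upper R.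
Let mU2 := @measurable_upper2 R.
Let mw2 := @measurable_weight2 R l1 l2.
Let w20 := @weight2_ge0 R l1 l2.
Let mw := @measurable_weight R l3.
Let w0 (p : RM * RM) : upper p -> 0 <= weight l3 p.
Proof. by move=> _; exact: weight_ge0. Qed.

Let l31 : 1 < l3.
Proof.
have a := l11; have b := l21; have : (0 : R) <= (2 * l)%:R by rewrite ler0n.
by move=> ?; lra.
Qed.

Let h1 : 0 < Re (l1%:C + l%:R). Proof. exact: Re_shift_gt0. Qed.
Let h2 : 0 < Re (l2%:C + l%:R). Proof. exact: Re_shift_gt0. Qed.

Let toCC_hp (p : (R * R) * (R * R)) : upper2 p -> (halfplane `*` halfplane) (toCC p).
Proof. by case: p => p q []. Qed.

Definition ker_tensor (j : nat) (w : C) (p : C * C) : C := ker (l1 + j%:R) w p.1 * ker (l2 + (l - j)%:R) w p.2.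

Lemma L22_ker_tensor j w : halfplane w -> L22 (ker_tensor j w).
Proof.
by move=> hw; apply: L22_tensor; apply: L2up_ker => //; rewrite lerDl.
Qed.

(** The exponents of both factors are shifted, and the shifts add up to [2 *
    l] in all cases; therefore all pairings are multiples of the same kernel. *)
Lemma ker_tensor_pairing (j m : nat) : exists d : R, (j <= l)%N -> (m <= l)%N ->
  forall w' w, halfplane w' -> halfplane w -> ip22 (ker_tensor j w') (ker_tensor m w) = d%:C * ker l3 w' w.
Proof.
have [c1 H1] := ker_pairing l11 j m.
have [c2 H2] := ker_pairing l21 (l - j) (l - m).
exists (c1 * c2) => jl ml w' w hw' hw.
rewrite /ker_tensor ip22_tensor; try by apply: L2up_ker => //; rewrite lerDl.
rewrite H1// H2// RMC.
have -> : l3 = (l1 + j%:R + m%:R) + (l2 + (l - j)%:R + (l - m)%:R).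
  have e : (2 * l)%:R = j%:R + (l - j)%:R + (m%:R + (l - m)%:R) :> R.
    by rewrite -!natrD (subnKC jl) (subnKC ml) addnn mul2n.
  by rewrite e; ring.
by rewrite (kerD (l1 + j%:R + m%:R)); ring.
Qed.

Lemma Psi_kerE w p : halfplane w -> upper2 p ->
  Ps (ker l3 w) (toCC p) = \sum_(j < l.+1) Psi_ker_coef l1 l2 l j * ker_tensor j w (toCC p).
Proof. by move=> hw up; rewrite Psi_ker_sum//; exact: toCC_hp. Qed.

Lemma L22_Psi_ker w : halfplane w -> L22 (Ps (ker l3 w)).
Proof.
move=> hw; apply: (L2_eq mU2 (f := fun p => \sum_(j < l.+1) Psi_ker_coef l1 l2 l j * ker_tensor j w (toCC p))).
  by move=> p up; rewrite Psi_kerE.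
apply: (L2_sum mU2 mw2 w20 _ (f := fun j p => Psi_ker_coef l1 l2 l j * ker_tensor j w (toCC p))) => j.
by apply: L2_scale => //; exact: L22_ker_tensor.
Qed.

Lemma Psi_ker_pairing : exists c : C, forall w' w, halfplane w' -> halfplane w ->
  ip22 (Ps (ker l3 w')) (Ps (ker l3 w)) = c * ker l3 w' w.
Proof.
have /choice[d Hd] : forall jm : nat * nat, exists d : R, (jm.1 <= l)%N -> (jm.2 <= l)%N ->
  forall w' w, halfplane w' -> halfplane w -> ip22 (ker_tensor jm.1 w') (ker_tensor jm.2 w) = d%:C * ker l3 w' w.
  by move=> [j m]; exact: ker_tensor_pairing.
pose co := Psi_ker_coef l1 l2 l.
exists (\sum_(j < l.+1) \sum_(m < l.+1) co j * ((co m)^* * (d (j : nat, m : nat))%:C)) => w' w hw' hw.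
pose F v (j : nat) (p : (R * R) * (R * R)) := co j * ker_tensor j v (toCC p).
have LF v j : halfplane v -> L2 leb4 upper2 (weight2 l1 l2) (F v j).
  by move=> hv; apply: L2_scale => //; exact: L22_ker_tensor.
have -> : ip22 (Ps (ker l3 w')) (Ps (ker l3 w)) =
    ip leb4 upper2 (weight2 l1 l2) (fun p => \sum_(j < l.+1) F w' j p) (fun p => \sum_(j < l.+1) F w j p).
  by apply: eq_ip => p up; exact: Psi_kerE.
rewrite (ip_sum mU2 mw2 w20 _ (fun j => LF w' j hw')); last first.
  by apply: (L2_sum mU2 mw2 w20) => j; exact: LF.
rewrite mulr_suml; apply: eq_bigr => j _.
rewrite (ip_sumr mU2 mw2 w20 _ (fun j => LF w j hw)); last exact: LF.
rewrite mulr_suml; apply: eq_bigr => m _.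
rewrite /F (ip_scale mU2 mw2 w20); [|exact: L22_ker_tensor|exact: LF].
rewrite (ip_scaler mU2 mw2 w20); [|exact: L22_ker_tensor|exact: L22_ker_tensor].
rewrite -[ip _ _ _ _ _]/(ip22 (ker_tensor j w') (ker_tensor m w)) (Hd (j : nat, m : nat))//=; last 2 first.
- by rewrite -ltnS.
- by rewrite -ltnS.
by rewrite !mulrA.
Qed.

(** The Beta weight is positive for real exponents. *)
Lemma beta_neq0 : cint leb `[-1, 1] (bw (l1%:C + l%:R) (l2%:C + l%:R)) != 0.
Proof.
set al := l1%:C + l%:R; set be := l2%:C + l%:R.
have wi := cintegrable_bw h1 h2.
have mI : measurable (`]-1, 1[ : set RM) by exact: measurable_itv.
have mJ : measurable (`[-1, 1] : set RM) by exact: measurable_itv.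
have wo : cintegrable leb `]-1, 1[ (bw al be) by exact: cintegrable_ooS.
rewrite cint_oo//.
have cR (a : R) x : 0 < x -> cpow x a%:C = (epow a x)%:C.
  by move=> x0; rewrite cpow_gt0// -RMC cexp_R.
have bR v : -1 < v < 1 -> bw al be v = (epow (l1 + l%:R - 1) (1 - v) * epow (l2 + l%:R - 1) (1 + v))%:C.
  move=> /andP[v1 v2]; rewrite RMC -!cR; [|lra|lra].
  by rewrite /bw /al /be !RBC !RDC natC.
have Rw0 v : -1 < v < 1 -> 0 < Re (bw al be v).
  by move=> v11; rewrite bR//= mulr_gt0// epow_gt0.
suff : 0 < sqn leb `]-1, 1[ (fun v => Re (bw al be v)) (fun=> 1).
  rewrite /sqn; apply: contraTneq => /(congr1 (@complex.Re R)) /= <-.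
  rewrite -leNgt le_eqVlt; apply/orP; left; apply/eqP.
  by apply: eq_Rintegral => v _; rewrite nc1 expr1n mul1r.
apply: (@sqn_gt0 _ _ _ leb _ `[0, 2^-1]%classic) => //.
- by have [] := cintegrable_measurable wo.
- by move=> v; rewrite mem_oo => /Rw0/ltW.
- by move=> v; rewrite mem_oo /= in_itv /= => /andP[v1 v2]; lra.
- rewrite [X in (0 < X)%E](_ : _ = (2^-1 - 0)%:E); last by apply: leb_itv; lra.
  by rewrite lte_fin; lra.
- move=> v /=; rewrite in_itv /= => /andP[v1 v2]; split; last exact: oner_neq0.
  by apply: Rw0; lra.
- split; first exact: cmeasurable_cst.
  by apply: (Rinteg_eq _ wo.1 mI) => v _; rewrite nc1 expr1n mul1r.
Qed.

(** The image of the kernel vanishes on the diagonal only, if at all; this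
    set does not meet the chosen product of two boxes. *)
Lemma sqn22_Psi_ker_gt0 : 0 < sqn22 (Ps (ker l3 'i)).
Proof.
have hi := @halfplane_i R.
pose A1 : set (RM * RM) := ((`[0, 1] : set RM) `*` (`[1, 2] : set RM))%classic.
pose A2 : set (RM * RM) := ((`[2, 3] : set RM) `*` (`[1, 2] : set RM))%classic.
apply: (@sqn_gt0 _ _ _ leb4 _ (A1 `*` A2)) => //.
- by apply: measurableX; exact: measurable_box.
- by move=> [p q] [/= hp hq]; split; [apply: box_upper hp|apply: box_upper hq].
- rewrite [X in (0 < X)%E](_ : _ = @lebp R A1 * @lebp R A2)%E; last first.
    by apply: product_measure1E; exact: measurable_box.
  rewrite [@lebp R A1](_ : _ = ((1 - 0) * (2 - 1))%:E); last first.
    by apply: box_measure => //; lra.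
  rewrite [@lebp R A2](_ : _ = ((3 - 2) * (2 - 1))%:E); last first.
    by apply: box_measure; lra.
  by rewrite -EFinM lte_fin; lra.
- move=> [p q] [/= hp hq].
  have up : upper p by apply: box_upper hp.
  have uq : upper q by apply: box_upper hq.
  split; first by rewrite /weight2 /= !weightE// mulr_gt0// epow_gt0.
  rewrite Psi_ker//=; rewrite !mulf_neq0 ?ker_neq0//.
  - by rewrite /Psi_cst invr_neq0// mulf_neq0 ?pnatr_eq0 -?lt0n ?fact_gt0// cpow_gt0// cexp_neq0.
  - exact: beta_neq0.
  rewrite expf_neq0// subr_eq0; apply/eqP => /(congr1 (@complex.Re R)) /=.
  move: hp hq; case: p {up} => x y; case: q {uq} => x' y' [/= + _] [/= + _].
  by rewrite !in_itv /= => /andP[? ?] /andP[? ?]; lra.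
- exact: L22_Psi_ker.
Qed.

(** The factor by which the squared norms are multiplied. It is read off at
    the kernel of ['i], whose squared norm is the product of the two
    denominators. *)
Definition norm_ratio : R := sqn22 (Ps (ker l3 'i)) / Re (ker l3 'i 'i) / bergman_cst l3.

Lemma norm_ratio_gt0 : 0 < norm_ratio.
Proof.
exact: (divr_gt0 (divr_gt0 sqn22_Psi_ker_gt0 (ker_diag_gt0 l3 (@halfplane_i R))) (bergman_cst_gt0 l31)).
Qed.

Lemma pairing w' w : halfplane w' -> halfplane w ->
  ip22 (Ps (ker l3 w')) (Ps (ker l3 w)) = norm_ratio%:C * ipup l3 (ker l3 w') (ker l3 w).
Proof.
move=> hw' hw; have hi := @halfplane_i R; have [c Hc] := Psi_ker_pairing.
rewrite Hc// reproducing//; [|exact: hol_ker|exact: L2up_ker].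
rewrite mulrA; congr (_ * _).
have k0 := ker_neq0 l3 ('i : C) 'i.
have r0 : (bergman_cst l3)%:C != 0 :> C.
  by apply/eqP => /(congr1 (@complex.Re R)) /= /eqP; rewrite gt_eqF// bergman_cst_gt0.
have e : (sqn22 (Ps (ker l3 'i)))%:C = c * ker l3 ('i : C) 'i.
  by rewrite -(Hc 'i 'i hi hi) /ip22 ip_sqn.
have eK : (Re (ker l3 'i 'i))%:C = ker l3 ('i : C) 'i by rewrite ker_diag.
have -> : norm_ratio%:C = c * ker l3 'i 'i * (ker l3 'i 'i)^-1 * (bergman_cst l3)%:C^-1.
  by rewrite /norm_ratio RMC RVC; congr (_ * _); rewrite RMC RVC eK; congr (_ * _).
by rewrite mulfK// divfK.
Qed.

Inductive kspan : (C -> C) -> Prop :=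
| kspan0 : kspan (fun=> 0)
| kspan_cons a w g : halfplane w -> kspan g -> kspan (fun z => a * ker l3 w z + g z).

Lemma kspan_ker (a : C) w : halfplane w -> kspan (fun z => a * ker l3 w z).
Proof.
move=> hw; have := kspan_cons a hw kspan0.
by rewrite (_ : (fun z => _ + 0) = fun z => a * ker l3 w z)//; apply/funext => z; rewrite addr0.
Qed.

Lemma kspan_lin g h (t : C) : kspan g -> kspan h -> kspan (fun z => g z + t * h z).
Proof.
move=> sg; elim=> [|a w h' hw sh IH].
  by rewrite (_ : (fun z => _) = g)//; apply/funext => z; rewrite mulr0 addr0.
rewrite (_ : (fun z => _) = fun z => (t * a) * ker l3 w z + (g z + t * h' z)).
  exact: kspan_cons.
by apply/funext => z; ring.
Qed.

Lemma kspan_hol g : kspan g -> hol g.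
Proof.
elim=> [z hz|a w h hw sh IH z hz]; first by exists 0; exact: has_slope_cst.
have [x Hx] := IH z hz; have [y Hy] := hol_ker l3 hw hz.
by exists (a * y + x); apply: has_slopeD => //; exact: has_slopeZ.
Qed.

Lemma kspan_L2 g : kspan g -> L2up l3 g.
Proof.
elim=> [|a w h hw sh IH]; first exact: L2_0.
by apply: L2_add => //; apply: L2_scale => //; exact: L2up_ker.
Qed.

Lemma Psi_cons a w g p : halfplane w -> hol g -> upper2 p ->
  Ps (fun z => a * ker l3 w z + g z) (toCC p) = a * Ps (ker l3 w) (toCC p) + Ps g (toCC p).
Proof.
move=> hw hg up.
exact: (Psi_linear h1 h2 a (hol_OPi (hol_ker l3 hw)) (hol_OPi hg) (toCC_hp up)).
Qed.

Lemma Psi_sub f g p : hol f -> hol g -> upper2 p ->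
  Ps (fun z => f z - g z) (toCC p) = Ps f (toCC p) - Ps g (toCC p).
Proof.
move=> hf hg up; rewrite (_ : (fun z => _) = fun z => (-1) * g z + f z); last first.
  by apply/funext => z; ring.
rewrite (Psi_linear h1 h2 (-1) (hol_OPi hg) (hol_OPi hf) (toCC_hp up)); ring.
Qed.

Lemma Psi0 p : Ps (fun=> 0) p = 0.
Proof.
rewrite PsiE /beta_average (eq_cint leb (g := fun=> 0)); last by move=> v _; rewrite mul0r.
by rewrite cint0 !mulr0.
Qed.

Lemma kspan_L22 g : kspan g -> L22 (Ps g).
Proof.
elim=> [|a w h hw sh IH].
  by apply: (L2_eq mU2 (f := fun=> 0)) => [p _|]; [rewrite Psi0|exact: L2_0].
apply: (L2_eq mU2 (f := fun p => a * Ps (ker l3 w) (toCC p) + Ps h (toCC p))).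
  by move=> p up; rewrite Psi_cons//; exact: kspan_hol.
exact: (L2_add mU2 mw2 w20 (L2_scale mU2 a (L22_Psi_ker hw)) IH).
Qed.

Lemma kspan_pairing1 g w : kspan g -> halfplane w ->
  ip22 (Ps g) (Ps (ker l3 w)) = norm_ratio%:C * ipup l3 g (ker l3 w).
Proof.
move=> sg hw; elim: sg => [|a w' h hw' sh IH].
  rewrite /ipup ip_0 mulr0 -[RHS](ip_0 leb4 upper2 (weight2 l1 l2) (fun p => Ps (ker l3 w) (toCC p))).
  by apply: eq_ip => p _; [exact: Psi0|exact: erefl].
have -> : ip22 (Ps (fun z => a * ker l3 w' z + h z)) (Ps (ker l3 w)) =
    ip leb4 upper2 (weight2 l1 l2) (fun p => a * Ps (ker l3 w') (toCC p) + Ps h (toCC p))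
      (fun p => Ps (ker l3 w) (toCC p)).
  by apply: eq_ip => p up //; rewrite Psi_cons//; exact: kspan_hol.
have Lk := L22_Psi_ker hw; have Lk' := L22_Psi_ker hw'; have Lh := kspan_L22 sh.
have Uk := L2up_ker l31 (lexx l3) hw; have Uk' := L2up_ker l31 (lexx l3) hw'.
have Uh := kspan_L2 sh.
rewrite (ip_add mU2 mw2 w20 (L2_scale mU2 a Lk') Lh Lk) (ip_scale mU2 mw2 w20 a Lk' Lk).
rewrite -[ip _ _ _ _ _]/(ip22 (Ps (ker l3 w')) (Ps (ker l3 w))) pairing//.
rewrite -[X in _ + X]/(ip22 (Ps h) (Ps (ker l3 w))) IH.
rewrite /ipup (ip_add mU mw w0 (L2_scale mU a Uk') Uh Uk) (ip_scale mU mw w0 a Uk' Uk).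
by ring.
Qed.

Lemma kspan_pairing g h : kspan g -> kspan h -> ip22 (Ps g) (Ps h) = norm_ratio%:C * ipup l3 g h.
Proof.
move=> sg; have Lg := kspan_L22 sg; have Ug := kspan_L2 sg.
elim=> [|a w k hw sk IH].
  have e1 : ip22 (Ps g) (Ps (fun=> 0)) = (ip22 (Ps (fun=> 0)) (Ps g))^*.
    exact: (ip_conj mU2 mw2 w20 (kspan_L22 kspan0) Lg).
  have e2 : ipup l3 g (fun=> 0) = (ipup l3 (fun=> 0) g)^*.
    exact: (ip_conj mU mw w0 (kspan_L2 kspan0) Ug).
  rewrite e1 e2 /ipup ip_0 (_ : ip22 _ _ = 0); first by rewrite conjc0 mulr0.
  rewrite -[RHS](ip_0 leb4 upper2 (weight2 l1 l2) (fun p => Ps g (toCC p))).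
  by apply: eq_ip => p _; [exact: Psi0|exact: erefl].
have -> : ip22 (Ps g) (Ps (fun z => a * ker l3 w z + k z)) =
    ip leb4 upper2 (weight2 l1 l2) (fun p => Ps g (toCC p))
      (fun p => a * Ps (ker l3 w) (toCC p) + Ps k (toCC p)).
  by apply: eq_ip => p up //; rewrite Psi_cons//; exact: kspan_hol.
have Lk := L22_Psi_ker hw; have Lh := kspan_L22 sk.
have Uk := L2up_ker l31 (lexx l3) hw; have Uh := kspan_L2 sk.
rewrite (ip_addr mU2 mw2 w20 (L2_scale mU2 a Lk) Lh Lg) (ip_scaler mU2 mw2 w20 a Lk Lg).
rewrite -[ip _ _ _ _ _]/(ip22 (Ps g) (Ps (ker l3 w))) kspan_pairing1//.
rewrite -[X in _ + X]/(ip22 (Ps g) (Ps k)) IH.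
rewrite /ipup (ip_addr mU mw w0 (L2_scale mU a Uk) Uh Ug) (ip_scaler mU mw w0 a Uk Ug).
by ring.
Qed.

Lemma kspan_norm g : kspan g -> sqn22 (Ps g) = norm_ratio * sqnup l3 g.
Proof.
move=> sg; apply: (@complexI R); rewrite RMC /sqnup -!ip_sqn; exact: kspan_pairing.
Qed.
End PsiIsometry.

(** * The isometry on the Bergman space *)

Section IsometryLimit.
Context {R : realType}.
Local Notation C := (R[i]).
Local Notation leb := (@lebesgue_measure R).
Local Notation leb2 := (leb \x leb)%E.
Local Notation leb4 := (@lebp R \x @lebp R)%E.
Local Notation RM := (measurableTypeR R).
Variables (l1 l2 : R) (l : nat).
Hypotheses (l11 : 1 < l1) (l21 : 1 < l2).
Local Notation l3 := (l1 + l2 + (2 * l)%:R).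
Local Notation Ps := (Psi l1%:C l2%:C l).
Local Notation ip22 := (ip22 l1 l2).
Local Notation sqn22 := (sqn22 l1 l2).
Local Notation L22 := (L22 l1 l2).
Local Notation kspan := (kspan l1 l2 l).
Local Notation norm_ratio := (norm_ratio l1 l2 l).
Let mU := @measurable_upper R.
Let mU2 := @measurable_upper2 R.
Let mw2 := @measurable_weight2 R l1 l2.
Let w20 := @weight2_ge0 R l1 l2.
Let mw := @measurable_weight R l3.
Let w0 (p : RM * RM) : upper p -> 0 <= weight l3 p.
Proof. by move=> _; exact: weight_ge0. Qed.

Let l31 : 1 < l3.
Proof.
have a := l11; have b := l21; have : (0 : R) <= (2 * l)%:R by rewrite ler0n.
by move=> ?; lra.
Qed.

Let h1 : 0 < Re (l1%:C + l%:R). Proof. exact: Re_shift_gt0. Qed.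
Let h2 : 0 < Re (l2%:C + l%:R). Proof. exact: Re_shift_gt0. Qed.

Let toCC_hp (p : (R * R) * (R * R)) : upper2 p -> (halfplane `*` halfplane) (toCC p).
Proof. by case: p => p q []. Qed.

(* The bound for point evaluations that results from the reproducing formula;
   it only depends on the height of the point, and decreases with it. *)
Let bnd (y : R) : R := 2 * epow (- l3) (2 * y) / bergman_cst l3.

Let bnd_decr x y : 0 < x -> x <= y -> bnd y <= bnd x.
Proof.
move=> x0 xy; rewrite /bnd ler_wpM2r ?invr_ge0 ?(ltW (bergman_cst_gt0 l31))// ler_wpM2l//.
by apply: ler_epowN; [have := l31; lra|lra|lra].
Qed.

(** The kernel and its multiple by ['i] detect the real and the imaginary
    part of the value of [u] at [w]. *)
Lemma near_orthogonal_bound u w (e : R) : hol u -> L2up l3 u -> halfplane w ->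
  (forall h, kspan h -> Re (ipup l3 u h) ^+ 2 <= sqnup l3 h * e) ->
  nc (u w) ^+ 2 <= bnd (Im w) * e.
Proof.
move=> hu Lu hw H; have LK := L2up_ker l31 (lexx l3) hw.
have S : sqnup l3 (ker l3 w) = bergman_cst l3 * epow (- l3) (2 * Im w).
  apply: (@complexI R); rewrite RMC -ker_diag// -reproducing//; last exact: hol_ker.
  by rewrite /ipup /sqnup ip_sqn.
have ipe a : ipup l3 u (fun z => a * ker l3 w z) = a^* * ((bergman_cst l3)%:C * u w).
  rewrite /ipup (ip_scaler mU mw w0)// -[ip _ _ _ _ _]/(ipup l3 u (ker l3 w)).
  by rewrite reproducing.
have ipn a : sqnup l3 (fun z => a * ker l3 w z) = nc a ^+ 2 * (bergman_cst l3 * epow (- l3) (2 * Im w)).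
  by rewrite /sqnup (sqn_scale mU)// -[sqn _ _ _ _]/(sqnup l3 (ker l3 w)) S.
have H1 := H _ (kspan_ker l1 l2 l 1 hw); have Hi := H _ (kspan_ker l1 l2 l 'i hw).
move: H1 Hi; rewrite !ipe !ipn !sqr_nc /bnd; have := bergman_cst_gt0 l31.
move: (bergman_cst l3) (epow _ _) (u w) => r k [a b] /= r0 H1 Hi.
rewrite mulrAC ler_pdivlMr// -(ler_pM2l r0); nra.
Qed.

(** The segment between two points of the half-plane stays away from the real
    line, and the values of [u] there are averaged. *)
Lemma Psi_le p : upper2 p -> exists K m : R, [/\ 0 < m & forall u (eps : R), hol u ->
  (forall w, m <= Im w -> nc (u w) <= eps) -> nc (Ps u (toCC p)) <= K * eps].
Proof.
move=> /toCC_hp; case: (toCC p) => z1 z2 [/= hz1 hz2].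
have [|m [B [m0 Hm]]] := @curve_bounded R (-1) 1 (seg z1 z2) _ (fun v _ => cont_seg z1 z2 v)
  (fun v v11 => seg_halfplane hz1 hz2 v11).
  by rewrite (@le_trans _ _ 0) ?oppr_le0.
pose W := bw (l1%:C + l%:R) (l2%:C + l%:R) : R -> C.
exists (nc ((z1 - z2) ^+ l * Psi_cst l1%:C l2%:C l) * \int[leb]_(v in `[-1, 1]) nc (W v)), m.
split=> // u eps hu ue; rewrite PsiE /= mulrA ncM -mulrA ler_wpM2l ?nc_ge0//.
rewrite [leRHS]mulrC /beta_average /=.
apply: (@cint_Mbound R W (fun v => u (seg z1 z2 v))).
- exact: cintegrable_bw.
- exact: cintegrable_average.
- by move=> v /Hm[mv _]; exact: ue.
Qed.

Lemma cmeasurable_OPiPi (F : C * C -> C) : OPiPi F -> cmeasurable (@upper2 R) (fun p => F (toCC p)).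
Proof.
move=> OF; have cF (p : (R * R) * (R * R)) : upper2 p -> contc (fun p => F (toCC p)) p.
  move=> up; apply: Contc.
  have cf := differentiable_continuous (OF _ (toCC_hp up)).
  apply: (@cvg_comp _ _ _ (toCC : (R * R) * (R * R) -> (C^o * C^o)%type) F); last exact: cf.
  have c1 : (toC q.1 : C^o) @[q --> p] --> (toC p.1 : C^o).
    exact: (@cvg_comp _ _ _ fst (toC : R * R -> C^o) _ _ _ cvg_fst (contcE (cont_toC _))).
  have c2 : (toC q.2 : C^o) @[q --> p] --> (toC p.2 : C^o).
    exact: (@cvg_comp _ _ _ snd (toC : R * R -> C^o) _ _ _ cvg_snd (contcE (cont_toC _))).
  exact: (@cvg_pair _ C^o C^o (nbhs p) _ _ _ _ _ (fun q => toC q.1) (fun q => toC q.2) c1 c2).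
by split; apply: measurable_cont4 mU2 _ => p /cF; [exact: contc_Re|exact: contc_Im].
Qed.

(** On the span of the kernels the squared norms are multiplied by a
    constant. The sequence [g] in this span that minimizes the distance to
    [f] is a Cauchy sequence, and so are its images. By the bounds on point
    evaluations [g] converges to [f] uniformly away from the real line, hence
    the images converge to the image of [f] pointwise; Fatou's lemma then
    shows that both sequences converge in norm. *)
Theorem Psi_isometry f : hol f -> L2up l3 f ->
  L22 (Ps f) /\ sqn22 (Ps f) = norm_ratio * sqnup l3 f.
Proof.
move=> hf Lf.
pose V (F : RM * RM -> C) := exists2 g, kspan g & F = (fun p => g (toC p)).
have V0 : exists F, V F by exists (fun=> 0), (fun=> 0) => //; exact: kspan0.
have VL F : V F -> L2 leb2 (upper : set (RM * RM)) (weight l3) F.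
  by move=> [g sg ->]; exact: (kspan_L2 l11 l21).
have Vlin F H (t : R) : V F -> V H -> V (fun p => F p + t%:C * H p).
  move=> [g sg ->] [h sh ->]; exists (fun z => g z + t%:C * h z) => //.
  exact: kspan_lin.
have [G [VG OG CG]] := minimizing_sequence mU mw w0 Lf V0 VL Vlin.
have /choice[g Hg] : forall k, exists g, kspan g /\ G k = (fun p => g (toC p)).
  by move=> k; have [g sg ->] := VG k; exists g.
have sg k := (Hg k).1; have hg k := kspan_hol (sg k).
have Lg k := kspan_L2 l11 l21 (sg k); have Lfg k := L2_sub mU mw w0 Lf (Lg k).
have hfg k : hol (fun z => f z - g k z) 
  by move=> z hz; have [a Ha] := hf z hz; have [b Hb] := hg k z hz; exists (a - b); exact: has_slopeB.
have O k h : kspan h -> Re (ipup l3 (fun z => f z - g k z) h) ^+ 2 <= sqnup l3 h * k.+1%:R^-1.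
  move=> sh; have := OG k _ (ex_intro2 _ _ h sh erefl).
  by rewrite (Hg k).2.
have Cg m k : sqnup l3 (fun z => g m z - g k z) <= 2 / m.+1%:R + 2 / k.+1%:R.
  by have := CG m k; rewrite (Hg m).2 (Hg k).2.
have Cgk m k : sqnup l3 (fun z => g (m + k)%N z - g k z) <= 4 / k.+1%:R.
  apply: (le_trans (Cg _ _)).
  have : (m + k).+1%:R^-1 <= k.+1%:R^-1 :> R.
    by rewrite lef_pV2 ?posrE ?ltr0n// ler_nat ltnS leq_addl.
  move: (_^-1) (_^-1) => x y; lra.
have P k w m0 : 0 < m0 -> m0 <= Im w -> nc (f w - g k w) <= Num.sqrt (bnd m0 / k.+1%:R).
  move=> m00 mw0; have hw : halfplane w by exact: lt_le_trans mw0.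
  rewrite -[leLHS](ger0_norm (nc_ge0 _)) -sqrtr_sqr ler_wsqrtr//.
  apply: (le_trans (near_orthogonal_bound (hfg k) (Lfg k) hw (O k))).
  by rewrite ler_wpM2r ?invr_ge0//; exact: bnd_decr.
(* Fatou's lemma for the differences of the terms of [g], in the half-plane
   and then in the product of half-planes. *)
have N1 k : sqnup l3 (fun z => f z - g k z) <= 4 / k.+1%:R.
  apply: (fatou_sqn mU mw w0 (u := fun m p => g (m + k)%N (toC p) - g k (toC p))
    (v := fun p => f (toC p) - g k (toC p)) _ (Lfg k).1 _ _).2.
  - by move=> m; exact: (L2_sub mU mw w0 (Lg (m + k)%N) (Lg k)).
  - move=> p up; apply: (nc_cvg (e := fun m => Num.sqrt (bnd p.2 / (m + k).+1%:R))).
      move=> m; rewrite (_ : _ - _ = f (toC p) - g (m + k)%N (toC p)); last by ring.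
      exact: P.
    exact: (cvg_shiftk (e := fun m => Num.sqrt (bnd p.2 / m.+1%:R)) k (sqrt_harmonic _)).
  - by move=> m; exact: Cgk.
have LPg k := kspan_L22 l11 l21 (sg k).
have mPf : cmeasurable upper2 (fun p => Ps f (toCC p)).
  by apply: cmeasurable_OPiPi; apply: Psi_OPiPi => //; exact: hol_OPi.
have sgk m k : kspan (fun z => g (m + k)%N z - g k z).
  have := kspan_lin (-1) (sg (m + k)%N) (sg k).
  by rewrite (_ : (fun z => _) = fun z => g (m + k)%N z - g k z)//; apply/funext => z; rewrite mulN1r.
have N2 k : L2 leb4 upper2 (weight2 l1 l2) (fun p => Ps f (toCC p) - Ps (g k) (toCC p)) /\
    sqn leb4 upper2 (weight2 l1 l2) (fun p => Ps f (toCC p) - Ps (g k) (toCC p)) <= norm_ratio * 4 / k.+1%:R.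
  apply: (fatou_sqn mU2 mw2 w20
    (u := fun m p => Ps (g (m + k)%N) (toCC p) - Ps (g k) (toCC p))).
  - by move=> m; exact: (L2_sub mU2 mw2 w20 (LPg (m + k)%N) (LPg k)).
  - apply: (cmeasurable_eq _ (cmeasurableD mPf (cmeasurableM (cmeasurable_cst upper2 (-1)) (LPg k).1))).
    by move=> p _; rewrite mulN1r.
  - move=> p up; have [K [m0 [m00 HK]]] := Psi_le up.
    apply: (nc_cvg (e := fun m => K * Num.sqrt (bnd m0 / (m + k).+1%:R))).
      move=> m; rewrite (_ : _ - _ = Ps f (toCC p) - Ps (g (m + k)%N) (toCC p)); last by ring.
      rewrite -(Psi_sub l l11 l21)//; apply: HK => // w mw1; exact: P.
    rewrite -[X in _ --> X](mulr0 K); apply: cvgM; first exact: cvg_cst.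
    exact: (cvg_shiftk (e := fun m => Num.sqrt (bnd m0 / m.+1%:R)) k (sqrt_harmonic _)).
  - move=> m; have -> : sqn leb4 upper2 (weight2 l1 l2)
        (fun p => Ps (g (m + k)%N) (toCC p) - Ps (g k) (toCC p)) =
        sqn22 (Ps (fun z => g (m + k)%N z - g k z)).
      by apply: eq_sqn => p up; rewrite (Psi_sub l l11 l21).
    rewrite (kspan_norm l11 l21)// -mulrA.
    by rewrite ler_wpM2l ?Cgk// ltW// norm_ratio_gt0.
have LPf : L22 (Ps f).
  apply: (L2_eq mU2 _ (L2_add mU2 mw2 w20 (N2 0).1 (LPg 0))) => p _; by rewrite subrK.
split=> //.
have c1 : sqnup l3 (g k) @[k --> \oo] --> sqnup l3 f.
  exact: (sqn_cvg mU mw w0 Lf Lg N1).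
have c2 : sqn22 (Ps (g k)) @[k --> \oo] --> sqn22 (Ps f).
  exact: (sqn_cvg mU2 mw2 w20 LPf LPg (fun k => (N2 k).2)).
have c3 : sqn22 (Ps (g k)) @[k --> \oo] --> norm_ratio * sqnup l3 f.
  under eq_fun do rewrite (kspan_norm l11 l21)//.
  by apply: cvgM; [exact: cvg_cst|exact: c1].
exact: (cvg_unique _ c2 c3).
Qed.
End IsometryLimit.

Theorem theorem2p2 (R : realType) (lam1 lam2 lam3 : R[i]) (l : nat)
    (hl : (lam3 - lam1 - lam2) / 2 = l%:R)
    (h1 : 0 < complex.Re (lam1 + l%:R))
    (h2 : 0 < complex.Re (lam2 + l%:R)) :
  [/\ forall f : R[i] -> R[i], OPi f -> OPiPi (Psi lam1 lam2 l f),
      forall (a : R[i]) (f g : R[i] -> R[i]), OPi f -> OPi g ->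
        forall p : R[i] * R[i], (halfplane `*` halfplane) p ->
        Psi lam1 lam2 l (fun z => a * f z + g z) p =
        a * Psi lam1 lam2 l f p + Psi lam1 lam2 l g p,
      forall (g : SL2cover R) (f : R[i] -> R[i]), OPi f ->
        forall p : R[i] * R[i], (halfplane `*` halfplane) p ->
        Psi lam1 lam2 l (pi_rep lam3 g f) p =
        pi_tensor lam1 lam2 g (Psi lam1 lam2 l f) p
    & complex.Im lam1 = 0 -> complex.Im lam2 = 0 ->
      1 < complex.Re lam1 -> 1 < complex.Re lam2 ->
      exists c : R, 0 < c /\
        forall f : R[i] -> R[i], H2 (complex.Re lam3) f ->
          H22 (complex.Re lam1) (complex.Re lam2) (Psi lam1 lam2 l f) /\
          normH22 (complex.Re lam1) (complex.Re lam2) (Psi lam1 lam2 l f) =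
          c * normH2 (complex.Re lam3) f].
Proof.
split.
- exact: Psi_OPiPi.
- by move=> a f g Of Og p hp; exact: Psi_linear.
- by move=> g f Of p hp; exact: Psi_intertwines hl h1 h2 Of hp.
have e3 : lam3 = lam1 + lam2 + 2 * l%:R by rewrite -hl; field.
case: lam1 lam2 e3 h1 h2 {hl} => [l1 y1] [l2 y2] -> /= h1' h2' i1 i2 l11 l21.
move: h1' h2'; rewrite {y1}i1 {y2}i2 => h1' h2'.
have -> : Re (l1%:C + l2%:C + 2 * l%:R) = l1 + l2 + (2 * l)%:R.
  by rewrite -natrM -natC -!RDC.
have mw2 := @measurable_weight2 R l1 l2.
exists (Num.sqrt (norm_ratio l1 l2 l)); split; first by rewrite sqrtr_gt0 norm_ratio_gt0.
move=> f [Of If].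
have w0 (p : measurableTypeR R * measurableTypeR R) : upper p ->
  0 <= weight (l1 + l2 + (2 * l)%:R) p by move=> _; exact: weight_ge0.
have Lf : L2up (l1 + l2 + (2 * l)%:R) f.
  exact: (inL2P _ (measurable_weight _) w0 _).1 If.
have [LP eP] := Psi_isometry l11 l21 (OPi_hol Of) Lf.
split.
  split; first exact: Psi_OPiPi.
  exact: (inL2P _ mw2 (@weight2_ge0 R l1 l2) _).2 LP.
have c0 := norm_ratio_gt0 l l11 l21.
transitivity (Num.sqrt (sqn22 l1 l2 (Psi l1%:C l2%:C l f))); first by [].
by rewrite eP sqrtrM ?(ltW c0).
Qed.
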